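(* Let $\rho:\mathbb R\to(0,\infty)$ be a $C^\infty$-smooth $2\pi$-periodic function and let $\Omega\subset\mathbb R^2$ be the bounded $C^\infty$-smooth domain, star-shaped with respect to the origin, given in polar coordinates by $\Omega=\{(r,\theta): r<\rho(\theta)\}$. Then, as $b\to0^+$, $$\lambda_1(b,\Omega^{\mathrm{ext}})\le b-\Bigl(\frac{|\Omega|}{2\pi}+\frac{\pi}{2\,\mathcal I_4(\Omega^{\mathrm{ext}})}\Bigr)b^2+\mathcal O(b^{5/2}).$$ Moreover, if $\Omega$ is not a disk, then there exists $b_0=b_0(\Omega)>0$ such that for all $0<b<b_0$, $$\lambda_1(b,\Omega^{\mathrm{ext}})<\lambda_1(b,\mathcal B_{R_\star}^{\mathrm{ext}}),$$ where $R_\star>0$ denotes the radius satisfying $\mathcal I_4(\mathcal B_{R_\star}^{\mathrm{ext}})=\mathcal I_4(\Omega^{\mathrm{ext}})$.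
   Context: $\mathcal B_R=\{x\in\mathbb R^2:|x|<R\}$, $|\Omega|$ is the area of $\Omega$, and $\Omega^{\mathrm{ext}}=\mathbb R^2\setminus\overline\Omega$. For $p>2$ and $0\in\Omega$, the $p$-th moment is $\mathcal I_p(\Omega^{\mathrm{ext}})=\int_{\Omega^{\mathrm{ext}}}|x|^{-p}\,\mathrm dx$. Let $\mathbf A(x)=\frac12(-x_2,x_1)^\top$ and, for $b>0$, $H^1_{\mathbf A}(\Omega^{\mathrm{ext}})=\{u\in L^2(\Omega^{\mathrm{ext}}):(-\mathrm i\nabla-b\mathbf A)u\in [L^2(\Omega^{\mathrm{ext}})]^2\}$. The lowest eigenvalue of the magnetic Neumann Laplacian $(-\mathrm i\nabla-b\mathbf A)^2$ in $L^2(\Omega^{\mathrm{ext}})$ is $\lambda_1(b,\Omega^{\mathrm{ext}})=\inf_{u\in H^1_{\mathbf A}(\Omega^{\mathrm{ext}})\setminus\{0\}}\int_{\Omega^{\mathrm{ext}}}|(-\mathrm i\nabla-b\mathbf A)u|^2\,\mathrm dx\,/\,\|u\|^2_{L^2(\Omega^{\mathrm{ext}})}$. *)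

(* Defs.v *)
From HB Require Import structures.
From mathcomp Require Import all_boot all_order all_algebra.
From mathcomp Require Import complex.
From mathcomp Require Import all_classical all_reals all_analysis.

Set Implicit Arguments.
Unset Strict Implicit.
Unset Printing Implicit Defensive.

Import Order.TTheory GRing.Theory Num.Theory numFieldNormedType.Exports.

Local Open Scope classical_set_scope.
Local Open Scope complex_scope.
Local Open Scope ring_scope.

Section plane.
Variable R : realType.
Implicit Types (U Omega : set (R * R)) (x : R * R) (b : R).

(* The library norm `|x| on R * R is the max norm, hence a separate name for
   the Euclidean one. *)
Definition enorm x : R := Num.sqrt (x.1 ^+ 2 + x.2 ^+ 2).

Definition disk (c : R * R) (r : R) : set (R * R) :=
  [set x | enorm (x - c) < r].

Definition ext Omega : set (R * R) := ~` closure Omega.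

Local Notation leb2 := (@lebesgue_measure R \x @lebesgue_measure R)%E.

Definition area Omega : R := fine (leb2 Omega).

Definition moment (p : R) U : R := \int[leb2]_(x in U) (enorm x `^ (- p)).

Definition smooth (f : R -> R) : Prop :=
  forall (n : nat) (t : R), derivable (derive1n n f) t 1.

Definition star_domain (rho : R -> R) : set (R * R) :=
  [set x | exists r theta : R, [/\ 0 <= r, r < rho theta &
    x = (r * cos theta, r * sin theta)]].

(* Functions on U are represented by total functions on the plane; their values
   outside U play no role. *)
Implicit Types (u w : R * R -> R[i])
  (W : (R * R -> R[i]) * (R * R -> R[i])).

Definition cintegral U u : R[i] :=
  (\int[leb2]_(x in U) complex.Re (u x)) +i*
  (\int[leb2]_(x in U) complex.Im (u x)).

Definition sqmod (z : R[i]) : R := complex.Re z ^+ 2 + complex.Im z ^+ 2.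

Definition L2 U u : Prop :=
  [/\ measurable_fun U (fun x => complex.Re (u x)),
      measurable_fun U (fun x => complex.Im (u x)) &
      leb2.-integrable U (fun x => (sqmod (u x))%:E)].

Definition L2normsq U u : R := \int[leb2]_(x in U) sqmod (u x).

Definition iter_derive (s : seq (R * R)) (phi : R * R -> R) : R * R -> R :=
  foldr (fun v g => 'D_v g) phi s.

Definition smooth2 (phi : R * R -> R) : Prop :=
  forall s : seq (R * R), continuous (iter_derive s phi) /\
    forall x v, derivable (iter_derive s phi) x v.

Definition test_function U (phi : R * R -> R) : Prop :=
  let supp := closure [set x | phi x != 0] in
  [/\ smooth2 phi, compact supp & supp `<=` U].

(* w = (- i d_e - b a) u on U in the sense of distributions, where a is the
   component of the vector potential in the direction e: integrating by parts
   against phi gives <w, phi> = <u, i d_e phi - b a phi>. Real-valued test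
   functions suffice by linearity. *)
Definition weak_magnetic_derivative b U (e : R * R) (a : R * R -> R) u w : Prop :=
  forall phi : R * R -> R, test_function U phi ->
    cintegral U (fun x => w x * (phi x)%:C) =
    cintegral U (fun x =>
      u x * ('i * ('D_e phi x)%:C - (b * a x * phi x)%:C)).

Definition vpot x : R * R := (- x.2 / 2, x.1 / 2).

Definition magnetic_gradient b U u W : Prop :=
  weak_magnetic_derivative b U (1, 0) (fun x => (vpot x).1) u W.1 /\
  weak_magnetic_derivative b U (0, 1) (fun x => (vpot x).2) u W.2.

(* The pair (u, W) exhibits u as an element of H^1_A(U), W being its magnetic
   gradient, which is unique up to equality almost everywhere in U. *)
Definition H1A b U u W : Prop :=
  [/\ L2 U u, L2 U W.1, L2 U W.2 & magnetic_gradient b U u W].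

Definition lambda1 b U : R :=
  inf [set q | exists u W, [/\ H1A b U u W, L2normsq U u != 0 &
    q = (L2normsq U W.1 + L2normsq U W.2) / L2normsq U u]].

End plane.

(* Main.v *)
(** Upper bound: the trial function (z + c / conj z) exp (- b |z|^2 / 4), with
    c = pi / I_4, restricted to the exterior, has explicit Gaussian integrals and
    already gives the expansion up to an error O(b^3), with |closure Omega| in
    place of |Omega|.

    Strict inequality: among the sets with prescribed I_4 of the exterior the
    disk has the least area (bathtub principle, strict because Omega is open and
    star-shaped), so it suffices to show
    lambda_1(b, ext B_r) >= b - (r^2 + o(1)) b^2.
    Write v = f + i g, L = - i d_theta and expand
    |v_r - g_0 v - g_1 L v|^2 >= 0 with radial weights g_0 and g_1. Up to a
    divergence, the energy dominates alpha T + beta J + gamma N, where T, J, N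
    are the integrals over a circle of |d_theta v|^2, of the angular current and
    of |v|^2; this is at least (b - b^2 (r^2 + o(1))) N because |J| <= T (an
    isoperimetric inequality) and T - 2 J + N >= 0. For a general element of
    H^1_A one mollifies: Jensen's inequality bounds the energy of the mollified
    function, and Fatou's lemma with Lebesgue differentiation on lines recovers
    its mass in the limit. *)
Require Import Defs.
From HB Require Import structures.
From mathcomp Require Import all_boot all_order all_algebra.
From mathcomp Require Import complex ring lra.
From mathcomp Require Import all_classical all_reals all_analysis.
From mathcomp Require Import measurable_realfun lebesgue_integral_under lebesgue_integral_differentiation.
Import Order.TTheory GRing.Theory Num.Theory numFieldNormedType.Exports.

Local Open Scope classical_set_scope.
Local Open Scope ring_scope.
Set Implicit Arguments.
Unset Strict Implicit.
Unset Printing Implicit Defensive.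

(** The obstacle is the lower bound: an o(1) error in the coefficient of b^2, uniform over angular
    momenta, for functions without regularity at the boundary. The weights are read off the trial
    function: for the unit disk c = 1, and g_0 + g_1 is, up to terms of order b, the quotient r v_r
    / v of (r + 1 / r) exp (- b r^2 / 4). Angular momentum 1 is thus extremal: T - 2 J + N is the
    integral of |L v - v|^2, while |J| <= T expresses that l^2 - l and l^2 + l are nonnegative for
    integers l. As g_1 vanishes at the inner radius and g_0 <= 0, the inner boundary term has the
    good sign for arbitrary boundary values. So no Neumann condition has to be justified, and the
    inner circle may be moved slightly into the domain, where mollification makes sense. A factor 1
    - r / M removes the outer boundary term. The resulting o(1) comes from sqrt b and from the
    enlarged radius; it is affordable because the gap given by the bathtub principle does not depend
    on b. The value c = pi / I_4 minimises 2 c^2 I_4 - 4 pi c, the part of energy minus b times mass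
    that depends on c at leading order. *)

Section substitution.
Context {R : realType}.
Local Notation mu := (@lebesgue_measure R).
Local Notation mu2 := (@lebesgue_measure R \x @lebesgue_measure R)%E.

(** * Change of variables on the line for nonnegative functions *)

Lemma ge0_integral_mrestr d (T : measurableType d) (m : {measure set T -> \bar R})
    (D : set T) (mD : measurable D) (f : T -> \bar R) :
  measurable_fun setT f -> (forall x, (0 <= f x)%E) ->
  (\int[(mrestr m mD : {measure set T -> \bar R})]_x f x = \int[m]_(x in D) f x)%E.
Proof.
move=> mf f0; rewrite -(setUv D) ge0_integral_setU//=.
- rewrite [X in (_ + X)%E](_ : _ = 0%E) ?adde0.
    apply: eq_measure_integral => A mA AD.
    by rewrite /= /mrestr setIidl.
  apply: null_set_integral => //; first exact: measurableC.
    exact: measurable_funTS.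
  by rewrite /= /mrestr setICl measure0.
- exact: measurableC.
- by rewrite setUv.
- by apply/disj_setPCl.
Qed.

(** The measure with density [w] on [D] is encoded as plane measure on the region under the graph of
    [w]; Tonelli in the second variable returns the factor [w t]. *)
Lemma ge0_integral_hypograph (D : set R) (w : R -> R) (h : R -> \bar R)
    (H := [set z : R * R | D z.1 /\ 0 <= z.2 < w z.1]) :
  measurable D -> measurable_fun setT w -> (forall t, D t -> 0 <= w t) ->
  measurable_fun setT h -> (forall t, (0 <= h t)%E) ->
  measurable H /\
  (\int[mu2]_(z in H) h z.1 = \int[mu]_(t in D) ((w t)%:E * h t))%E.
Proof.
move=> mD mw w0 mh h0.
have mH : measurable H.
  have -> : H = (fst @^-1` D) `&` ((snd : R * R -> R) @^-1` `[0, +oo[) `&`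
      [set z | (z.2 < w z.1)].
    apply/seteqP; split => [[x y] /= [Dx /andP[y0 yw]]|[x y] /=].
      by split=> //; split=> //=; rewrite in_itv/= andbT.
    by move=> [[Dx /=]]; rewrite in_itv/= andbT => y0 yw; split=> //; exact/andP.
  apply: measurableI; first apply: measurableI.
  - by rewrite -[X in measurable X]setTI; exact: measurable_fst.
  - by rewrite -[X in measurable X]setTI; exact: measurable_snd.
  - rewrite -[X in measurable X]setTI.
    have -> : [set z : R * R | z.2 < w z.1] =
       (fun z : R * R => z.2 < w z.1) @^-1` [set true] by [].
    apply: (measurable_fun_ltr (D := setT)) => //.
      exact: measurableT_comp.
split=> //.
rewrite integral_mkcond fubini_tonelli1/=; last 2 first.
- apply/(measurable_restrictT _ mH); apply: measurable_funTS.
  exact: measurableT_comp.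
- by move=> z; rewrite patchE; case: ifP.
rewrite [RHS]integral_mkcond; apply: eq_integral => t _.
rewrite /fubini_F patchE; case: ifPn => [|nDt]; last first.
  apply: integral0_eq => s _; rewrite patchE; case: ifPn => //.
  by rewrite inE => -[/= Dt]; move: nDt; rewrite notin_setE.
rewrite inE => Dt.
transitivity (\int[mu]_(s in `[0%R, w t[) (cst (h t) s))%E.
  rewrite [RHS]integral_mkcond; apply: eq_integral => s _.
  rewrite !patchE; case: ifPn; rewrite ?inE ?notin_setE/=.
    by move=> [_ hs]; rewrite mem_set//= in_itv.
  by move=> hs; rewrite memNset//= in_itv/= => ?; apply: hs.
rewrite integral_cst//= lebesgue_measure_itv/= lte_fin oppr0 adde0 muleC.
case: ltP => // wt0; have -> : w t = 0 by apply/eqP; rewrite eq_le wt0 w0.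
by [].
Qed.

(** The last hypothesis says that the image under [phi] of the density [w] on [D] gives each
    half-open interval its length. Uniqueness of Lebesgue measure then identifies the two measures,
    so each use only has to compute integrals over preimages of intervals. *)
Lemma ge0_substitution (D : set R) (w phi : R -> R) :
  measurable D -> measurable_fun setT w -> measurable_fun setT phi ->
  (forall t, D t -> 0 <= w t) ->
  (forall a b : R, a < b ->
     (\int[mu]_(t in D `&` phi @^-1` [set` `]a, b]%R]) (w t)%:E = (b - a)%:E)%E) ->
  forall g : R -> \bar R, measurable_fun setT g -> (forall y, 0 <= g y)%E ->
  (\int[mu]_y g y = \int[mu]_(t in D) ((w t)%:E * g (phi t)))%E.
Proof.
move=> mD mw mphi w0 wphi g mg g0.
have mgphi : measurable_fun setT (g \o phi) by exact: measurableT_comp.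
have [mH <-] := @ge0_integral_hypograph D w (g \o phi) mD mw w0 mgphi
  (fun t => g0 _).
set H := [set _ | _] in mH *.
transitivity (\int[mrestr mu2 mH]_z ((g \o phi) z.1))%E; last first.
  apply: (@ge0_integral_mrestr _ _ mu2 H mH (fun z => (g \o phi) z.1)).
    exact: measurableT_comp.
  by move=> z; exact: g0.
have mphi1 : measurable_fun [set: measurableTypeR R * measurableTypeR R]
    (phi \o fst : _ -> measurableTypeR R) by exact: measurableT_comp.
(* The area under the graph of [w], projected to the first axis and carried along [phi]. *)
pose nu0 : {measure set (measurableTypeR R) -> \bar R} :=
  pushforward (mrestr mu2 mH) (phi \o fst : _ -> measurableTypeR R).
pose nu := nu0 mphi1.
transitivity (\int[nu]_y g y)%E; last first.
  exact: (@ge0_integral_pushforward _ _ _ (measurableTypeR R) R _ mphi1 (mrestr mu2 mH) setT g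
    measurableT mg (in1W g0)).
suff munu A : measurable A -> A `<=` setT -> mu A = nu A.
  have := @eq_measure_integral _ _ _ setT nu mu g munu; exact.
move=> mA _; apply: lebesgue_measure_unique => //= X [[a b]/= ab <-].
rewrite /pushforward/= /mrestr.
have mab : measurable (`]a, b]%classic : set R) by [].
have mpab : measurable (phi @^-1` `]a, b]).
  by rewrite -[X in measurable X]setTI; exact: mphi.
have := @ge0_integral_hypograph D w (EFin \o \1_(phi @^-1` `]a, b])) mD mw w0.
move=> /(_ _ _)[].
  by apply/measurable_EFinP.
  by move=> t; rewrite lee_fin.
move=> _.
rewrite (_ : (fun z : R * R => _) = (fun z => (\1_((phi \o fst) @^-1` `]a,b]) z)%:E))//.
rewrite integral_indic//; last first.
  by rewrite comp_preimage -[X in measurable X]setTI; exact: measurable_fst.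
move=> ->.
rewrite lebesgue_measure_itv/= lte_fin.
have [ab'|ba] := ltP a b.
  rewrite -EFinB -wphi// integral_mkcondr; apply: eq_integral => t _.
  rewrite patchE /= indicE; case: ifPn; rewrite ?mule1 ?mule0//.
symmetry; apply: integral0_eq => t _ /=.
rewrite indicE memNset ?mule0//= in_itv/= => /andP[h1 h2].
by move: (lt_le_trans h1 h2); rewrite ltNge ba.
Qed.

End substitution.

(** * Elementary substitutions: dilation, translation, reflection, tangent *)

Section polar.
Context {R : realType}.
Local Notation mu := (@lebesgue_measure R).
Local Notation mu2 := (@lebesgue_measure R \x @lebesgue_measure R)%E.

Lemma measurable_invr : measurable_fun [set: R] (@GRing.inv R).
Proof.
(* Inversion is continuous away from 0; the point 0, where the inverse is 0 by convention, is split
   off. *)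
have -> : [set: R] = [set 0] `|` [set x | x != 0].
  by apply/seteqP; split => x //= _; have [->|] := eqVneq x 0; [left|right].
have o0 : open [set x : R | x != 0].
  have -> : [set x : R | x != 0] = ~` [set 0].
    by apply/seteqP; split => x /= /eqP.
  by apply: closed_openC; exact: closed_eq.
apply/measurable_funU => //; first exact: open_measurable.
split.
  exact: measurable_fun_set1.
apply: open_continuous_measurable_fun => // x; rewrite inE/= => x0.
exact: inv_continuous.
Qed.

Lemma measurable_funV d (T : measurableType d) (D : set T) (f : T -> R) :
  measurable_fun D f -> measurable_fun D (fun x => (f x)^-1).
Proof. by move=> mf; apply: measurableT_comp => //; exact: measurable_invr. Qed.

Lemma measurable_cos : measurable_fun [set: R] (@cos R).
Proof. by apply: continuous_measurable_fun; exact: continuous_cos. Qed.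

Lemma measurable_sin : measurable_fun [set: R] (@sin R).
Proof. by apply: continuous_measurable_fun; exact: continuous_sin. Qed.

Lemma measurable_tan : measurable_fun [set: R] (@tan R).
Proof.
rewrite /tan; apply: measurable_funM; first exact: measurable_sin.
by apply: measurable_funV; exact: measurable_cos.
Qed.

Lemma integral_cst_oc (a b c : R) : a < b ->
  (\int[mu]_(t in `]a, b]) c%:E = (c * (b - a))%:E)%E.
Proof.
move=> ab; have := @integral_cst _ _ _ mu `]a, b]%classic.
move=> /(_ (measurable_itv _) c%:E) ->; rewrite /= lebesgue_measure_itv/= lte_fin ab.
by rewrite -EFinB -EFinM.
Qed.

Lemma integral_cst_co (a b c : R) : a < b ->
  (\int[mu]_(t in `[a, b[) c%:E = (c * (b - a))%:E)%E.
Proof.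
move=> ab; have := @integral_cst _ _ _ mu `[a, b[%classic.
move=> /(_ (measurable_itv _) c%:E) ->; rewrite /= lebesgue_measure_itv/= lte_fin ab.
by rewrite -EFinB -EFinM.
Qed.

Lemma ge0_integral_scale (c : R) (g : R -> \bar R) : 0 < c ->
  measurable_fun setT g -> (forall y, 0 <= g y)%E ->
  (\int[mu]_y g y = \int[mu]_t (c%:E * g (c * t)%R))%E.
Proof.
move=> c0 mg g0.
apply: (@ge0_substitution R setT (cst c) (fun t => c * t)) => //.
- exact: measurable_funM.
- by move=> t _; exact: ltW.
move=> a b ab; rewrite setTI.
have -> : (fun t => c * t) @^-1` `]a, b] = `](a / c), (b / c)]%classic.
  apply/seteqP; split => x /=; rewrite !in_itv/= ltr_pdivrMr// ler_pdivlMr//.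
    by rewrite mulrC.
  by rewrite mulrC.
rewrite integral_cst_oc ?ltr_pM2r ?invr_gt0//.
by rewrite -mulrBl mulrCA divff ?mulr1// gt_eqF.
Qed.

Lemma ge0_integral_shift (c : R) (g : R -> \bar R) :
  measurable_fun setT g -> (forall y, 0 <= g y)%E ->
  (\int[mu]_y g y = \int[mu]_t (g (t + c)%R))%E.
Proof.
move=> mg g0.
rewrite (@ge0_substitution R setT (cst 1) (fun t => t + c)) => //.
- by apply: eq_integral => t _; rewrite mul1e.
- exact: measurable_funD.
move=> a b ab; rewrite setTI.
have -> : (fun t => t + c) @^-1` `]a, b] = `](a - c), (b - c)]%classic.
  by apply/seteqP; split => x /=; rewrite !in_itv/= ltrBlDr lerBrDr.
rewrite integral_cst_oc ?ltrD2r//.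
by congr EFin; ring.
Qed.

Lemma ge0_integral_opp (g : R -> \bar R) :
  measurable_fun setT g -> (forall y, 0 <= g y)%E ->
  (\int[mu]_y g y = \int[mu]_t (g (- t)%R))%E.
Proof.
move=> mg g0.
rewrite (@ge0_substitution R setT (cst 1) (@GRing.opp R)) => //.
  by apply: eq_integral => t _; rewrite mul1e.
move=> a b ab; rewrite setTI.
have -> : -%R @^-1` `]a, b] = `[(- b), (- a)[%classic.
  by apply/seteqP; split => x /=; rewrite !in_itv/= ltrNr lerNl andbC.
rewrite integral_cst_co ?ltrN2//.
by congr EFin; ring.
Qed.

(** At a fixed abscissa x > 0 this replaces the ordinate by the polar angle. Doing so line by line
    reduces polar coordinates to Tonelli and one-dimensional substitutions, with no planar change of
    variables. *)
Lemma ge0_integral_tan (x : R) (g : R -> \bar R) : 0 < x ->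
  measurable_fun setT g -> (forall y, 0 <= g y)%E ->
  (\int[mu]_y g y = \int[mu]_(t in `](- (pi / 2))%R, (pi / 2)%R[)
     ((x / cos t ^+ 2)%:E * g (x * tan t)%R))%E.
Proof.
move=> x0 mg g0.
apply: (@ge0_substitution R _ (fun t => x / cos t ^+ 2) (fun t => x * tan t)) => //.
- apply: measurable_funM => //; apply: measurable_funV.
  by apply: measurable_funX; exact: measurable_cos.
- by apply: measurable_funM => //; exact: measurable_tan.
- by move=> t _; rewrite divr_ge0 ?sqr_ge0 ?ltW.
move=> a b ab.
have axbx : a / x < b / x by rewrite ltr_pM2r// invr_gt0.
have -> : `](- (pi / 2)), (pi / 2)[ `&` (fun t => x * tan t) @^-1` `]a, b] =
    `](atan (a / x)), (atan (b / x))]%classic.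
  apply/seteqP; split => t /=; rewrite !in_itv/=.
    move=> [/andP[t1 t2]]; rewrite mulrC -ltr_pdivrMr// -ler_pdivlMr//.
    move=> /andP[/lt_atan h1 /le_atan h2].
    by move: h1 h2; rewrite tanK ?in_itv/= ?t1// => -> ->.
  move=> /andP[h1 h2].
  have t1 : - (pi / 2) < t by rewrite (lt_trans _ h1)// atan_gtNpi2.
  have t2 : t < pi / 2 by rewrite (le_lt_trans h2)// atan_ltpi2.
  split; first by rewrite t1.
  rewrite mulrC -ltr_pdivrMr// -ler_pdivlMr// -[a / x]atanK -[b / x]atanK.
  rewrite ltr_tan ?in_itv/= ?atan_gtNpi2 ?atan_ltpi2 ?t1 ?t2// h1/=.
  move: h2; rewrite le_eqVlt => /predU1P[->//|h2].
  by rewrite ltW// ltr_tan ?in_itv/= ?atan_gtNpi2 ?atan_ltpi2 ?t1 ?t2.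
have cosn0 t : t \in `[(atan (a / x)), (atan (b / x))] -> cos t != 0.
  rewrite in_itv/= => /andP[t1 t2]; rewrite gt_eqF// cos_gt0_pihalf//.
  by rewrite (lt_le_trans _ t1) ?atan_gtNpi2// (le_lt_trans t2)// atan_ltpi2.
rewrite integral_itv_obnd_cbnd; last first.
  apply/measurable_EFinP/measurable_funTS; apply: measurable_funM => //.
  by apply: measurable_funV; apply: measurable_funX; exact: measurable_cos.
have dtan t : t \in `[(atan (a / x)), (atan (b / x))] ->
    is_derive t 1 (fun t => x * tan t) (x / cos t ^+ 2).
  move=> /cosn0 h; exact: (is_deriveZ x (is_derive_tan h)).
have ctan t : t \in `[(atan (a / x)), (atan (b / x))] ->
    {for t, continuous (fun t => x * tan t)}.
  move=> /dtan h; apply: differentiable_continuous; apply/derivable1_diffP.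
  exact: ex_derive.
rewrite (@continuous_FTC2 _ _ (fun t => x * tan t)).
- rewrite !atanK -EFinB; congr EFin.
  by rewrite mulrC divfK ?gt_eqF// mulrC divfK ?gt_eqF.
- exact: lt_atan.
- apply: continuous_in_subspaceT => t; rewrite inE/= => /cosn0 h.
  apply: cvgM; first exact: cvg_cst.
  apply: cvgV; first by rewrite expf_neq0.
  apply: (@cvg_comp _ _ _ cos (fun y => y ^+ 2) (nbhs t) (nbhs (cos t))).
    exact: continuous_cos.
  exact: exprn_continuous.
- have lm := lt_atan axbx.
  split.
  + move=> t tab; have /dtan h : t \in `[(atan (a / x)), (atan (b / x))].
      exact: subset_itv_oo_cc.
    exact: ex_derive.
  + by apply: cvg_at_right_filter; apply: ctan; rewrite in_itv/= lexx ltW.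
  + by apply: cvg_at_left_filter; apply: ctan; rewrite in_itv/= lexx ltW.
move=> t tab; rewrite derive1E.
have /dtan h : t \in `[(atan (a / x)), (atan (b / x))].
  exact: subset_itv_oo_cc.
by rewrite derive_val.
Qed.

End polar.

(** * Polar coordinates in the plane *)

Section polar.
Context {R : realType}.
Local Notation mu := (@lebesgue_measure R).
Local Notation mu2 := (@lebesgue_measure R \x @lebesgue_measure R)%E.
Local Notation plane := (measurableTypeR R * measurableTypeR R)%type.
Implicit Type f : R * R -> \bar R.

Let Dt : set R := `](- (pi / 2)), (pi / 2)[.
Let Dr : set R := `]0, +oo[.

Lemma measurable_fun_polar f (phi psi : plane -> R) :
  measurable_fun [set: plane] f ->
  measurable_fun [set: plane] phi -> measurable_fun [set: plane] psi ->
  measurable_fun [set: plane] (fun z => f (phi z, psi z)).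
Proof.
move=> mf mp mq; apply: (measurableT_comp mf).
exact: measurable_fun_pair.
Qed.

(** Substitute y = x tan t at fixed x, exchange the integrals, then substitute x = r cos t at fixed
    t. The two weights x / cos^2 t and cos t multiply to the Jacobian r. *)
Lemma ge0_integral_right_half_plane f : measurable_fun [set: plane] f ->
  (forall z, 0 <= f z)%E ->
  (\int[mu2]_(z in [set z : R * R | (0 < z.1)%R]) f z =
   \int[mu]_(t in Dt) \int[mu]_(r in Dr)
     (r%:E * f (r * cos t, r * sin t)%R))%E.
Proof.
move=> mf f0.
(* The integrand after the first substitution, extended by zero so that Tonelli applies on the whole
   plane. *)
pose k : plane -> \bar R := (fun z : plane =>
  (z.1 / cos z.2 ^+ 2)%:E * f (z.1, z.1 * tan z.2)%R)%E \_ (Dr `*` Dt).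
have mDD : measurable (Dr `*` Dt : set plane) by apply: measurableX; exact: measurable_itv.
have mk : measurable_fun [set: plane] k.
  apply/(measurable_restrictT _ mDD); apply: measurable_funTS.
  apply: emeasurable_funM.
    apply/measurable_EFinP; apply: measurable_funM => //.
    apply: measurable_funV; apply: measurable_funX.
    by apply: measurableT_comp => //; exact: measurable_cos.
  apply: (measurable_fun_polar mf) => //.
  apply: measurable_funM => //.
  by apply: measurableT_comp => //; exact: measurable_tan.
have k0 z : (0 <= k z)%E.
  rewrite /k patchE; case: ifPn => //; rewrite inE => -[/=].
  rewrite /Dr/= in_itv/= andbT => z0 _ /=; apply: mule_ge0; last exact: f0.
  by rewrite lee_fin; apply: divr_ge0; [exact: ltW|exact: sqr_ge0].
have mH : measurable ([set z | (0 < z.1)%R] : set plane).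
  rewrite (_ : [set _ | _] = fst @^-1` Dr).
    by rewrite -[X in measurable X]setTI; apply: measurable_fst => //; exact: measurable_itv.
  by apply/seteqP; split => z /=; rewrite /Dr/= in_itv/= andbT.
rewrite integral_mkcond fubini_tonelli1/=; last 2 first.
- by apply/(measurable_restrictT _ mH); exact: measurable_funTS.
- by move=> z; rewrite patchE; case: ifP.
transitivity (\int[mu]_x \int[mu]_t k (x, t))%E.
  apply: eq_integral => x _; rewrite /fubini_F.
  have [x0|x0] := ltP 0 x; last first.
    rewrite !integral0_eq// => y _; rewrite ?/k patchE memNset//=.
    - by move=> [/=]; rewrite /Dr/= in_itv/= andbT ltNge x0.
    - by apply/negP; rewrite -leNgt.
  transitivity (\int[mu]_y f (x, y))%E.
    by apply: eq_integral => y _; rewrite patchE mem_set.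
  rewrite (@ge0_integral_tan _ x (fun y => f (x, y)) x0)//; last first.
    exact: (measurableT_comp mf).
  rewrite [LHS]integral_mkcond; apply: eq_integral => t _.
  rewrite /k !patchE; case: ifPn; rewrite ?inE ?notin_setE => ht.
    by rewrite mem_set//; split=> //=; rewrite /Dr/= in_itv/= x0.
  by rewrite memNset// => -[].
rewrite (fubini_tonelli k mk k0) [RHS]integral_mkcond; apply: eq_integral => t _.
rewrite patchE; case: ifPn; rewrite ?inE ?notin_setE => ht; last first.
  by apply: integral0_eq => x _; rewrite /k patchE memNset//= => -[].
have ct : 0 < cos t by apply: cos_gt0_pihalf.
rewrite (ge0_integral_scale ct)//; last exact: (measurableT_comp mk).
rewrite [RHS]integral_mkcond; apply: eq_integral => r _.
rewrite /k !patchE/=; case: ifPn; rewrite ?inE ?notin_setE.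
  move=> [/=]; rewrite {1}/Dr/= in_itv/= andbT pmulr_rgt0// => r0 _.
  rewrite mem_set; last by rewrite /Dr/= in_itv/= r0.
  rewrite muleA -EFinM (mulrC (cos t) r) /tan.
  congr (_%:E * f (_, _))%E; first by field; rewrite gt_eqF.
  by field; rewrite gt_eqF.
move=> h; rewrite memNset ?mule0// => hr; apply: h; split => //=.
by move: hr; rewrite /Dr/= !in_itv/= !andbT pmulr_rgt0.
Qed.

Lemma ge0_integral_opp_plane f : measurable_fun [set: plane] f ->
  (forall z, 0 <= f z)%E ->
  (\int[mu2]_z f z = \int[mu2]_z f (- z.1, - z.2)%R)%E.
Proof.
move=> mf f0.
have mfN : measurable_fun [set: plane] (fun z => f (- z.1, - z.2)).
  by apply: (measurable_fun_polar mf); apply: measurableT_comp.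
rewrite fubini_tonelli1; [|exact: mf|exact: f0].
rewrite fubini_tonelli1; [|exact: mfN|by move=> z; exact: f0].
rewrite [LHS]ge0_integral_opp; last 2 first.
- exact: measurable_fun_fubini_tonelli_F.
- by move=> y; apply: integral_ge0.
apply: eq_integral => x _; rewrite /fubini_F ge0_integral_opp//.
exact: (measurableT_comp mf).
Qed.

Definition ray f (t : R) : \bar R :=
  (\int[mu]_(r in Dr) (r%:E * f (r * cos t, r * sin t)%R))%E.

Lemma ray_ge0 f t : (forall z, 0 <= f z)%E -> (0 <= ray f t)%E.
Proof.
move=> f0; apply: integral_ge0 => r; rewrite /Dr/= in_itv/= andbT => r0.
by rewrite mule_ge0// lee_fin ltW.
Qed.

Lemma measurable_ray f : measurable_fun [set: plane] f ->
  (forall z, 0 <= f z)%E -> measurable_fun setT (ray f).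
Proof.
move=> mf f0.
pose h : plane -> \bar R := (fun z => (z.2%:E * f (z.2 * cos z.1, z.2 * sin z.1)%R)%E)
   \_ (setT `*` Dr).
rewrite (_ : ray f = fun t => \int[mu]_r h (t, r))%E; last first.
  apply/funext => t; rewrite /ray integral_mkcond; apply: eq_integral => r _.
  rewrite /h !patchE/=; case: ifPn; rewrite ?inE ?notin_setE => hr.
    by rewrite mem_set.
  by rewrite memNset// => -[].
have mD : measurable (setT `*` Dr : set plane).
  by apply: measurableX => //; exact: measurable_itv.
apply: (@measurable_fun_fubini_tonelli_F _ _ _ _ _ mu h).
  apply/(measurable_restrictT _ mD); apply: measurable_funTS.
  apply: emeasurable_funM; first exact/measurable_EFinP.
  apply: (measurable_fun_polar mf); apply: measurable_funM => //.
    by apply: measurableT_comp => //; exact: measurable_cos.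
  by apply: measurableT_comp => //; exact: measurable_sin.
move=> z; rewrite /h patchE; case: ifPn => //; rewrite inE => -[_].
by rewrite /Dr/= in_itv/= andbT => z0; rewrite mule_ge0// lee_fin ltW.
Qed.

(** Reflection through the origin reduces this to the right half plane and shifts the angle by
    pi. *)
Lemma ge0_integral_left_half_plane f : measurable_fun [set: plane] f ->
  (forall z, 0 <= f z)%E ->
  (\int[mu2]_(z in [set z : R * R | (z.1 < 0)%R]) f z =
   \int[mu]_(t in `](pi / 2)%R, (pi / 2 + pi)%R[) ray f t)%E.
Proof.
move=> mf f0.
have mH : measurable ([set z | (z.1 < 0)%R] : set plane).
  rewrite (_ : [set _ | _] = fst @^-1` `]-oo, 0[).
    rewrite -[X in measurable X]setTI.
    by apply: measurable_fst => //; exact: measurable_itv.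
  by apply/seteqP; split => z /=; rewrite in_itv/=.
rewrite integral_mkcond ge0_integral_opp_plane; last 2 first.
- by apply/(measurable_restrictT _ mH); exact: measurable_funTS.
- by move=> z; rewrite patchE; case: ifP.
have mfN : measurable_fun [set: plane] (fun z => f (- z.1, - z.2)).
  by apply: (measurable_fun_polar mf); apply: measurableT_comp.
transitivity (\int[mu2]_(z in [set z : R * R | (0 < z.1)%R]) f (- z.1, - z.2)%R)%E.
  rewrite [RHS]integral_mkcond; apply: eq_integral => z _.
  rewrite !patchE; congr (if _ then _ else _).
  by apply/idP/idP; rewrite !inE/= oppr_lt0.
rewrite (ge0_integral_right_half_plane mfN (fun z => f0 (- z.1, - z.2))).
have mr := measurable_ray mf f0.
rewrite [RHS]integral_mkcond (@ge0_integral_shift _ pi); last 2 first.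
- apply/(measurable_restrictT _ (measurable_itv _)).
  exact: measurable_funTS.
- by move=> t; rewrite patchE; case: ifP => // _; exact: ray_ge0.
rewrite integral_mkcond; apply: eq_integral => t _; rewrite !patchE.
have -> : (t + pi \in `](pi / 2), (pi / 2 + pi)[%classic) = (t \in Dt).
  rewrite /Dt !mem_setE !in_itv/= ltrD2r; congr andb.
  by apply/idP/idP => h; have := pi_gt0 R; lra.
case: ifP => // _; apply: eq_integral => r _ /=.
by rewrite cosDpi sinDpi !mulrN.
Qed.

(** The angles start at - pi / 2 because the right half plane comes first, followed by the left
    one. *)
Theorem ge0_integral_polar f : measurable_fun [set: plane] f ->
  (forall z, 0 <= f z)%E ->
  (\int[mu2]_z f z =
   \int[mu]_(t in `[(- (pi / 2))%R, (- (pi / 2) + pi *+ 2)%R]) ray f t)%E.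
Proof.
move=> mf f0.
have mr := measurable_ray mf f0.
have mI (i : interval R) : measurable (fst @^-1` [set` i] : set plane).
  rewrite -[X in measurable X]setTI.
  by apply: measurable_fst => //; exact: measurable_itv.
have E1 : [set z : R * R | 0 < z.1] = fst @^-1` `]0, +oo[.
  by apply/seteqP; split => z /=; rewrite in_itv/= andbT.
have E2 : [set z : R * R | z.1 < 0] = fst @^-1` `]-oo, 0[.
  by apply/seteqP; split => z /=; rewrite in_itv/=.
have E3 : [set: R * R] = [set z | z.1 < 0] `|` (fst @^-1` `[0, 0] `|` [set z | 0 < z.1]).
  apply/seteqP; split => // -[x y] _ /=; rewrite in_itv/= -eq_le.
  by case: (ltgtP x 0) => h; [left|right;right|right;left].
have m1 : measurable ([set z | 0 < z.1] : set plane) by rewrite E1; exact: mI.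
have m2 : measurable ([set z | z.1 < 0] : set plane) by rewrite E2; exact: mI.
have m0 : measurable (fst @^-1` `[0, 0] : set plane) by exact: mI.
rewrite E3 ge0_integral_setU//; last 3 first.
- exact: measurableU.
- exact: measurable_funTS.
- apply/disj_setPS => -[x y] [/= x0]; rewrite in_itv/=.
  move=> [/andP[h _]|h]; [have := le_lt_trans h x0|have := lt_trans h x0];
  by rewrite ltxx.
rewrite ge0_integral_setU//; last 2 first.
- exact: measurable_funTS.
- apply/disj_setPS => -[x y] [/=]; rewrite in_itv/= => /andP[_ h1] h2.
  by have := lt_le_trans h2 h1; rewrite ltxx.
(* The vertical axis is a null set. *)
rewrite [X in (_ + (X + _))%E](_ : _ = 0%E) ?add0e; last first.
  apply: null_set_integral => //; first exact: measurable_funTS.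
  rewrite (_ : fst @^-1` _ = [set 0 : R] `*` [set: R]).
    by rewrite /= product_measure1E//= lebesgue_measure_set1 mul0e.
  apply/seteqP; split => -[x y] /=; rewrite in_itv/= -eq_le.
    by move=> /eqP.
  by move=> [-> _].
rewrite ge0_integral_left_half_plane// ge0_integral_right_half_plane//.
rewrite -(@integral_itv_bndoo _ (pi / 2) _ _ true false); last exact: measurable_funTS.
rewrite -[X in (_ + X)%E](@integral_itv_bndoo _ _ _ (ray f) true true); last first.
  exact: measurable_funTS.
rewrite addeC -ge0_integral_setU//.
- congr (integral mu _ (ray f)); apply/seteqP; split => t /=; rewrite !in_itv/=.
    by move=> [/andP[h1 h2]|/andP[h1 h2]]; apply/andP; split; move: h1 h2; lra.
  move=> /andP[h1 h2]; have [h|h] := ltP t (pi / 2); [left|right].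
    by rewrite h1.
  by apply/andP; split => //; lra.
- exact: measurable_funTS.
- by move=> t _; exact: ray_ge0.
- apply/disj_setPS => t [/=]; rewrite !in_itv/= => /andP[_ h1] /andP[h2 _].
  by have := lt_le_trans h1 h2; rewrite ltxx.
Qed.

End polar.

(** * Derivatives, continuity and the fundamental theorem of calculus *)

Section derivation_rules.
Context {R : realType}.
Implicit Types (f g : R -> R) (x : R).

Lemma der_cst (c x : R) : is_derive x 1 (fun=> c) 0.
Proof. exact: is_derive_cst. Qed.

Lemma der_id x : is_derive x 1 (fun t => t) 1.
Proof. exact: is_derive_id. Qed.

Lemma der_D f g x df dg : is_derive x 1 f df -> is_derive x 1 g dg ->
  is_derive x 1 (fun t => f t + g t) (df + dg).
Proof. by move=> hf hg; exact: (is_deriveD hf hg). Qed.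

Lemma der_N f x df : is_derive x 1 f df -> is_derive x 1 (fun t => - f t) (- df).
Proof. by move=> hf; exact: (is_deriveN hf). Qed.

Lemma der_M f g x df dg : is_derive x 1 f df -> is_derive x 1 g dg ->
  is_derive x 1 (fun t => f t * g t) (df * g x + f x * dg).
Proof.
move=> hf hg; rewrite addrC (mulrC df).
exact: (is_deriveM hf hg).
Qed.

Lemma der_comp f g x df dg : is_derive (g x) 1 f df -> is_derive x 1 g dg ->
  is_derive x 1 (fun t => f (g t)) (df * dg).
Proof. by move=> hf hg; exact: is_derive1_comp. Qed.

Lemma der_X f x df (n : nat) : is_derive x 1 f df ->
  is_derive x 1 (fun t => f t ^+ n) (n%:R * f x ^+ n.-1 * df).
Proof.
move=> hf; elim: n => [|n IH].
  rewrite mul0r mul0r; under eq_fun do rewrite expr0; exact: der_cst.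
under eq_fun do rewrite exprS.
have := der_M hf IH; set a := (X in is_derive _ _ _ X).
suff -> : a = n.+1%:R * f x ^+ n * df by [].
rewrite /a; case: n {IH a} => [|n] /=; first by rewrite !expr0; ring.
by rewrite -[n.+2%:R]natr1 !exprS; ring.
Qed.

Lemma der_V f x df : is_derive x 1 f df -> f x != 0 ->
  is_derive x 1 (fun t => (f t)^-1) (- df / f x ^+ 2).
Proof.
move=> hf fx0; have := is_deriveV fx0 hf; set a := (X in is_derive _ _ _ X).
by suff -> : a = - df / f x ^+ 2 by []; rewrite /a /GRing.scale/=; field.
Qed.

Lemma der_exp f x df : is_derive x 1 f df ->
  is_derive x 1 (fun t => expR (f t)) (expR (f x) * df).
Proof. by move=> hf; apply: der_comp => //; exact: is_derive_expR. Qed.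

Lemma der_cos f x df : is_derive x 1 f df ->
  is_derive x 1 (fun t => cos (f t)) (- sin (f x) * df).
Proof. by move=> hf; apply: der_comp. Qed.

Lemma der_sin f x df : is_derive x 1 f df ->
  is_derive x 1 (fun t => sin (f t)) (cos (f x) * df).
Proof. by move=> hf; apply: der_comp. Qed.

Lemma der_continuous f x df : is_derive x 1 f df -> {for x, continuous f}.
Proof.
move=> hf; apply: differentiable_continuous; apply/derivable1_diffP.
exact: ex_derive.
Qed.

Lemma ctn_D f g : continuous f -> continuous g -> continuous (fun t => f t + g t).
Proof. by move=> cf cg t; apply: cvgD; [exact: cf|exact: cg]. Qed.

Lemma ctn_N f : continuous f -> continuous (fun t => - f t).
Proof. by move=> cf t; apply: cvgN; exact: cf. Qed.

Lemma ctn_M f g : continuous f -> continuous g -> continuous (fun t => f t * g t).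
Proof. by move=> cf cg t; apply: cvgM; [exact: cf|exact: cg]. Qed.

Lemma ctn_X f n : continuous f -> continuous (fun t => f t ^+ n).
Proof.
move=> cf t; apply: (@cvg_comp _ _ _ f (fun y => y ^+ n) (nbhs t) (nbhs (f t))).
  exact: cf.
exact: exprn_continuous.
Qed.

Lemma ctn_cst (c : R) : continuous (fun _ : R => c).
Proof. by move=> t; exact: cvg_cst. Qed.

Lemma continuous_FTCE f F (a b : R) : a <= b ->
  (forall x, a <= x <= b -> is_derive x 1 F (f x)) ->
  (forall x, a <= x <= b -> {for x, continuous f}) ->
  (\int[@lebesgue_measure R]_(x in `[a, b]) (f x)%:E = (F b - F a)%:E)%E.
Proof.
rewrite le_eqVlt => /predU1P[<-|ab] dF cf.
  by rewrite set_itv1 integral_set1 subrr.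
rewrite (@continuous_FTC2 _ f F a b ab)//.
- by apply: continuous_in_subspaceT => x; rewrite inE/= in_itv/=; exact: cf.
- split.
  + move=> x; rewrite in_itv/= => /andP[ax xb].
    by apply: ex_derive; apply: dF; rewrite !ltW.
  + by apply: cvg_at_right_filter; apply: der_continuous (dF _ _); rewrite lexx ltW.
  + by apply: cvg_at_left_filter; apply: der_continuous (dF _ _); rewrite lexx ltW.
move=> x; rewrite in_itv/= => /andP[ax xb]; rewrite derive1E.
have dFx : is_derive x 1 F (f x) by apply: dF; rewrite !ltW.
by rewrite derive_val.
Qed.

Lemma continuous_FTC f F (a b : R) : a <= b ->
  (forall x, a <= x <= b -> is_derive x 1 F (f x)) ->
  (forall x, a <= x <= b -> {for x, continuous f}) ->
  \int[@lebesgue_measure R]_(x in `[a, b]) f x = F b - F a.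
Proof. by move=> ab dF cf; rewrite /Rintegral (continuous_FTCE ab dF cf). Qed.

End derivation_rules.

(** Follows the shape of the function and leaves the conditions of [der_V] that denominators do not
    vanish. *)
Ltac der := repeat first
  [ exact: der_cst | exact: der_id
  | match goal with
    | |- is_derive _ _ (fun t => expR _) _ => apply: der_exp
    | |- is_derive _ _ (fun t => cos _) _ => apply: der_cos
    | |- is_derive _ _ (fun t => sin _) _ => apply: der_sin
    | |- is_derive _ _ (fun t => _ + _) _ => apply: der_D
    | |- is_derive _ _ (fun t => - _) _ => apply: der_N
    | |- is_derive _ _ (fun t => _^-1) _ => apply: der_V
    | |- is_derive _ _ (fun t => _ ^+ _) _ => apply: der_X
    | |- is_derive _ _ (fun t => _ * _) _ => apply: der_M
    end ].

Ltac ctn := repeat first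
  [ match goal with
    | H : continuous ?f |- continuous ?f => exact: H
    | H : continuous ?f |- continuous (fun t => ?f t) => exact: H
    | |- continuous (GRing.mul _) => exact: mulrl_continuous
    | |- continuous (fun t => _ + _) => apply: ctn_D
    | |- continuous (fun t => - _) => apply: ctn_N
    | |- continuous (fun t => _ ^+ _) => apply: ctn_X
    | |- continuous (fun t => _ * _) => apply: ctn_M
    | |- continuous (fun t => _) => exact: ctn_cst
    end ].

(** * Decay of polynomials against exponentials *)

Section exp_limits.
Context {R : realType}.

Lemma cvg_invr_pinfty : (x : R)^-1 @[x --> +oo] --> 0.
Proof.
apply/gtr0_cvgV0; last exact: cvg_id.
by near=> x; near: x; exact: nbhs_pinfty_gt.
Unshelve. all: by end_near. Qed.

(** Uses the term of degree n + 1 of the exponential series, one more than the power; the spare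
    factor 1 / x is what tends to zero. *)
Lemma exprn_expR_le (n : nat) (x : R) : 0 < x ->
  x ^+ n * expR (- x) <= n.+1`!%:R / x.
Proof.
move=> x0; have := @expR_ge1Dxn _ x n (ltW x0); set F := n.+1`!%:R => h.
have F0 : 0 < F by rewrite ltr0n fact_gt0.
rewrite ler_pdivlMr// expRN mulrAC ler_pdivrMr ?expR_gt0// -exprSr.
rewrite mulrC -ler_pdivrMr//; apply: le_trans h; lra.
Qed.

Lemma cvg_exprn_expR (n : nat) : x ^+ n * expR (- x) @[x --> +oo] --> (0 : R).
Proof.
apply: (@squeeze_cvgr _ _ _ _ (cst 0) (fun x => n.+1`!%:R * x^-1)).
- near=> x; have x0 : 0 < x by near: x; exact: nbhs_pinfty_gt.
  apply/andP; split; last exact: exprn_expR_le.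
  by apply: mulr_ge0; [apply: exprn_ge0; exact: ltW|exact: expR_ge0].
- exact: cvg_cst.
- rewrite -[X in _ --> X](mulr0 n.+1`!%:R); apply: cvgM; first exact: cvg_cst.
  exact: cvg_invr_pinfty.
Unshelve. all: by end_near. Qed.

End exp_limits.

(** * Radial and Gaussian integrals *)

Section radial.
Context {R : realType}.
Local Notation mu := (@lebesgue_measure R).
Local Notation mu2 := (@lebesgue_measure R \x @lebesgue_measure R)%E.
Local Notation plane := (measurableTypeR R * measurableTypeR R)%type.
Implicit Types (b r t : R).

Lemma enorm_ge0 (x : R * R) : 0 <= enorm x. Proof. exact: sqrtr_ge0. Qed.

Lemma sqr_enorm (x : R * R) : enorm x ^+ 2 = x.1 ^+ 2 + x.2 ^+ 2.
Proof. by rewrite sqr_sqrtr// addr_ge0// sqr_ge0. Qed.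

Lemma enorm_polar r t : 0 <= r -> enorm (r * cos t, r * sin t) = r.
Proof.
move=> r0; rewrite /enorm/= !exprMn -mulrDr cos2Dsin2 mulr1.
by rewrite sqrtr_sqr ger0_norm.
Qed.

Lemma measurable_enorm : measurable_fun [set: plane] (@enorm R).
Proof.
apply: measurableT_comp.
  by apply: continuous_measurable_fun; exact: sqrt_continuous.
by apply: measurable_funD; apply: measurable_funX.
Qed.

Lemma ge0_integral_radial (g : R -> \bar R) : measurable_fun setT g ->
  (forall r, 0 <= g r)%E ->
  (\int[mu2]_z g (enorm z) =
   (pi *+ 2)%:E * \int[mu]_(r in `]0%R, +oo[) (r%:E * g r))%E.
Proof.
move=> mg g0; have mge : measurable_fun [set: plane] (fun z => g (enorm z)).
  by apply: measurableT_comp => //; exact: measurable_enorm.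
rewrite ge0_integral_polar//.
set I := (X in (_ * X)%E).
have rayE t : ray (fun z => g (enorm z)) t = I.
  rewrite /ray /I; apply: eq_integral => r; rewrite inE/= in_itv/= andbT => r0.
  by rewrite enorm_polar ?ltW.
under eq_integral do rewrite rayE.
rewrite -[LHS]/(\int[mu]_(t in _) cst I t)%E integral_cst//=.
rewrite lebesgue_measure_itv/= lte_fin ltrDl pmulrn_lgt0// pi_gt0.
by rewrite -EFinB addrAC subrr add0r muleC.
Qed.

Lemma ge0_FTC_pinfty (f F : R -> R) (a l : R) :
  (forall x, a <= x -> is_derive x 1 F (f x)) ->
  (forall x, a <= x -> {for x, continuous f}) ->
  (forall x, a <= x -> 0 <= f x) ->
  F x @[x --> +oo] --> l ->
  (\int[mu]_(x in `]a, +oo[) (f x)%:E = (l - F a)%:E)%E.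
Proof.
move=> dF cf f0 Fl.
rewrite integral_itv_obnd_cbnd; last first.
  apply/measurable_EFinP; apply: open_continuous_measurable_fun => //.
  by move=> x; rewrite inE/= in_itv/= andbT => ax; apply: cf; rewrite ltW.
rewrite (@ge0_continuous_FTC2y _ f F a l)//.
- apply: continuous_in_subspaceT => x; rewrite inE/= in_itv/= andbT; exact: cf.
- by move=> x /ltW ax; apply: ex_derive; exact: dF.
- by apply: cvg_at_right_filter; apply: der_continuous; exact: dF.
move=> x; rewrite in_itv/= andbT => /ltW ax; rewrite derive1E.
by have dFx := dF _ ax; rewrite derive_val.
Qed.

Lemma cvg_half_sqr_pinfty b : 0 < b -> b * r ^+ 2 / 2 @[r --> +oo] --> +oo.
Proof.
move=> b0; apply/cvgryPge => A; near=> r.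
have r1 : 1 <= r by near: r; exact: nbhs_pinfty_ge.
have rA : 2 * A / b <= r.
  by near: r; apply: nbhs_pinfty_ge; rewrite num_real.
rewrite ler_pdivlMr//; move: rA; rewrite ler_pdivrMr// => rA.
have : r * b <= r * b * r by rewrite ler_peMr// mulr_ge0 ?(le_trans ler01 r1) ?ltW.
by rewrite expr2; lra.
Unshelve. all: by end_near. Qed.

Lemma cvg_exprn_gauss b (n : nat) : 0 < b ->
  (b * r ^+ 2 / 2) ^+ n * expR (- (b * r ^+ 2 / 2)) @[r --> +oo] --> (0 : R).
Proof.
move=> b0.
exact: (@cvg_comp _ _ _ (fun r => b * r ^+ 2 / 2) (fun x => x ^+ n * expR (- x))
  _ _ _ (cvg_half_sqr_pinfty b0) (@cvg_exprn_expR R n)).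
Qed.

(** The square of the factor exp (- b |z|^2 / 4) of the trial function, as it appears in
    densities. *)
Definition gauss b (z : R * R) : R := expR (- (b * enorm z ^+ 2 / 2)).

Definition gauss_moment b n (z : R * R) : R := (b * enorm z ^+ 2 / 2) ^+ n * gauss b z.

(** With q = b r^2 / 2, a primitive of r q^n exp (- q) is - P(q) exp (- q) / b exactly when P - P' =
    q^n. The polynomials used are 1, q + 1 and q^2 + 2 q + 2, and the value of the integral is read
    off at q = 0. *)
Let gauss_integral_aux b (n : nat) (P : R -> R) : 0 < b ->
  (forall r, 0 <= r -> is_derive r 1
     (fun r => - (P (b * r ^+ 2 / 2) * expR (- (b * r ^+ 2 / 2)) / b))
     (r * ((b * r ^+ 2 / 2) ^+ n * expR (- (b * r ^+ 2 / 2))))) ->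
  P (b * r ^+ 2 / 2) * expR (- (b * r ^+ 2 / 2)) @[r --> +oo] --> 0 ->
  (\int[mu2]_z (gauss_moment b n z)%:E = (pi *+ 2 * P 0 / b)%:E)%E.
Proof.
move=> b0 dP Pl.
pose g r := ((b * r ^+ 2 / 2) ^+ n * expR (- (b * r ^+ 2 / 2))).
have cg : continuous g.
  move=> r; rewrite /g; apply: der_continuous; der.
have g0 r : 0 <= g r.
  by rewrite mulr_ge0 ?expR_ge0// exprn_ge0// divr_ge0// mulr_ge0 ?sqr_ge0// ltW.
rewrite -[LHS]/(\int[mu2]_z (g (enorm z))%:E)%E.
rewrite (@ge0_integral_radial (EFin \o g)); last 2 first.
- by apply/measurable_EFinP; exact: continuous_measurable_fun.
- by move=> r; rewrite lee_fin.
rewrite (_ : \int[mu]_(r in _) _ = (0 - - (P (b * 0 ^+ 2 / 2) *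
    expR (- (b * 0 ^+ 2 / 2)) / b))%:E)%E; last first.
  apply: (@ge0_FTC_pinfty (fun r => r * g r) _ 0 0 dP).
  - by move=> r _; apply: cvgM; [exact: cvg_id|exact: cg].
  - by move=> r r0; rewrite mulr_ge0.
  - rewrite -oppr0; apply: cvgN; rewrite -(mul0r b^-1); apply: cvgM => //.
    exact: cvg_cst.
rewrite -EFinM; congr EFin; rewrite expr0n/= mulr0 mul0r oppr0 expR0 mulr1.
by rewrite sub0r opprK mulrA.
Qed.

Lemma gauss_integral0 b : 0 < b ->
  (\int[mu2]_z (gauss_moment b 0 z)%:E = (pi *+ 2 / b)%:E)%E.
Proof.
move=> b0; apply: etrans; first apply: (@gauss_integral_aux b 0 (fun=> 1)) => //.
- move=> r r0 /=; apply: is_derive_eq; rewrite /GRing.scale/=.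
  by field; rewrite ?gt_eqF.
- have := cvg_exprn_gauss 0 b0.
  by under eq_fun do rewrite expr0.
- by rewrite mulr1.
Qed.

Lemma gauss_integral1 b : 0 < b ->
  (\int[mu2]_z (gauss_moment b 1 z)%:E = (pi *+ 2 / b)%:E)%E.
Proof.
move=> b0.
apply: etrans; first apply: (@gauss_integral_aux b 1 (fun q => q + 1)) => //.
- move=> r r0 /=; apply: is_derive_eq; rewrite /GRing.scale/=.
  by field; rewrite ?gt_eqF.
- have := cvgD (cvg_exprn_gauss 1 b0) (cvg_exprn_gauss 0 b0).
  rewrite addr0 => h; apply: cvg_trans; last exact: h.
  apply: near_eq_cvg; near=> r.
  by rewrite !fctE ?expr0 ?expr1; ring.
- by rewrite /= add0r mulr1.
Unshelve. all: by end_near. Qed.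

Lemma gauss_integral2 b : 0 < b ->
  (\int[mu2]_z (gauss_moment b 2 z)%:E = (pi *+ 4 / b)%:E)%E.
Proof.
move=> b0.
apply: etrans; first apply: (@gauss_integral_aux b 2 (fun q => q ^+ 2 + 2 * q + 2)) => //.
- move=> r r0 /=; apply: is_derive_eq; rewrite /GRing.scale/=.
  by field; rewrite ?gt_eqF.
- have c2 : (cst (2 : R)) r @[r --> (+oo : set_system R)] --> (2 : R) by exact: cvg_cst.
  have h := cvgD (cvg_exprn_gauss 2 b0) (cvgD (cvgM c2 (cvg_exprn_gauss 1 b0))
    (cvgM c2 (cvg_exprn_gauss 0 b0))).
  rewrite mulr0 !addr0 in h; apply: cvg_trans; last exact: h.
  apply: near_eq_cvg; near=> r.
  by rewrite !fctE /cst /= ?expr0 ?expr1; ring.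
- by congr EFin; rewrite /= expr0n/=; ring.
Unshelve. all: by end_near. Qed.

(** This is I_4 of the exterior of a centred disk; it makes R_star^2 = pi / I_4. *)
Lemma integral_enorm_powN4 (rho : R) : 0 < rho ->
  (\int[mu2]_(z in [set z | (rho < enorm z)%R]) (enorm z ^- 4)%:E =
   (pi / rho ^+ 2)%:E)%E.
Proof.
move=> r0.
have mD : measurable (`]rho, +oo[%classic : set R) by exact: measurable_itv.
rewrite integral_mkcond.
transitivity (\int[mu2]_z (((fun r => (r ^- 4)%:E) \_ `]rho, +oo[) (enorm z)))%E.
  apply: eq_integral => z _; rewrite !patchE; congr (if _ then _ else _).
  by apply/idP/idP; rewrite !inE/= in_itv/= andbT.
rewrite ge0_integral_radial; last 2 first.
- apply/(measurable_restrictT _ mD); apply: measurable_funTS.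
  by apply/measurable_EFinP; apply: measurable_funV; apply: measurable_funX.
- move=> r; rewrite patchE; case: ifP => //; rewrite inE/= in_itv/= andbT => h.
  by rewrite lee_fin invr_ge0 exprn_ge0// ltW// (lt_trans r0).
rewrite (_ : \int[mu]_(r in _) _ = \int[mu]_(r in `]rho, +oo[) (r ^- 3)%:E)%E; last first.
  rewrite integral_mkcond [RHS]integral_mkcond; apply: eq_integral => r _.
  rewrite !patchE; case: ifPn => [|h]; case: ifPn => //.
  - rewrite !inE/= !in_itv/= !andbT => h _.
    by rewrite -EFinM; congr EFin; field; rewrite gt_eqF// (lt_trans _ h).
  - by rewrite mule0.
  - move: h; rewrite notin_setE inE/= !in_itv/= !andbT => h h'.
    by exfalso; apply: h; exact: lt_trans h'.
rewrite (_ : \int[mu]_(r in _) _ = (0 - - (rho ^- 2 / 2))%:E)%E; last first.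
  apply: (@ge0_FTC_pinfty (fun r => r ^- 3) (fun r => - (r ^- 2 / 2)) rho 0).
  - move=> x rx; have x0 : x != 0 by rewrite gt_eqF// (lt_le_trans r0).
    have x2 : x ^+ 2 != 0 by rewrite expf_neq0.
    by apply: is_derive_eq; rewrite /GRing.scale/=; field.
  - move=> x rx; have x0 : x != 0 by rewrite gt_eqF// (lt_le_trans r0).
    by apply: der_continuous; der; rewrite expf_neq0.
  - by move=> x rx; rewrite invr_ge0 exprn_ge0// (le_trans (ltW r0)).
  rewrite -oppr0; apply: cvgN; rewrite -(mul0r 2^-1); apply: cvgM; last exact: cvg_cst.
  rewrite -(mul0r (0:R)).
  have h := cvgM (@cvg_invr_pinfty R) (@cvg_invr_pinfty R).
  apply: cvg_trans; last exact: h.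
  apply: near_eq_cvg; near=> x.
  by rewrite /= expr2 invfM.
by rewrite -EFinM; congr EFin; field; rewrite gt_eqF.
Unshelve. all: by end_near. Qed.

Lemma measurable_enorm_itv (i : interval R) :
  measurable ([set z | enorm z \in i] : set plane).
Proof.
rewrite -[X in measurable X]setTI.
by apply: (measurable_enorm measurableT (Y := [set` i])); exact: measurable_itv.
Qed.

Lemma measure_disk0 (rho : R) : 0 < rho ->
  mu2 [set z | enorm z <= rho] = (pi * rho ^+ 2)%:E.
Proof.
move=> r0.
have mD : measurable ([set z | enorm z <= rho] : set plane).
  rewrite (_ : [set _ | _] = [set z | enorm z \in `]-oo, rho]]).
    exact: measurable_enorm_itv.
  by apply/seteqP; split => z /=; rewrite in_itv/=.
have mI : measurable (`]-oo, rho]%classic : set R) by exact: measurable_itv.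
rewrite -[LHS]mul1e -(integral_cst mu2 mD) integral_mkcond.
transitivity (\int[mu2]_z ((cst 1%E \_ `]-oo, rho]) (enorm z)))%E.
  by apply: eq_integral => z _; rewrite !patchE; congr (if _ then _ else _).
rewrite ge0_integral_radial; last 2 first.
- by apply/(measurable_restrictT _ mI).
- by move=> r; rewrite patchE; case: ifP.
rewrite (_ : \int[mu]_(r in _) _ = \int[mu]_(r in `[0%R, rho]) r%:E)%E; last first.
  rewrite -integral_itv_obnd_cbnd; last first.
    by apply/measurable_EFinP.
  rewrite integral_mkcond [RHS]integral_mkcond; apply: eq_integral => r _.
  rewrite !patchE/= !mem_setE !in_itv/= andbT.
  by case: (0 < r) => //=; case: (r <= rho); rewrite ?mule1 ?mule0.
rewrite (_ : \int[mu]_(r in _) _ = (rho ^+ 2 / 2 - 0 ^+ 2 / 2)%:E)%E; last first.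
  apply: (@continuous_FTCE R (fun r => r) (fun r => r ^+ 2 / 2) 0 rho (ltW r0)).
  - by move=> x _; apply: is_derive_eq; rewrite /GRing.scale/=; field.
  - by move=> x _; exact: cvg_id.
by rewrite -EFinM; congr EFin; field.
Qed.

End radial.

Ltac nng := repeat first
  [ match goal with
    | H : is_true (0 < ?y) |- is_true (0 < ?y) => exact: H
    | H : is_true (0 <= ?y) |- is_true (0 <= ?y) => exact: H
    | H : is_true (0 < ?y) |- is_true (0 <= ?y) => exact: (ltW H)
    | H : is_true (?y <= ?z) |- is_true (?y <= ?z) => exact: H
    | H : is_true (?y < ?z) |- is_true (?y < ?z) => exact: H
    | |- is_true (0 <= _ ^+ 2) => exact: sqr_ge0
    | |- is_true (0 <= _ * _) => apply: mulr_ge0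
    | |- is_true (0 <= _ ^+ _) => apply: exprn_ge0
    | |- is_true (0 <= _ + _) => apply: addr_ge0
    | |- is_true (0 <= _^-1) => rewrite invr_ge0
    | |- is_true (0 < _ * _) => apply: mulr_gt0
    | |- is_true (0 < _ ^+ _) => apply: exprn_gt0
    | |- is_true (0 < _ + _) => apply: addr_gt0
    | |- is_true (0 < _^-1) => rewrite invr_gt0
    | |- is_true (0 <= _%:R) => exact: ler0n
    | |- is_true (0 < _%:R) => by rewrite ltr0n
    | |- is_true (0 <= 1) => exact: ler01
    | |- is_true (0 < 1) => exact: ltr01
    end ].

(** * The radial weights and the quadratic form they produce *)

Section radial_weights.
Context {R : realType}.
Implicit Types (b c x : R).

(** The weight g_1 in units where the disk has radius 1, so that [b] stands for b r_0^2. The first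
    term is x v' / v for v = x + 1 / x, the profile of z + 1 / conj z. Without the second term
    [walpha + wbeta] would be - 4 b / (x^2 + 1)^2, more than the surplus near 2 b / (x^2 + 1)^2 in
    [wgamma] can absorb when x is close to 1. The second term keeps the value 0 at x = 1, and its
    factor (1 + b x^2)^-2 confines it to distances below the magnetic length 1 / sqrt b. *)
Definition wsig b x : R := (x ^+ 2 - 1) / (x ^+ 2 + 1) -
  16 * b * (x - 1) / (1 + b * x ^+ 2) ^+ 2 * (x ^+ 2 / (x ^+ 2 + 1) ^+ 2).

Definition wsig' b x : R := 4 * x / (x ^+ 2 + 1) ^+ 2 -
  16 * b * ((1 - 3 * b * x ^+ 2 + 4 * b * x) / (1 + b * x ^+ 2) ^+ 3 *
              (x ^+ 2 / (x ^+ 2 + 1) ^+ 2) -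
            (x - 1) / (1 + b * x ^+ 2) ^+ 2 *
              (2 * x * (x ^+ 2 - 1) / (x ^+ 2 + 1) ^+ 3)).

(** The weight g_0. The Gaussian contributes - b x^2 / 2. The other term cancels the constant - b in
    [wbeta] up to O(b (x^2 + 1)^-2) and turns [wgamma] into b - b^2 + (2 b + b^2) / (x^2 + 1)^2,
    which is where the coefficient r^2 of b^2 originates. *)
Definition wg b x : R := - (b * x ^+ 2 / 2 + b * x ^+ 2 / (x ^+ 2 + 1)).

Definition wg' b x : R := - (b * x + b * (2 * x) / (x ^+ 2 + 1) ^+ 2).

(** The coefficients of T, J and N that remain when the square is expanded and exact derivatives are
    removed. *)
Definition walpha b x : R := (1 - wsig b x ^+ 2) / x ^+ 2.
Definition wbeta b x : R :=
  - b - wsig' b x / x - 2 * wg b x * wsig b x / x ^+ 2.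
Definition wgamma b x : R :=
  b ^+ 2 * x ^+ 2 / 4 - wg b x ^+ 2 / x ^+ 2 - wg' b x / x.

(** With X = (x^2 + 1)^-2, [walpha] = X A and [walpha + wbeta] = X E, the difference of the two
    sides is X A (T - J) + X E J + Gam N. It is nonnegative as soon as |E| <= A and X E + Gam >= 0:
    for E >= 0 by |J| <= T, and for E < 0 by trading - X E against T - 2 J + N >= 0. Here c is sqrt
    b in the rescaled units. *)
Lemma weight_form_ge (x c b eps T J N : R) : b = c ^+ 2 ->
  1 <= x -> 0 < c -> c <= 1 / 20 -> c * 100 * 110 <= eps ->
  0 <= N -> J <= T -> - T <= J -> 0 <= T - 2 * J + N ->
  (b - b ^+ 2 * (1 + eps)) * N <=
    walpha b x * T + wbeta b x * J + wgamma b x * N.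
Proof.
move=> b_def x1 c0 c20 ceps N0 JT TJ TJN.
have eps0 : 0 <= eps by lra.
have x0 : 0 < x by exact: lt_le_trans x1.
have b0 : 0 < b by rewrite b_def exprn_gt0.
have x10 : 0 <= x - 1 by rewrite subr_ge0.
have x20 : 0 < x ^+ 2 by rewrite exprn_gt0.
(* The existential form makes each abbreviation opaque, so that the arithmetic tactics treat it as
   an atom. *)
have [q q_def] : exists z, z = x ^+ 2 + 1 by eexists. have q0 : 0 < q by rewrite q_def; lra.
have x2q : x ^+ 2 <= q by rewrite q_def; lra.
have [p p_def] : exists z, z = b * x ^+ 2 by eexists. have p0 : 0 < p by rewrite p_def; nng.
have p1 : 0 < 1 + p by lra.
have [w w_def] : exists z, z = (1 + p)^-1 by eexists. have w0 : 0 < w by rewrite w_def invr_gt0.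
have w1 : w <= 1 by rewrite w_def invf_le1//; lra.
have wp : w * (1 + p) = 1 by rewrite w_def mulVf// gt_eqF.
have pw1 : p * w <= 1 by move: wp; lra.
have [X X_def] : exists z, z = q ^- 2 by eexists. have X0 : 0 < X by rewrite X_def invr_gt0 exprn_gt0.
have XQ : X * q ^+ 2 = 1 by rewrite X_def mulVf// gt_eqF// exprn_gt0.
have [s s_def] : exists z, z = (x ^+ 2 - 1) / q by eexists.
have s0 : 0 <= s.
  have -> : s = (x - 1) * (x + 1) / q by rewrite s_def; congr (_ / _); ring.
  by apply: divr_ge0; nng.
have [kap kap_def] : exists z, z = 256 * b ^+ 2 * (x * (x - 1)) ^+ 2 * w ^+ 4 * X by eexists.
have [A A_def] : exists z, z = 4 + 32 * b * s * (x - 1) * w ^+ 2 - kap by eexists.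
have [E E_def] : exists z, z = - 4 * b + 16 * b * x * w ^+ 3 * (1 - 3 * p + 4 * b * x) - kap -
  16 * b ^+ 2 * x ^+ 2 * (x - 1) * w ^+ 2 * (1 + 2 / q) by eexists.
have qn0 : x ^+ 2 + 1 != 0 by rewrite -q_def gt_eqF.
have pn0 : 1 + b * x ^+ 2 != 0 by rewrite -p_def gt_eqF.
have xn0 : x != 0 by rewrite gt_eqF.
have alphaE : walpha b x = X * A.
  rewrite /walpha /wsig A_def kap_def s_def X_def w_def p_def q_def; field.
  by rewrite xn0 pn0 qn0.
have eE : walpha b x + wbeta b x = X * E.
  rewrite /walpha /wbeta /wsig /wsig' /wg E_def kap_def X_def w_def p_def q_def; field.
  by rewrite xn0 pn0 qn0.
have gammaE : wgamma b x = b - b ^+ 2 * (1 + eps) +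
    (X * (2 * b + b ^+ 2) + eps * b ^+ 2).
  by rewrite /wgamma /wg /wg' X_def q_def; field; rewrite xn0 qn0.
have kap0 : 0 <= kap.
  by rewrite kap_def; nng.
have xx0 : 0 <= x * (x - 1) by nng.
have xx1 : x * (x - 1) <= q by rewrite q_def mulrBr mulr1 -expr2; lra.
have kap1 : kap <= 256 * b ^+ 2.
  have h1 : (x * (x - 1)) ^+ 2 * X <= 1.
    by rewrite -[Z in _ <= Z]XQ mulrC ler_pM2l//; apply: lerXn2r; rewrite ?nnegrE; nng.
  have h2 : w ^+ 4 <= 1 by rewrite exprn_ile1// ltW.
  have -> : kap = 256 * b ^+ 2 * ((x * (x - 1)) ^+ 2 * X * w ^+ 4).
    by rewrite kap_def; ring.
  apply: ler_piMr; first by nng.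
  by apply: mulr_ile1; nng.
have [m m_def] : exists z, z = c * x * w by eexists. have m0 : 0 < m by rewrite m_def; nng.
have pE : p = (c * x) ^+ 2 by rewrite p_def b_def; ring.
(* Since p = (c x)^2, this is 2 c x <= 1 + (c x)^2. *)
have m1 : m <= 1 / 2.
  have : m * 2 <= w * (1 + p).
    rewrite m_def (_ : c * x * w * 2 = w * (c * x * 2)); last by ring.
    rewrite ler_pM2l// pE; have := sqr_ge0 (c * x - 1); rewrite sqrrB; clear; lra.
  by rewrite wp; clear; lra.
(* In E, the term [t1] comes from the derivative of the correction in [wsig], [kap] from its square,
   and [t3] from its product with [wg]. *)
have [t1 t1_def] : exists z, z = 16 * b * x * w ^+ 3 * (1 - 3 * p + 4 * b * x) by eexists.
have [t3 t3_def] : exists z, z = 16 * b ^+ 2 * x ^+ 2 * (x - 1) * w ^+ 2 * (1 + 2 / q) by eexists.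
have EE : E = - 4 * b + t1 - kap - t3 by rewrite E_def t1_def t3_def.
have t30 : 0 <= t3.
  by rewrite t3_def; nng.
have q2 : 1 + 2 / q <= 2.
  have : 2 / q <= 1.
    by rewrite ler_pdivrMr// mul1r q_def; clear -x1; nra.
  clear; lra.
have t31 : t3 <= 32 * (b ^+ 2 * x ^+ 3 * w ^+ 2).
  have -> : 32 * (b ^+ 2 * x ^+ 3 * w ^+ 2) =
    16 * b ^+ 2 * x ^+ 2 * x * w ^+ 2 * 2 by ring.
  have h : 0 < 16 * b ^+ 2 * x ^+ 2 * w ^+ 2 by nng.
  have -> : t3 = 16 * b ^+ 2 * x ^+ 2 * w ^+ 2 * ((x - 1) * (1 + 2 / q)).
    by rewrite t3_def; ring.
  have -> : 16 * b ^+ 2 * x ^+ 2 * x * w ^+ 2 * 2 =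
     16 * b ^+ 2 * x ^+ 2 * w ^+ 2 * (x * 2) by ring.
  rewrite ler_pM2l//; apply: ler_pM => //; [nng|clear; lra].
have t32 : t3 <= 16 * c.
  apply: le_trans t31 _.
  have -> : b ^+ 2 * x ^+ 3 * w ^+ 2 = c * (m * (p * w)).
    by rewrite m_def p_def b_def; ring.
  have : m * (p * w) <= 1 / 2 * 1 by apply: ler_pM; nng.
  move=> h; have : c * (m * (p * w)) <= c * (1 / 2 * 1) by rewrite ler_pM2l.
  by clear; lra.
have [v v_def] : exists z, z = w ^+ 2 * (1 - 3 * p + 4 * b * x) by eexists.
have vE : v = w ^+ 2 - 3 * (w * (p * w)) + 4 * c * (m * w).
  by rewrite v_def m_def b_def; ring.
have w21 : w ^+ 2 <= 1 by rewrite exprn_ile1// ltW.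
have pw0 : 0 < p * w by rewrite mulr_gt0.
have wpw : 0 <= w * (p * w) <= 1.
  by apply/andP; split; [nng|apply: mulr_ile1 => //; nng].
have cmw : 0 <= c * (m * w) <= c.
  apply/andP; split; first by nng.
  have m11 : m <= 1 by clear -m1; lra.
  have : m * w <= 1 by apply: mulr_ile1; nng.
  by move=> h; rewrite -[leRHS]mulr1 ler_pM2l.
have w20 : 0 <= w ^+ 2 by exact: sqr_ge0.
have v1 : -3 <= v <= 2.
  rewrite vE; move: wpw cmw => /andP[h1 h2] /andP[h3 h4].
  by apply/andP; split; clear -h1 h2 h3 h4 w21 w20 c20 c0; lra.
have t1E : t1 = 16 * c * (m * v) by rewrite t1_def v_def m_def b_def; ring.
have mv : - (3 / 2) <= m * v <= 1.
  move: v1 => /andP[v3 v2]; apply/andP; split; clear -v3 v2 m0 m1; nra.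
have t1b : - (24 * c) <= t1 <= 16 * c.
  by rewrite t1E; move: mv => /andP[h1 h2]; apply/andP; split; clear -h1 h2 c0; nra.
have bc : b <= 1 / 400 by rewrite b_def; clear -c0 c20; nra.
have b2c : 256 * b ^+ 2 <= b by clear -b0 bc; nra.
have E3 : - 3 <= E.
  rewrite EE; move: t1b => /andP[h1 h2].
  by clear -h1 h2 kap0 kap1 t30 t32 b0 bc b2c c0 c20; lra.
have E1 : E <= 3.
  rewrite EE; move: t1b => /andP[h1 h2].
  by clear -h1 h2 kap0 kap1 t30 t32 b0 bc b2c c0 c20; lra.
have A3 : 3 <= A.
  have : 0 <= 32 * b * s * (x - 1) * w ^+ 2.
    by nng.
  by rewrite A_def; clear -kap1 bc b2c; lra.
have Gam0 : 0 <= X * (2 * b + b ^+ 2) + eps * b ^+ 2.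
  by nng.
have GE0 : 0 <= X * E + (X * (2 * b + b ^+ 2) + eps * b ^+ 2).
  (* Below the magnetic length the correction gives t1 >= 12 b x, and since x >= 1 this outweighs
     all negative terms of E. *)
  have [p32|p32] := lerP p (1 / 32).
    have w32 : 32 / 33 <= w.
      have : w * (1 + p) <= w * (33 / 32).
        by rewrite ler_pM2l//; clear -p32; lra.
      by rewrite wp; clear; lra.
    have w3 : 9 / 10 <= w ^+ 3.
      apply: (@le_trans _ _ ((32 / 33) ^+ 3)); first by clear; lra.
      by apply: lerXn2r; rewrite ?nnegrE; nng.
    have bx : b <= b * x by apply: ler_peMr; nng.
    have t1l : 12 * (b * x) <= t1.
      have -> : t1 = b * x * (16 * (w ^+ 3 * (1 - 3 * p + 4 * b * x))).
        by rewrite t1_def; ring.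
      rewrite mulrC ler_pM2l; last by nng.
      have : 9 / 10 * (29 / 32) <= w ^+ 3 * (1 - 3 * p + 4 * b * x).
        have bx0 : 0 < b * x by nng.
        by apply: ler_pM; clear -w3 p32 bx0; lra.
      by clear; lra.
    have t3l : t3 <= b * x.
      apply: le_trans t31 _.
      have -> : 32 * (b ^+ 2 * x ^+ 3 * w ^+ 2) = b * x * (32 * p * w ^+ 2).
        by rewrite p_def; ring.
      apply: ler_piMr; first by nng.
      have : p * w ^+ 2 <= 1 / 32 * 1 by apply: ler_pM; nng.
      by clear; lra.
    rewrite addrA -mulrDr addr_ge0//; last by nng.
    apply: mulr_ge0; first exact: ltW.
    rewrite EE.
    have := sqr_ge0 b; clear -t1l t3l kap1 b2c bx b0; lra.
  (* Beyond the magnetic length E may be negative, but X is at most u^4 with u = 1 / x <= 6 c,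
     because u^2 p = c^2 and p > 1 / 32. The deficit X S is then O(c b^2) and is paid for by eps
     b^2. *)
  have [u u_def] : exists z, z = x^-1 by eexists. have u0 : 0 < u by rewrite u_def invr_gt0.
  have ux : u * x = 1 by rewrite u_def mulVf.
  have u6 : u <= 6 * c.
    have u2 : u ^+ 2 * p = c ^+ 2.
      by rewrite pE -[RHS]mulr1 -(expr1n R 2) -ux; ring.
    have : u ^+ 2 <= (6 * c) ^+ 2.
      have u20 := sqr_ge0 u.
      rewrite (_ : (6 * c) ^+ 2 = 36 * c ^+ 2); last by ring.
      by rewrite -u2; clear -p32 u20; nra.
    by rewrite ler_sqr// nnegrE; nng.
  have Xu : X <= u ^+ 4.
    rewrite X_def u_def -exprVn (_ : x^-1 ^+ 4 = (x ^+ 2)^-1 ^+ 2); last first.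
      by rewrite !exprVn -exprM.
    by rewrite lerXn2r// ?nnegrE; nng; rewrite lef_pV2 ?posrE.
  have t1l : - (48 * (b * x)) <= t1.
    have -> : t1 = b * x * (16 * (w * v)) by rewrite t1_def v_def; ring.
    rewrite -mulrN mulrC mulNr -mulrN ler_pM2l; last by nng.
    by move: v1 => /andP[v3 v2]; clear -v3 v2 w0 w1; nra.
  have t3l : t3 <= 32 * (b ^+ 2 * x ^+ 3).
    apply: le_trans t31 _; rewrite ler_pM2l// ler_piMr//.
    by nng.
  have low : - (2 * b + 48 * (b * x) + 256 * b ^+ 2 + 32 * (b ^+ 2 * x ^+ 3)) <=
    E + (2 * b + b ^+ 2) by rewrite EE; have := sqr_ge0 b; clear -t1l t3l kap1; lra.
  have [S S_def] : exists z, z = 2 * b + 48 * (b * x) + 256 * b ^+ 2 +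
    32 * (b ^+ 2 * x ^+ 3) by eexists.
  rewrite -S_def in low.
  have S0 : 0 <= S by rewrite S_def; nng.
  have XS : X * S <= u ^+ 4 * S by rewrite ler_wpM2r.
  have uS : u ^+ 4 * S = 2 * b * u ^+ 4 + 48 * b * u ^+ 3 + 256 * b ^+ 2 * u ^+ 4 +
      32 * b ^+ 2 * u.
    by rewrite S_def u_def; field.
  have cn0 : 0 < 6 * c by nng.
  have u3 : u ^+ 3 <= (6 * c) ^+ 3 by rewrite lerXn2r// ?nnegrE; nng.
  have u4 : u ^+ 4 <= (6 * c) ^+ 4 by rewrite lerXn2r// ?nnegrE; nng.
  have b20 : 0 < b ^+ 2 by rewrite exprn_gt0.
  have a1 : 2 * b * u ^+ 4 <= b ^+ 2 * c * ((72 * 36) * c).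
    apply: (@le_trans _ _ (2 * b * (6 * c) ^+ 4)).
      by rewrite ler_pM2l; nng.
    by rewrite b_def le_eqVlt; apply/orP; left; apply/eqP; ring.
  have a2 : 48 * b * u ^+ 3 <= b ^+ 2 * c * (96 * 108).
    apply: (@le_trans _ _ (48 * b * (6 * c) ^+ 3)).
      by rewrite ler_pM2l; nng.
    by rewrite b_def le_eqVlt; apply/orP; left; apply/eqP; ring.
  have a3 : 256 * b ^+ 2 * u ^+ 4 <= b ^+ 2 * c * ((576 * 576) * c ^+ 3).
    apply: (@le_trans _ _ (256 * b ^+ 2 * (6 * c) ^+ 4)).
      by rewrite ler_pM2l; nng.
    by rewrite le_eqVlt; apply/orP; left; apply/eqP; ring.
  have a4 : 32 * b ^+ 2 * u <= b ^+ 2 * c * 192.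
    apply: (@le_trans _ _ (32 * b ^+ 2 * (6 * c))).
      by rewrite ler_pM2l; nng.
    by rewrite le_eqVlt; apply/orP; left; apply/eqP; ring.
  have c3 : c ^+ 3 <= (1 / 20) ^+ 3 by rewrite lerXn2r// ?nnegrE; nng.
  have tot : u ^+ 4 * S <= eps * b ^+ 2.
    (* For c <= 1 / 20 the four bounds add up to less than 100 * 110 times c b^2; this is the
       constant in the hypothesis on [eps]. *)
    rewrite uS; apply: (@le_trans _ _ (b ^+ 2 * c * (100 * 110))).
      have h : (72 * 36) * c + (96 * 108) + (576 * 576) * c ^+ 3 + 192 <= 100 * 110 by clear -c3 c20; lra.
      have : b ^+ 2 * c * ((72 * 36) * c + (96 * 108) + (576 * 576) * c ^+ 3 + 192) <=
        b ^+ 2 * c * (100 * 110) by rewrite ler_pM2l; nng.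
      by clear -a1 a2 a3 a4; lra.
    by rewrite -mulrA (mulrC eps) ler_pM2l// mulrA.
  have : X * - S <= X * (E + (2 * b + b ^+ 2)) by rewrite ler_pM2l.
  by clear -XS tot; lra.
rewrite gammaE (_ : wbeta b x = X * E - walpha b x); last by rewrite -eE; ring.
rewrite alphaE.
have [Gam Gam_def] : exists z, z = X * (2 * b + b ^+ 2) + eps * b ^+ 2 by eexists.
rewrite -Gam_def in Gam0 GE0 *.
rewrite -subr_ge0.
have -> : X * A * T + (X * E - X * A) * J + (b - b ^+ 2 * (1 + eps) + Gam) * N -
  (b - b ^+ 2 * (1 + eps)) * N = X * A * (T - J) + X * E * J + Gam * N by ring.
have XE3 : X * E <= X * A by rewrite ler_pM2l//; clear -E1 A3; lra.
have XEN : - (X * A) <= X * E by rewrite -mulrN ler_pM2l//; clear -E3 A3; lra.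
have XA0 : 0 <= X * A by apply: mulr_ge0; [exact: ltW|clear -A3; lra].
(* For X E >= 0 the combination of T - J and T + J suffices; otherwise - X E multiplies T - 2 J + N
   and the remaining N-term is controlled by [GE0]. *)
have [e0|e0] := lerP 0 (X * E).
  have -> : X * A * (T - J) + X * E * J + Gam * N =
    (X * A - X * E / 2) * (T - J) + X * E / 2 * (T + J) + Gam * N by field.
  by apply: addr_ge0; [apply: addr_ge0|]; apply: mulr_ge0 => //;
    clear -XE3 XA0 JT TJ e0; lra.
have h1 : 0 <= (X * A + X * E) * (T - J) by apply: mulr_ge0; [clear -XEN; lra|clear -JT; lra].
have h2 : 0 <= - (X * E) * (T - 2 * J + N) by apply: mulr_ge0 => //; clear -e0; lra.
have h3 : 0 <= (X * E + Gam) * N by rewrite mulr_ge0.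
have -> : X * A * (T - J) + X * E * J + Gam * N =
  (X * A + X * E) * (T - J) + - (X * E) * (T - 2 * J + N) + (X * E + Gam) * N.
  by ring.
by rewrite !addr_ge0.
Qed.

End radial_weights.

(** * The isoperimetric inequality on a circle *)

Section circle.
Context {R : realType}.
Local Notation mu := (@lebesgue_measure R).
Implicit Types (f g h c : R -> R) (a b k : R).

Lemma continuous_integrable_itv f a b : continuous f ->
  mu.-integrable `[a, b] (EFin \o f).
Proof.
move=> cf; apply: continuous_compact_integrable; first exact: segment_compact.
exact: continuous_subspaceT.
Qed.

Lemma Rintegral_split f a b (c : R) : a <= b -> b <= c -> continuous f ->
  \int[mu]_(x in `[a, c]) f x =
  \int[mu]_(x in `[a, b]) f x + \int[mu]_(x in `[b, c]) f x.
Proof.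
move=> ab bc cf; have ic := continuous_integrable_itv a c cf.
have := @Rintegral_itvB R f (BLeft a) (BRight c) b ic.
rewrite !bnd_simp => /(_ ab bc).
rewrite Rintegral_itv_obnd_cbnd; last first.
  apply: integrableS (continuous_integrable_itv b c cf) => //.
  exact: subset_itv_oc_cc.
lra.
Qed.

(* Completing the square: [(h' - c h)^2 >= 0] with [c' + c^2 = - k^2]. *)
Lemma riccati_comparison h h' c c' k a b : a <= b ->
  (forall x : R, is_derive x 1 h (h' x)) -> continuous h' ->
  (forall x : R, a <= x <= b -> is_derive x 1 c (c' x)) ->
  (forall x : R, a <= x <= b -> {for x, continuous c'}) ->
  (forall x : R, a <= x <= b -> c' x + c x ^+ 2 = - k ^+ 2) ->
  c b * h b ^+ 2 - c a * h a ^+ 2 <=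
  \int[mu]_(x in `[a, b]) (h' x ^+ 2 - k ^+ 2 * h x ^+ 2).
Proof.
move=> ab dh ch' dc cc' ric.
have ch : continuous h by move=> x; exact: der_continuous (dh x).
pose G x := c' x * h x ^+ 2 + c x * (2 * h x * h' x).
have cX (u : R -> R) x : {for x, continuous u} -> {for x, continuous (fun x => u x ^+ 2)}.
  move=> cu; apply: (@cvg_comp _ _ _ u (fun y => y ^+ 2) (nbhs x) (nbhs (u x))) => //.
  exact: exprn_continuous.
have cG x : a <= x <= b -> {for x, continuous G}.
  move=> xab; apply: cvgD.
    by apply: cvgM; [exact: cc'|apply: cX; exact: ch].
  apply: cvgM; first by exact: der_continuous (dc _ xab).
  apply: cvgM; last exact: ch'.
  by apply: cvgM; [exact: cvg_cst|exact: ch].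
have dG x : a <= x <= b -> is_derive x 1 (fun x => c x * h x ^+ 2) (G x).
  move=> xab; have hc := dc _ xab; have hh := dh x.
  by apply: is_derive_eq; rewrite /GRing.scale/= /G; ring.
rewrite -(continuous_FTC ab dG cG); apply: le_Rintegral => //.
- apply: continuous_compact_integrable; first exact: segment_compact.
  by apply: continuous_in_subspaceT => x; rewrite inE/= in_itv/=; exact: cG.
- apply: continuous_integrable_itv => x; apply: cvgB; first by apply: cX; exact: ch'.
  by apply: cvgM; [exact: cvg_cst|apply: cX; exact: ch].
move=> x; rewrite /= in_itv/= => /ric e.
rewrite -subr_ge0 /G.
have -> : c' x = - k ^+ 2 - c x ^+ 2 by rewrite -e; ring.
have := sqr_ge0 (h' x - c x * h x); rewrite sqrrB; lra.
Qed.

(** The lowest frequency of a function antiperiodic with shift 2 pi is 1/2. Such a function has a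
    zero z in the interval; Riccati comparison on both sides of z, for every k < 1/2, replaces
    Fourier series. *)
Lemma antiperiodic_wirtinger h h' a :
  (forall x : R, is_derive x 1 h (h' x)) -> continuous h' ->
  (forall x : R, h (x + pi *+ 2) = - h x) ->
  0 <= \int[mu]_(x in `[a, (a + pi *+ 2)%R]) (h' x ^+ 2 - h x ^+ 2 / 4).
Proof.
move=> dh ch' ah; set b := a + pi *+ 2.
have pi0 := pi_gt0 R.
have ab : a <= b by rewrite /b mulr2n; lra.
have ch : continuous h by move=> x; exact: der_continuous (dh x).
have cX (u : R -> R) : continuous u -> continuous (fun x => u x ^+ 2).
  move=> cu x; apply: (@cvg_comp _ _ _ u (fun y => y ^+ 2) (nbhs x) (nbhs (u x))).
    exact: cu.
  exact: exprn_continuous.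
have hb : h b = - h a by exact: ah.
have [z zab hz] : exists2 z, z \in `[a, b] & h z = 0.
  apply: IVT => //; first exact: continuous_subspaceT.
  by rewrite hb; case: (leP (h a) (- h a)) => ?; apply/andP; split; lra.
move: zab; rewrite in_itv/= => /andP[az zb].
(* The comparison functions are k tan (k (z - pi - x)) left of z and k tan (k (z + pi - x)) right of
   z. The argument stays within k pi < pi / 2, so they are regular up to the end points. *)
have key k : 0 < k -> k < 1 / 2 ->
    0 <= \int[mu]_(x in `[a, b]) (h' x ^+ 2 - k ^+ 2 * h x ^+ 2).
  move=> k0 k2.
  pose c s x := k * tan (k * (s - x)).
  pose c' s x := - (k ^+ 2 * (1 + tan (k * (s - x)) ^+ 2)).
  have cosk s x : - pi <= s - x <= pi -> cos (k * (s - x)) != 0.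
    move=> /andP[h1 h2]; rewrite gt_eqF// cos_gt0_pihalf//.
    by apply/andP; split; nra.
  have dtan s x : - pi <= s - x <= pi ->
      is_derive x 1 (fun x => tan (k * (s - x)))
        (- k * (1 + tan (k * (s - x)) ^+ 2)).
    move=> /cosk h0.
    have -> : - k * (1 + tan (k * (s - x)) ^+ 2) = cos (k * (s - x)) ^- 2 * - k.
      by rewrite -cos2_tan2//; exact: mulrC.
    apply: (@der_comp _ (@tan R) (fun x => k * (s - x))).
    by apply: is_derive_eq; rewrite /GRing.scale/=; ring.
  have dc s x : - pi <= s - x <= pi -> is_derive x 1 (c s) (c' s x).
    move=> /dtan d; rewrite /c /c'.
    by apply: is_derive_eq; rewrite /GRing.scale/=; ring.
  have cc s x : - pi <= s - x <= pi -> {for x, continuous (c' s)}.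
    move=> /dtan d; apply: cvgN; apply: cvgM; first exact: cvg_cst.
    apply: cvgD; first exact: cvg_cst.
    apply: (@cvg_comp _ _ _ (fun x => tan (k * (s - x))) (fun y => y ^+ 2) (nbhs x)
      (nbhs (tan (k * (s - x))))); last exact: exprn_continuous.
    exact: der_continuous d.
  have ric s x : c' s x + c s x ^+ 2 = - k ^+ 2 by rewrite /c /c'; ring.
  have cf : continuous (fun x => h' x ^+ 2 - k ^+ 2 * h x ^+ 2).
    move=> x; apply: cvgB; first exact: (cX h').
    by apply: cvgM; [exact: cvg_cst|exact: (cX h)].
  rewrite (Rintegral_split az zb cf).
  have e1 : c (z - pi) z * h z ^+ 2 - c (z - pi) a * h a ^+ 2 <=
    \int[mu]_(x in `[a, z]) (h' x ^+ 2 - k ^+ 2 * h x ^+ 2).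
    refine (@riccati_comparison h h' (c (z - pi)) (c' (z - pi)) k a z az dh ch' _ _ (fun x _ => ric _ x)).
    - by move=> x /andP[h1 h2]; apply: dc; apply/andP; split; move: zb; rewrite /b mulr2n; lra.
    - by move=> x /andP[h1 h2]; apply: cc; apply/andP; split; move: zb; rewrite /b mulr2n; lra.
  have e2 : c (z + pi) b * h b ^+ 2 - c (z + pi) z * h z ^+ 2 <=
    \int[mu]_(x in `[z, b]) (h' x ^+ 2 - k ^+ 2 * h x ^+ 2).
    refine (@riccati_comparison h h' (c (z + pi)) (c' (z + pi)) k z b zb dh ch' _ _ (fun x _ => ric _ x)).
    - by move=> x /andP[h1 h2]; apply: dc; apply/andP; split; move: az h2; rewrite /b mulr2n; lra.
    - by move=> x /andP[h1 h2]; apply: cc; apply/andP; split; move: az h2; rewrite /b mulr2n; lra.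
  (* The boundary terms cancel: those at z because h vanishes there, those at a and b because they
     agree after the shift by 2 pi. *)
  have e3 : c (z - pi) a = c (z + pi) b.
    by rewrite /c /b; congr (_ * tan (_ * _)); rewrite mulr2n; ring.
  by move: e1 e2; rewrite e3 hb hz sqrrN expr0n/= !mulr0; lra.
pose A := \int[mu]_(x in `[a, b]) (h' x ^+ 2).
pose B := \int[mu]_(x in `[a, b]) (h x ^+ 2).
have iA := continuous_integrable_itv a b (cX _ ch').
have iB := continuous_integrable_itv a b (cX _ ch).
have E k : \int[mu]_(x in `[a, b]) (h' x ^+ 2 - k * h x ^+ 2) = A - k * B.
  rewrite RintegralB//; last first.
    apply: continuous_integrable_itv => x.
    by apply: cvgM; [exact: cvg_cst|exact: (cX h)].
  by rewrite RintegralZl.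
have B0 : 0 <= B by apply: Rintegral_ge0 => x _; exact: sqr_ge0.
rewrite (_ : (fun x => _) = (fun x => h' x ^+ 2 - 4^-1 * h x ^+ 2)); last first.
  by apply/funext => x; rewrite (mulrC (h x ^+ 2)).
rewrite E leNgt; apply/negP => neg.
have A0 : 0 <= A by apply: Rintegral_ge0 => x _; exact: sqr_ge0.
have Bp : 0 < B by lra.
(* If A < B / 4, put delta = B / 4 - A. For this k, k^2 B = B / 4 - delta / 2 + delta^2 / (4 B)
   exceeds A, against [key]. *)
pose k := 1 / 2 - (B / 4 - A) / (2 * B).
have kB : k * B = A / 2 + 3 / 8 * B by rewrite /k; field; rewrite gt_eqF.
have k0 : 0 < k by rewrite -(pmulr_lgt0 _ Bp) kB; lra.
have k2 : k < 1 / 2 by rewrite -(ltr_pM2r Bp) kB; lra.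
have := key _ k0 k2; rewrite E => h1.
have : k ^+ 2 * B ^+ 2 <= A * B.
  have := mulr_ge0 h1 B0; rewrite mulrBl; lra.
rewrite -exprMn kB => h2.
have AB : 0 < B - 4 * A by lra.
have := mulr_gt0 AB AB.
move: h2; clear -A0 Bp neg; nra.
Qed.

(** Multiplying f + i g by exp (- i x / 2) gives the antiperiodic pair p + i q and shifts L to L +
    1/2; the Wirtinger bound (L - 1/2)^2 >= 1/4 on the original function is L^2 - L >= 0. *)
Lemma circle_isoperimetric f f' g g' a :
  (forall x : R, is_derive x 1 f (f' x)) -> continuous f' ->
  (forall x : R, is_derive x 1 g (g' x)) -> continuous g' ->
  periodic f (pi *+ 2) -> periodic g (pi *+ 2) ->
  \int[mu]_(x in `[a, (a + pi *+ 2)%R]) (f x * g' x - g x * f' x) <=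
  \int[mu]_(x in `[a, (a + pi *+ 2)%R]) (f' x ^+ 2 + g' x ^+ 2).
Proof.
move=> df cf' dg cg' pf pg.
have cf : continuous f by move=> x; exact: der_continuous (df x).
have cg : continuous g by move=> x; exact: der_continuous (dg x).
pose C x : R := cos (x / 2); pose S x : R := sin (x / 2).
pose p x := f x * C x + g x * S x.
pose q x := g x * C x - f x * S x.
pose p' x := f' x * C x - f x * S x / 2 + g' x * S x + g x * C x / 2.
pose q' x := g' x * C x - g x * S x / 2 - f' x * S x - f x * C x / 2.
have dp (x : R) : is_derive x 1 p (p' x).
  have h1 := df x; have h2 := dg x; rewrite /p /p' /C /S.
  by apply: is_derive_eq; rewrite /GRing.scale/=; field.
have dq (x : R) : is_derive x 1 q (q' x).
  have h1 := df x; have h2 := dg x; rewrite /q /q' /C /S.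
  by apply: is_derive_eq; rewrite /GRing.scale/=; field.
have cC : continuous C by move=> x; apply: der_continuous; rewrite /C; der.
have cS : continuous S by move=> x; apply: der_continuous; rewrite /S; der.
have cp' : continuous p' by rewrite /p'; ctn.
have cq' : continuous q' by rewrite /q'; ctn.
have half x : (x + pi *+ 2) / 2 = x / 2 + pi by rewrite mulr2n; field.
have ap x : p (x + pi *+ 2) = - p x.
  rewrite /p /C /S half cosDpi sinDpi pf pg; ring.
have aq x : q (x + pi *+ 2) = - q x.
  rewrite /q /C /S half cosDpi sinDpi pf pg; ring.
have := addr_ge0 (antiperiodic_wirtinger a dp cp' ap) (antiperiodic_wirtinger a dq cq' aq).
have cp : continuous p by move=> x; exact: der_continuous (dp x).
have cq : continuous q by move=> x; exact: der_continuous (dq x).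
rewrite -RintegralD//; [|by apply: continuous_integrable_itv; ctn..].
rewrite -subr_ge0 -RintegralB//; last 2 first.
- by apply: continuous_integrable_itv; ctn.
- by apply: continuous_integrable_itv; ctn.
rewrite (_ : (fun x => _) = (fun x => f' x ^+ 2 + g' x ^+ 2 - (f x * g' x - g x * f' x)))//.
apply/funext => x; have e : S x ^+ 2 = 1 - C x ^+ 2 by rewrite /S sin2cos2.
have -> : p' x ^+ 2 - p x ^+ 2 / 4 + (q' x ^+ 2 - q x ^+ 2 / 4) =
  (f' x ^+ 2 + g' x ^+ 2 - (f x * g' x - g x * f' x)) * (C x ^+ 2 + S x ^+ 2).
  by rewrite /p /q /p' /q'; field.
by rewrite e addrCA subrr addr0 mulr1.
Qed.

End circle.

(** * Derivatives and bounds of the weights *)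

Section weights_derivative.
Context {R : realType}.
Implicit Types (b x : R).

Lemma is_derive_wsig b x : 0 <= b -> is_derive x 1 (wsig b) (wsig' b x).
Proof.
move=> b0.
have q0 : x ^+ 2 + 1 != 0 by rewrite gt_eqF// ltr_wpDl// sqr_ge0.
have q2 : (x ^+ 2 + 1) ^+ 2 != 0 by rewrite expf_neq0.
have p0 : 1 + b * x ^+ 2 != 0 by rewrite gt_eqF// ltr_wpDr// mulr_ge0// sqr_ge0.
have p2 : (1 + b * x ^+ 2) ^+ 2 != 0 by rewrite expf_neq0.
rewrite /wsig /wsig'.
apply: is_derive_eq; rewrite /GRing.scale/=; field.
by rewrite q0 p0.
Qed.

Lemma is_derive_wg b x : is_derive x 1 (wg b) (wg' b x).
Proof.
have q0 : x ^+ 2 + 1 != 0 by rewrite gt_eqF// ltr_wpDl// sqr_ge0.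
by rewrite /wg /wg'; apply: is_derive_eq; rewrite /GRing.scale/=; field.
Qed.

(** Needed for the error made by differentiating the cutoff, where g_1 multiplies the angular
    current. *)
Lemma wsig_bound b x : 0 <= b -> b <= 1 / 400 -> 1 <= x -> -1 <= wsig b x <= 1.
Proof.
move=> b0 b4 x1; rewrite /wsig.
have x0 : 0 < x by exact: lt_le_trans x1.
have x10 : 0 <= x - 1 by rewrite subr_ge0.
have q0 : 0 < x ^+ 2 + 1 by rewrite ltr_wpDl// sqr_ge0.
have p1 : 1 <= 1 + b * x ^+ 2 by rewrite lerDl mulr_ge0// sqr_ge0.
have s0 : 0 <= (x ^+ 2 - 1) / (x ^+ 2 + 1).
  have -> : x ^+ 2 - 1 = (x - 1) * (x + 1) by ring.
  by apply: divr_ge0; nng.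
have s1 : (x ^+ 2 - 1) / (x ^+ 2 + 1) <= 1 by rewrite ler_pdivrMr//; clear; lra.
set k := (X in _ <= _ - X <= _).
have k0 : 0 <= k.
  by rewrite /k; apply: mulr_ge0; apply: divr_ge0; nng.
have k1 : k <= 1.
  rewrite /k; have -> : 16 * b * (x - 1) / (1 + b * x ^+ 2) ^+ 2 * (x ^+ 2 / (x ^+ 2 + 1) ^+ 2)
    = 16 * b * ((x - 1) * x ^+ 2 / (x ^+ 2 + 1) ^+ 2) / (1 + b * x ^+ 2) ^+ 2.
    by field; rewrite !gt_eqF// (lt_le_trans ltr01).
  rewrite ler_pdivrMr; last by rewrite exprn_gt0// (lt_le_trans ltr01).
  rewrite mul1r; apply: (@le_trans _ _ 1); last by rewrite exprn_ege1.
  have h : (x - 1) * x ^+ 2 / (x ^+ 2 + 1) ^+ 2 <= 1.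
    rewrite ler_pdivrMr ?exprn_gt0// mul1r.
    by apply: (@le_trans _ _ ((x ^+ 2 + 1) * (x ^+ 2 + 1)));
      [apply: ler_pM; [nng|nng|clear -x1; nra|clear; lra]|rewrite expr2].
  have h0 : 0 <= (x - 1) * x ^+ 2 / (x ^+ 2 + 1) ^+ 2 by apply: divr_ge0; nng.
  have : 16 * b * ((x - 1) * x ^+ 2 / (x ^+ 2 + 1) ^+ 2) <= 16 * b * 1.
    by apply: ler_wpM2l => //; nng.
  by clear -b4; lra.
by apply/andP; split; clear -s0 s1 k0 k1; lra.
Qed.

Lemma wg_bound b x : 0 <= b -> - (3 / 2 * (b * x ^+ 2)) <= wg b x <= 0.
Proof.
move=> b0; rewrite /wg.
have x2 := sqr_ge0 x; have q0 : 0 < x ^+ 2 + 1 by rewrite ltr_wpDl.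
have p0 : 0 <= b * x ^+ 2 by rewrite mulr_ge0.
have h0 : 0 <= b * x ^+ 2 / (x ^+ 2 + 1) by rewrite divr_ge0// ltW.
have h1 : b * x ^+ 2 / (x ^+ 2 + 1) <= b * x ^+ 2.
  by rewrite ler_pdivrMr// ler_peMr//; clear -x2; lra.
by apply/andP; split; clear -p0 h0 h1; lra.
Qed.

End weights_derivative.

(** * Integration of bounded measurable functions on a rectangle *)

Section rectangle.
Context {R : realType}.
Local Notation mu := (@lebesgue_measure R).
Local Notation mu2 := (@lebesgue_measure R \x @lebesgue_measure R)%E.
Local Notation plane := (measurableTypeR R * measurableTypeR R)%type.
Variables (r0 r1 t0 t1 : R).
Let I : set R := `[r0, r1]%classic.
Let J : set R := `[t0, t1]%classic.
Let D : set plane := I `*` J.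

Let mI : measurable (I : set (measurableTypeR R)).
Proof. exact: measurable_itv. Qed.
Let mJ : measurable (J : set (measurableTypeR R)).
Proof. exact: measurable_itv. Qed.

(** Closed under sums and products, which makes integrability of the many terms of the energy
    identity syntactic. The bound is asked on the rectangle only, as 1 / r is unbounded
    elsewhere. *)
Definition bounded_measurable (h : R * R -> R) : Prop :=
  measurable_fun [set: plane] h /\ exists C, forall z, D z -> `|h z| <= C.

Lemma bdm_cst (c : R) : bounded_measurable (fun=> c).
Proof. by split; [exact: measurable_cst|exists `|c|]. Qed.

Lemma bdm_D (f g : R * R -> R) : bounded_measurable f -> bounded_measurable g ->
  bounded_measurable (fun z => f z + g z).
Proof.
move=> [mf [A fA]] [mg [B gB]]; split; first exact: measurable_funD.
by exists (A + B) => z Dz; rewrite (le_trans (ler_normD _ _))// lerD ?fA ?gB.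
Qed.

Lemma bdm_N (f : R * R -> R) : bounded_measurable f ->
  bounded_measurable (fun z => - f z).
Proof.
move=> [mf [A fA]]; split; first by apply: measurableT_comp.
by exists A => z Dz; rewrite normrN fA.
Qed.

Lemma bdm_M (f g : R * R -> R) : bounded_measurable f -> bounded_measurable g ->
  bounded_measurable (fun z => f z * g z).
Proof.
move=> [mf [A fA]] [mg [B gB]]; split; first exact: measurable_funM.
by exists (A * B) => z Dz; rewrite normrM ler_pM ?fA ?gB.
Qed.

Lemma bdm_X (f : R * R -> R) n : bounded_measurable f ->
  bounded_measurable (fun z => f z ^+ n).
Proof.
move=> bf; elim: n => [|n IH].
  by under eq_fun do rewrite expr0; exact: bdm_cst.
by under eq_fun do rewrite exprS; exact: bdm_M.
Qed.

Lemma measurable_rect : measurable D.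
Proof. by apply: measurableX; exact: measurable_itv. Qed.

Lemma bdm_integrable h : bounded_measurable h -> mu2.-integrable D (EFin \o h).
Proof.
move=> [mh [C hC]]; apply: measurable_bounded_integrable.
- exact: measurable_rect.
- rewrite /D /= product_measure1E; [|exact: measurable_itv|exact: measurable_itv].
  by rewrite /= !lebesgue_measure_itv/=; case: ifP => _; case: ifP => _;
    rewrite ?mule0 ?mul0e ?ltry// -!EFinB -EFinM ltry.
- exact: measurable_funTS.
exists C; split; first exact: num_real.
by move=> x Cx z Dz; apply: (le_trans (hC z Dz)); exact: ltW.
Qed.

Lemma bdm_slice_r h r : bounded_measurable h -> I r ->
  mu.-integrable J (EFin \o (fun t => h (r, t))).
Proof.
move=> [mh [C hC]] Ir; apply: measurable_bounded_integrable.
- exact: measurable_itv.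
- by rewrite /J /= lebesgue_measure_itv/=; case: ifP => _; rewrite ?ltry// -EFinB ltry.
- by apply: measurable_funTS; exact: (measurableT_comp mh).
exists C; split; first exact: num_real.
by move=> x Cx t Jt; apply: (le_trans (hC (r, t) _)) => //; exact: ltW.
Qed.

Lemma bdm_slice_t h t : bounded_measurable h -> J t ->
  mu.-integrable I (EFin \o (fun r => h (r, t))).
Proof.
move=> [mh [C hC]] Jt; apply: measurable_bounded_integrable.
- exact: measurable_itv.
- by rewrite /I /= lebesgue_measure_itv/=; case: ifP => _; rewrite ?ltry// -EFinB ltry.
- by apply: measurable_funTS; exact: (measurableT_comp mh).
exists C; split; first exact: num_real.
by move=> x Cx r Ir; apply: (le_trans (hC (r, t) _)) => //; exact: ltW.
Qed.

Let ge0_fine_integral d (T : measurableType d) (m : {measure set T -> \bar R})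
    (E : set T) (h : T -> R) : measurable E -> m.-integrable E (EFin \o h) ->
  (0 <= \int[m]_(x in E) (h x)%:E)%E = (0 <= \int[m]_(x in E) h x).
Proof.
move=> mE ih; rewrite /Rintegral -{1}(@fineK _ (\int[m]_(x in E) (h x)%:E)%E) ?lee_fin//.
exact: integrable_fin_num.
Qed.

(** Lets each piece of the energy identity be integrated first in the variable in which its sign
    shows. *)
Lemma rect_ge0_r h : bounded_measurable h ->
  (forall r, I r -> 0 <= \int[mu]_(t in J) h (r, t)) ->
  0 <= \int[mu2]_(z in D) h z.
Proof.
move=> bh h0; have ih := bdm_integrable bh.
rewrite -ge0_fine_integral//; last exact: measurable_rect.
rewrite integral_mkcond -integral12_prod_meas1/=; last first.
  by have /integrable_mkcond := ih; apply; exact: measurable_rect.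
apply: integral_ge0 => r _.
have [Ir|nIr] := pselect (I r).
  set Z := (Z in (0 <= Z)%E).
  have -> : Z = (\int[mu]_(t in J) (h (r, t))%:E)%E.
    rewrite /Z [RHS]integral_mkcond; apply: eq_integral => t _; rewrite !patchE.
    congr (if _ then _ else _); apply/idP/idP; rewrite !inE.
      by move=> [].
    by split.
  rewrite (ge0_fine_integral mJ (bdm_slice_r bh Ir)).
  exact: h0.
set Z := (Z in (0 <= Z)%E); suff -> : Z = 0%E by [].
by apply: integral0_eq => t _; rewrite patchE memNset// => -[].
Qed.

Lemma rect_ge0_t h : bounded_measurable h ->
  (forall t, J t -> 0 <= \int[mu]_(r in I) h (r, t)) ->
  0 <= \int[mu2]_(z in D) h z.
Proof.
move=> bh h0; have ih := bdm_integrable bh.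
rewrite -ge0_fine_integral//; last exact: measurable_rect.
rewrite integral_mkcond -integral21_prod_meas1/=; last first.
  by have /integrable_mkcond := ih; apply; exact: measurable_rect.
apply: integral_ge0 => t _.
have [Jt|nJt] := pselect (J t).
  set Z := (Z in (0 <= Z)%E).
  have -> : Z = (\int[mu]_(r in I) (h (r, t))%:E)%E.
    rewrite /Z [RHS]integral_mkcond; apply: eq_integral => r _; rewrite !patchE.
    congr (if _ then _ else _); apply/idP/idP; rewrite !inE.
      by move=> [].
    by split.
  rewrite (ge0_fine_integral mI (bdm_slice_t bh Jt)).
  exact: h0.
set Z := (Z in (0 <= Z)%E); suff -> : Z = 0%E by [].
by apply: integral0_eq => r _; rewrite patchE memNset// => -[].
Qed.

End rectangle.

Ltac bdm_tac := repeat first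
  [ match goal with
    | H : bounded_measurable _ _ _ _ ?f |- bounded_measurable _ _ _ _ ?f => exact: H
    | |- bounded_measurable _ _ _ _ (fun z => _ + _) => apply: bdm_D
    | |- bounded_measurable _ _ _ _ (fun z => - _) => apply: bdm_N
    | |- bounded_measurable _ _ _ _ (fun z => _ ^+ _) => apply: bdm_X
    | |- bounded_measurable _ _ _ _ (fun z => _ * _) => apply: bdm_M
    | |- bounded_measurable _ _ _ _ (fun z => _) => exact: bdm_cst
    end ].

(** * The weighted energy inequality on an annulus *)

Section annulus.
Context {R : realType}.
Local Notation mu := (@lebesgue_measure R).
Local Notation mu2 := (@lebesgue_measure R \x @lebesgue_measure R)%E.
Local Notation plane := (measurableTypeR R * measurableTypeR R)%type.

(** The same [Frt] is the derivative of [Ft] in r and of [Fr] in t: the symmetry of mixed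
    derivatives is part of the data. *)
Record polar_C2 (r0 r1 a : R) (F Fr Ft Frt : R -> R -> R) : Prop := PolarC2 {
  pc2_r : forall r t : R, is_derive r 1 (F ^~ t) (Fr r t);
  pc2_t : forall r t : R, is_derive t 1 (F r) (Ft r t);
  pc2_tr : forall r t : R, is_derive r 1 (Ft ^~ t) (Frt r t);
  pc2_rt : forall r t : R, is_derive t 1 (Fr r) (Frt r t);
  pc2_cr : forall t, continuous (Fr ^~ t);
  pc2_ct : forall r, continuous (Ft r);
  pc2_ctr : forall t, continuous (Frt ^~ t);
  pc2_crt : forall r, continuous (Frt r);
  pc2_per : forall r, periodic (F r) (pi *+ 2);
  pc2_perr : forall r, periodic (Fr r) (pi *+ 2);
  pc2_b : bounded_measurable r0 r1 a (a + pi *+ 2) (fun z => F z.1 z.2);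
  pc2_br : bounded_measurable r0 r1 a (a + pi *+ 2) (fun z => Fr z.1 z.2);
  pc2_bt : bounded_measurable r0 r1 a (a + pi *+ 2) (fun z => Ft z.1 z.2);
  pc2_brt : bounded_measurable r0 r1 a (a + pi *+ 2) (fun z => Frt z.1 z.2)
}.

Lemma ctn_V (f : R -> R) : continuous f -> (forall t, f t != 0) ->
  continuous (fun t => (f t)^-1).
Proof. by move=> cf f0 t; apply: cvgV => //; exact: cf. Qed.

Lemma continuous_wsig (b : R) : 0 <= b -> continuous (wsig b).
Proof. by move=> b0 x; exact: der_continuous (is_derive_wsig x b0). Qed.

Lemma continuous_wg (b : R) : continuous (wg b).
Proof. by move=> x; exact: der_continuous (is_derive_wg b x). Qed.

Lemma continuous_wsig' (b : R) : 0 <= b -> continuous (wsig' b).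
Proof.
move=> b0; have ci : continuous (fun x : R => x) by move=> x; exact: cvg_id.
have c1 n : continuous (fun x : R => ((x ^+ 2 + 1) ^+ n)^-1).
  apply: ctn_V; first by ctn.
  by move=> x; rewrite expf_neq0// gt_eqF// ltr_wpDl// sqr_ge0.
have c2 n : continuous (fun x : R => ((1 + b * x ^+ 2) ^+ n)^-1).
  apply: ctn_V; first by ctn.
  by move=> x; rewrite expf_neq0// gt_eqF// ltr_wpDr// mulr_ge0// sqr_ge0.
have c12 := c1 2; have c13 := c1 3; have c22 := c2 2; have c23 := c2 3.
by rewrite /wsig'; ctn.
Qed.

Lemma continuous_wg' (b : R) : continuous (wg' b).
Proof.
have ci : continuous (fun x : R => x) by move=> x; exact: cvg_id.
have c1 : continuous (fun x : R => ((x ^+ 2 + 1) ^+ 2)^-1).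
  apply: ctn_V; first by ctn.
  by move=> x; rewrite expf_neq0// gt_eqF// ltr_wpDl// sqr_ge0.
by rewrite /wg'; ctn.
Qed.

Lemma bdm_radial (r0 r1 t0 t1 : R) (u : R -> R) : continuous u ->
  bounded_measurable r0 r1 t0 t1 (fun z => u z.1).
Proof.
move=> cu; split.
  by apply: measurableT_comp => //; exact: continuous_measurable_fun.
have [N [_ hN]] : bounded_set (u @` `[r0, r1]).
  apply: compact_bounded; apply: continuous_compact; last exact: segment_compact.
  exact: continuous_subspaceT.
exists (`|N| + 1) => -[r t] [/= hr _].
by apply: (hN (`|N| + 1)); [rewrite ltr_pwDr ?ler_norm|exists r].
Qed.

Lemma bdm_inv (r0 r1 t0 t1 : R) : 0 < r0 ->
  bounded_measurable r0 r1 t0 t1 (fun z => z.1^-1).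
Proof.
move=> r00; split.
  by apply: measurable_funV.
exists r0^-1 => -[r t] [/=]; rewrite in_itv/= => /andP[h1 h2] _.
have r_gt0 : 0 < r by exact: lt_le_trans h1.
by rewrite ger0_norm ?invr_ge0 ?(ltW r_gt0)// lef_pV2 ?posrE.
Qed.

Variables (b c eps r0 M a : R).
Hypotheses (r0_gt0 : 0 < r0) (r0M : r0 < M).
(** The dimensionless field strength; after the scaling x = r / r0 the weights depend on it
    alone. *)
Let bh := b * r0 ^+ 2.
Hypotheses (bhE : bh = c ^+ 2) (c0 : 0 < c) (c20 : c <= 1 / 20)
  (ceps : c * 100 * 110 <= eps).
Variables (F Fr Ft Frt G Gr Gt Grt : R -> R -> R).
Hypotheses (HF : polar_C2 r0 M a F Fr Ft Frt) (HG : polar_C2 r0 M a G Gr Gt Grt).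

Let lam := b - b ^+ 2 * r0 ^+ 2 * (1 + eps).

(* Polar form of [|(-i grad - b A) v|^2] for [v = F + i G]. *)
Definition polar_energy (r t : R) : R :=
  Fr r t ^+ 2 + Gr r t ^+ 2 + (Ft r t / r + b * r / 2 * G r t) ^+ 2 +
  (Gt r t / r - b * r / 2 * F r t) ^+ 2.

Definition polar_mass (r t : R) : R := F r t ^+ 2 + G r t ^+ 2.

Let j r t := F r t * Gt r t - G r t * Ft r t.
(** Vanishes at the outer radius and so removes the boundary term there; its slope - 1 / M is the
    only error. *)
Let om (r : R) : R := 1 - r / M.
Let G0 (r : R) := wg bh (r / r0).
Let G0' (r : R) := wg' bh (r / r0) / r0.
Let sg (r : R) := wsig bh (r / r0).
Let sg' (r : R) := wsig' bh (r / r0) / r0.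

Let bh0 : 0 < bh. Proof. by rewrite bhE exprn_gt0. Qed.
Let M0 : 0 < M. Proof. exact: lt_trans r0M. Qed.

(** The r-derivative of om (g_0 |v|^2 + g_1 j). *)
Let h1 (z : R * R) := let r := z.1 in let t := z.2 in
  - M^-1 * (G0 r * polar_mass r t + sg r * j r t) +
  om r * (G0' r * polar_mass r t + G0 r * (2 * (F r t * Fr r t + G r t * Gr r t)) +
          sg' r * j r t +
          sg r * (Fr r t * Gt r t + F r t * Grt r t - Gr r t * Ft r t - G r t * Frt r t)).

(** The t-derivative of om g_1 (G F_r - F G_r). *)
Let h2 (z : R * R) := let r := z.1 in let t := z.2 in
  om r * sg r * (Gt r t * Fr r t + G r t * Frt r t - Ft r t * Gr r t - F r t * Grt r t).

Let al r := (1 - sg r ^+ 2) / r ^+ 2.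
Let be r := - b - sg' r / r - 2 * G0 r * sg r / r ^+ 2.
Let ga r := b ^+ 2 * r ^+ 2 / 4 - G0 r ^+ 2 / r ^+ 2 - G0' r / r.

Let h3 (z : R * R) := let r := z.1 in let t := z.2 in
  r * om r * (al r * (Ft r t ^+ 2 + Gt r t ^+ 2) + be r * j r t +
     (ga r - lam) * polar_mass r t).

Let sq (z : R * R) := let r := z.1 in let t := z.2 in
  r * om r * ((Fr r t - (G0 r * F r t + sg r * Gt r t) / r) ^+ 2 +
              (Gr r t - (G0 r * G r t - sg r * Ft r t) / r) ^+ 2).

(** The cross terms of [sq] contain 2 g_1 (F_r G_t - G_r F_t). This is a sum of exact derivatives
    because the mixed derivatives in [h1] and [h2] cancel. The rest of the cross terms is in [h1],
    and the remaining quadratic terms make up [h3]. *)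
Let energy_identity r t : r != 0 ->
  r * om r * polar_energy r t - lam * r * om r * polar_mass r t
    - M^-1 * (G0 r * polar_mass r t + sg r * j r t) =
  h1 (r, t) + h2 (r, t) + h3 (r, t) + sq (r, t).
Proof.
move=> rn0; rewrite /h1 /h2 /h3 /sq /= /polar_energy /polar_mass /al /be /ga /j.
by field; rewrite rn0 gt_eqF.
Qed.

Let r0n : r0 != 0. Proof. by rewrite gt_eqF. Qed.

Let cscale (u : R -> R) : continuous u -> continuous (fun r : R => u (r / r0)).
Proof.
move=> cu r; apply: (@cvg_comp _ _ _ (fun r : R => r / r0) u (nbhs r) (nbhs (r / r0))).
  by apply: cvgM; [exact: cvg_id|exact: cvg_cst].
exact: cu.
Qed.

Let cG0 : continuous G0. Proof. by apply: cscale; exact: continuous_wg. Qed.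
Let csg : continuous sg.
Proof. by apply: cscale; apply: continuous_wsig; exact: ltW. Qed.
Let cG0' : continuous G0'.
Proof.
by apply: ctn_M; [apply: cscale; exact: continuous_wg'|exact: ctn_cst].
Qed.
Let csg' : continuous sg'.
Proof.
apply: ctn_M; last exact: ctn_cst.
by apply: cscale; apply: continuous_wsig'; exact: ltW.
Qed.
Let cid : continuous (fun r : R => r). Proof. by move=> r; exact: cvg_id. Qed.
Let com : continuous om. Proof. by rewrite /om; have h := cid; ctn. Qed.

Local Notation bdm := (bounded_measurable r0 M a (a + pi *+ 2)).

Let bid : bdm (fun z => z.1). Proof. exact: (bdm_radial _ _ _ _ cid). Qed.
Let binv : bdm (fun z => z.1^-1). Proof. exact: (bdm_inv _ _ _ r0_gt0). Qed.
Let bG0 : bdm (fun z => G0 z.1). Proof. by apply: bdm_radial. Qed.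
Let bG0' : bdm (fun z => G0' z.1). Proof. by apply: bdm_radial. Qed.
Let bsg : bdm (fun z => sg z.1). Proof. by apply: bdm_radial. Qed.
Let bsg' : bdm (fun z => sg' z.1). Proof. by apply: bdm_radial. Qed.
Let bom : bdm (fun z => om z.1). Proof. by apply: bdm_radial. Qed.


Let bmass : bdm (fun z => polar_mass z.1 z.2).
Proof.
by have := pc2_b HF; have := pc2_b HG; rewrite /polar_mass => ? ?; bdm_tac.
Qed.

Let bj : bdm (fun z => j z.1 z.2).
Proof.
have := pc2_b HF; have := pc2_b HG; have := pc2_bt HF; have := pc2_bt HG.
by rewrite /j => ? ? ? ?; bdm_tac.
Qed.

Let benergy : bdm (fun z => polar_energy z.1 z.2).
Proof.
have := pc2_b HF; have := pc2_b HG; have := pc2_bt HF; have := pc2_bt HG.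
have := pc2_br HF; have := pc2_br HG; have := bid; have := binv.
by rewrite /polar_energy => ? ? ? ? ? ? ? ?; bdm_tac.
Qed.

Let bh1 : bdm h1.
Proof.
have := pc2_b HF; have := pc2_b HG; have := pc2_bt HF; have := pc2_bt HG.
have := pc2_br HF; have := pc2_br HG; have := pc2_brt HF; have := pc2_brt HG.
have := bmass; have := bj; have := bG0; have := bG0'; have := bsg; have := bsg'.
have := bom.
by rewrite /h1 => ? ? ? ? ? ? ? ? ? ? ? ? ? ? ?; bdm_tac.
Qed.

Let bh2 : bdm h2.
Proof.
have := pc2_b HF; have := pc2_b HG; have := pc2_bt HF; have := pc2_bt HG.
have := pc2_br HF; have := pc2_br HG; have := pc2_brt HF; have := pc2_brt HG.
have := bsg; have := bom.
by rewrite /h2 => ? ? ? ? ? ? ? ? ? ?; bdm_tac.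
Qed.

Let bh3 : bdm h3.
Proof.
have := pc2_bt HF; have := pc2_bt HG.
have bi2 : bdm (fun z => (z.1 ^+ 2)^-1).
  by under eq_fun do rewrite -exprVn; exact: bdm_X.
have := bmass; have := bj; have := bG0; have := bG0'; have := bsg; have := bsg'.
have := bom; have := bid; have := binv.
by rewrite /h3 /al /be /ga /= => ? ? ? ? ? ? ? ? ? ? ?; bdm_tac.
Qed.

Let scaled_derive (u u' : R -> R) (r : R) : (forall x : R, is_derive x 1 u (u' x)) ->
  is_derive r 1 (fun r : R => u (r / r0)) (u' (r / r0) / r0).
Proof.
move=> du; apply: der_comp; apply: is_derive_eq; rewrite /GRing.scale/=; ring.
Qed.

Let dG0 (r : R) : is_derive r 1 G0 (G0' r).
Proof. by apply: scaled_derive => x; exact: is_derive_wg. Qed.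

Let dsg (r : R) : is_derive r 1 sg (sg' r).
Proof. by apply: scaled_derive => x; apply: is_derive_wsig; exact: ltW. Qed.

Let continuous_of_derive (u u' : R -> R) : (forall x : R, is_derive x 1 u (u' x)) ->
  continuous u.
Proof. by move=> du x; exact: der_continuous (du x). Qed.

Let sg_r0 : sg r0 = 0.
Proof.
by rewrite /sg /wsig divff// expr1n subrr mul0r mulr0 !mul0r subr0.
Qed.

Let G0_le0 r : G0 r <= 0.
Proof. by have /andP[] := wg_bound (r / r0) (ltW bh0). Qed.

Let om_ge0 r : r <= M -> 0 <= om r.
Proof. by move=> rM; rewrite /om subr_ge0 ler_pdivrMr// mul1r. Qed.

Let mass_ge0 r t : 0 <= polar_mass r t.
Proof. by rewrite addr_ge0// sqr_ge0. Qed.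

(** The term at M vanishes with [om]. At r0 the weight [sg] vanishes and [G0] is nonpositive, so
    what is left has the good sign whatever the boundary values of v. *)
Let int_h1 : 0 <= \int[mu2]_(z in `[r0, M] `*` `[a, a + pi *+ 2]) h1 z.
Proof.
apply: (rect_ge0_t bh1) => t _.
pose Phi r := om r * (G0 r * polar_mass r t + sg r * j r t).
have cF : continuous (F ^~ t) by exact: continuous_of_derive (fun x => pc2_r HF x t).
have cG : continuous (G ^~ t) by exact: continuous_of_derive (fun x => pc2_r HG x t).
have cFt : continuous (Ft ^~ t) by exact: continuous_of_derive (fun x => pc2_tr HF x t).
have cGt : continuous (Gt ^~ t) by exact: continuous_of_derive (fun x => pc2_tr HG x t).
have cFr := (@pc2_cr _ _ _ _ _ _ _ HF t); have cGr := (@pc2_cr _ _ _ _ _ _ _ HG t).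
have cFrt := (@pc2_ctr _ _ _ _ _ _ _ HF t); have cGrt := (@pc2_ctr _ _ _ _ _ _ _ HG t).
have ch : continuous (fun r => h1 (r, t)).
  have := cG0; have := cG0'; have := csg; have := csg'; have := com.
  by rewrite /h1 /j /polar_mass /= => ? ? ? ? ?; ctn.
have dPhi (r : R) : is_derive r 1 Phi (h1 (r, t)).
  have ? := pc2_r HF r t; have ? := pc2_r HG r t.
  have ? := pc2_tr HF r t; have ? := pc2_tr HG r t.
  have ? := dG0 r; have ? := dsg r.
  rewrite /Phi /h1 /polar_mass /j /om /=.
  by apply: is_derive_eq; rewrite /GRing.scale/=; field; rewrite gt_eqF.
rewrite (continuous_FTC (ltW r0M) (fun r _ => dPhi r) (fun r _ => ch r)).
rewrite /Phi sg_r0 mul0r addr0 {1}/om divff ?gt_eqF// subrr mul0r sub0r oppr_ge0.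
apply: mulr_ge0_le0; first by apply: om_ge0; exact: ltW.
by apply: mulr_le0_ge0; [exact: G0_le0|exact: mass_ge0].
Qed.

(** On each circle the integral of the t-derivative vanishes by periodicity. *)
Let int_h2 : 0 <= \int[mu2]_(z in `[r0, M] `*` `[a, a + pi *+ 2]) h2 z.
Proof.
apply: (rect_ge0_r bh2) => r _.
pose Psi t := om r * sg r * (G r t * Fr r t - F r t * Gr r t).
have cF : continuous (F r) by exact: continuous_of_derive (pc2_t HF r).
have cG : continuous (G r) by exact: continuous_of_derive (pc2_t HG r).
have cFr : continuous (Fr r) by exact: continuous_of_derive (pc2_rt HF r).
have cGr : continuous (Gr r) by exact: continuous_of_derive (pc2_rt HG r).
have cFt := (@pc2_ct _ _ _ _ _ _ _ HF r); have cGt := (@pc2_ct _ _ _ _ _ _ _ HG r).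
have cFrt := (@pc2_crt _ _ _ _ _ _ _ HF r); have cGrt := (@pc2_crt _ _ _ _ _ _ _ HG r).
have ch : continuous (fun t => h2 (r, t)) by rewrite /h2 /=; ctn.
have dPsi (t : R) : is_derive t 1 Psi (h2 (r, t)).
  have ? := pc2_t HF r t; have ? := pc2_t HG r t.
  have ? := pc2_rt HF r t; have ? := pc2_rt HG r t.
  rewrite /Psi /h2 /=.
  by apply: is_derive_eq; rewrite /GRing.scale/=; ring.
have aa : a <= a + pi *+ 2 by rewrite lerDl mulrn_wge0// pi_ge0.
rewrite (continuous_FTC aa (fun r _ => dPsi r) (fun r _ => ch r)).
by rewrite /Psi (pc2_per HF) (pc2_per HG) (pc2_perr HF) (pc2_perr HG) subrr.
Qed.

(** On each circle this is [weight_form_ge] at x = r / r0, after dividing all coefficients by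
    r0^2. *)
Let int_h3 : 0 <= \int[mu2]_(z in `[r0, M] `*` `[a, a + pi *+ 2]) h3 z.
Proof.
apply: (rect_ge0_r bh3) => r; rewrite /= in_itv/= => /andP[r0r rM].
have r_gt0 : 0 < r by exact: lt_le_trans r0r.
have cF : continuous (F r) by exact: continuous_of_derive (pc2_t HF r).
have cG : continuous (G r) by exact: continuous_of_derive (pc2_t HG r).
have cFt := (@pc2_ct _ _ _ _ _ _ _ HF r); have cGt := (@pc2_ct _ _ _ _ _ _ _ HG r).
pose T := \int[mu]_(t in `[a, (a + pi *+ 2)%R]) (Ft r t ^+ 2 + Gt r t ^+ 2).
pose J := \int[mu]_(t in `[a, (a + pi *+ 2)%R]) (F r t * Gt r t - G r t * Ft r t).
pose N := \int[mu]_(t in `[a, (a + pi *+ 2)%R]) (F r t ^+ 2 + G r t ^+ 2).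
have iT : mu.-integrable `[a, (a + pi *+ 2)%R]
  (EFin \o (fun t => Ft r t ^+ 2 + Gt r t ^+ 2)).
  by apply: continuous_integrable_itv; ctn.
have iJ : mu.-integrable `[a, (a + pi *+ 2)%R]
  (EFin \o (fun t => F r t * Gt r t - G r t * Ft r t)).
  by apply: continuous_integrable_itv; ctn.
have iN : mu.-integrable `[a, (a + pi *+ 2)%R]
  (EFin \o (fun t => F r t ^+ 2 + G r t ^+ 2)).
  by apply: continuous_integrable_itv; ctn.
have lin A B C : \int[mu]_(t in `[a, (a + pi *+ 2)%R])
    (A * (Ft r t ^+ 2 + Gt r t ^+ 2) + B * (F r t * Gt r t - G r t * Ft r t) +
     C * (F r t ^+ 2 + G r t ^+ 2)) = A * T + B * J + C * N.
  rewrite RintegralD//; last 2 first.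
  - by apply: continuous_integrable_itv; ctn.
  - by apply: continuous_integrable_itv; ctn.
  rewrite RintegralD//; last 2 first.
  - by apply: continuous_integrable_itv; ctn.
  - by apply: continuous_integrable_itv; ctn.
  by rewrite !RintegralZl.
rewrite (_ : (fun t => h3 (r, t)) = (fun t =>
    r * om r * al r * (Ft r t ^+ 2 + Gt r t ^+ 2) +
    r * om r * be r * (F r t * Gt r t - G r t * Ft r t) +
    r * om r * (ga r - lam) * (F r t ^+ 2 + G r t ^+ 2))); last first.
  by apply/funext => t; rewrite /h3 /= /j /polar_mass; ring.
rewrite lin.
have -> : r * om r * al r * T + r * om r * be r * J + r * om r * (ga r - lam) * N =
  r * om r * (al r * T + be r * J + ga r * N - lam * N) by ring.
apply: mulr_ge0; first by apply: mulr_ge0; [exact: ltW|exact: om_ge0].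
pose x := r / r0.
have x1 : 1 <= x by rewrite /x ler_pdivlMr// mul1r.
have rx : r = x * r0 by rewrite /x divfK.
have xn : x != 0 by rewrite gt_eqF// (lt_le_trans ltr01).
have JT : J <= T.
  exact: (circle_isoperimetric a (pc2_t HF r) cFt (pc2_t HG r) cGt
    ((@pc2_per _ _ _ _ _ _ _ HF r)) ((@pc2_per _ _ _ _ _ _ _ HG r))).
(* Exchanging F and G reverses the orientation and the sign of the current. *)
have TJ : - T <= J.
  rewrite lerNl.
  have := circle_isoperimetric a (pc2_t HG r) cGt (pc2_t HF r) cFt
    ((@pc2_per _ _ _ _ _ _ _ HG r)) ((@pc2_per _ _ _ _ _ _ _ HF r)).
  rewrite (_ : \int[mu]_(t in _) (Gt r t ^+ 2 + Ft r t ^+ 2) = T); last first.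
    by apply: eq_Rintegral => t _; rewrite addrC.
  apply: le_trans; rewrite (_ : - J = -1 * J); last by ring.
  rewrite /J -RintegralZl// le_eqVlt; apply/orP; left; apply/eqP.
  by apply: eq_Rintegral => t _ /=; ring.
have N0 : 0 <= N by apply: Rintegral_ge0 => t _; rewrite addr_ge0// sqr_ge0.
(* The integrand is (G_t - F)^2 + (F_t + G)^2, that is |L v - v|^2. *)
have TJN : 0 <= T - 2 * J + N.
  have -> : T - 2 * J + N = 1 * T + (- 2) * J + 1 * N by ring.
  rewrite -lin; apply: Rintegral_ge0 => t _.
  have := sqr_ge0 (Gt r t - F r t); have := sqr_ge0 (Ft r t + G r t).
  by rewrite sqrrB sqrrD; lra.
have := @weight_form_ge R x c bh eps T J N bhE x1 c0 c20 ceps N0 JT TJ TJN.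
have e1 : al r = walpha bh x / r0 ^+ 2.
  by rewrite /al /walpha /sg -/x rx; field; rewrite xn r0n.
have e2 : be r = wbeta bh x / r0 ^+ 2.
  by rewrite /be /wbeta /sg /sg' /G0 -/x rx /bh; field; rewrite xn r0n.
have e3 : ga r = wgamma bh x / r0 ^+ 2.
  by rewrite /ga /wgamma /G0' /G0 -/x rx /bh; field; rewrite xn r0n.
have e4 : lam = (bh - bh ^+ 2 * (1 + eps)) / r0 ^+ 2.
  by rewrite /lam /bh; field.
rewrite e1 e2 e3 e4 => h.
have -> : walpha bh x / r0 ^+ 2 * T + wbeta bh x / r0 ^+ 2 * J +
  wgamma bh x / r0 ^+ 2 * N - (bh - bh ^+ 2 * (1 + eps)) / r0 ^+ 2 * N =
  (walpha bh x * T + wbeta bh x * J + wgamma bh x * N -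
  (bh - bh ^+ 2 * (1 + eps)) * N) / r0 ^+ 2 by ring.
by apply: divr_ge0; rewrite ?subr_ge0// exprn_ge0// ltW.
Qed.

Let bh_small : bh <= 1 / 400.
Proof.
rewrite bhE (_ : 1 / 400 = (1 / 20) ^+ 2 :> R); last by field.
by apply: lerXn2r; rewrite ?nnegrE ?divr_ge0// ltW.
Qed.

Let DD : set plane := `[r0, M] `*` `[a, a + pi *+ 2].
Let mass_side (z : R * R) : R := lam * z.1 * (1 - z.1 / M) * polar_mass z.1 z.2.
Let energy_side (z : R * R) : R :=
  z.1 * ((1 - z.1 / M) * polar_energy z.1 z.2 + (2 * b * z.1 + 1) / M *
        (polar_mass z.1 z.2 + polar_energy z.1 z.2)).

(** The energy identity is integrated after dropping [sq]. The term from the slope of the cutoff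
    goes to the energy side, where its factor (2 b r + 1) / M tends to zero pointwise as M grows. *)
Lemma annulus_inequality : 0 < b -> (
  \int[mu2]_(z in DD) (mass_side z)%:E <= \int[mu2]_(z in DD) (energy_side z)%:E)%E.
Proof.
move=> b0; have := bom; have := bmass; have := benergy; have := bid; rewrite /om => k1 k2 k3 k4.
have bL : bdm mass_side by rewrite /mass_side; bdm_tac.
have bR : bdm energy_side by rewrite /energy_side; bdm_tac.
have iL := bdm_integrable bL; have iR := bdm_integrable bR.
have mD := @measurable_rect R r0 M a (a + pi *+ 2).
have i1 := bdm_integrable bh1; have i2 := bdm_integrable bh2.
have i3 := bdm_integrable bh3.
have b12 : bdm (fun z => h1 z + h2 z) by exact: bdm_D bh1 bh2.
have b123 : bdm (fun z => h1 z + h2 z + h3 z) by exact: bdm_D b12 bh3.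
have pos : 0 <= \int[mu2]_(z in `[r0, M] `*` `[a, a + pi *+ 2]) (h1 z + h2 z + h3 z).
  rewrite (RintegralD mD (bdm_integrable b12) i3) (RintegralD mD i1 i2).
  by rewrite !addr_ge0 ?int_h1 ?int_h2 ?int_h3.
have fL : (\int[mu2]_(z in DD) (mass_side z)%:E)%E \is a fin_num.
  exact: (integrable_fin_num mD iL).
have fR : (\int[mu2]_(z in DD) (energy_side z)%:E)%E \is a fin_num.
  exact: (integrable_fin_num mD iR).
rewrite -(fineK fL) -(fineK fR).
rewrite lee_fin -subr_ge0.
have := RintegralB mD iR iL; rewrite /Rintegral => <-; apply: (le_trans pos).
apply: le_Rintegral => //.
- exact: bdm_integrable.
- exact: (bdm_integrable (bdm_D bR (bdm_N bL))).
move=> -[r t] [/=]; rewrite in_itv/= => /andP[r0r rM] _.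
have r_gt0 : 0 < r by exact: lt_le_trans r0r.
have rn : r != 0 by rewrite gt_eqF.
have idn := energy_identity t rn.
have sq0 : 0 <= sq (r, t).
  apply: mulr_ge0; first by apply: mulr_ge0; [exact: ltW|exact: om_ge0].
  by apply: addr_ge0; exact: sqr_ge0.
have mass0 := mass_ge0 r t.
have /andP[g1 g2] := wg_bound (r / r0) (ltW bh0).
have x1 : 1 <= r / r0 by rewrite ler_pdivlMr// mul1r.
have /andP[s1 s2] := wsig_bound (ltW bh0) bh_small x1.
have bhx : bh * (r / r0) ^+ 2 = b * r ^+ 2 by rewrite /bh; field.
rewrite bhx -/(G0 r) in g1; rewrite -/(sg r) in s1 s2.
pose P := Ft r t / r + b * r / 2 * G r t.
pose Q := Gt r t / r - b * r / 2 * F r t.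
(* The angular current in terms of the covariant angular derivative (P, Q), which the energy
   controls, plus the contribution of the potential. *)
have jE : j r t = r * (F r t * Q - G r t * P) + b * r ^+ 2 / 2 * polar_mass r t.
  by rewrite /j /P /Q /polar_mass; field.
have en : P ^+ 2 + Q ^+ 2 <= polar_energy r t.
  by rewrite /polar_energy -/P -/Q; have := sqr_ge0 (Fr r t); have := sqr_ge0 (Gr r t);
    lra.
have FQ : `|F r t * Q - G r t * P| <= (polar_mass r t + polar_energy r t) / 2.
  have := sqr_ge0 (F r t - Q); have := sqr_ge0 (F r t + Q).
  have := sqr_ge0 (G r t - P); have := sqr_ge0 (G r t + P).
  rewrite ler_norml; move: en; rewrite /polar_mass !sqrrB !sqrrD.
  by move=> *; apply/andP; split; lra.
have br0 : 0 <= b * r ^+ 2 by rewrite mulr_ge0 ?sqr_ge0 ?ltW.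
have jb : `|j r t| <= r * ((polar_mass r t + polar_energy r t) / 2) +
    b * r ^+ 2 / 2 * polar_mass r t.
  rewrite jE (le_trans (ler_normD _ _))// lerD//.
    by rewrite normrM gtr0_norm// ler_pM2l.
  by rewrite ger0_norm// mulr_ge0// divr_ge0.
have sgj : - (sg r * j r t) <= `|j r t|.
  rewrite (le_trans (ler_norm _))// normrN normrM ler_piMl// ler_norml.
  by rewrite s1.
have e0 : 0 <= polar_energy r t by rewrite !addr_ge0// sqr_ge0.
have G0m : - (G0 r * polar_mass r t) <= 3 / 2 * (b * r ^+ 2) * polar_mass r t.
  by rewrite -mulNr ler_wpM2r// lerNl.
(* The potential part of the current gives b r^2 / 2 and the bound on [wg] gives 3 / 2 b r^2;
   together 2 b r^2. *)
have key : - (G0 r * polar_mass r t + sg r * j r t) <=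
    (2 * b * r ^+ 2 + r) * (polar_mass r t + polar_energy r t).
  have := mulr_ge0 br0 e0; have := mulr_ge0 (ltW r_gt0) mass0.
  have := mulr_ge0 (ltW r_gt0) e0.
  by move: jb sgj G0m; lra.
have : M^-1 * - (G0 r * polar_mass r t + sg r * j r t) <=
    M^-1 * ((2 * b * r ^+ 2 + r) * (polar_mass r t + polar_energy r t)).
  by rewrite ler_pM2l// invr_gt0.
move: idn sq0; rewrite /om /energy_side /mass_side /=.
set h := h1 _ + h2 _ + h3 _; lra.
Qed.

End annulus.

(** * Directional derivatives along lines *)

Section directional.
Context {R : realType}.

Lemma is_derive_line (phi : R * R -> R) (x v : R * R) (d : R) :
  is_derive (0 : R) 1 (fun h => phi (h *: v + x)) d -> is_derive x v phi d.
Proof.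
have E : (fun h : R => h^-1 *: ((phi \o shift x) (h *: v) - phi x)) =
  (fun h : R => h^-1 *: (((fun h => phi (h *: v + x)) \o shift 0) (h *: 1) -
     (fun h => phi (h *: v + x)) 0)).
  apply/funext => h /=; rewrite scale0r add0r addr0.
  by rewrite [h *: 1](mulr1 h).
move=> [dv Dv]; split.
  by rewrite /derivable E.
by rewrite -Dv /derive E.
Qed.

Lemma is_derive_line1 (phi : R * R -> R) (x1 x2 d : R) :
  is_derive x1 1 (fun t => phi (t, x2)) d -> is_derive (x1, x2) (1, 0) phi d.
Proof.
move=> h; apply: is_derive_line.
rewrite (_ : (fun h => _) = (fun h => phi (h + x1, x2))).
  rewrite -[d]mulr1; apply: (@der_comp _ (fun t => phi (t, x2)) (fun h => h + x1)).
    by rewrite add0r.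
  by apply: is_derive_eq; rewrite addr0.
apply/funext => k; congr phi; congr pair; rewrite /= /GRing.scale/= ?mulr1 ?mulr0 ?add0r//.
Qed.

Lemma is_derive_line2 (phi : R * R -> R) (x1 x2 d : R) :
  is_derive x2 1 (fun t => phi (x1, t)) d -> is_derive (x1, x2) (0, 1) phi d.
Proof.
move=> h; apply: is_derive_line.
rewrite (_ : (fun h => _) = (fun h => phi (x1, h + x2))).
  rewrite -[d]mulr1; apply: (@der_comp _ (fun t => phi (x1, t)) (fun h => h + x2)).
    by rewrite add0r.
  by apply: is_derive_eq; rewrite addr0.
apply/funext => k; congr phi; congr pair; rewrite /= /GRing.scale/= ?mulr1 ?mulr0 ?add0r//.
Qed.

End directional.

(** * A class of smooth functions closed under differentiation *)

Section bump.
Context {R : realType}.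
Implicit Types (t x : R) (n : nat).

(** The functions t^-n exp (- 1 / t), extended by zero. The power n is carried along because
    differentiation maps the family into its own linear span. *)
Definition flat n t : R := if 0 < t then t^-1 ^+ n * expR (- t^-1) else 0.

Lemma flat_ge0 n t : 0 <= flat n t.
Proof.
rewrite /flat; case: ifPn => // t0.
by rewrite mulr_ge0 ?expR_ge0// exprn_ge0// invr_ge0 ltW.
Qed.

Lemma exprn_expRN_le_fact n x : 0 < x -> x ^+ n * expR (- x) <= n`!%:R.
Proof.
move=> x0; case: n => [|n].
  by rewrite expr0 mul1r fact0 -[leRHS]expR0 ler_expR oppr_le0 ltW.
rewrite expRN ler_pdivrMr ?expR_gt0//.
have F0 : 0 < n.+1`!%:R :> R by rewrite ltr0n fact_gt0.
have := @expR_ge1Dxn _ x n (ltW x0) => h.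
rewrite mulrC -ler_pdivrMr//; apply: le_trans h; lra.
Qed.

Lemma flat_bounded n t : `|flat n t| <= n`!%:R.
Proof.
rewrite ger0_norm ?flat_ge0// /flat; case: ifPn => // t0.
by apply: exprn_expRN_le_fact; rewrite invr_gt0.
Qed.

(** The quadratic bound makes the difference quotient at 0 tend to 0, the only point where the
    derivative is not computed by the usual rules. *)
Lemma flat_quadratic n t : `|flat n t| <= n.+2`!%:R * t ^+ 2.
Proof.
rewrite ger0_norm ?flat_ge0// {1}/flat; case: ifPn => [t0|_]; last first.
  by rewrite mulr_ge0 ?sqr_ge0.
have := @exprn_expRN_le_fact n.+2 t^-1; rewrite invr_gt0 => /(_ t0).
move=> h; rewrite !exprS in h.
have -> : t^-1 ^+ n * expR (- t^-1) =
   (t^-1 * (t^-1 * t^-1 ^+ n) * expR (- t^-1)) * t ^+ 2.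
  by field; rewrite gt_eqF.
by rewrite ler_wpM2r// sqr_ge0.
Qed.

Lemma is_derive_flat n t :
  is_derive t 1 (flat n) (- (n%:R * flat n.+1 t) + flat n.+2 t).
Proof.
have [t0|t0|->] := ltgtP t 0.
- rewrite /flat !ltNge !(ltW t0)/= mulr0 oppr0 addr0.
  apply: (@near_eq_is_derive _ _ _ (cst 0)).
  near=> s; rewrite ltNge ltW//=; near: s; exact: lt_nbhsl.
- have nr : \near t, (fun s => s^-1 ^+ n * expR (- s^-1)) t = flat n t.
    by near=> s; rewrite /flat ifT//; near: s; exact: lt_nbhsr.
  suff key : is_derive t 1 (fun s => s^-1 ^+ n * expR (- s^-1))
      (- (n%:R * flat n.+1 t) + flat n.+2 t) by exact: near_eq_is_derive nr key.
  have tn0 : t != 0 by rewrite gt_eqF.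
  rewrite /flat t0; have h : is_derive t 1 (fun s => s^-1) (- t ^- 2).
    have := der_V (der_id t) tn0; by rewrite mulN1r.
  have h1 := der_X n h; have h2 := der_exp (der_N h).
  have := der_M h1 h2; set d := (X in is_derive _ _ _ X).
  suff -> : d = - (n%:R * (t^-1 ^+ n.+1 * expR (- t^-1))) + t^-1 ^+ n.+2 * expR (- t^-1).
    by [].
  rewrite /d; case: n {h1 d nr} => [|n].
    by rewrite !mul0r !expr0 /= !exprS !expr0; field.
  by rewrite /= !exprS; field.
rewrite /flat ltxx mulr0 oppr0 addr0.
have lim : (fun h : R => h^-1 *: (flat n (h *: 1 + 0) - flat n 0)) @ 0^' --> (0 : R).
  apply/norm_cvg0P.
  apply: (@squeeze_cvgr _ _ _ _ (cst 0) (fun h => n.+2`!%:R * `|h|)).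
  - near=> h; rewrite normr_ge0/=.
    have hn0 : h != 0 by near: h; exact: nbhs_dnbhs_neq.
    rewrite {2}/flat ltxx subr0 addr0 [h *: 1](mulr1 h) normrM normfV.
    rewrite mulrC ler_pdivrMr ?normr_gt0//.
    by rewrite -mulrA -normrM -expr2 (ger0_norm (sqr_ge0 h)); exact: flat_quadratic.
  - exact: cvg_cst.
  - rewrite -[X in _ --> X](mulr0 n.+2`!%:R); apply: cvgM; first exact: cvg_cst.
    rewrite -[X in _ --> X](@normr0 R R); apply: cvg_norm.
    by apply: cvg_within.
split; first by apply/cvg_ex; exists 0.
exact/cvg_lim.
Unshelve. all: by end_near. Qed.

(** Generating the class from [flat] and constants by sums and products lets all derivatives, their
    continuity and their boundedness be obtained by induction, without estimates of higher order. *)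
Inductive smooth_fun : (R -> R) -> Prop :=
| smooth_flat n (a b : R) : smooth_fun (fun t => flat n (a * t + b))
| smooth_cst (c : R) : smooth_fun (fun=> c)
| smooth_add f g : smooth_fun f -> smooth_fun g -> smooth_fun (fun t => f t + g t)
| smooth_mul f g : smooth_fun f -> smooth_fun g -> smooth_fun (fun t => f t * g t).

Lemma smooth_fun_derive f : smooth_fun f ->
  exists f', smooth_fun f' /\ forall t : R, is_derive t 1 f (f' t).
Proof.
elim=> {f} [n a b|c|f g _ [f' [sf df]] _ [g' [sg dg]]|f g hf [f' [sf df]] hg [g' [sg dg]]].
- exists (fun t => (- n%:R * flat n.+1 (a * t + b) + flat n.+2 (a * t + b)) * a); split.
    by do !constructor.
  move=> t; apply: (@der_comp _ (flat n) (fun t => a * t + b)).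
    by have := is_derive_flat n (a * t + b); rewrite mulNr.
  by apply: is_derive_eq; rewrite addr0 /GRing.scale/= mulr1.
- by exists (fun=> 0); split; [constructor|move=> t; exact: der_cst].
- by exists (fun t => f' t + g' t); split; [constructor|move=> t; exact: der_D].
- exists (fun t => f' t * g t + f t * g' t); split; last by move=> t; exact: der_M.
  by constructor; constructor.
Qed.

Lemma smooth_fun_bounded f : smooth_fun f -> exists C : R, forall t, `|f t| <= C.
Proof.
elim=> {f} [n a b|c|f g _ [A hA] _ [B hB]|f g _ [A hA] _ [B hB]].
- by exists n`!%:R => t; exact: flat_bounded.
- by exists `|c|.
- by exists (A + B) => t; rewrite (le_trans (ler_normD _ _))// lerD.
- by exists (A * B) => t; rewrite normrM ler_pM.
Qed.

Lemma smooth_fun_affine f a b : smooth_fun f -> smooth_fun (fun t => f (a * t + b)).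
Proof.
elim=> {f} [n a' b'|c|f g _ hf _ hg|f g _ hf _ hg].
- have -> : (fun t => flat n (a' * (a * t + b) + b')) =
    (fun t => flat n (a' * a * t + (a' * b + b'))).
    by apply/funext => t; congr flat; ring.
  exact: smooth_flat.
- exact: smooth_cst.
- exact: smooth_add.
- exact: smooth_mul.
Qed.

Lemma smooth_fun_continuous f : smooth_fun f -> continuous f.
Proof. by move=> /smooth_fun_derive[f' [_ df]] t; exact: der_continuous (df t). Qed.

(** The planar analogue; it is stable under every directional derivative, which yields [smooth2] for
    products of two one-variable kernels. *)
Inductive smooth_fun2 : (R * R -> R) -> Prop :=
| smooth2_fst f : smooth_fun f -> smooth_fun2 (fun y => f y.1)
| smooth2_snd f : smooth_fun f -> smooth_fun2 (fun y => f y.2)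
| smooth2_add f g : smooth_fun2 f -> smooth_fun2 g -> smooth_fun2 (fun y => f y + g y)
| smooth2_mul f g : smooth_fun2 f -> smooth_fun2 g -> smooth_fun2 (fun y => f y * g y).

Lemma smooth_fun2_derive f (v : R * R) : smooth_fun2 f ->
  exists f', smooth_fun2 f' /\ forall x : R * R, is_derive x v f (f' x).
Proof.
elim=> {f} [f hf|f hf|f g _ [f' [sf df]] _ [g' [sg dg]]|f g hf [f' [sf df]] hg [g' [sg dg]]].
- have [f' [sf df]] := smooth_fun_derive hf.
  exists (fun y => f' y.1 * v.1); split.
    apply: (smooth2_mul (smooth2_fst sf)).
    exact: (smooth2_fst (smooth_cst v.1)).
  move=> x; apply: is_derive_line => /=.
  apply: (@der_comp _ f (fun h => h * v.1 + x.1)).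
    by rewrite mul0r add0r.
  by apply: is_derive_eq; rewrite /GRing.scale/=; ring.
- have [f' [sf df]] := smooth_fun_derive hf.
  exists (fun y => f' y.2 * v.2); split.
    apply: (smooth2_mul (smooth2_snd sf)).
    exact: (smooth2_snd (smooth_cst v.2)).
  move=> x; apply: is_derive_line => /=.
  apply: (@der_comp _ f (fun h => h * v.2 + x.2)).
    by rewrite mul0r add0r.
  by apply: is_derive_eq; rewrite /GRing.scale/=; ring.
- exists (fun y => f' y + g' y); split; first exact: smooth2_add.
  by move=> x; exact: (is_deriveD (df x) (dg x)).
- exists (fun y => f y * g' y + g y * f' y); split.
    by apply: smooth2_add; exact: smooth2_mul.
  by move=> x; exact: (is_deriveM (df x) (dg x)).
Qed.

Lemma smooth_fun2_continuous f : smooth_fun2 f -> continuous f.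
Proof.
elim=> {f} [f hf|f hf|f g _ cf _ cg|f g _ cf _ cg] x.
- apply: (@cvg_comp _ _ _ fst f (nbhs x) (nbhs x.1)); first exact: cvg_fst.
  exact: smooth_fun_continuous.
- apply: (@cvg_comp _ _ _ snd f (nbhs x) (nbhs x.2)); first exact: cvg_snd.
  exact: smooth_fun_continuous.
- by apply: cvgD; [exact: cf|exact: cg].
- by apply: cvgM; [exact: cf|exact: cg].
Qed.

Lemma smooth_fun2_smooth2 f : smooth_fun2 f -> smooth2 f.
Proof.
move=> sf s.
have : smooth_fun2 (iter_derive s f).
  elim: s => [//|v s IH] /=.
  have [g [sg dg]] := smooth_fun2_derive v IH.
  have -> : 'D_v (iter_derive s f) = g by apply/funext => x; exact: (@derive_val _ _ _ _ _ _ _ (dg x)).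
  exact: sg.
move=> sg; split; first exact: smooth_fun2_continuous.
by move=> x v; have [g [_ dg]] := smooth_fun2_derive v sg; exact: (@ex_derive _ _ _ _ _ _ _ (dg x)).
Qed.

End bump.

(** * Mollifiers on the line *)

Section mollifier.
Context {R : realType}.
Local Notation mu := (@lebesgue_measure R).

(** The factors vanish for t <= -1 and for t >= 1 respectively. *)
Let B (t : R) : R := flat 0 (1 * t + 1) * flat 0 (-1 * t + 1).

Let sB : smooth_fun B. Proof. by do !constructor. Qed.

Let B0 t : 0 <= B t. Proof. by rewrite mulr_ge0// flat_ge0. Qed.

Let Bsupp t : 1 <= `|t| -> B t = 0.
Proof.
rewrite /B /flat; case: ifPn => [h1|]; last by rewrite mul0r.
case: ifPn => [h2|]; last by rewrite mulr0.
by rewrite leNgt ltr_norml => /negP[]; apply/andP; split; lra.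
Qed.

Let B1 t : B t <= 1.
Proof.
have h s : flat 0 s <= 1 :> R by have := flat_bounded 0 s; rewrite fact0; exact/le_trans/ler_norm.
by rewrite mulr_ile1// ?flat_ge0.
Qed.

Let mB : measurable_fun [set: R] B.
Proof. by apply: continuous_measurable_fun; exact: smooth_fun_continuous sB. Qed.

Let I : \bar R := (\int[mu]_t (B t)%:E)%E.

Let mEB : measurable_fun [set: measurableTypeR R] (EFin \o B).
Proof. exact/measurable_EFinP. Qed.

Let I_lty : (I < +oo)%E.
Proof.
have -> : I = (\int[mu]_(t in `[(- 1)%R, 1%R]) (B t)%:E)%E.
  rewrite /I [RHS]integral_mkcond; apply: eq_integral => t _.
  rewrite patchE; case: ifPn => //; rewrite notin_setE/= in_itv/=.
  by move=> /negP; rewrite -ler_norml -ltNge => /ltW/Bsupp ->.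
apply: (@le_lt_trans _ _ (\int[mu]_(t in `[(- 1)%R, 1%R]) (cst 1%E t))%E).
  apply: ge0_le_integral => //; first by move=> t _; rewrite lee_fin.
    by apply: measurable_funTS.
  by move=> t _; rewrite lee_fin.
by rewrite integral_cst// mul1e /= lebesgue_measure_itv/=; case: ifP; rewrite ?ltry// -EFinB ltry.
Qed.

Let I_gt0 : (0 < I)%E.
Proof.
(* For |t| <= 1/2 both arguments of [flat] are at least 1/2, so each factor is at least exp (-
   2). *)
pose c : R := expR (- 2) * expR (- 2).
have c0 : 0 < c by rewrite mulr_gt0 ?expR_gt0.
have : (0 < \int[mu]_(t in `](- (1/2))%R, (1/2)%R]) c%:E)%E.
  by rewrite integral_cst_oc; [rewrite lte_fin mulr_gt0//; lra|lra].
move=> /lt_le_trans; apply.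
rewrite [leLHS]integral_mkcond; apply: ge0_le_integral => //.
- by move=> t _; rewrite patchE; case: ifP => // _; rewrite lee_fin ltW.
- apply/(measurable_restrictT _ (measurable_itv _)).
  exact: measurable_cst.
move=> t _; rewrite patchE; case: ifPn => [|_]; last by rewrite lee_fin.
rewrite inE/= in_itv/= => /andP[h1 h2]; rewrite lee_fin /c /B /flat.
rewrite !ifT; [|lra|lra]; rewrite !expr0 !mul1r; apply: ler_pM; rewrite ?expR_ge0//.
  rewrite ler_expR lerN2 -[leRHS]invrK lef_pV2 ?posrE ?invr_gt0//; lra.
rewrite ler_expR lerN2 -[leRHS]invrK lef_pV2 ?posrE ?invr_gt0//; lra.
Qed.

(** The constant C in the bound C / d does not depend on d: this is what compares the mollification
    with averages over intervals in Lebesgue differentiation. *)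
Lemma mollifier_ex : exists C : R, forall d : R, 0 < d -> exists p : R -> R,
  [/\ smooth_fun p, forall t, 0 <= p t, forall t, d <= `|t| -> p t = 0,
      forall t, p t <= C / d & (\int[mu]_t (p t)%:E = 1)%E].
Proof.
pose J := fine I.
have J0 : 0 < J by rewrite fine_gt0// I_gt0 I_lty.
have JI : I = J%:E by rewrite fineK// ge0_fin_numE ?I_lty// ltW.
exists J^-1 => d d0; exists (fun t => (J * d)^-1 * B (d^-1 * t + 0)).
have Jd0 : 0 < J * d by rewrite mulr_gt0.
split.
- by apply: smooth_mul; [exact: smooth_cst|exact: smooth_fun_affine].
- by move=> t; rewrite mulr_ge0// invr_ge0 ltW.
- move=> t dt; rewrite Bsupp ?mulr0// addr0 normrM normfV (gtr0_norm d0).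
  by rewrite mulrC ler_pdivlMr// mul1r.
- by move=> t; rewrite invfM ler_piMr// mulr_ge0// invr_ge0 ltW.
have di0 : 0 < d^-1 by rewrite invr_gt0.
have EB0 t : (0 <= (EFin \o B) t)%E by rewrite lee_fin.
have := ge0_integral_scale di0 mEB EB0.
rewrite [LHS](_ : _ = I)// JI => e.
transitivity (\int[mu]_t ((J^-1)%:E * ((d^-1)%:E * (B (d^-1 * t))%:E)))%E.
  apply: eq_integral => t _; rewrite -!EFinM; congr EFin.
  by rewrite addr0 invfM mulrA.
rewrite ge0_integralZl//.
- by rewrite -e -EFinM mulVf// gt_eqF.
- apply: emeasurable_funM => //; apply/measurable_EFinP; apply: (measurableT_comp mB).
  exact: mulrl_measurable.
- by move=> t _; rewrite -EFinM lee_fin mulr_ge0// ltW.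
- by rewrite lee_fin invr_ge0 ltW.
Qed.

End mollifier.

(** * Convolution with a product kernel *)

Section convolution.
Context {R : realType}.
Local Notation mu := (@lebesgue_measure R).
Local Notation mu2 := (@lebesgue_measure R \x @lebesgue_measure R)%E.
Local Notation plane := (measurableTypeR R * measurableTypeR R)%type.
Implicit Types (p q : R -> R) (u : R * R -> R).

(** A product kernel, rather than a radial one: the smoothing can then be undone one variable at a
    time, with one-dimensional differentiation theorems. *)
Definition conv p q u (x : R * R) : R :=
  \int[mu2]_y (u y * (p (x.1 - y.1) * q (x.2 - y.2))).

Lemma integrable_mul_bounded (u k : plane -> R) (C : R) :
  mu2.-integrable setT (EFin \o u) -> measurable_fun [set: plane] k ->
  (forall y, `|k y| <= C) -> mu2.-integrable setT (EFin \o (fun y => u y * k y)).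
Proof.
move=> iu mk kC.
have mu_ : measurable_fun [set: plane] u.
  by apply/measurable_EFinP; exact: (measurable_int mu2 iu).
have iCu : mu2.-integrable setT (fun y => C%:E * (EFin \o u) y)%E by exact: integrableZl.
apply: (le_integrable _ _ _ iCu) => //.
  by apply/measurable_EFinP; exact: measurable_funM.
move=> y _; rewrite -EFinM !abse_EFin lee_fin !normrM mulrC.
apply: ler_pM => //; exact: (le_trans (kC y) (ler_norm _)).
Qed.

Lemma measurable_kernel p q (x : R * R) : smooth_fun p -> smooth_fun q ->
  measurable_fun [set: plane] (fun y => p (x.1 - y.1) * q (x.2 - y.2)).
Proof.
move=> sp sq.
have mp := continuous_measurable_fun (smooth_fun_continuous sp).
have mq := continuous_measurable_fun (smooth_fun_continuous sq).
apply: measurable_funM; (apply: measurableT_comp => //; exact: measurable_funB).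
Qed.

Lemma integrable_conv p q u x : smooth_fun p -> smooth_fun q ->
  mu2.-integrable setT (EFin \o u) ->
  mu2.-integrable setT (EFin \o (fun y => u y * (p (x.1 - y.1) * q (x.2 - y.2)))).
Proof.
move=> sp sq iu; have [A hA] := smooth_fun_bounded sp; have [C hC] := smooth_fun_bounded sq.
apply: (@integrable_mul_bounded _ _ (A * C)) => //; first exact: measurable_kernel.
by move=> y; rewrite /= normrM; apply: ler_pM.
Qed.

Lemma conv_bounded p q u : smooth_fun p -> smooth_fun q ->
  mu2.-integrable setT (EFin \o u) -> exists C, forall x, `|conv p q u x| <= C.
Proof.
move=> sp sq iu; have [A hA] := smooth_fun_bounded sp; have [C hC] := smooth_fun_bounded sq.
have iau : mu2.-integrable setT (EFin \o (fun y => `|u y|)).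
  by have := integrable_abse iu; apply: eq_integrable.
exists (\int[mu2]_y (A * C * `|u y|)) => x.
rewrite (le_trans (le_normr_Rintegral _ (integrable_conv x sp sq iu)))//.
apply: le_Rintegral => //.
- by have := integrable_abse (integrable_conv x sp sq iu); apply: eq_integrable.
- by have := integrableZl measurableT (A * C) iau; apply.
move=> y _; rewrite /= normrM mulrC; apply: ler_pM => //.
by rewrite normrM; apply: ler_pM.
Qed.

(** Derivative along a curve (g1, g2) of bounded velocity, stated so as to cover both rays and
    circles. Differentiation under the integral puts all derivatives on the kernel. *)
Lemma is_derive_conv p p' q q' u (g1 g2 g1' g2' : R -> R) (K s : R) :
  smooth_fun p -> smooth_fun p' -> smooth_fun q -> smooth_fun q' ->
  (forall t : R, is_derive t 1 p (p' t)) -> (forall t : R, is_derive t 1 q (q' t)) ->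
  mu2.-integrable setT (EFin \o u) ->
  (forall t : R, is_derive t 1 g1 (g1' t)) -> (forall t : R, is_derive t 1 g2 (g2' t)) ->
  (forall t, `|g1' t| <= K) -> (forall t, `|g2' t| <= K) ->
  is_derive s 1 (fun t => conv p q u (g1 t, g2 t))
    (g1' s * conv p' q u (g1 s, g2 s) + g2' s * conv p q' u (g1 s, g2 s)).
Proof.
move=> sp sp' sq sq' dp dq iu dg1 dg2 K1 K2.
have [A hA] := smooth_fun_bounded sp; have [C hC] := smooth_fun_bounded sq.
have [A' hA'] := smooth_fun_bounded sp'; have [C' hC'] := smooth_fun_bounded sq'.
pose f (t : R) (y : plane) := u y * (p (g1 t - y.1) * q (g2 t - y.2)).
pose f' (t : R) (y : plane) := u y *
  (g1' t * p' (g1 t - y.1) * q (g2 t - y.2) + p (g1 t - y.1) * (g2' t * q' (g2 t - y.2))).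
have df (t : R) (y : plane) : is_derive t (1 : R) (f ^~ y) (f' t y).
  have e1 := @der_comp R p (fun t => g1 t - y.1) t _ _ (dp _) (der_D (dg1 t) (der_cst (- y.1) t)).
  have e2 := @der_comp R q (fun t => g2 t - y.2) t _ _ (dq _) (der_D (dg2 t) (der_cst (- y.2) t)).
  apply: (@is_derive_eq _ _ _ _ _ _ _ _ (der_M (der_cst (u y) t) (der_M e1 e2))).
  by rewrite /f'; ring.
have f1 : partial1of2 f = f'.
  apply/funext => t; apply/funext => y; rewrite partial1of2E.
  exact: (@derive_val _ _ _ _ _ _ _ (df t y)).
pose Gd (y : plane) := `|u y| * (K * A' * C + A * (K * C')).
have Gd0 y : 0 <= Gd y.
  have h0 (w : R -> R) (D : R) : (forall t, `|w t| <= D) -> 0 <= D.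
    by move=> h; exact: le_trans (h 0).
  have := h0 _ _ K1; have := h0 _ _ hA; have := h0 _ _ hC.
  have := h0 _ _ hA'; have := h0 _ _ hC' => *.
  by apply: mulr_ge0 => //; nng.
have iGd : mu2.-integrable setT (EFin \o Gd).
  have iau : mu2.-integrable setT (EFin \o (fun y => `|u y|)).
    by have := integrable_abse iu; apply: eq_integrable.
  by apply: (integrable_mul_bounded iau (C := `|K * A' * C + A * (K * C')|)).
have I1 : `](s - 1), (s + 1)[%classic s by rewrite /= in_itv/=; lra.
have intf t : `](s - 1), (s + 1)[%classic t -> mu2.-integrable setT (EFin \o f t).
  by move=> _; exact: (integrable_conv (g1 t, g2 t)).
have d1 t y : `](s - 1), (s + 1)[%classic t -> [set: plane] y -> derivable (f ^~ y) t 1.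
  by move=> _ _; exact: (@ex_derive _ _ _ _ _ _ _ (df t y)).
have ub t y : `](s - 1), (s + 1)[%classic t -> [set: plane] y ->
    `|partial1of2 f t y| <= Gd y.
  move=> _ _; rewrite f1 /f' /Gd normrM ler_wpM2l// (le_trans (ler_normD _ _))//.
  by apply: lerD; rewrite !normrM; apply: ler_pM => //; apply: ler_pM.
split.
  exact: (derivable_under_integral measurableT I1 intf d1 Gd0 iGd ub).
rewrite -derive1E.
rewrite (differentiation_under_integral measurableT I1 intf d1 Gd0 iGd ub) f1.
have i1 := integrable_conv (g1 s, g2 s) sp' sq iu.
have i2 := integrable_conv (g1 s, g2 s) sp sq' iu.
rewrite /conv -RintegralZl// -RintegralZl// -RintegralD//=.
- by apply: eq_Rintegral => y _; rewrite /f' /=; ring.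
- by have := integrableZl measurableT (g1' s) i1; apply.
- by have := integrableZl measurableT (g2' s) i2; apply.
Qed.

Lemma sigma_finite_plane : @sigma_finite _ plane R setT mu2.
Proof.
have h := lebesgue_integral_fubini.measure_function_Measure_isSigmaFinite__to__measure_function_isSigmaFinite mu mu.
exact: isSigmaFinite.sigma_finiteT h.
Qed.
(* The canonical sigma-finite structure on products only covers probability
   measures. *)
Definition plane_measure : {sigma_finite_measure set plane -> \bar R} :=
  HB.pack_for {sigma_finite_measure set plane -> \bar R} mu2
    (Measure_isSigmaFinite.Build _ _ _ mu2 sigma_finite_plane).

Lemma integral_plane_measure (f : plane -> \bar R) : (\int[mu2]_x f x = \int[plane_measure]_x f x)%E.
Proof. exact: eq_measure_integral. Qed.

Lemma measurable_integral_plane (k : plane * plane -> \bar R) :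
  measurable_fun [set: (plane * plane)%type] k -> (forall z, 0 <= k z)%E ->
  measurable_fun [set: plane] (fun x => \int[mu2]_y k (x, y))%E.
Proof.
move=> mk k0; under eq_fun do rewrite integral_plane_measure.
exact: (@measurable_fun_fubini_tonelli_F _ _ plane plane R plane_measure k mk k0).
Qed.

Lemma ge0_integral_plane_swap (k : plane * plane -> \bar R) :
  measurable_fun [set: (plane * plane)%type] k -> (forall z, 0 <= k z)%E ->
  (\int[mu2]_x \int[mu2]_y k (x, y) = \int[mu2]_y \int[mu2]_x k (x, y))%E.
Proof.
move=> mk k0; rewrite !integral_plane_measure.
under eq_integral do rewrite integral_plane_measure.
under [RHS]eq_integral do rewrite integral_plane_measure.
exact: (@fubini_tonelli _ _ plane plane R plane_measure plane_measure k mk k0).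
Qed.

(** The integral is split into positive and negative parts, since measurability of parameter
    integrals is known for nonnegative functions. *)
Lemma measurable_conv p q u : smooth_fun p -> smooth_fun q ->
  mu2.-integrable setT (EFin \o u) -> measurable_fun [set: plane] (conv p q u).
Proof.
move=> sp sq iu.
have mu_ : measurable_fun [set: plane] u.
  by apply/measurable_EFinP; exact: (measurable_int mu2 iu).
have mp := continuous_measurable_fun (smooth_fun_continuous sp).
have mq := continuous_measurable_fun (smooth_fun_continuous sq).
pose h (z : plane * plane) : \bar R :=
  (u z.2 * (p (z.1.1 - z.2.1) * q (z.1.2 - z.2.2)))%:E.
have mh : measurable_fun [set: (plane * plane)%type] h.
  apply/measurable_EFinP; apply: measurable_funM; first exact: measurableT_comp.
  apply: measurable_funM; (apply: measurableT_comp => //; apply: measurable_funB);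
    by apply: measurableT_comp.
rewrite (_ : conv p q u = fun x => fine (\int[mu2]_y (h^\+)%E (x, y) - \int[mu2]_y (h^\-)%E (x, y))%E).
  apply: measurableT_comp => //; apply: emeasurable_funB.
    by apply: measurable_integral_plane => //; exact: measurable_funepos.
  by apply: measurable_integral_plane => //; exact: measurable_funeneg.
apply/funext => x; rewrite /conv /Rintegral [in LHS]integralE; congr (fine _).
by congr (_ - _)%E; apply: eq_integral => y _; rewrite !(funeposE, funenegE).
Qed.

End convolution.

(** * Mollified functions in polar coordinates *)

Section conv_polar.
Context {R : realType}.
Local Notation mu := (@lebesgue_measure R).
Local Notation mu2 := (@lebesgue_measure R \x @lebesgue_measure R)%E.
Local Notation plane := (measurableTypeR R * measurableTypeR R)%type.
Implicit Types (p q : R -> R) (u : R * R -> R).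

Definition polar_point (r t : R) : R * R := (r * cos t, r * sin t).

Lemma is_derive_conv_ray p p' q q' u (r t : R) :
  smooth_fun p -> smooth_fun p' -> smooth_fun q -> smooth_fun q' ->
  (forall t : R, is_derive t 1 p (p' t)) -> (forall t : R, is_derive t 1 q (q' t)) ->
  mu2.-integrable setT (EFin \o u) ->
  is_derive r 1 (fun r => conv p q u (polar_point r t))
    (cos t * conv p' q u (polar_point r t) + sin t * conv p q' u (polar_point r t)).
Proof.
move=> sp sp' sq sq' dp dq iu.
have d1 (c s : R) : is_derive s 1 (fun r : R => r * c) c.
  by apply: (@is_derive_eq _ _ _ _ _ _ _ _ (der_M (der_id s) (der_cst c s))); ring.
apply: (@is_derive_conv _ p p' q q' u (fun r => r * cos t) (fun r => r * sin t)
  (fun=> cos t) (fun=> sin t) 1 r) => // _.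
  by rewrite cos_max.
by rewrite sin_max.
Qed.

Lemma is_derive_conv_circle p p' q q' u (r t : R) :
  smooth_fun p -> smooth_fun p' -> smooth_fun q -> smooth_fun q' ->
  (forall t : R, is_derive t 1 p (p' t)) -> (forall t : R, is_derive t 1 q (q' t)) ->
  mu2.-integrable setT (EFin \o u) ->
  is_derive t 1 (fun t => conv p q u (polar_point r t))
    (- (r * sin t) * conv p' q u (polar_point r t) +
     r * cos t * conv p q' u (polar_point r t)).
Proof.
move=> sp sp' sq sq' dp dq iu.
apply: (@is_derive_conv _ p p' q q' u (fun t => r * cos t) (fun t => r * sin t)
  (fun t => - (r * sin t)) (fun t => r * cos t) `|r| t) => // s.
- apply: (@is_derive_eq _ _ _ _ _ _ _ _ (der_M (der_cst r s) (der_cos (der_id s)))); ring.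
- by rewrite normrN normrM ler_piMr// sin_max.
- by rewrite normrM ler_piMr// cos_max.
Qed.

Lemma measurable_conv_polar p q u : smooth_fun p -> smooth_fun q ->
  mu2.-integrable setT (EFin \o u) ->
  measurable_fun [set: plane] (fun z => conv p q u (polar_point z.1 z.2)).
Proof.
move=> sp sq iu.
apply: (measurableT_comp (measurable_conv sp sq iu)); apply: measurable_fun_pair.
  by apply: measurable_funM => //; apply: measurableT_comp => //; exact: measurable_cos.
by apply: measurable_funM => //; apply: measurableT_comp => //; exact: measurable_sin.
Qed.

Section C2.
Variables (r0 r1 a : R) (p p1 p2 p3 q q1 q2 q3 : R -> R) (u : R * R -> R).
Hypotheses (sp : smooth_fun p) (sp1 : smooth_fun p1) (sp2 : smooth_fun p2)
  (sp3 : smooth_fun p3) (sq : smooth_fun q) (sq1 : smooth_fun q1)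
  (sq2 : smooth_fun q2) (sq3 : smooth_fun q3).
Hypotheses (dp : forall t : R, is_derive t 1 p (p1 t))
  (dp1 : forall t : R, is_derive t 1 p1 (p2 t))
  (dp2 : forall t : R, is_derive t 1 p2 (p3 t))
  (dq : forall t : R, is_derive t 1 q (q1 t))
  (dq1 : forall t : R, is_derive t 1 q1 (q2 t))
  (dq2 : forall t : R, is_derive t 1 q2 (q3 t)).
Hypothesis iu : mu2.-integrable setT (EFin \o u).

Let K f g (r t : R) := conv f g u (polar_point r t).

Let Kcr f f' g g' t : smooth_fun f -> smooth_fun f' -> smooth_fun g -> smooth_fun g' ->
  (forall t : R, is_derive t 1 f (f' t)) -> (forall t : R, is_derive t 1 g (g' t)) ->
  continuous (K f g ^~ t).
Proof.
move=> h1 h2 h3 h4 h5 h6 r.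
exact: der_continuous (is_derive_conv_ray r t h1 h2 h3 h4 h5 h6 iu).
Qed.

Let Kct f f' g g' r : smooth_fun f -> smooth_fun f' -> smooth_fun g -> smooth_fun g' ->
  (forall t : R, is_derive t 1 f (f' t)) -> (forall t : R, is_derive t 1 g (g' t)) ->
  continuous (K f g r).
Proof.
move=> h1 h2 h3 h4 h5 h6 t.
exact: der_continuous (is_derive_conv_circle r t h1 h2 h3 h4 h5 h6 iu).
Qed.

Let bK f g : smooth_fun f -> smooth_fun g ->
  bounded_measurable r0 r1 a (a + pi *+ 2) (fun z => K f g z.1 z.2).
Proof.
move=> h1 h2; split; first exact: measurable_conv_polar.
by have [C hC] := conv_bounded h1 h2 iu; exists C => z _; exact: hC.
Qed.

Let ccos : continuous (@cos R).
Proof. exact: continuous_cos. Qed.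
Let csin : continuous (@sin R).
Proof. exact: continuous_sin. Qed.
Let cid : continuous (fun r : R => r).
Proof. by move=> r; exact: cvg_id. Qed.

Let bcos : bounded_measurable r0 r1 a (a + pi *+ 2) (fun z => cos z.2).
Proof.
split; first by apply: measurableT_comp => //; exact: measurable_cos.
by exists 1 => z _; rewrite cos_max.
Qed.
Let bsin : bounded_measurable r0 r1 a (a + pi *+ 2) (fun z => sin z.2).
Proof.
split; first by apply: measurableT_comp => //; exact: measurable_sin.
by exists 1 => z _; rewrite sin_max.
Qed.
Let brd : bounded_measurable r0 r1 a (a + pi *+ 2) (fun z => z.1).
Proof. exact: (@bdm_radial R r0 r1 a (a + pi *+ 2) (fun r => r)). Qed.

(** The chain rule for (r cos t, r sin t). The third derivatives of the kernels serve only to show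
    that the second-order convolutions are continuous. *)
Lemma conv_polar_C2 : polar_C2 r0 r1 a (K p q)
  (fun r t => cos t * K p1 q r t + sin t * K p q1 r t)
  (fun r t => - (r * sin t) * K p1 q r t + r * cos t * K p q1 r t)
  (fun r t => - sin t * K p1 q r t + cos t * K p q1 r t +
     r * (cos t * sin t * (K p q2 r t - K p2 q r t) +
          (cos t ^+ 2 - sin t ^+ 2) * K p1 q1 r t)).
Proof.
have dr r t := is_derive_conv_ray r t sp sp1 sq sq1 dp dq iu.
have dr1 r t := is_derive_conv_ray r t sp1 sp2 sq sq1 dp1 dq iu.
have dr2 r t := is_derive_conv_ray r t sp sp1 sq1 sq2 dp dq1 iu.
have dt r t := is_derive_conv_circle r t sp sp1 sq sq1 dp dq iu.
have dt1 r t := is_derive_conv_circle r t sp1 sp2 sq sq1 dp1 dq iu.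
have dt2 r t := is_derive_conv_circle r t sp sp1 sq1 sq2 dp dq1 iu.
have cr1 t : continuous (K p1 q ^~ t) by exact: (Kcr sp1 sp2 sq sq1 dp1 dq).
have cr2 t : continuous (K p q1 ^~ t) by exact: (Kcr sp sp1 sq1 sq2 dp dq1).
have cr3 t : continuous (K p2 q ^~ t) by exact: (Kcr sp2 sp3 sq sq1 dp2 dq).
have cr4 t : continuous (K p1 q1 ^~ t) by exact: (Kcr sp1 sp2 sq1 sq2 dp1 dq1).
have cr5 t : continuous (K p q2 ^~ t) by exact: (Kcr sp sp1 sq2 sq3 dp dq2).
have ct1 r : continuous (K p1 q r) by exact: (Kct sp1 sp2 sq sq1 dp1 dq).
have ct2 r : continuous (K p q1 r) by exact: (Kct sp sp1 sq1 sq2 dp dq1).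
have ct3 r : continuous (K p2 q r) by exact: (Kct sp2 sp3 sq sq1 dp2 dq).
have ct4 r : continuous (K p1 q1 r) by exact: (Kct sp1 sp2 sq1 sq2 dp1 dq1).
have ct5 r : continuous (K p q2 r) by exact: (Kct sp sp1 sq2 sq3 dp dq2).
have b0 := bK sp sq; have b1 := bK sp1 sq; have b2 := bK sp sq1.
have b3 := bK sp2 sq; have b4 := bK sp1 sq1; have b5 := bK sp sq2.
have ds (t : R) : is_derive t 1 (fun t : R => sin t) (cos t * 1).
  exact: der_sin (der_id t).
have dc (t : R) : is_derive t 1 (fun t : R => cos t) (- sin t * 1).
  exact: der_cos (der_id t).
have hc := bcos; have hs := bsin; have hr := brd.
split.
- exact: dr.
- exact: dt.
- move=> r t; apply: (@is_derive_eq _ _ _ _ _ _ _ _ (der_D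
    (der_M (der_N (der_M (der_id r) (der_cst (sin t) r))) (dr1 r t))
    (der_M (der_M (der_id r) (der_cst (cos t) r)) (dr2 r t)))).
  by rewrite /K; ring.
- move=> r t.
  have h := der_D (der_M (dc t) (dt1 r t)) (der_M (ds t) (dt2 r t)).
  apply: (@is_derive_eq _ _ _ _ _ _ _ _ h).
  by rewrite /K; ring.
- by move=> t; have := cr1 t; have := cr2 t => ? ?; ctn.
- by move=> r; have := ct1 r; have := ct2 r => ? ?; have := ccos; have := csin => ? ?; ctn.
- move=> t; have := cr1 t; have := cr2 t; have := cr3 t; have := cr4 t; have := cr5 t.
  by move=> ? ? ? ? ?; have := cid => ?; ctn.
- move=> r; have := ct1 r; have := ct2 r; have := ct3 r; have := ct4 r; have := ct5 r.
  by move=> ? ? ? ? ?; have := ccos; have := csin => ? ?; ctn.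
- by move=> r t; rewrite /K /polar_point ?cosD2pi ?sinD2pi.
- by move=> r t; rewrite /K /polar_point ?cosD2pi ?sinD2pi.
- exact: b0.
- by bdm_tac.
- by bdm_tac.
- by bdm_tac.
Qed.

End C2.

(** The angles run over the same interval as in [ge0_integral_polar], so the right side is an
    integral over a rectangle of the kind treated in [annulus_inequality]. *)
Lemma ge0_integral_annulus (r0 M : R) (h : R * R -> R) : 0 < r0 ->
  measurable_fun [set: plane] h ->
  (forall z, r0 <= enorm z <= M -> 0 <= h z) ->
  (\int[mu2]_(z in [set z | (r0 <= enorm z <= M)%R]) (h z)%:E =
   \int[mu2]_(z in (`[r0, M]%classic `*` `[(- (pi / 2))%R, (- (pi / 2) + pi *+ 2)%R]%classic))
     ((z.1 * h (polar_point z.1 z.2))%R)%:E)%E.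
Proof.
move=> r00 mh h0.
pose A : set plane := [set z | r0 <= enorm z <= M].
have mA : measurable A by exact: (@measurable_enorm_itv R `[r0, M]).
pose f : plane -> \bar R := (fun z => (h z)%:E) \_ A.
have f0 z : (0 <= f z)%E.
  by rewrite /f patchE; case: ifPn => // /[!inE] zA; rewrite lee_fin h0.
have mf : measurable_fun [set: plane] f.
  apply/(measurable_restrictT _ mA); apply: measurable_funTS; exact/measurable_EFinP.
rewrite integral_mkcond -/A -/f (ge0_integral_polar mf f0).
pose k (z : plane) : R := z.1 * h (polar_point z.1 z.2).
pose J : set R := `[(- (pi / 2)), (- (pi / 2) + pi *+ 2)]%classic.
pose g : plane -> \bar R := (fun z => (k z)%:E) \_ (`[r0, M] `*` J).
have mk : measurable_fun [set: plane] k.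
  apply: measurable_funM => //; apply: (measurableT_comp mh); apply: measurable_fun_pair.
    by apply: measurable_funM => //; apply: measurableT_comp => //; exact: measurable_cos.
  by apply: measurable_funM => //; apply: measurableT_comp => //; exact: measurable_sin.
have mg : measurable_fun [set: plane] g.
  apply/(measurable_restrictT _ (@measurable_rect R r0 M _ _)).
  by apply: measurable_funTS; exact/measurable_EFinP.
have g0 z : (0 <= g z)%E.
  rewrite /g patchE; case: ifPn => // /[!inE] -[]; rewrite /= in_itv/= => /andP[h1 h2] _.
  have z0 : 0 <= z.1 by rewrite (le_trans (ltW r00)).
  by rewrite lee_fin mulr_ge0// h0// enorm_polar// h1.
rewrite [RHS]integral_mkcond -/J -/k -/g.
rewrite [RHS]fubini_tonelli2; [|exact: mg|exact: g0].
rewrite [LHS]integral_mkcond; apply: eq_integral => t _.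
rewrite /fubini_G patchE; case: ifPn => tJ; last first.
  rewrite integral0_eq// => r _; rewrite /g patchE ifF//; apply/negbTE.
  by apply: contra tJ => /[!inE] -[].
rewrite /ray [LHS]integral_mkcond; apply: eq_integral => r _; rewrite !patchE.
case: ifPn; rewrite ?inE ?notin_setE /= in_itv/= andbT => hr.
  have er : (r * cos t, r * sin t) \in A = ((r, t) \in `[r0, M]%classic `*` J).
    apply/idP/idP; rewrite !inE /A /= enorm_polar ?(ltW hr)// in_itv/=.
      by move=> ?; split => //; move: tJ; rewrite inE.
    by case.
  rewrite /f /g !patchE er; case: ifP => _; last by rewrite mule0.
  by rewrite -EFinM.
rewrite /g patchE ifF//; apply/negbTE; apply/negP; rewrite inE /= in_itv/= => -[/andP[h1 _] _].
by apply: hr; exact: lt_le_trans h1.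
Qed.

End conv_polar.

(** * The energy inequality for mollified functions *)

Section conv_annulus.
Context {R : realType}.
Local Notation mu := (@lebesgue_measure R).
Local Notation mu2 := (@lebesgue_measure R \x @lebesgue_measure R)%E.
Local Notation plane := (measurableTypeR R * measurableTypeR R)%type.

Definition conv_mass p q (f g : R * R -> R) z := conv p q f z ^+ 2 + conv p q g z ^+ 2.

(* The squared modulus of (-i grad - b A) v for v the mollification of f + i g;
   p' and q' stand for the derivatives of p and q. *)
Definition conv_energy b p p' q q' (f g : R * R -> R) z :=
  (conv p' q f z + b * (vpot z).1 * conv p q g z) ^+ 2 +
  (conv p q' f z + b * (vpot z).2 * conv p q g z) ^+ 2 +
  (conv p' q g z - b * (vpot z).1 * conv p q f z) ^+ 2 +
  (conv p q' g z - b * (vpot z).2 * conv p q f z) ^+ 2.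

(** This is [annulus_inequality] translated back to Cartesian coordinates; the factor r of its two
    sides is the polar Jacobian. *)
Lemma conv_annulus (b c eps r0 M : R) p p' q q' (f g : R * R -> R) :
  0 < b -> 0 < r0 -> r0 < M -> b * r0 ^+ 2 = c ^+ 2 -> 0 < c -> c <= 1 / 20 ->
  c * 100 * 110 <= eps -> 0 <= b - b ^+ 2 * r0 ^+ 2 * (1 + eps) ->
  smooth_fun p -> smooth_fun p' -> smooth_fun q -> smooth_fun q' ->
  (forall t : R, is_derive t 1 p (p' t)) -> (forall t : R, is_derive t 1 q (q' t)) ->
  mu2.-integrable setT (EFin \o f) -> mu2.-integrable setT (EFin \o g) ->
  (\int[mu2]_(z in [set z : R * R | (r0 <= enorm z <= M)%R]) ((b - b ^+ 2 * r0 ^+ 2 * (1 + eps)) *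
      ((1 - enorm z / M) * conv_mass p q f g z))%:E <=
   \int[mu2]_(z in [set z : R * R | (r0 <= enorm z <= M)%R]) ((1 - enorm z / M) * conv_energy b p p' q q' f g z +
     (2 * b * enorm z + 1) / M *
     (conv_mass p q f g z + conv_energy b p p' q q' f g z))%:E)%E.
Proof.
move=> b0 r00 r0M bc c0 c20 ceps lam0 sp sp' sq sq' dp dq if_ ig.
have M0 : 0 < M by rewrite (lt_trans r00).
have [p2 [sp2 dp2]] := smooth_fun_derive sp'; have [p3 [sp3 dp3]] := smooth_fun_derive sp2.
have [q2 [sq2 dq2]] := smooth_fun_derive sq'; have [q3 [sq3 dq3]] := smooth_fun_derive sq2.
have cF := conv_polar_C2 r0 M (- (pi / 2)) sp sp' sp2 sp3 sq sq' sq2 sq3 dp dp2 dp3 dq dq2 dq3 if_.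
have cG := conv_polar_C2 r0 M (- (pi / 2)) sp sp' sp2 sp3 sq sq' sq2 sq3 dp dp2 dp3 dq dq2 dq3 ig.
have mc (a a' : R -> R) h : smooth_fun a -> smooth_fun a' -> mu2.-integrable setT (EFin \o h) ->
  measurable_fun [set: plane] (conv a a' h) by exact: measurable_conv.
have me : measurable_fun [set: plane] (@enorm R) by exact: measurable_enorm.
have mM : measurable_fun [set: plane] (conv_mass p q f g).
  by apply: measurable_funD; apply: measurable_funX; exact: mc.
have mv1 : measurable_fun [set: plane] (fun z => b * (vpot z).1).
  apply: measurable_funM => //; rewrite /vpot/=; apply: measurable_funM => //.
  by apply: measurableT_comp => //; exact: measurable_snd.
have mv2 : measurable_fun [set: plane] (fun z => b * (vpot z).2).
  by apply: measurable_funM => //; rewrite /vpot/=; apply: measurable_funM.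
have mE : measurable_fun [set: plane] (conv_energy b p p' q q' f g).
  rewrite /conv_energy; do !apply: measurable_funD; apply: measurable_funX;
    (apply: measurable_funB || apply: measurable_funD); try exact: mc;
    by apply: measurable_funM => //; exact: mc.
have m1 : measurable_fun [set: plane] (fun z => 1 - enorm z / M).
  by apply: measurable_funB => //; apply: measurable_funM.
have m2 : measurable_fun [set: plane] (fun z => (2 * b * enorm z + 1) / M).
  by apply: measurable_funM => //; apply: measurable_funD => //; apply: measurable_funM.
have mass0 z : 0 <= conv_mass p q f g z by rewrite addr_ge0// sqr_ge0.
have en0 z : 0 <= conv_energy b p p' q q' f g z by rewrite !addr_ge0// sqr_ge0.
have w1 z : r0 <= enorm z <= M -> 0 <= 1 - enorm z / M.
  by move=> /andP[_ h]; rewrite subr_ge0 ler_pdivrMr// mul1r.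
have w2 z : 0 <= (2 * b * enorm z + 1) / M.
  have := enorm_ge0 z => h; apply: divr_ge0; last exact: ltW.
  by apply: addr_ge0 => //; apply: mulr_ge0 => //; apply: mulr_ge0 => //; exact: ltW.
rewrite [X in (X <= _)%E](@ge0_integral_annulus _ r0 M (fun z =>
  (b - b ^+ 2 * r0 ^+ 2 * (1 + eps)) * ((1 - enorm z / M) * conv_mass p q f g z)))//; last 2 first.
- by apply: measurable_funM => //; exact: measurable_funM.
- by move=> z /w1 h; rewrite mulr_ge0// mulr_ge0.
rewrite [X in (_ <= X)%E](@ge0_integral_annulus _ r0 M (fun z =>
  (1 - enorm z / M) * conv_energy b p p' q q' f g z + (2 * b * enorm z + 1) / M *
     (conv_mass p q f g z + conv_energy b p p' q q' f g z)))//; last 2 first.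
- by apply: measurable_funD; apply: measurable_funM => //; exact: measurable_funD.
- by move=> z /w1 h; apply: addr_ge0; apply: mulr_ge0 => //; exact: addr_ge0.
have := annulus_inequality r00 r0M bc c0 c20 ceps cF cG b0.
set X1 := (X in (X <= _)%E -> _); set Y1 := (X in (_ <= X)%E -> _).
set X2 := (X in _ -> (X <= _)%E); set Y2 := (X in _ -> (_ <= X)%E).
suff [-> ->] : X1 = X2 /\ Y1 = Y2 by [].
split; apply: eq_integral => -[r t]; rewrite inE => -[/= ] /[!in_itv]/= /andP[h1 h2] _;
  have rp : 0 < r by exact: lt_le_trans h1.
  congr EFin; rewrite /polar_point/= enorm_polar ?(ltW rp)// /polar_mass /conv_mass /polar_point.
  by ring.
have rn : r != 0 by rewrite gt_eqF.
have Mn : M != 0 by rewrite gt_eqF.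
have eE : polar_energy b (fun r t => conv p q f (polar_point r t))
    (fun r t => cos t * conv p' q f (polar_point r t) + sin t * conv p q' f (polar_point r t))
    (fun r t => - (r * sin t) * conv p' q f (polar_point r t) + r * cos t * conv p q' f (polar_point r t))
    (fun r t => conv p q g (polar_point r t))
    (fun r t => cos t * conv p' q g (polar_point r t) + sin t * conv p q' g (polar_point r t))
    (fun r t => - (r * sin t) * conv p' q g (polar_point r t) + r * cos t * conv p q' g (polar_point r t))
    r t = conv_energy b p p' q q' f g (polar_point r t).
  rewrite /polar_energy /conv_energy /vpot /=.
  set F := conv p q f _; set G := conv p q g _; set F1 := conv p' q f _.
  set F2 := conv p q' f _; set G1 := conv p' q g _; set G2 := conv p q' g _.
  have cs := cos2Dsin2 t; move: (cos t) (sin t) cs => C S cs.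
  have -> : (- (r * S) * F1 + r * C * F2) / r = - S * F1 + C * F2 by field.
  have -> : (- (r * S) * G1 + r * C * G2) / r = - S * G1 + C * G2 by field.
  apply/eqP; rewrite -subr_eq0; apply/eqP.
  (* Polar and Cartesian energies differ by the rotation through t, so their difference is a
     multiple of cos^2 t + sin^2 t - 1. *)
  have C2 : C ^+ 2 = 1 - S ^+ 2 by rewrite -cs addrK.
  rewrite (_ : _ - _ = (C ^+ 2 + S ^+ 2 - 1) * (F1 ^+ 2 + F2 ^+ 2 + G1 ^+ 2 + G2 ^+ 2
     - (b * r / 2) ^+ 2 * (F ^+ 2 + G ^+ 2))); last by field.
  by rewrite cs subrr mul0r.
by congr EFin; rewrite /= eE /polar_point/= enorm_polar ?(ltW rp).
Qed.

End conv_annulus.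

(** * Jensen's inequality and transfer of weights *)

Section jensen.
Context {R : realType}.
Local Notation mu := (@lebesgue_measure R).
Local Notation mu2 := (@lebesgue_measure R \x @lebesgue_measure R)%E.
Local Notation plane := (measurableTypeR R * measurableTypeR R)%type.
Variables (p q : R -> R).
Hypotheses (sp : smooth_fun p) (sq : smooth_fun q)
  (p0 : forall t, 0 <= p t) (q0 : forall t, 0 <= q t)
  (pint : (\int[mu]_t (p t)%:E = 1)%E) (qint : (\int[mu]_t (q t)%:E = 1)%E).

Let mp : measurable_fun [set: measurableTypeR R] p.
Proof. exact: continuous_measurable_fun (smooth_fun_continuous sp). Qed.
Let mq : measurable_fun [set: measurableTypeR R] q.
Proof. exact: continuous_measurable_fun (smooth_fun_continuous sq). Qed.

Let reflect1 (h : R -> R) x : measurable_fun [set: measurableTypeR R] h ->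
  (forall t, 0 <= h t) -> (\int[mu]_y (h (x - y))%:E = \int[mu]_y (h y)%:E)%E.
Proof.
move=> mh h0; rewrite [RHS](@ge0_integral_opp _ (fun t => (h t)%:E)).
- rewrite [RHS](@ge0_integral_shift _ (- x) (fun t => (h (- t))%:E)).
  + by apply: eq_integral => y _; congr ((h _)%:E); ring.
  + by apply/measurable_EFinP; apply: (measurableT_comp mh).
  + by move=> y; rewrite lee_fin.
- by apply/measurable_EFinP; exact: mh.
- by move=> y; rewrite lee_fin.
Qed.

Let shift1 (h : R -> R) x : measurable_fun [set: measurableTypeR R] h ->
  (forall t, 0 <= h t) -> (\int[mu]_y (h (y - x))%:E = \int[mu]_y (h y)%:E)%E.
Proof.
move=> mh h0; rewrite [RHS](@ge0_integral_shift _ (- x) (fun t => (h t)%:E))//.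
by apply/measurable_EFinP; exact: mh.
Qed.

Let prod1 (h k : R -> R) : measurable_fun [set: measurableTypeR R] h ->
  measurable_fun [set: measurableTypeR R] k -> (forall t, 0 <= h t) -> (forall t, 0 <= k t) ->
  (\int[mu]_t (h t)%:E = 1)%E -> (\int[mu]_t (k t)%:E = 1)%E ->
  (\int[mu2]_z (h z.1 * k z.2)%:E = 1)%E.
Proof.
move=> mh mk h0 k0 hi ki; rewrite fubini_tonelli1/=.
- rewrite -[RHS]hi; apply: eq_integral => x _; rewrite /fubini_F/=.
  under eq_integral do rewrite EFinM.
  rewrite ge0_integralZl ?ki ?mule1//.
  + by apply/measurable_EFinP; exact: mk.
  + by move=> y _; rewrite lee_fin.
  + by rewrite lee_fin.
- apply/measurable_EFinP; apply: measurable_funM.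
    by apply: (measurableT_comp mh); exact: measurable_fst.
  by apply: (measurableT_comp mk); exact: measurable_snd.
- by move=> z; rewrite lee_fin mulr_ge0.
Qed.

Lemma integral_kernel (x : R * R) : (\int[mu2]_y (p (x.1 - y.1) * q (x.2 - y.2))%:E = 1)%E.
Proof.
apply: (@prod1 (fun y => p (x.1 - y)) (fun y => q (x.2 - y))) => //.
- by apply: (measurableT_comp mp); exact: measurable_funB.
- by apply: (measurableT_comp mq); exact: measurable_funB.
- by rewrite reflect1.
- by rewrite reflect1.
Qed.

Lemma integral_kernel_swap (y : R * R) : (\int[mu2]_x (p (x.1 - y.1) * q (x.2 - y.2))%:E = 1)%E.
Proof.
apply: (@prod1 (fun x => p (x - y.1)) (fun x => q (x - y.2))) => //.
- by apply: (measurableT_comp mp); exact: measurable_funB.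
- by apply: (measurableT_comp mq); exact: measurable_funB.
- by rewrite shift1.
- by rewrite shift1.
Qed.

Lemma integrable_kernel (x : R * R) :
  mu2.-integrable setT (EFin \o (fun y => p (x.1 - y.1) * q (x.2 - y.2))).
Proof.
apply/integrableP; split; first by apply/measurable_EFinP; exact: measurable_kernel.
rewrite (_ : (fun _ => _) = fun y => (p (x.1 - y.1) * q (x.2 - y.2))%:E).
  by rewrite integral_kernel ltry.
by apply/funext => y; rewrite /= ger0_norm// mulr_ge0.
Qed.

(** The variance of h under the probability kernel is nonnegative: integrate (h - c)^2 with c the
    mean. *)
Lemma conv_sqr_le (h : R * R -> R) x : mu2.-integrable setT (EFin \o h) ->
  mu2.-integrable setT (EFin \o (fun y => h y ^+ 2)) ->
  conv p q h x ^+ 2 <= conv p q (fun y => h y ^+ 2) x.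
Proof.
move=> ih ih2; set c := conv p q h x.
have i1 := integrable_conv x sp sq ih; have i2 := integrable_conv x sp sq ih2.
have i3 := integrable_kernel x.
have i1c : mu2.-integrable setT (EFin \o (fun y => (- 2 * c) * (h y * (p (x.1 - y.1) * q (x.2 - y.2))))).
  by have := integrableZl measurableT (- 2 * c) i1; apply.
have i3c : mu2.-integrable setT (EFin \o (fun y => c ^+ 2 * (p (x.1 - y.1) * q (x.2 - y.2)))).
  by have := integrableZl measurableT (c ^+ 2) i3; apply.
have i23 : mu2.-integrable setT (EFin \o (fun y => h y ^+ 2 * (p (x.1 - y.1) * q (x.2 - y.2)) +
    (- 2 * c) * (h y * (p (x.1 - y.1) * q (x.2 - y.2))))).
  by have := integrableD measurableT i2 i1c; apply.
have : 0 <= \int[mu2]_y (h y ^+ 2 * (p (x.1 - y.1) * q (x.2 - y.2)) +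
    (- 2 * c) * (h y * (p (x.1 - y.1) * q (x.2 - y.2))) +
    c ^+ 2 * (p (x.1 - y.1) * q (x.2 - y.2))).
  apply: Rintegral_ge0 => y _.
  rewrite (_ : _ + _ = (h y - c) ^+ 2 * (p (x.1 - y.1) * q (x.2 - y.2))); last by ring.
  by apply: mulr_ge0; [exact: sqr_ge0|exact: mulr_ge0].
rewrite (RintegralD measurableT i23 i3c) (RintegralD measurableT i2 i1c).
rewrite RintegralZl// RintegralZl//.
have -> : \int[mu2]_y (p (x.1 - y.1) * q (x.2 - y.2)) = 1.
  by rewrite /Rintegral integral_kernel.
have -> : \int[mu2]_y (h y * (p (x.1 - y.1) * q (x.2 - y.2))) = c by [].
have -> : \int[mu2]_y (h y ^+ 2 * (p (x.1 - y.1) * q (x.2 - y.2))) =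
  conv p q (fun y => h y ^+ 2) x by [].
move=> h0; rewrite -subr_ge0; apply: le_trans h0 _; rewrite le_eqVlt; apply/orP; left; apply/eqP; ring.
Qed.

Lemma conv_le (h k : R * R -> R) x : mu2.-integrable setT (EFin \o h) ->
  mu2.-integrable setT (EFin \o k) ->
  (forall y, p (x.1 - y.1) * q (x.2 - y.2) != 0 -> h y <= k y) ->
  conv p q h x <= conv p q k x.
Proof.
move=> ih ik hk; apply: le_Rintegral => //.
- exact: integrable_conv.
- exact: integrable_conv.
move=> y _ /=; have [e|e] := eqVneq (p (x.1 - y.1) * q (x.2 - y.2)) 0.
  by rewrite e !mulr0.
by apply: ler_wpM2r; [exact: mulr_ge0|exact: hk].
Qed.

Lemma conv_ge0 (h : R * R -> R) x : (forall y, 0 <= h y) -> 0 <= conv p q h x.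
Proof. by move=> h0; apply: Rintegral_ge0 => y _; rewrite mulr_ge0// mulr_ge0. Qed.

Lemma convD (h k : R * R -> R) x : mu2.-integrable setT (EFin \o h) ->
  mu2.-integrable setT (EFin \o k) ->
  conv p q (fun y => h y + k y) x = conv p q h x + conv p q k x.
Proof.
move=> ih ik; rewrite /conv -RintegralD//; try exact: integrable_conv.
by apply: eq_Rintegral => y _; rewrite mulrDl.
Qed.

Lemma convZ (a : R) (h : R * R -> R) x : mu2.-integrable setT (EFin \o h) ->
  conv p q (fun y => a * h y) x = a * conv p q h x.
Proof.
move=> ih; rewrite /conv -RintegralZl//; last exact: integrable_conv.
by apply: eq_Rintegral => y _; rewrite -mulrA.
Qed.

(** Tonelli moves the kernel onto the weight. Only points x within d of y in each coordinate matter,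
    so the weight at x may be replaced by any bound for it at y. *)
Lemma weighted_conv_le (d : R) (A : set (R * R)) (w wt h : R * R -> R) :
  (forall t, d <= `|t| -> p t = 0) -> (forall t, d <= `|t| -> q t = 0) ->
  measurable (A : set plane) -> measurable_fun [set: plane] w ->
  (forall z, A z -> 0 <= w z) -> (forall z, 0 <= wt z) ->
  measurable_fun [set: plane] wt ->
  mu2.-integrable setT (EFin \o h) -> (forall z, 0 <= h z) ->
  (forall x y, A x -> `|x.1 - y.1| < d -> `|x.2 - y.2| < d -> h y != 0 -> w x <= wt y) ->
  (\int[mu2]_(x in A) (w x * conv p q h x)%:E <= \int[mu2]_y (wt y * h y)%:E)%E.
Proof.
move=> psupp qsupp mA mw w0 wt0 mwt ih h0 wwt.
have mh : measurable_fun [set: plane] h.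
  by apply/measurable_EFinP; exact: (measurable_int mu2 ih).
pose wA : plane -> R := w \_ A.
have wA0 z : 0 <= wA z by rewrite /wA patchE; case: ifPn => // /[!inE]; exact: w0.
have mwA : measurable_fun [set: plane] wA.
  by apply/(measurable_restrictT _ mA); exact: measurable_funTS.
pose k (z : plane * plane) : \bar R :=
  (wA z.1 * (h z.2 * (p (z.1.1 - z.2.1) * q (z.1.2 - z.2.2))))%:E.
have k0 z : (0 <= k z)%E by rewrite lee_fin !mulr_ge0.
have mphi : measurable_fun [set: (plane * plane)%type]
    (fun z => p (z.1.1 - z.2.1) * q (z.1.2 - z.2.2)).
  apply: measurable_funM; [apply: (measurableT_comp mp)|apply: (measurableT_comp mq)];
    by apply: measurable_funB; apply: measurableT_comp.
have mk : measurable_fun [set: (plane * plane)%type] k.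
  apply/measurable_EFinP; apply: measurable_funM; first exact: measurableT_comp.
  by apply: measurable_funM => //; exact: measurableT_comp.
have e1 : (\int[mu2]_(x in A) (w x * conv p q h x)%:E = \int[mu2]_x \int[mu2]_y k (x, y))%E.
  rewrite integral_mkcond; apply: eq_integral => x _; rewrite patchE /k /wA /= patchE.
  case: ifPn => xA; last by rewrite integral0_eq// => y _; rewrite mul0r.
  have ic := integrable_conv x sp sq ih.
  under eq_integral do rewrite EFinM.
  rewrite integralZl//; rewrite EFinM; congr (_ * _)%E.
  by rewrite /conv /Rintegral fineK//; exact: (integrable_fin_num _ ic).
rewrite e1 ge0_integral_plane_swap//; apply: ge0_le_integral => //.
- by move=> y _; apply: integral_ge0.
- apply: (measurable_integral_plane (k := fun z => k (z.2, z.1))) => //.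
  by apply: (measurableT_comp mk); exact: measurable_fun_pair.
- by apply/measurable_EFinP; exact: measurable_funM.
move=> y _; apply: (@le_trans _ _ (\int[mu2]_x ((wt y * h y)%:E *
    (p (x.1 - y.1) * q (x.2 - y.2))%:E))%E).
  have mphiy : measurable_fun [set: plane] (fun x => p (x.1 - y.1) * q (x.2 - y.2)).
    apply: measurable_funM; [apply: (measurableT_comp mp)|apply: (measurableT_comp mq)];
      by apply: measurable_funB.
  apply: ge0_le_integral => //.
  - by apply: (measurableT_comp mk); exact: measurable_fun_pair.
  - by apply: emeasurable_funM => //; exact/measurable_EFinP.
  move=> x _; rewrite -EFinM lee_fin /k/=.
  have [->|px] := eqVneq (p (x.1 - y.1)) 0; first by rewrite !(mul0r, mulr0).
  have [->|qx] := eqVneq (q (x.2 - y.2)) 0; first by rewrite !(mul0r, mulr0).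
  have [->|hy] := eqVneq (h y) 0; first by rewrite !(mul0r, mulr0).
  rewrite mulrA; apply: ler_wpM2r; first exact: mulr_ge0.
  apply: ler_wpM2r => //; rewrite /wA patchE; case: ifPn => //; rewrite inE => Ax.
  apply: wwt => //; rewrite ltNge; apply/negP.
    by move=> /psupp e; rewrite e eqxx in px.
  by move=> /qsupp e; rewrite e eqxx in qx.
rewrite ge0_integralZl//.
- by rewrite integral_kernel_swap mule1.
- apply/measurable_EFinP; apply: measurable_funM;
    [apply: (measurableT_comp mp)|apply: (measurableT_comp mq)]; by apply: measurable_funB.
- by move=> x _; rewrite lee_fin mulr_ge0.
- by rewrite lee_fin mulr_ge0.
Qed.

End jensen.

(** * Fatou's lemma on lines *)

Section fatou_slices.
Context {R : realType}.
Local Notation mu := (@lebesgue_measure R).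
Local Notation mu2 := (@lebesgue_measure R \x @lebesgue_measure R)%E.
Local Notation plane := (measurableTypeR R * measurableTypeR R)%type.

Lemma measurable_limn_einf d (T : measurableType d) (D : set T) (f : (T -> \bar R)^nat) :
  (forall n, measurable_fun D (f n)) ->
  measurable_fun D (fun x => limn_einf (f ^~ x)).
Proof.
move=> mf; rewrite /limn_einf; apply: measurableT_comp => //.
apply: (@measurable_fun_limn_esup _ _ _ _ (fun n x => (- f n x)%E)) => n.
by apply: measurableT_comp.
Qed.

Lemma limn_einf_ge0 (u : (\bar R)^nat) : (forall n, 0 <= u n)%E -> (0 <= limn_einf u)%E.
Proof.
move=> u0; rewrite limn_einf_lim; apply: lime_ge; first exact: is_cvg_einfs.
by near=> n; apply: le_ereal_inf_tmp => _ [m _ <-].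
Unshelve. all: by end_near. Qed.

Lemma limn_einf_le (u : (\bar R)^nat) (B : \bar R) : (forall n, u n <= B)%E -> (limn_einf u <= B)%E.
Proof.
move=> uB; rewrite limn_einf_lim; apply: lime_le; first exact: is_cvg_einfs.
near=> n; apply: (le_trans _ (uB n)); apply: ereal_inf_lbound; exists n => //=.
Unshelve. all: by end_near. Qed.

Lemma measurable_slice (h : plane -> R) : measurable_fun [set: plane] h -> (forall z, 0 <= h z) ->
  measurable_fun [set: measurableTypeR R] (fun s => \int[mu]_t (h (s, t))%:E)%E.
Proof.
move=> mh h0.
apply: (@measurable_fun_fubini_tonelli_F _ _ _ _ R mu (fun z => (h z)%:E)).
- exact/measurable_EFinP.
- by move=> z; rewrite lee_fin.
Qed.

(** Convergence is known almost everywhere on almost every line, not jointly in the plane. Hence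
    Fatou is applied twice, to the inner and to the outer integral. *)
Lemma fatou_slices (H : nat -> plane -> R) (H0 : plane -> R) (B : \bar R) :
  (forall n, measurable_fun [set: plane] (H n)) -> measurable_fun [set: plane] H0 ->
  (forall n z, 0 <= H n z) -> (forall z, 0 <= H0 z) ->
  {ae mu, forall s, {ae mu, forall t, H n (s, t) @[n --> \oo] --> H0 (s, t)}} ->
  (forall n, \int[mu]_s \int[mu]_t (H n (s, t))%:E <= B)%E ->
  (\int[mu]_s \int[mu]_t (H0 (s, t))%:E <= B)%E.
Proof.
move=> mH mH0 Hge H0ge ae le_B.
pose I n s := (\int[mu]_t (H n (s, t))%:E)%E.
have I0 n s : (0 <= I n s)%E by apply: integral_ge0 => t _; rewrite lee_fin.
have mI n : measurable_fun [set: measurableTypeR R] (I n) by exact: measurable_slice.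
have sec (h : plane -> R) s : measurable_fun [set: plane] h ->
    measurable_fun [set: measurableTypeR R] (fun t => (h (s, t))%:E).
  by move=> mh; apply/measurable_EFinP; apply: (measurableT_comp mh).
apply: (@le_trans _ _ (\int[mu]_s limn_einf (I ^~ s))%E).
  apply: ae_ge0_le_integral => //.
  - by move=> s _; apply: integral_ge0 => t _; rewrite lee_fin.
  - exact: measurable_slice.
  - by move=> s _; exact: limn_einf_ge0.
  - exact: measurable_limn_einf.
  apply: filterS ae => s aes _.
  apply: (@le_trans _ _ (\int[mu]_t limn_einf (fun n => (H n (s, t))%:E))%E).
    apply: ae_ge0_le_integral => //.
    - by move=> t _; rewrite lee_fin.
    - exact: sec.
    - by move=> t _; apply: limn_einf_ge0 => n; rewrite lee_fin.
    - by apply: measurable_limn_einf => n; exact: sec.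
    apply: filterS aes => t cv _.
    have cE : (fun n => (H n (s, t))%:E) @ \oo --> (H0 (s, t))%:E.
      by apply: cvg_EFin; [exact: nearW|exact: cv].
    by rewrite (cvg_limn_einf_sup cE).1.
  apply: fatou => //; first by move=> n; exact: sec.
  by move=> n t _; rewrite lee_fin.
apply: (le_trans (fatou _ _ _ _)) => //; exact: limn_einf_le.
Qed.

End fatou_slices.

(** * Recovering a function from its mollifications *)

Section mollifier_sequence.
Context {R : realType}.
Local Notation mu := (@lebesgue_measure R).
Local Notation mu2 := (@lebesgue_measure R \x @lebesgue_measure R)%E.
Local Notation plane := (measurableTypeR R * measurableTypeR R)%type.
Variables (C : R) (d : nat -> R) (p : nat -> R -> R).
Hypotheses (sp : forall n, smooth_fun (p n)) (p0 : forall n t, 0 <= p n t)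
  (psupp : forall n t, d n <= `|t| -> p n t = 0) (pC : forall n t, p n t <= C / d n)
  (pint : forall n, (\int[mu]_t (p n t)%:E = 1)%E)
  (d0 : forall n, 0 < d n) (dcvg : d @ \oo --> (0 : R)).

Let mp n : measurable_fun [set: measurableTypeR R] (p n).
Proof. exact: continuous_measurable_fun (smooth_fun_continuous (sp n)). Qed.

Let mpx n x : measurable_fun [set: measurableTypeR R] (fun y => p n (x - y)).
Proof. by apply: (measurableT_comp (mp n)); exact: measurable_funB. Qed.

Let EFp n x : (\int[mu]_y (p n (x - y))%:E = 1)%E.
Proof.
rewrite -(pint n) (@ge0_integral_opp _ (fun t => (p n t)%:E)).
- rewrite (@ge0_integral_shift _ (- x) (fun t => (p n (- t))%:E)).
  + by apply: eq_integral => y _; congr ((p n _)%:E); ring.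
  + by apply/measurable_EFinP; apply: (measurableT_comp (mp n)).
  + by move=> y; rewrite lee_fin.
- by apply/measurable_EFinP; exact: mp.
- by move=> y; rewrite lee_fin.
Qed.

Let C0 : 0 <= C.
Proof.
have := le_trans (p0 0 0) (pC 0 0); rewrite pmulr_lge0// invr_gt0; exact: d0.
Qed.

Let integrable_mul1 (h : R -> R) n x : mu.-integrable setT (EFin \o h) ->
  mu.-integrable setT (EFin \o (fun y => h y * p n (x - y))).
Proof.
move=> ih; have mh : measurable_fun [set: measurableTypeR R] h.
  by apply/measurable_EFinP; exact: (measurable_int mu ih).
have iCu : mu.-integrable setT (fun y => (C / d n)%:E * (EFin \o h) y)%E.
  exact: integrableZl.
apply: (le_integrable _ _ _ iCu) => //.
  by apply/measurable_EFinP; exact: measurable_funM.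
move=> y _; rewrite -EFinM !abse_EFin lee_fin !normrM mulrC.
by apply: ler_pM => //; rewrite -normrM (ger0_norm (p0 n _)) (le_trans (pC n _))// ler_norm.
Qed.

(** The error at x is at most C / d times the integral of |h - h(x)| over the interval of radius d,
    that is 2 C times the average, which tends to zero at Lebesgue points. *)
Lemma conv1_cvg (h : R -> R) : mu.-integrable setT (EFin \o h) ->
  {ae mu, forall x : measurableTypeR R, \int[mu]_y (h y * p n (x - y)) @[n --> \oo] --> h x}.
Proof.
move=> ih; have mh : measurable_fun [set: measurableTypeR R] h.
  by apply/measurable_EFinP; exact: (measurable_int mu ih).
have LD : {ae mu, forall x : measurableTypeR R, lebesgue_pt h x}.
  exact: (lebesgue_differentiation (open_integrable_locally openT ih)).
move: LD; apply: filterS; first exact: (ae_filter_ringOfSetsType mu).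
move=> x Lx.
apply/subr_cvg0; apply: norm_cvg0.
have dn : d @ \oo --> (0 : R)^'+.
  move=> A [e /= e0 eA].
  have /cvgrPdist_lt/(_ _ e0) := dcvg; apply: filterS => n /= dne.
  exact: eA.
have cD : ((2 * C)%:E * davg h x (d n) @[n --> \oo] --> 0)%E.
  rewrite -(mule0 (2 * C)%:E); apply: cvgeZl => //.
  exact: (cvg_comp _ _ dn Lx).
have bnd n : ((`|\int[mu]_y (h y * p n (x - y)) - h x|)%:E <= (2 * C)%:E * davg h x (d n))%E.
  have i1 := integrable_mul1 n x ih.
  have i2 : mu.-integrable setT (EFin \o (fun y => h x * p n (x - y))).
    apply/integrableP; split; first by apply/measurable_EFinP; exact: measurable_funM.
    rewrite (_ : (fun _ => _) = fun y => ((`|h x|)%:E * (p n (x - y))%:E)%E).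
      rewrite ge0_integralZl//.
      - by rewrite EFp mule1 ltry.
      - exact/measurable_EFinP.
      - by move=> y _; rewrite lee_fin.
    by apply/funext => y; rewrite /= normrM (ger0_norm (p0 n _)) EFinM.
  have e2 : \int[mu]_y (h x * p n (x - y)) = h x.
    rewrite /Rintegral; under eq_integral do rewrite EFinM.
    have ip : mu.-integrable setT (EFin \o (fun y => p n (x - y))).
      apply/integrableP; split; first exact/measurable_EFinP.
      under eq_integral => y _ do rewrite /= (ger0_norm (p0 n _)).
      by rewrite EFp ltry.
    by rewrite integralZl// EFp mule1.
  have i3 : mu.-integrable setT (EFin \o (fun y => (h y - h x) * p n (x - y))).
    have := integrableB measurableT i1 i2; apply: eq_integrable => // y _ /=.
    by rewrite -EFinB mulrBl.
  rewrite -{1}e2 -RintegralB//.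
  rewrite (_ : \int[mu]_y _ = \int[mu]_y ((h y - h x) * p n (x - y))); last first.
    by apply: eq_Rintegral => y _; rewrite mulrBl.
  have := le_normr_Rintegral measurableT i3; rewrite -lee_fin => /le_trans; apply.
  rewrite /Rintegral fineK; last first.
    by apply: integrable_fin_num => //; exact: (integrable_norm i3).
  rewrite /davg /iavg lebesgue_measure_ball ?(ltW (d0 n))//.
  rewrite (_ : (d n *+ 2)%:E^-1%E = ((d n *+ 2)^-1)%:E); last first.
    by rewrite inver gt_eqF// pmulrn_lgt0//.
  rewrite muleA -EFinM (_ : 2 * C * (d n *+ 2)^-1 = C / d n); last first.
    by have := d0 n => dn0; field; rewrite gt_eqF.
  have mB : measurable (ball x (d n)) by exact: measurable_ball.
  have m3 : measurable_fun [set: measurableTypeR R] (fun y => `|h y - h x|).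
    by apply: measurableT_comp => //; exact: measurable_funB.
  rewrite -ge0_integralZl//; last 2 first.
  - apply: measurableT_comp => //; apply/measurable_EFinP; apply: measurable_funTS.
    exact: measurable_funB.
  - by rewrite lee_fin divr_ge0// ltW.
  rewrite [leRHS]integral_mkcond; apply: ge0_le_integral => //.
  - apply/measurable_EFinP; apply: measurableT_comp => //; apply: measurable_funM => //.
    exact: measurable_funB.
  - apply/(measurable_restrictT _ mB); apply: measurable_funTS.
    apply: emeasurable_funM => //; apply: measurableT_comp => //; apply/measurable_EFinP.
    exact: measurable_funB.
  move=> y _; rewrite patchE; case: ifPn => [_|].
    rewrite abse_EFin -EFinM lee_fin normrM mulrC ler_wpM2r// (ger0_norm (p0 n _)); exact: pC.
  rewrite notin_setE /ball/= => /negP; rewrite -leNgt => dx.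
  by rewrite psupp// mulr0 normr0.
have c0 : ((`|\int[mu]_y (h y * p n (x - y)) - h x|)%:E @[n --> \oo] --> 0)%E.
  apply: (squeeze_cvge _ (cvg_cst _) cD).
  by near=> n; rewrite lee_fin normr_ge0 bnd.
exact: (fine_cvg c0).
Unshelve. all: by end_near. Qed.

Variables (f g : R * R -> R).
Hypotheses (if_ : mu2.-integrable setT (EFin \o f)) (ig : mu2.-integrable setT (EFin \o g)).

(** Smoothing in the second variable only, the intermediate stage between a function and its full
    mollification. *)
Definition conv2 k (u : R * R -> R) (z : plane) : R := \int[mu]_y (u (z.1, y) * p k (z.2 - y)).

Let imul k (s : R) (u : plane -> R) : mu2.-integrable setT (EFin \o u) ->
  mu2.-integrable setT (EFin \o (fun y => u y * p k (s - y.2))).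
Proof.
move=> iu; apply: (@integrable_mul_bounded _ _ _ (C / d k)) => //.
  by apply: (measurableT_comp (mp k)); apply: measurable_funB.
by move=> y; rewrite ger0_norm.
Qed.

(** Only almost everywhere: the section of u must be integrable for the real-valued integral to
    agree with the extended one. *)
Lemma conv2_fubini k (s : R) (u : plane -> R) : mu2.-integrable setT (EFin \o u) ->
  {ae mu, forall y1, (conv2 k u (y1, s))%:E =
     fubini_F mu (EFin \o (fun y => u y * p k (s - y.2))) y1}.
Proof.
move=> iu; apply: filterS (ae_integrable1 (imul k s iu)) => y1 i1.
by rewrite /conv2 /Rintegral fineK//; exact: (integrable_fin_num _ i1).
Qed.

Lemma measurable_conv2 k (u : plane -> R) : mu2.-integrable setT (EFin \o u) ->
  measurable_fun [set: plane] (conv2 k u).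
Proof.
move=> iu.
have mu_ : measurable_fun [set: plane] u.
  by apply/measurable_EFinP; exact: (measurable_int mu2 iu).
pose h (z : plane * measurableTypeR R) : \bar R := (u (z.1.1, z.2) * p k (z.1.2 - z.2))%:E.
have mh : measurable_fun [set: (plane * measurableTypeR R)%type] h.
  apply/measurable_EFinP; apply: measurable_funM.
    apply: (measurableT_comp mu_); apply: measurable_fun_pair => //.
    exact: measurableT_comp.
  by apply: (measurableT_comp (mp k)); apply: measurable_funB => //; exact: measurableT_comp.
have F (w : plane * measurableTypeR R -> \bar R) : measurable_fun setT w -> (forall z, 0 <= w z)%E ->
    measurable_fun [set: plane] (fun x => \int[mu]_y w (x, y))%E.
  by move=> mw w0; exact: (@measurable_fun_fubini_tonelli_F _ _ plane (measurableTypeR R) R mu w mw w0).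
rewrite (_ : conv2 k u = fun x => fine (\int[mu]_y (h^\+)%E (x, y) - \int[mu]_y (h^\-)%E (x, y))%E).
  apply: measurableT_comp => //; apply: emeasurable_funB.
    by apply: F => //; exact: measurable_funepos.
  by apply: F => //; exact: measurable_funeneg.
apply/funext => x; rewrite /conv2 /Rintegral [in LHS]integralE; congr (fine _).
by congr (_ - _)%E; apply: eq_integral => y _; rewrite !(funeposE, funenegE).
Qed.

Lemma integrable_conv2 k (s : R) (u : plane -> R) : mu2.-integrable setT (EFin \o u) ->
  mu.-integrable setT (EFin \o (fun y1 => conv2 k u (y1, s))).
Proof.
move=> iu; have iF := integrable_fubini_F (imul k s iu).
have m1 : measurable_fun [set: measurableTypeR R] (fun y1 : R => conv2 k u (y1, s)).
  by apply: (measurableT_comp (measurable_conv2 k iu)); exact: measurable_fun_pair.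
apply/integrableP; split; first exact/measurable_EFinP.
have /integrableP[mF] := iF; apply: le_lt_trans.
apply: ae_ge0_le_integral => //.
- by apply: measurableT_comp => //; exact/measurable_EFinP.
- by apply: measurableT_comp.
apply: filterS (conv2_fubini k s iu) => y1 /= e _.
by rewrite -e.
Qed.

(** The full mollification is a one-dimensional mollification of [conv2] along horizontal lines,
    which brings it within reach of [conv1_cvg]. *)
Lemma conv_slices n k (x1 x2 : R) (u : plane -> R) : mu2.-integrable setT (EFin \o u) ->
  conv (p n) (p k) u (x1, x2) = \int[mu]_y1 (conv2 k u (y1, x2) * p n (x1 - y1)).
Proof.
move=> iu; rewrite /conv /Rintegral; congr fine.
have ic := integrable_conv (x1, x2) (sp n) (sp k) iu.
rewrite -[LHS](integral12_prod_meas1 ic).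
have i1 := integrable_conv2 k x2 iu; have i2 := integrable_mul1 n x1 i1.
apply: ae_eq_integral => //.
- exact: (measurable_int mu (integrable_fubini_F ic)).
- exact: (measurable_int mu i2).
apply: filterS2 (conv2_fubini k x2 iu) (ae_integrable1 (imul k x2 iu)) => y1 e iy _.
rewrite EFinM e /fubini_F -integralZr//.
by apply: eq_integral => y2 _; rewrite /= -EFinM; congr EFin; ring.
Qed.

(** The two kernels have independent indices so that the limits can be taken one after the other,
    each along lines. *)
Lemma conv_fatou (w : plane -> R) (B : \bar R) :
  measurable_fun [set: plane] w -> (forall z, 0 <= w z) ->
  (forall n k, \int[mu2]_z (w z * (conv (p n) (p k) f z ^+ 2 + conv (p n) (p k) g z ^+ 2))%:E <= B)%E ->
  (\int[mu2]_z (w z * (f z ^+ 2 + g z ^+ 2))%:E <= B)%E.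
Proof.
move=> mw w0 hB.
have mf : measurable_fun [set: plane] f.
  by apply/measurable_EFinP; exact: (measurable_int mu2 if_).
have mg : measurable_fun [set: plane] g.
  by apply/measurable_EFinP; exact: (measurable_int mu2 ig).
have mwsq (a b : plane -> R) : measurable_fun [set: plane] a -> measurable_fun [set: plane] b ->
    measurable_fun [set: plane] (fun z => w z * (a z ^+ 2 + b z ^+ 2)).
  by move=> ma mb; apply: measurable_funM => //; apply: measurable_funD; apply: measurable_funX.
have wsq0 (a b : plane -> R) z : 0 <= w z * (a z ^+ 2 + b z ^+ 2).
  by rewrite mulr_ge0// addr_ge0// sqr_ge0.
have mswap (a : plane -> R) : measurable_fun [set: plane] a ->
    measurable_fun [set: plane] (fun z => a (z.2, z.1)).
  by move=> ma; apply: (measurableT_comp ma); exact: measurable_fun_pair.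
have ton1 (a : plane -> R) : measurable_fun [set: plane] a -> (forall z, 0 <= a z) ->
    (\int[mu2]_z (a z)%:E = \int[mu]_s \int[mu]_t (a (s, t))%:E)%E.
  move=> ma a0; rewrite fubini_tonelli1//; exact/measurable_EFinP.
have ton2 (a : plane -> R) : measurable_fun [set: plane] a -> (forall z, 0 <= a z) ->
    (\int[mu2]_z (a z)%:E = \int[mu]_t \int[mu]_s (a (s, t))%:E)%E.
  move=> ma a0; rewrite fubini_tonelli2//; exact/measurable_EFinP.
have csq (h1 h2 : nat -> R) (z : plane) (a b : R) : h1 @ \oo --> a -> h2 @ \oo --> b ->
    w z * (h1 n ^+ 2 + h2 n ^+ 2) @[n --> \oo] --> w z * (a ^+ 2 + b ^+ 2).
  move=> c1 c2; apply: cvgM; first exact: cvg_cst.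
  by apply: cvgD; rewrite expr2; under eq_fun do rewrite expr2; apply: cvgM.
(* The limit in n at fixed k. Coordinates are exchanged because the inner limit is along horizontal
   lines. *)
have step1 k : (\int[mu2]_z (w z * (conv2 k f z ^+ 2 + conv2 k g z ^+ 2))%:E <= B)%E.
  have mfk := measurable_conv2 k if_; have mgk := measurable_conv2 k ig.
  rewrite ton2//; last exact: mwsq.
  apply: (@fatou_slices _
    (fun n z => w (z.2, z.1) * (conv (p n) (p k) f (z.2, z.1) ^+ 2 + conv (p n) (p k) g (z.2, z.1) ^+ 2))
    (fun z => w (z.2, z.1) * (conv2 k f (z.2, z.1) ^+ 2 + conv2 k g (z.2, z.1) ^+ 2))).
  - move=> n; apply: (mswap (fun z => w z * (conv (p n) (p k) f z ^+ 2 + conv (p n) (p k) g z ^+ 2))).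
    by apply: mwsq; exact: measurable_conv.
  - by apply: (mswap (fun z => w z * (conv2 k f z ^+ 2 + conv2 k g z ^+ 2))); exact: mwsq.
  - by move=> n z; exact: wsq0.
  - by move=> z; exact: wsq0.
  - apply: aeW => s.
    apply: filterS2 (conv1_cvg (integrable_conv2 k s if_)) (conv1_cvg (integrable_conv2 k s ig)).
    move=> t c1 c2 /=; apply: csq.
      by under eq_fun do rewrite conv_slices//.
    by under eq_fun do rewrite conv_slices//.
  move=> n; rewrite -(ton2 (fun z => w z * (conv (p n) (p k) f z ^+ 2 + conv (p n) (p k) g z ^+ 2)))//.
  by apply: mwsq; exact: measurable_conv.
(* The limit in k, along vertical lines. *)
rewrite ton1//; last exact: mwsq.
apply: (@fatou_slices _ (fun k z => w z * (conv2 k f z ^+ 2 + conv2 k g z ^+ 2))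
  (fun z => w z * (f z ^+ 2 + g z ^+ 2))).
- by move=> k; apply: mwsq; exact: measurable_conv2.
- exact: mwsq.
- by move=> k z; exact: wsq0.
- by move=> z; exact: wsq0.
- apply: filterS2 (ae_integrable1 if_) (ae_integrable1 ig) => s i1 i2.
  apply: filterS2 (conv1_cvg i1) (conv1_cvg i2) => t c1 c2 /=.
  exact: csq.
by move=> k; rewrite -(ton1 (fun z => w z * (conv2 k f z ^+ 2 + conv2 k g z ^+ 2)))//;
  apply: mwsq; exact: measurable_conv2.
Qed.

End mollifier_sequence.

(** * Testing the weak gradient against the kernels *)

Section weak_derivative.
Context {R : realType}.
Local Notation mu := (@lebesgue_measure R).
Local Notation mu2 := (@lebesgue_measure R \x @lebesgue_measure R)%E.
Local Notation plane := (measurableTypeR R * measurableTypeR R)%type.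
Local Notation Re := (@complex.Re R).
Local Notation Im := (@complex.Im R).

Lemma enorm_le_add (x y : R * R) : enorm x <= enorm y + `|x.1 - y.1| + `|x.2 - y.2|.
Proof.
have E0 := enorm_ge0 y; have E2 := sqr_enorm y.
have n1 := normr_ge0 (x.1 - y.1); have n2 := normr_ge0 (x.2 - y.2).
set s := `|x.1 - y.1| in n1 *; set t := `|x.2 - y.2| in n2 *.
have y1 : `|y.1| <= enorm y.
  by rewrite -sqrtr_sqr /enorm; apply: ler_wsqrtr; rewrite lerDl sqr_ge0.
have y2 : `|y.2| <= enorm y.
  by rewrite -sqrtr_sqr /enorm; apply: ler_wsqrtr; rewrite lerDr sqr_ge0.
have x1 : `|x.1| <= `|y.1| + s by rewrite -{1}(subrK y.1 x.1) addrC ler_normD.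
have x2 : `|x.2| <= `|y.2| + t by rewrite -{1}(subrK y.2 x.2) addrC ler_normD.
have S0 : 0 <= enorm y + s + t by rewrite !addr_ge0.
rewrite -(ler_pXn2r (n := 2)) ?nnegrE ?enorm_ge0// sqr_enorm.
have q1 : x.1 ^+ 2 <= (`|y.1| + s) ^+ 2.
  by rewrite -real_normK ?num_real// ler_pXn2r ?nnegrE// addr_ge0.
have q2 : x.2 ^+ 2 <= (`|y.2| + t) ^+ 2.
  by rewrite -(real_normK (num_real x.2)) ler_pXn2r ?nnegrE// addr_ge0.
have e1 := real_normK (num_real y.1); have e2 := real_normK (num_real y.2).
have p1 : `|y.1| * s <= enorm y * s by exact: ler_wpM2r.
have p2 : `|y.2| * t <= enorm y * t by exact: ler_wpM2r.
have st : 0 <= s * t by exact: mulr_ge0.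
rewrite sqrrD in q1; rewrite sqrrD in q2; rewrite e1 in q1; rewrite e2 in q2.
rewrite (_ : (enorm y + s + t) ^+ 2 = enorm y ^+ 2 + 2 * (enorm y * s) + 2 * (enorm y * t) +
  2 * (s * t) + s ^+ 2 + t ^+ 2); last by ring.
rewrite E2; rewrite !mulr2n in q1 q2; lra.
Qed.

(** The inequality is strict so that p vanishes on a whole neighbourhood of t. *)
Lemma derive_outside_support (p p' : R -> R) (d t : R) :
  (forall t, d <= `|t| -> p t = 0) -> (forall t : R, is_derive t 1 p (p' t)) ->
  d < `|t| -> p' t = 0.
Proof.
move=> psupp dp dt.
have h : is_derive t 1 p 0.
  apply: (near_eq_is_derive (f := cst 0)).
  have : \forall s \near t, d < `|s|.
    have c : (fun s : R => `|s|) @ t --> `|t| by exact: norm_continuous.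
    exact: (cvgr_gt _ c).
  by apply: filterS => s ds; rewrite psupp// ltW.
by rewrite -(@derive_val _ _ _ _ _ _ _ (dp t)) (@derive_val _ _ _ _ _ _ _ h).
Qed.

Section kernel.
Variables (p p' q q' : R -> R) (d : R) (x : R * R).
Hypotheses (sp : smooth_fun p) (sq : smooth_fun q)
  (dp : forall t : R, is_derive t 1 p (p' t)) (dq : forall t : R, is_derive t 1 q (q' t))
  (psupp : forall t, d <= `|t| -> p t = 0) (qsupp : forall t, d <= `|t| -> q t = 0).

Definition kernel (y : R * R) : R := p (x.1 - y.1) * q (x.2 - y.2).

Lemma kernel_smooth2 : smooth2 kernel.
Proof.
apply: smooth_fun2_smooth2.
have h (f : R -> R) (c : R) : smooth_fun f -> smooth_fun (fun t => f (c - t)).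
  move=> sf; have := smooth_fun_affine (-1) c sf.
  by congr smooth_fun; apply/funext => t; congr f; ring.
exact: (smooth2_mul (smooth2_fst (h _ _ sp)) (smooth2_snd (h _ _ sq))).
Qed.

Lemma kernel_test_function (U : set (R * R)) :
  (forall y, `|x.1 - y.1| <= d -> `|x.2 - y.2| <= d -> U y) -> test_function U kernel.
Proof.
move=> boxU; pose B : set (R * R) := `[x.1 - d, x.1 + d]%classic `*` `[x.2 - d, x.2 + d]%classic.
have cB : compact B by apply: compact_setX; exact: segment_compact.
have clB : closed B by apply: compact_closed => //; exact: norm_hausdorff.
have sB : closure [set y | kernel y != 0] `<=` B.
  rewrite [X in _ `<=` X]((closure_id B).1 clB); apply: closureS => y /= ky.
  have in_itv_of (f : R -> R) (s t : R) : (forall t, d <= `|t| -> f t = 0) -> f (s - t) != 0 ->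
      t \in `[s - d, s + d].
    move=> fs f0; rewrite in_itv/=.
    have : `|s - t| < d by rewrite ltNge; apply: contra f0 => /fs ->.
    by rewrite ltr_norml => /andP[h1 h2]; apply/andP; split; lra.
  split => /=.
    by apply: (in_itv_of p) => //; apply: contra ky => /eqP e; rewrite /kernel e mul0r.
  by apply: (in_itv_of q) => //; apply: contra ky => /eqP e; rewrite /kernel e mulr0.
split; first exact: kernel_smooth2.
  by apply: (subclosed_compact _ cB) => //; exact: closed_closure.
move=> y /sB [] /=; rewrite !in_itv/= => /andP[h1 h2] /andP[h3 h4].
by apply: boxU; rewrite ler_norml; apply/andP; split; lra.
Qed.

Lemma derive_kernel1 y : 'D_(1, 0) kernel y = - (p' (x.1 - y.1) * q (x.2 - y.2)).
Proof.
case: y => y1 y2; apply: (@derive_val _ _ _ _ _ _ _ (is_derive_line1 _)).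
have h := @der_comp R p (fun t => x.1 - t) y1 _ _ (dp _)
  (der_D (der_cst x.1 y1) (der_N (der_id y1))).
apply: (@is_derive_eq _ _ _ _ _ _ _ _ (der_M h (der_cst (q (x.2 - y2)) y1))).
by rewrite /=; ring.
Qed.

Lemma derive_kernel2 y : 'D_(0, 1) kernel y = - (p (x.1 - y.1) * q' (x.2 - y.2)).
Proof.
case: y => y1 y2; apply: (@derive_val _ _ _ _ _ _ _ (is_derive_line2 _)).
have h := @der_comp R q (fun t => x.2 - t) y2 _ _ (dq _)
  (der_D (der_cst x.2 y2) (der_N (der_id y2))).
apply: (@is_derive_eq _ _ _ _ _ _ _ _ (der_M (der_cst (p (x.1 - y1)) y2) h)).
by rewrite /=; ring.
Qed.

End kernel.

Lemma Rintegral_restrict (U V : set (R * R)) (h k : R * R -> R) : measurable (U : set plane) ->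
  V `<=` U -> (forall y, ~ V y -> k y = 0) ->
  \int[mu2]_(y in U) (h y * k y) = \int[mu2]_y ((h \_ V) y * k y).
Proof.
move=> mU VU k0; rewrite [LHS]Rintegral_mkcond; apply: eq_Rintegral => y _.
rewrite !patchE; case: (pselect (V y)) => Vy.
  by rewrite (mem_set Vy) (mem_set (VU _ Vy)).
by rewrite k0// !mulr0 if_same.
Qed.

(** Real and imaginary parts of the complex identity, with u and w cut off to a set V containing the
    supports of the test function and of its derivative. The cutoff leaves all integrals unchanged
    and will make the factors integrable. *)
Lemma weak_identity (b : R) (U V : set (R * R)) e (a phi dphi : R * R -> R) u w :
  measurable (U : set plane) -> V `<=` U -> weak_magnetic_derivative b U e a u w ->
  test_function U phi -> (forall y, 'D_e phi y = dphi y) ->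
  (forall y, ~ V y -> phi y = 0) -> (forall y, ~ V y -> dphi y = 0) ->
  \int[mu2]_y (((Im \o w) \_ V) y * phi y) =
    \int[mu2]_y (((Re \o u) \_ V) y * dphi y - b * (a y * ((Im \o u) \_ V) y) * phi y) /\
  \int[mu2]_y (((Re \o w) \_ V) y * phi y) =
    \int[mu2]_y (- (((Im \o u) \_ V) y * dphi y) - b * (a y * ((Re \o u) \_ V) y) * phi y).
Proof.
move=> mU VU weak tphi Dphi phi0 dphi0.
have rst (k : R * R -> R) : (forall y, ~ V y -> k y = 0) ->
    \int[mu2]_(y in U) k y = \int[mu2]_y k y.
  move=> k0; rewrite [LHS]Rintegral_mkcond; apply: eq_Rintegral => y _.
  rewrite patchE; case: ifPn => //; rewrite notin_setE => nU.
  by rewrite k0// => /VU.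
have := weak phi tphi; rewrite /cintegral => -[eR eI].
split.
  have -> : \int[mu2]_y (((Im \o w) \_ V) y * phi y) =
      \int[mu2]_(y in U) Im (w y * (phi y)%:C%C).
    rewrite -(Rintegral_restrict _ mU VU phi0); apply: eq_Rintegral => y _ /=.
    by case: (w y) => wr wi /=; rewrite mulr0 add0r.
  rewrite eI rst => [|y nV]; last first.
    rewrite Dphi phi0// dphi0//; case: (u y) => ur ui /=.
    by ring.
  apply: eq_Rintegral => y _; rewrite Dphi !patchE.
  case: ifPn => [_|]; last first.
    rewrite notin_setE => nV; rewrite phi0// dphi0//; case: (u y) => ur ui /=.
    by ring.
  by rewrite /=; case: (u y) => ur ui /=; ring.
have -> : \int[mu2]_y (((Re \o w) \_ V) y * phi y) =
    \int[mu2]_(y in U) Re (w y * (phi y)%:C%C).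
  rewrite -(Rintegral_restrict _ mU VU phi0); apply: eq_Rintegral => y _ /=.
  by case: (w y) => wr wi /=; rewrite mulr0 subr0.
rewrite eR rst => [|y nV]; last first.
  rewrite Dphi phi0// dphi0//; case: (u y) => ur ui /=.
  by ring.
apply: eq_Rintegral => y _; rewrite Dphi !patchE.
case: ifPn => [_|]; last first.
  by rewrite notin_setE => nV; rewrite phi0// dphi0//; case: (u y) => ur ui /=; ring.
by rewrite /=; case: (u y) => ur ui /=; ring.
Qed.

End weak_derivative.

(** * Pointwise bound of the mollified energy *)

Section mollified_bound.
Context {R : realType}.
Local Notation mu := (@lebesgue_measure R).
Local Notation mu2 := (@lebesgue_measure R \x @lebesgue_measure R)%E.
Local Notation plane := (measurableTypeR R * measurableTypeR R)%type.
Local Notation Re := (@complex.Re R).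
Local Notation Im := (@complex.Im R).

Lemma integrable_ge0_le (h k : R * R -> R) : mu2.-integrable setT (EFin \o k) ->
  measurable_fun [set: plane] h -> (forall y, `|h y| <= k y) ->
  mu2.-integrable setT (EFin \o h).
Proof.
move=> ik mh hk; apply: (le_integrable _ _ _ ik) => //; first exact/measurable_EFinP.
by move=> y _; rewrite !abse_EFin lee_fin (le_trans (hk y))// ler_norm.
Qed.

Lemma young_sqr (B z d : R) : 0 < d -> (B + z) ^+ 2 <= (1 + d) * B ^+ 2 + (1 + d^-1) * z ^+ 2.
Proof.
move=> d0; rewrite -subr_ge0.
have -> : (1 + d) * B ^+ 2 + (1 + d^-1) * z ^+ 2 - (B + z) ^+ 2 = d^-1 * (d * B - z) ^+ 2.
  by field; rewrite gt_eqF.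
by rewrite mulr_ge0 ?sqr_ge0// invr_ge0 ltW.
Qed.

Section pointwise.
Variables (p p' q q' : R -> R) (d : R) (x : R * R).
Hypotheses (sp : smooth_fun p) (sp' : smooth_fun p') (sq : smooth_fun q) (sq' : smooth_fun q')
  (dp : forall t : R, is_derive t 1 p (p' t)) (dq : forall t : R, is_derive t 1 q (q' t))
  (psupp : forall t, d <= `|t| -> p t = 0) (qsupp : forall t, d <= `|t| -> q t = 0)
  (p0 : forall t, 0 <= p t) (q0 : forall t, 0 <= q t)
  (pint : (\int[mu]_t (p t)%:E = 1)%E) (qint : (\int[mu]_t (q t)%:E = 1)%E).
Hypothesis d0 : 0 < d.

(** Young's inequality with parameter d for the sum of h and an error b (a y - a x) k with |a y - a
    x| <= d / 2: the second coefficient is (1 + 1 / d) (d / 2)^2 = (d^2 + d) / 4, which vanishes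
    with d. *)
Definition shift_bound b (h k : R * R -> R) y :=
  (1 + d) * h y ^+ 2 + b ^+ 2 * ((d ^+ 2 + d) / 4) * k y ^+ 2.

(** Multiplication by the potential does not commute with mollification. The left side is the square
    of the mollification of h + b (a y - a x) k, and Jensen applies to that function. *)
Lemma conv_shift_sqr (b C : R) (a h k : R * R -> R) :
  mu2.-integrable setT (EFin \o h) -> mu2.-integrable setT (EFin \o (fun y => h y ^+ 2)) ->
  mu2.-integrable setT (EFin \o k) -> mu2.-integrable setT (EFin \o (fun y => k y ^+ 2)) ->
  measurable_fun [set: plane] a -> (forall y, k y != 0 -> `|a y| <= C) ->
  (forall y, `|x.1 - y.1| <= d -> `|x.2 - y.2| <= d -> `|a y - a x| <= d / 2) ->
  (conv p q h x + b * conv p q (fun y => a y * k y) x - b * a x * conv p q k x) ^+ 2 <=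
  conv p q (shift_bound b h k) x.
Proof.
move=> ih ih2 ik ik2 ma aC ad.
have mk : measurable_fun [set: plane] k.
  by apply/measurable_EFinP; exact: (measurable_int mu2 ik).
have mh : measurable_fun [set: plane] h.
  by apply/measurable_EFinP; exact: (measurable_int mu2 ih).
have zl (c : R) (f : R * R -> R) : mu2.-integrable setT (EFin \o f) ->
    mu2.-integrable setT (EFin \o (fun y => c * f y)).
  by move=> i; have := integrableZl measurableT c i; apply.
have ad2 (f g : R * R -> R) : mu2.-integrable setT (EFin \o f) -> mu2.-integrable setT (EFin \o g) ->
    mu2.-integrable setT (EFin \o (fun y => f y + g y)).
  by move=> i j; have := integrableD measurableT i j; apply.
have iak : mu2.-integrable setT (EFin \o (fun y => a y * k y)).
  have in_ : mu2.-integrable setT (EFin \o (fun y => `|C| * `|k y|)).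
    by apply: zl; have := integrable_norm ik; apply.
  apply: (integrable_ge0_le in_); first exact: measurable_funM.
  move=> y; rewrite normrM; have [->|ky] := eqVneq (k y) 0; first by rewrite normr0 !mulr0.
  by apply: ler_wpM2r => //; rewrite (le_trans (aC y ky))// ler_norm.
pose g (y : R * R) := h y + b * ((a y - a x) * k y).
have gE : g = fun y => h y + (b * (a y * k y) + (- (b * a x)) * k y).
  by apply/funext => y; rewrite /g; ring.
have ig : mu2.-integrable setT (EFin \o g).
  by rewrite gE; apply: (ad2 _ _ ih); apply: ad2; exact: zl.
have cgE : conv p q g x = conv p q h x + b * conv p q (fun y => a y * k y) x - b * a x * conv p q k x.
  rewrite gE convD//; last by apply: ad2; exact: zl.
  by rewrite convD//; [rewrite !convZ//; ring|exact: zl|exact: zl].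
have ig2 : mu2.-integrable setT (EFin \o (fun y => g y ^+ 2)).
  have ib : mu2.-integrable setT (EFin \o (fun y => 2 * h y ^+ 2 +
      (2 * (`|b| * (`|C| + `|a x|)) ^+ 2) * k y ^+ 2)).
    by apply: ad2; exact: zl.
  apply: (integrable_ge0_le ib).
    apply: measurable_funX; apply: measurable_funD => //; apply: measurable_funM => //.
    by apply: measurable_funM => //; exact: measurable_funB.
  move=> y; rewrite ger0_norm ?sqr_ge0// /g.
  have [->|ky] := eqVneq (k y) 0.
    rewrite !mulr0 addr0 expr0n/= mulr0 addr0.
    by have := sqr_ge0 (h y); lra.
  have := young_sqr (h y) (b * ((a y - a x) * k y)) ltr01; rewrite invr1 => /le_trans; apply.
  apply: lerD; first by rewrite le_eqVlt; apply/orP; left; apply/eqP; ring.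
  rewrite [(`|b| * _) ^+ 2]exprMn real_normK ?num_real//.
  rewrite (_ : (1 + 1) * _ = (2 * b ^+ 2 * k y ^+ 2) * (a y - a x) ^+ 2); last by ring.
  rewrite (_ : 2 * (b ^+ 2 * (`|C| + `|a x|) ^+ 2) * k y ^+ 2 =
    (2 * b ^+ 2 * k y ^+ 2) * (`|C| + `|a x|) ^+ 2); last by ring.
  apply: ler_wpM2l.
    by apply: mulr_ge0; [apply: mulr_ge0 => //; exact: sqr_ge0|exact: sqr_ge0].
  rewrite -(real_normK (num_real (a y - a x))); apply: lerXn2r; rewrite ?nnegrE ?addr_ge0//.
  by rewrite (le_trans (ler_normB _ _))// lerD2r (le_trans (aC y ky))// ler_norm.
have isb : mu2.-integrable setT (EFin \o shift_bound b h k) by apply: ad2; exact: zl.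
rewrite -cgE; apply: (le_trans (conv_sqr_le sp sq p0 q0 pint qint x ig ig2)).
apply: conv_le => // y pq.
have pp : `|x.1 - y.1| < d.
  rewrite ltNge; apply: contra pq => /psupp ->; by rewrite mul0r.
have qq : `|x.2 - y.2| < d.
  rewrite ltNge; apply: contra pq => /qsupp ->; by rewrite mulr0.
have ady := ad y (ltW pp) (ltW qq).
apply: (le_trans (young_sqr (h y) (b * ((a y - a x) * k y)) d0)).
rewrite /shift_bound lerD2l !exprMn.
have -> : (d ^+ 2 + d) / 4 = (1 + d^-1) * (d / 2) ^+ 2 by field; rewrite gt_eqF.
rewrite (_ : (1 + d^-1) * (b ^+ 2 * ((a y - a x) ^+ 2 * k y ^+ 2)) =
  (b ^+ 2 * (1 + d^-1) * k y ^+ 2) * (a y - a x) ^+ 2); last by ring.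
rewrite (_ : b ^+ 2 * ((1 + d^-1) * (d / 2) ^+ 2) * k y ^+ 2 =
  (b ^+ 2 * (1 + d^-1) * k y ^+ 2) * (d / 2) ^+ 2); last by ring.
apply: ler_wpM2l.
  apply: mulr_ge0; last exact: sqr_ge0.
  apply: mulr_ge0; first exact: sqr_ge0.
  by rewrite addr_ge0// invr_ge0 ltW.
rewrite -(real_normK (num_real (a y - a x))); apply: lerXn2r; rewrite ?nnegrE//.
by rewrite divr_ge0// ltW.
Qed.

Variables (b R0 M : R) (u : R * R -> R[i]) (W : (R * R -> R[i]) * (R * R -> R[i])).
Let U : set (R * R) := [set y | R0 < enorm y].
(** A bounded part of the exterior, of finite area, so that square integrable functions become
    integrable on it. *)
Let V : set (R * R) := [set y | R0 < enorm y < M + 1].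
Hypotheses (mW : magnetic_gradient b U u W) (M0 : 0 < M).
Let rs (h : R * R -> R) := h \_ V.
Hypothesis i1 : forall w : R * R -> R[i], w = u \/ w = W.1 \/ w = W.2 ->
  [/\ mu2.-integrable setT (EFin \o rs (Re \o w)), mu2.-integrable setT (EFin \o rs (Im \o w)),
   mu2.-integrable setT (EFin \o (fun y => rs (Re \o w) y ^+ 2)) &
   mu2.-integrable setT (EFin \o (fun y => rs (Im \o w) y ^+ 2))].
Hypotheses (dx : R0 + 2 * d < enorm x) (dM : 2 * d < 1) (xM : enorm x <= M).

Definition energy_bound y :=
  shift_bound b (rs (Im \o W.1)) (rs (Im \o u)) y +
  (shift_bound b (rs (Im \o W.2)) (rs (Im \o u)) y +
  (shift_bound b (rs (Re \o W.1)) (rs (Re \o u)) y +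
   shift_bound b (rs (Re \o W.2)) (rs (Re \o u)) y)).

Let mU : measurable (U : set plane).
Proof.
have := @measurable_enorm_itv R `]R0, +oo[; congr measurable.
by apply/seteqP; split => z /=; rewrite in_itv/= andbT.
Qed.

Let VU : V `<=` U. Proof. by move=> y /= /andP[]. Qed.

(** On the box the norm changes by at most 2 d, which is less than 1 and less than the distance of x
    to the removed disk. *)
Let boxV y : `|x.1 - y.1| <= d -> `|x.2 - y.2| <= d -> V y.
Proof.
move=> h1 h2; have := enorm_le_add x y; have := enorm_le_add y x.
rewrite (distrC y.1 x.1) (distrC y.2 x.2) => k1 k2.
move: h1 h2 k1 k2 dx dM xM; rewrite /V/=.
move: (`|x.1 - y.1|) (`|x.2 - y.2|) => s t h1 h2 k1 k2 h3 h4 h5.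
by apply/andP; split; lra.
Qed.

Let phi := kernel p q x.

Let phi0 y : ~ V y -> phi y = 0.
Proof.
move=> nV; rewrite /phi /kernel.
have [h1|h1] := leP `|x.1 - y.1| d; last by rewrite psupp ?mul0r// ltW.
have [h2|h2] := leP `|x.2 - y.2| d; last by rewrite qsupp ?mulr0// ltW.
by case: nV; exact: boxV.
Qed.

Let dphi10 y : ~ V y -> - (p' (x.1 - y.1) * q (x.2 - y.2)) = 0.
Proof.
move=> nV.
have [h1|h1] := leP `|x.1 - y.1| d; last first.
  by rewrite (derive_outside_support psupp dp h1) mul0r oppr0.
have [h2|h2] := leP `|x.2 - y.2| d; last by rewrite qsupp ?mulr0 ?oppr0// ltW.
by case: nV; exact: boxV.
Qed.

Let dphi20 y : ~ V y -> - (p (x.1 - y.1) * q' (x.2 - y.2)) = 0.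
Proof.
move=> nV.
have [h1|h1] := leP `|x.1 - y.1| d; last by rewrite psupp ?mul0r ?oppr0// ltW.
have [h2|h2] := leP `|x.2 - y.2| d; last first.
  by rewrite (derive_outside_support qsupp dq h2) mulr0 oppr0.
by case: nV; exact: boxV.
Qed.

Let tphi : test_function U phi.
Proof.
by apply: (kernel_test_function sp sq psupp qsupp) => y h1 h2; exact: VU (boxV h1 h2).
Qed.

Let mV : measurable (V : set plane).
Proof.
have := @measurable_enorm_itv R `]R0, (M + 1)[; congr measurable. 
Qed.

Lemma vpot_bound (y : R * R) : `|(vpot y).1| <= enorm y /\ `|(vpot y).2| <= enorm y.
Proof.
have h (s : R) : s ^+ 2 <= enorm y ^+ 2 -> `|s / 2| <= enorm y.
  move=> hs; have : `|s| <= enorm y.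
    by rewrite -(ler_pXn2r (n := 2)) ?nnegrE ?enorm_ge0// real_normK ?num_real.
  have := normr_ge0 s; rewrite normrM (ger0_norm (_ : 0 <= 2^-1)) ?invr_ge0//; lra.
split; rewrite /vpot/=.
  by apply: h; rewrite sqrrN sqr_enorm lerDr sqr_ge0.
by apply: h; rewrite sqr_enorm lerDl sqr_ge0.
Qed.

Let aC (h : R * R -> R) y : rs h y != 0 -> `|(vpot y).1| <= M + 1 /\ `|(vpot y).2| <= M + 1.
Proof.
rewrite /rs patchE; case: ifPn => [|_]; last by rewrite eqxx.
rewrite inE /= => /andP[_ yM] _; have [h1 h2] := vpot_bound y.
by split; [apply: (le_trans h1)|apply: (le_trans h2)]; exact: ltW.
Qed.

Let ad1 y : `|x.1 - y.1| <= d -> `|x.2 - y.2| <= d -> `|(vpot y).1 - (vpot x).1| <= d / 2.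
Proof.
move=> _ h; rewrite /vpot/= (_ : _ - _ = (x.2 - y.2) / 2); last by ring.
by rewrite normrM (ger0_norm (_ : 0 <= 2^-1)) ?invr_ge0// ler_wpM2r// invr_ge0.
Qed.

Let ad2 y : `|x.1 - y.1| <= d -> `|x.2 - y.2| <= d -> `|(vpot y).2 - (vpot x).2| <= d / 2.
Proof.
move=> h _; rewrite /vpot/= (_ : _ - _ = - (x.1 - y.1) / 2); last by ring.
by rewrite normrM normrN (ger0_norm (_ : 0 <= 2^-1)) ?invr_ge0// ler_wpM2r// invr_ge0.
Qed.

Let ma1 : measurable_fun [set: plane] (fun y => (vpot y).1).
Proof.
rewrite /vpot/=; apply: measurable_funM => //.
by apply: measurableT_comp => //; exact: measurable_snd.
Qed.
Let ma2 : measurable_fun [set: plane] (fun y => (vpot y).2).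
Proof. by rewrite /vpot/=; apply: measurable_funM. Qed.

Let iak (a k : R * R -> R) : measurable_fun [set: plane] a ->
  (forall y, rs k y != 0 -> `|a y| <= M + 1) ->
  mu2.-integrable setT (EFin \o rs k) ->
  mu2.-integrable setT (EFin \o (fun y => a y * rs k y)).
Proof.
move=> ma aM ik.
have mk : measurable_fun [set: plane] (rs k).
  by apply/measurable_EFinP; exact: (measurable_int mu2 ik).
have in_ : mu2.-integrable setT (EFin \o (fun y => (M + 1) * `|rs k y|)).
  by have := integrableZl measurableT (M + 1) (integrable_norm ik); apply.
apply: (integrable_ge0_le in_); first exact: measurable_funM.
move=> y; rewrite normrM; have [->|ky] := eqVneq (rs k y) 0; first by rewrite normr0 !mulr0.
by apply: ler_wpM2r => //; exact: aM.
Qed.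

(** The weak equation tested with the kernel centred at x: the mollified component of W equals a
    derivative of the mollified u plus the mollified potential term. P and Q are the kernels with
    one of them differentiated. *)
Let conv_identity (e : R * R) (a : R * R -> R) (w : R * R -> R[i]) (P Q : R -> R) :
  smooth_fun P -> smooth_fun Q ->
  weak_magnetic_derivative b U e a u w -> w = W.1 \/ w = W.2 ->
  measurable_fun [set: plane] a -> (forall k y, rs k y != 0 -> `|a y| <= M + 1) ->
  (forall y, 'D_e phi y = - (P (x.1 - y.1) * Q (x.2 - y.2))) ->
  (forall y, ~ V y -> - (P (x.1 - y.1) * Q (x.2 - y.2)) = 0) ->
  conv p q (rs (Im \o w)) x =
    - conv P Q (rs (Re \o u)) x - b * conv p q (fun y => a y * rs (Im \o u) y) x /\
  conv p q (rs (Re \o w)) x =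
    conv P Q (rs (Im \o u)) x - b * conv p q (fun y => a y * rs (Re \o u) y) x.
Proof.
move=> sP sQ weak wW ma aM De D0.
have [eI eR] := weak_identity mU VU weak tphi De phi0 D0.
have [ur ui _ _] := i1 (or_introl erefl).
have iI := iak ma (aM (Im \o u)) ui; have iR := iak ma (aM (Re \o u)) ur.
have j1 := integrable_conv x sP sQ ur; have j2 := integrable_conv x sP sQ ui.
have j3 := integrable_conv x sp sq iI; have j4 := integrable_conv x sp sq iR.
have zl (c : R) (f : R * R -> R) : mu2.-integrable setT (EFin \o f) ->
    mu2.-integrable setT (EFin \o (fun y => c * f y)).
  by move=> i; have := integrableZl measurableT c i; apply.
split.
  rewrite [LHS]eI /conv -mulN1r -RintegralZl// -RintegralZl// -RintegralB//.
  - by apply: eq_Rintegral => y _; rewrite /phi /kernel /rs; ring.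
  - exact: (zl (-1)).
  - exact: (zl b).
rewrite [LHS]eR /conv -RintegralZl// -RintegralB//; last exact: (zl b).
by apply: eq_Rintegral => y _; rewrite /phi /kernel /rs; ring.
Qed.

(** Each of the four squares of the mollified energy is, up to sign inside, a commutator expression
    handled by [conv_shift_sqr]. *)
Lemma conv_energy_le :
  conv_energy b p p' q q' (rs (Re \o u)) (rs (Im \o u)) x <= conv p q energy_bound x.
Proof.
have [w1 w2] := mW.
have [|I1 R1] := conv_identity sp' sq w1 (or_introl erefl) ma1 (fun k y h => (aC h).1) _ dphi10.
  exact: derive_kernel1.
have [|I2 R2] := conv_identity sp sq' w2 (or_intror erefl) ma2 (fun k y h => (aC h).2) _ dphi20.
  exact: derive_kernel2.
have [ur ui ur2 ui2] := i1 (or_introl erefl).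
have [vr vi vr2 vi2] := i1 (or_intror (or_introl erefl)).
have [sr si sr2 si2] := i1 (or_intror (or_intror erefl)).
have T1 := conv_shift_sqr b vi vi2 ui ui2 ma1 (fun y h => (aC h).1) ad1.
have T2 := conv_shift_sqr b si si2 ui ui2 ma2 (fun y h => (aC h).2) ad2.
have T3 := conv_shift_sqr b vr vr2 ur ur2 ma1 (fun y h => (aC h).1) ad1.
have T4 := conv_shift_sqr b sr sr2 ur ur2 ma2 (fun y h => (aC h).2) ad2.
have zl (c : R) (f : R * R -> R) : mu2.-integrable setT (EFin \o f) ->
    mu2.-integrable setT (EFin \o (fun y => c * f y)).
  by move=> i; have := integrableZl measurableT c i; apply.
have adI (f g : R * R -> R) : mu2.-integrable setT (EFin \o f) -> mu2.-integrable setT (EFin \o g) ->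
    mu2.-integrable setT (EFin \o (fun y => f y + g y)).
  by move=> i j; have := integrableD measurableT i j; apply.
have ish (h k : R * R -> R) : mu2.-integrable setT (EFin \o (fun y => h y ^+ 2)) ->
    mu2.-integrable setT (EFin \o (fun y => k y ^+ 2)) ->
    mu2.-integrable setT (EFin \o shift_bound b h k).
  by move=> ih ik; apply: adI; exact: zl.
have j1 := ish _ _ vi2 ui2; have j2 := ish _ _ si2 ui2.
have j3 := ish _ _ vr2 ur2; have j4 := ish _ _ sr2 ur2.
have j34 := adI _ _ j3 j4; have j234 := adI _ _ j2 j34.
rewrite /energy_bound (convD sp sq x j1 j234) (convD sp sq x j2 j34) (convD sp sq x j3 j4).
rewrite /conv_energy !addrA.
apply: lerD; [apply: lerD; [apply: lerD|]|].
- apply: le_trans T1; rewrite I1 -[leRHS]sqrrN le_eqVlt; apply/orP; left; apply/eqP.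
  by congr (_ ^+ 2); ring.
- apply: le_trans T2; rewrite I2 -[leRHS]sqrrN le_eqVlt; apply/orP; left; apply/eqP.
  by congr (_ ^+ 2); ring.
- apply: le_trans T3; rewrite R1 le_eqVlt; apply/orP; left; apply/eqP.
  by congr (_ ^+ 2); ring.
- apply: le_trans T4; rewrite R2 le_eqVlt; apply/orP; left; apply/eqP.
  by congr (_ ^+ 2); ring.
Qed.

End pointwise.

End mollified_bound.

(** * Lower bound of the energy outside a disk *)

Section lower_bound.
Context {R : realType}.
Local Notation mu := (@lebesgue_measure R).
Local Notation mu2 := (@lebesgue_measure R \x @lebesgue_measure R)%E.
Local Notation plane := (measurableTypeR R * measurableTypeR R)%type.
Local Notation Re := (@complex.Re R).
Local Notation Im := (@complex.Im R).

Lemma integrable_scale (c : R) (f : R * R -> R) : mu2.-integrable setT (EFin \o f) ->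
  mu2.-integrable setT (EFin \o (fun y => c * f y)).
Proof. by move=> i; have := integrableZl measurableT c i; apply. Qed.

Lemma integrable_add (f g : R * R -> R) : mu2.-integrable setT (EFin \o f) ->
  mu2.-integrable setT (EFin \o g) -> mu2.-integrable setT (EFin \o (fun y => f y + g y)).
Proof. by move=> i j; have := integrableD measurableT i j; apply. Qed.

Lemma integrable_patch (U : set plane) (f : plane -> R) : measurable U ->
  mu2.-integrable U (EFin \o f) -> mu2.-integrable setT (EFin \o (f \_ U)).
Proof.
move=> mU i; have := (integrable_mkcond (EFin \o f) mU).1 i.
by apply: eq_integrable => // y _; rewrite /= !patchE; case: ifP.
Qed.

Lemma ge0_integral_Rintegral (f : R * R -> R) : mu2.-integrable setT (EFin \o f) ->
  (\int[mu2]_y (f y)%:E = (\int[mu2]_y f y)%:E)%E.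
Proof. by move=> i; rewrite /Rintegral fineK//; exact: (integrable_fin_num _ i). Qed.

(** On a set of finite measure |h| <= 1 + h^2 gives integrability. *)
Lemma L2_patch (U V : set (R * R)) (w : R * R -> R[i]) : measurable (U : set plane) ->
  measurable (V : set plane) -> V `<=` U -> (mu2 V < +oo)%E -> L2 U w ->
  [/\ mu2.-integrable setT (EFin \o ((Re \o w) \_ V)),
   mu2.-integrable setT (EFin \o ((Im \o w) \_ V)),
   mu2.-integrable setT (EFin \o (fun y => ((Re \o w) \_ V) y ^+ 2)) &
   mu2.-integrable setT (EFin \o (fun y => ((Im \o w) \_ V) y ^+ 2))].
Proof.
move=> mU mV VU Voo [mRe mIm iw].
have iN := integrable_patch mU iw.
have i1 : mu2.-integrable setT (EFin \o ((cst (1 : R) : plane -> R) \_ V)).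
  apply: integrable_patch => //; apply/integrableP; split.
    by apply/measurable_EFinP; exact: measurable_cst.
  under eq_integral do rewrite /= normr1.
  by rewrite integral_cst// mul1e.
have key (h : R * R -> R) : measurable_fun (U : set plane) h ->
    (forall y, U y -> h y ^+ 2 <= sqmod (w y)) ->
    mu2.-integrable setT (EFin \o (h \_ V)) /\
    mu2.-integrable setT (EFin \o (fun y => (h \_ V) y ^+ 2)).
  move=> mh hN.
  have mhV : measurable_fun [set: plane] (h \_ V).
    by apply/(measurable_restrictT _ mV); exact: measurable_funS mh.
  have sqV y : (h \_ V) y ^+ 2 <= ((fun y => sqmod (w y)) \_ U) y.
    rewrite !patchE; case: ifPn => [|_].
      by rewrite inE => Vy; rewrite (mem_set (VU _ Vy)) hN//; exact: VU.
    by rewrite [leLHS]expr0n/=; case: ifP => // _; rewrite addr_ge0// sqr_ge0.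
  have i2 : mu2.-integrable setT (EFin \o (fun y => (h \_ V) y ^+ 2)).
    apply: (integrable_ge0_le iN); first exact: measurable_funX.
    by move=> y; rewrite ger0_norm ?sqr_ge0.
  split => //; apply: (integrable_ge0_le (integrable_add i1 i2)) => // y.
  rewrite !patchE; case: ifPn => _; last by rewrite normr0 expr0n/= addr0.
  have := sqr_ge0 (`|h y| - 1); rewrite sqrrB real_normK ?num_real// expr1n mulr1.
  by have := normr_ge0 (h y); rewrite mulr2n /=; have := sqr_ge0 (h y); lra.
have hRe y : U y -> (Re \o w) y ^+ 2 <= sqmod (w y) by move=> _; rewrite /sqmod lerDl sqr_ge0.
have hIm y : U y -> (Im \o w) y ^+ 2 <= sqmod (w y) by move=> _; rewrite /sqmod lerDr sqr_ge0.
have [a1 a2] := key _ mRe hRe; have [b1 b2] := key _ mIm hIm.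
by [].
Qed.

Lemma le_limn_einf (u v : (\bar R)^nat) : (forall n, u n <= v n)%E -> (limn_einf u <= limn_einf v)%E.
Proof.
move=> uv; rewrite !limn_einf_lim; apply: lee_lim; [exact: is_cvg_einfs|exact: is_cvg_einfs|].
near=> n; apply: le_ereal_inf_tmp => _ [k /= nk <-].
by apply: (le_trans _ (uv k)); apply: ereal_inf_lbound; exists k.
Unshelve. all: by end_near. Qed.

Variables (b eps R0 R1 : R) (u : R * R -> R[i]) (W : (R * R -> R[i]) * (R * R -> R[i])).
Let U : set (R * R) := [set y | R0 < enorm y].
Hypotheses (b0 : 0 < b) (R00 : 0 < R0) (R01 : R0 < R1) (HH : H1A b U u W).
Hypotheses (c20 : Num.sqrt b * R1 <= 1 / 20) (ceps : Num.sqrt b * R1 * 100 * 110 <= eps)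
  (lam0 : 0 <= b - b ^+ 2 * R1 ^+ 2 * (1 + eps)).
Let lam : R := b - b ^+ 2 * R1 ^+ 2 * (1 + eps).
Let Nf : R * R -> R := (fun y => sqmod (u y)) \_ U.
Let Ef : R * R -> R := (fun y => sqmod (W.1 y) + sqmod (W.2 y)) \_ U.

Let sqmod_ge0 (z : R[i]) : 0 <= sqmod z.
Proof. by rewrite addr_ge0// sqr_ge0. Qed.

Let mU : measurable (U : set plane).
Proof.
have := @measurable_enorm_itv R `]R0, +oo[; congr measurable.
by apply/seteqP; split => z /=; rewrite in_itv/= andbT.
Qed.

Let iNf : mu2.-integrable setT (EFin \o Nf).
Proof. by have [[_ _ i] _ _ _] := HH; exact: integrable_patch. Qed.

Let iEf : mu2.-integrable setT (EFin \o Ef).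
Proof.
have [_ [_ _ i1] [_ _ i2] _] := HH; apply: integrable_patch => //.
by have := integrableD mU i1 i2; apply.
Qed.

Let Nf0 y : 0 <= Nf y. Proof. by rewrite /Nf patchE; case: ifP. Qed.
Let Ef0 y : 0 <= Ef y. Proof. by rewrite /Ef patchE; case: ifP => // _; rewrite addr_ge0. Qed.

Let mNf : measurable_fun [set: plane] Nf.
Proof. by apply/measurable_EFinP; exact: (measurable_int mu2 iNf). Qed.
Let mEf : measurable_fun [set: plane] Ef.
Proof. by apply/measurable_EFinP; exact: (measurable_int mu2 iEf). Qed.

(** * The estimate at a fixed margin and outer radius *)

Section fixed_scale.
Variables (r0 M d : R).
Hypotheses (rR : R0 + 2 * d < r0) (rR1 : r0 <= R1) (rM : r0 < M) (d0 : 0 < d) (d1 : 2 * d < 1).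
Let V : set (R * R) := [set y | R0 < enorm y < M + 1].
Let A : set (R * R) := [set y | r0 <= enorm y <= M].
Let wL z := ((fun z => lam * (1 - enorm z / M)) \_ A) z.
(** The weight (2 b |x| + 1) / M of the cutoff error, evaluated at a point y within 2 d < 1 of x;
    hence |y| + 1. *)
Let K y := (2 * b * (enorm y + 1) + 1) / M.

Let mV : measurable (V : set plane).
Proof.
have := @measurable_enorm_itv R `]R0, (M + 1)[; congr measurable.
Qed.

Let mA : measurable (A : set plane).
Proof. exact: (@measurable_enorm_itv R `[r0, M]). Qed.

Let VU : V `<=` U. Proof. by move=> y /= /andP[]. Qed.
Let r00 : 0 < r0. Proof. by have := R00; have := rR; have := d0; lra. Qed.
Let M0 : 0 < M. Proof. exact: lt_trans r00 rM. Qed.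

Let V_lty : (mu2 V < +oo)%E.
Proof.
have M10 : 0 < M + 1 by have := M0; lra.
apply: (@le_lt_trans _ _ (mu2 [set z | enorm z <= M + 1])); last by rewrite measure_disk0// ltry.
apply: le_measure; rewrite ?inE//.
  rewrite (_ : [set z | enorm z <= M + 1] = [set z | enorm z \in `]-oo, (M + 1)]]).
    exact: measurable_enorm_itv.
  by apply/seteqP; split => z /=; rewrite in_itv.
by move=> z /= /andP[_ /ltW].
Qed.

Let i1 (w : R * R -> R[i]) : w = u \/ w = W.1 \/ w = W.2 ->
  [/\ mu2.-integrable setT (EFin \o ((Re \o w) \_ V)),
   mu2.-integrable setT (EFin \o ((Im \o w) \_ V)),
   mu2.-integrable setT (EFin \o (fun y => ((Re \o w) \_ V) y ^+ 2)) &
   mu2.-integrable setT (EFin \o (fun y => ((Im \o w) \_ V) y ^+ 2))].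
Proof.
have [h1 h2 h3 _] := HH.
by case=> [->|[->|->]]; exact: (L2_patch mU mV VU V_lty).
Qed.

Let NV y := ((Re \o u) \_ V) y ^+ 2 + ((Im \o u) \_ V) y ^+ 2.

Let NVE y : NV y = (Nf \_ V) y.
Proof.
rewrite /NV /Nf !patchE; case: ifPn => [|_]; last by rewrite expr0n/= addr0.
by rewrite inE => /VU Uy; rewrite mem_set.
Qed.

Let EVE y : energy_bound d b R0 M u W y =
  (1 + d) * (Ef \_ V) y + b ^+ 2 * ((d ^+ 2 + d) / 2) * (Nf \_ V) y.
Proof.
rewrite /energy_bound /shift_bound /Nf /Ef !patchE -/V; case: ifPn => [|_].
  by rewrite inE => /VU Uy; rewrite mem_set// /sqmod /=; field.
by rewrite expr0n/= !mulr0 !addr0.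
Qed.

Let iNV : mu2.-integrable setT (EFin \o NV).
Proof. by have [_ _ a c] := i1 (or_introl erefl); exact: integrable_add. Qed.

Let iEV : mu2.-integrable setT (EFin \o energy_bound d b R0 M u W).
Proof.
have [_ _ a c] := i1 (or_introl erefl).
have [_ _ a1 c1] := i1 (or_intror (or_introl erefl)).
have [_ _ a2 c2] := i1 (or_intror (or_intror erefl)).
rewrite /energy_bound /shift_bound.
by do !(apply: integrable_add); exact: integrable_scale.
Qed.

Let NV0 y : 0 <= NV y. Proof. by rewrite addr_ge0// sqr_ge0. Qed.
Let EV0 y : 0 <= energy_bound d b R0 M u W y.
Proof.
rewrite EVE; apply: addr_ge0; apply: mulr_ge0; rewrite ?patchE; try (by case: ifP).
  by have := d0; lra.
by rewrite mulr_ge0 ?sqr_ge0// divr_ge0// addr_ge0 ?sqr_ge0// ltW.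
Qed.

Let me : measurable_fun [set: plane] (@enorm R).
Proof. exact: measurable_enorm. Qed.

Let K0 y : 0 <= K y.
Proof.
have h := enorm_ge0 y; apply: divr_ge0; last exact: (ltW M0).
apply: addr_ge0 => //; apply: mulr_ge0; last by rewrite addr_ge0.
by rewrite mulr_ge0// ltW.
Qed.

Let mK : measurable_fun [set: plane] K.
Proof.
apply: measurable_funM => //; apply: measurable_funD => //; apply: measurable_funM => //.
exact: measurable_funD.
Qed.

Let w1 z : A z -> 0 <= 1 - enorm z / M.
Proof. by move=> /andP[_ h]; rewrite subr_ge0 ler_pdivrMr// mul1r. Qed.

Let m1 : measurable_fun [set: plane] (fun z => 1 - enorm z / M).
Proof. by apply: measurable_funB => //; apply: measurable_funM. Qed.

(** Replacing r0 by the larger R1 only lowers the constant, and makes it independent of the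
    scale. *)
Let lam_r0 : lam <= b - b ^+ 2 * r0 ^+ 2 * (1 + eps).
Proof.
have e0 : 0 <= eps.
  apply: le_trans ceps; rewrite !mulr_ge0 ?sqrtr_ge0//.
  exact: ltW (lt_trans R00 R01).
rewrite /lam lerD2l lerN2; apply: ler_wpM2r; first by lra.
apply: ler_wpM2l; first exact: sqr_ge0.
by apply: lerXn2r; rewrite ?nnegrE ?(ltW r00)// (le_trans (ltW r00)).
Qed.

(** The mass stays mollified on the left. On the right the mollified densities are bounded by
    mollifications, whose kernels are then integrated out against the weights, giving a bound
    independent of the mollifiers. *)
Let conv_bound p p' q q' :
  smooth_fun p -> smooth_fun p' -> smooth_fun q -> smooth_fun q' ->
  (forall t : R, is_derive t 1 p (p' t)) -> (forall t : R, is_derive t 1 q (q' t)) ->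
  (forall t, d <= `|t| -> p t = 0) -> (forall t, d <= `|t| -> q t = 0) ->
  (forall t, 0 <= p t) -> (forall t, 0 <= q t) ->
  (\int[mu]_t (p t)%:E = 1)%E -> (\int[mu]_t (q t)%:E = 1)%E ->
  (\int[mu2]_z (wL z * (conv p q ((Re \o u) \_ V) z ^+ 2 + conv p q ((Im \o u) \_ V) z ^+ 2))%:E <=
   \int[mu2]_y ((1 + K y) * energy_bound d b R0 M u W y)%:E + \int[mu2]_y (K y * NV y)%:E)%E.
Proof.
move=> sp sp' sq sq' dp dq psupp qsupp p0 q0 pint qint.
have [ur ui ur2 ui2] := i1 (or_introl erefl).
set f := _ \_ V in ur ur2 *; set g := (Im \o u) \_ V in ui ui2 *.
have cE z : wL z * (conv p q f z ^+ 2 + conv p q g z ^+ 2) =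
    ((fun z => lam * ((1 - enorm z / M) * conv_mass p q f g z)) \_ A) z.
  rewrite /wL !patchE; case: ifP => _; last by rewrite mul0r.
  by rewrite mulrA.
have mm0 z : 0 <= conv_mass p q f g z by rewrite addr_ge0// sqr_ge0.
have me0 z : 0 <= conv_energy b p p' q q' f g z by rewrite !addr_ge0// sqr_ge0.
have mc (a a' : R -> R) h : smooth_fun a -> smooth_fun a' -> mu2.-integrable setT (EFin \o h) ->
  measurable_fun [set: plane] (conv a a' h) by exact: measurable_conv.
have mM : measurable_fun [set: plane] (conv_mass p q f g).
  by apply: measurable_funD; apply: measurable_funX; exact: mc.
have mv1 : measurable_fun [set: plane] (fun z => b * (vpot z).1).
  apply: measurable_funM => //; rewrite /vpot/=; apply: measurable_funM => //.
  by apply: measurableT_comp => //; exact: measurable_snd.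
have mv2 : measurable_fun [set: plane] (fun z => b * (vpot z).2).
  by apply: measurable_funM => //; rewrite /vpot/=; apply: measurable_funM.
have mE : measurable_fun [set: plane] (conv_energy b p p' q q' f g).
  rewrite /conv_energy; do !apply: measurable_funD; apply: measurable_funX;
    (apply: measurable_funB || apply: measurable_funD); try exact: mc;
    by apply: measurable_funM => //; exact: mc.
pose w2 z := (2 * b * enorm z + 1) / M.
have mw2 : measurable_fun [set: plane] w2.
  by apply: measurable_funM => //; apply: measurable_funD => //; apply: measurable_funM.
have w20 z : 0 <= w2 z.
  have h := enorm_ge0 z; apply: divr_ge0; last exact: (ltW M0).
  by apply: addr_ge0 => //; apply: mulr_ge0 => //; rewrite mulr_ge0// ltW.
have iA (h : R * R -> R) : mu2.-integrable setT (EFin \o h) ->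
    measurable_fun [set: plane] (conv p q h) by exact: mc.
apply: (@le_trans _ _ (\int[mu2]_(z in A) ((b - b ^+ 2 * r0 ^+ 2 * (1 + eps)) *
      ((1 - enorm z / M) * conv_mass p q f g z))%:E)%E).
  rewrite [leRHS]integral_mkcond; apply: ge0_le_integral => //.
  - move=> z _; rewrite cE lee_fin patchE; case: ifPn => // /[!inE] /w1 h.
    by rewrite mulr_ge0// mulr_ge0.
  - apply/measurable_EFinP; under eq_fun do rewrite cE.
    apply/(measurable_restrictT _ mA); apply: measurable_funTS.
    by apply: measurable_funM => //; exact: measurable_funM.
  - apply/(measurable_restrictT _ mA); apply: measurable_funTS; apply/measurable_EFinP.
    by apply: measurable_funM => //; exact: measurable_funM.
  move=> z _; rewrite cE !patchE; case: ifPn => // /[!inE] /w1 h; rewrite lee_fin.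
  by apply: ler_wpM2r; [exact: mulr_ge0|exact: lam_r0].
apply: (@le_trans _ _ (\int[mu2]_(z in A) ((1 - enorm z / M) * conv_energy b p p' q q' f g z +
     (2 * b * enorm z + 1) / M * (conv_mass p q f g z + conv_energy b p p' q q' f g z))%:E)%E).
  have cc : Num.sqrt b * r0 <= Num.sqrt b * R1 by rewrite ler_wpM2l ?sqrtr_ge0.
  apply: (conv_annulus (c := Num.sqrt b * r0)) => //.
  - by rewrite exprMn sqr_sqrtr// ltW.
  - by rewrite mulr_gt0// sqrtr_gt0.
  - exact: le_trans cc c20.
  - by apply: le_trans ceps; rewrite !ler_pM2r.
  - exact: le_trans lam0 lam_r0.
apply: (@le_trans _ _ (\int[mu2]_(z in A) (((1 - enorm z / M + w2 z) *
     conv p q (energy_bound d b R0 M u W) z)%:E + (w2 z * conv p q NV z)%:E))%E).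
  apply: ge0_le_integral => //.
  - move=> z /w1 h; rewrite lee_fin; apply: addr_ge0; first exact: mulr_ge0.
    by apply: mulr_ge0; [exact: w20|exact: addr_ge0].
  - apply/measurable_EFinP; apply: measurable_funTS.
    by apply: measurable_funD; apply: measurable_funM => //; exact: measurable_funD.
  - apply: measurable_funTS; apply: emeasurable_funD; apply/measurable_EFinP; apply: measurable_funM => //.
    + exact: measurable_funD.
    + exact: iA.
    + exact: iA.
  move=> z Az; rewrite -EFinD lee_fin -/(w2 z).
  have h1 : conv_energy b p p' q q' f g z <= conv p q (energy_bound d b R0 M u W) z.
    have [_ _ _ mg] := HH; have /andP[z1 z2] := Az.
    by apply: conv_energy_le => //; exact: lt_le_trans z1.
  have h2 : conv_mass p q f g z <= conv p q NV z.
    by rewrite /NV convD//; apply: lerD; apply: conv_sqr_le.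
  have h := w1 Az.
  rewrite (_ : _ + _ = (1 - enorm z / M + w2 z) * conv_energy b p p' q q' f g z +
    w2 z * conv_mass p q f g z); last by ring.
  apply: lerD.
    by apply: ler_wpM2l => //; rewrite addr_ge0.
  exact: ler_wpM2l.
have c1 z : 0 <= conv p q (energy_bound d b R0 M u W) z by exact: conv_ge0.
have c2 z : 0 <= conv p q NV z by exact: conv_ge0.
rewrite ge0_integralD//; last 4 first.
- by move=> z /w1 h; rewrite lee_fin mulr_ge0// addr_ge0.
- apply: measurable_funTS; apply/measurable_EFinP; apply: measurable_funM; last exact: iA.
  exact: measurable_funD.
- by move=> z _; rewrite lee_fin mulr_ge0.
- by apply: measurable_funTS; apply/measurable_EFinP; apply: measurable_funM => //; exact: iA.
have w2K x y : `|x.1 - y.1| < d -> `|x.2 - y.2| < d -> w2 x <= K y.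
  move=> h1 h2; rewrite /w2 /K; apply: ler_wpM2r; first by rewrite invr_ge0 (ltW M0).
  rewrite lerD2r; apply: ler_wpM2l; first by rewrite mulr_ge0// ltW.
  by have := enorm_le_add x y; have := d1; lra.
apply: leeD.
  apply: (@weighted_conv_le _ _ _ sp sq p0 q0 pint qint d) => //.
  - exact: measurable_funD.
  - by move=> z /w1 h; rewrite addr_ge0.
  - by move=> z; rewrite addr_ge0.
  - exact: measurable_funD.
  move=> x y Ax h1 h2 _; apply: lerD; last exact: w2K.
  by rewrite lerBlDr lerDl divr_ge0 ?enorm_ge0// ltW.
apply: (@weighted_conv_le _ _ _ sp sq p0 q0 pint qint d) => //.
by move=> x y Ax h1 h2 _; exact: w2K.
Qed.

(** Only the width of the mollifiers tends to zero; d is kept as the margin around the annulus and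
    survives in the right side. *)
Lemma fixed_scale_bound :
  (\int[mu2]_z (((fun z => lam * (1 - enorm z / M) * Nf z) \_ A) z)%:E <=
   \int[mu2]_y (((fun y => (1 + K y) * ((1 + d) * Ef y + b ^+ 2 * ((d ^+ 2 + d) / 2) * Nf y) +
     K y * Nf y) \_ V) y)%:E)%E.
Proof.
have [C hC] := @mollifier_ex R.
(* Every width d / (n + 1) is at most d, so all these mollifiers obey the bound with margin d. *)
have dn0 n : 0 < d / n.+1%:R by rewrite divr_gt0.
have /choice[p hp] : forall n, exists p : R -> R,
    [/\ smooth_fun p, forall t, 0 <= p t, forall t, d / n.+1%:R <= `|t| -> p t = 0,
    forall t, p t <= C / (d / n.+1%:R) & (\int[mu]_t (p t)%:E = 1)%E].
  by move=> n; exact: hC.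
have [ur ui ur2 ui2] := i1 (or_introl erefl).
have wL0 z : 0 <= wL z.
  by rewrite /wL patchE; case: ifPn => // /[!inE] /w1 h; rewrite mulr_ge0.
have mwL : measurable_fun [set: plane] wL.
  by apply/(measurable_restrictT _ mA); apply: measurable_funTS; exact: measurable_funM.
have dcvg : (fun n : nat => d / n.+1%:R) @ \oo --> (0 : R).
  rewrite -(mulr0 d); apply: cvgM; [exact: cvg_cst|exact: cvg_harmonic].
have fat := conv_fatou (fun n => let: And5 h _ _ _ _ := hp n in h)
  (fun n => let: And5 _ h _ _ _ := hp n in h) (fun n => let: And5 _ _ h _ _ := hp n in h)
  (fun n => let: And5 _ _ _ h _ := hp n in h) (fun n => let: And5 _ _ _ _ h := hp n in h)
  dn0 dcvg ur ui mwL wL0.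
have suppd n t : d <= `|t| -> p n t = 0.
  have [_ _ h _ _] := hp n; move=> dt; apply: h; apply: le_trans dt.
  by rewrite ler_pdivrMr// ler_peMr ?(ltW d0)// ler1n.
have RE : (\int[mu2]_y ((1 + K y) * energy_bound d b R0 M u W y)%:E +
   \int[mu2]_y (K y * NV y)%:E = \int[mu2]_y (((fun y => (1 + K y) * ((1 + d) * Ef y +
   b ^+ 2 * ((d ^+ 2 + d) / 2) * Nf y) + K y * Nf y) \_ V) y)%:E)%E.
  have mN : measurable_fun [set: plane] NV.
    by apply/measurable_EFinP; exact: (measurable_int mu2 iNV).
  have mE : measurable_fun [set: plane] (energy_bound d b R0 M u W).
    by apply/measurable_EFinP; exact: (measurable_int mu2 iEV).
  rewrite -ge0_integralD//.
  - apply: eq_integral => y _; rewrite -EFinD NVE EVE !patchE; congr EFin.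
    by case: ifP => // _; rewrite !mulr0 !addr0 !mulr0.
  - by move=> y _; rewrite lee_fin mulr_ge0// addr_ge0.
  - by apply/measurable_EFinP; apply: measurable_funM => //; exact: measurable_funD.
  - by move=> y _; rewrite lee_fin mulr_ge0.
  - by apply/measurable_EFinP; exact: measurable_funM.
have LE : (\int[mu2]_z (wL z * (((Re \o u) \_ V) z ^+ 2 + ((Im \o u) \_ V) z ^+ 2))%:E =
   \int[mu2]_z (((fun z => lam * (1 - enorm z / M) * Nf z) \_ A) z)%:E)%E.
  apply: eq_integral => z _; rewrite -/(NV z) NVE /wL !patchE; congr EFin.
  case: ifPn => [|_]; last by rewrite mul0r.
  rewrite inE => /andP[z1 z2]; rewrite mem_set//; apply/andP; split; last lra.
  by apply: lt_le_trans z1; have := d0; have := rR; lra.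
rewrite -LE -RE; apply: fat => n k.
have [h1 h2 h3 h4 h5] := hp n; have [k1 k2 k3 k4 k5] := hp k.
have [p' [sp' dp']] := smooth_fun_derive h1; have [q' [sq' dq']] := smooth_fun_derive k1.
exact: (conv_bound h1 sp' k1 sq' dp' dq' (suppd n) (suppd k) h2 k2 h5 k5).
Qed.

End fixed_scale.

(** A single parameter h = 1 / (n + 1) drives the limit: M = S / h, r0 = R0 + (R1 - R0) h, d = eta
    h. The value of [S] ensures r0 < M, and the two bounds on [eta] ensure R0 + 2 d < r0 and 2 d <
    1. *)
Let hh (n : nat) : R := n.+1%:R^-1.
Let S : R := R1 + 1.
Let eta : R := Num.min ((R1 - R0) / 4) (1 / 4).
Let Mn n := S / hh n.
Let rn n := R0 + (R1 - R0) * hh n.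
Let dn n := eta * hh n.

Let hh0 n : 0 < hh n. Proof. by rewrite invr_gt0. Qed.
Let hh1 n : hh n <= 1. Proof. by rewrite invf_le1// ler1n. Qed.
Let S1 : 1 <= S. Proof. by have := R00; have := R01; rewrite /S; lra. Qed.
Let eta0 : 0 < eta. Proof. by rewrite lt_min; apply/andP; split; have := R01; lra. Qed.
Let eta1 : eta <= (R1 - R0) / 4. Proof. by rewrite ge_min lexx. Qed.
Let eta2 : eta <= 1 / 4. Proof. by rewrite ge_min lexx orbT. Qed.

Let dn0 n : 0 < dn n. Proof. exact: mulr_gt0. Qed.
Let dn1 n : 2 * dn n < 1.
Proof.
have := ler_pM (ltW eta0) (ltW (hh0 n)) eta2 (hh1 n); rewrite mulr1 /dn; lra.
Qed.
Let rRn n : R0 + 2 * dn n < rn n.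
Proof.
rewrite /rn /dn ltrD2l mulrA; rewrite ltr_pM2r//; have := eta1; have := R01; lra.
Qed.
Let rR1n n : rn n <= R1.
Proof.
have : (R1 - R0) * hh n <= (R1 - R0) * 1 by rewrite ler_wpM2l// subr_ge0 ltW.
by rewrite /rn; lra.
Qed.
Let rMn n : rn n < Mn n.
Proof.
apply: (le_lt_trans (rR1n n)); rewrite /Mn ltr_pdivlMr//.
have R1p := lt_trans R00 R01.
by have : R1 * hh n <= R1 * 1; [rewrite ler_wpM2l// ltW|rewrite /S; lra].
Qed.

Let hcvg : hh @ \oo --> (0 : R). Proof. exact: cvg_harmonic. Qed.

Let comp_cvg (P : R -> R) : continuous P -> P (hh n) @[n --> \oo] --> P 0.
Proof. by move=> cP; apply: (cvg_comp _ _ hcvg); exact: cP. Qed.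

Let G n y := (((fun y => (1 + (2 * b * (enorm y + 1) + 1) / Mn n) * ((1 + dn n) * Ef y +
  b ^+ 2 * ((dn n ^+ 2 + dn n) / 2) * Nf y) + (2 * b * (enorm y + 1) + 1) / Mn n * Nf y) \_
  [set y | R0 < enorm y < Mn n + 1]) y).
Let F n z := (((fun z => lam * (1 - enorm z / Mn n) * Nf z) \_
  [set y | rn n <= enorm y <= Mn n]) z).

Let Mlarge (B : R) : \forall n \near \oo, B < Mn n.
Proof.
have : S^-1 * `|B| * hh n @[n --> \oo] --> S^-1 * `|B| * 0.
  by apply: cvgM; [exact: cvg_cst|exact: hcvg].
rewrite mulr0 => /cvgrPdist_lt/(_ _ ltr01); apply: filterS => n.
have Sp : 0 < S by exact: lt_le_trans S1.
rewrite sub0r normrN ger0_norm; last by rewrite !mulr_ge0// invr_ge0 ltW.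
move=> h; apply: (le_lt_trans (ler_norm B)); rewrite /Mn ltr_pdivlMr//.
by move: h; rewrite -mulrA mulrC ltr_pdivrMr// mul1r.
Qed.

(** For large n the point y lies in the truncated set, and there [G n y] is a polynomial in h with
    value [Ef y] at 0. *)
Let G_cvg y : G n y @[n --> \oo] --> Ef y.
Proof.
have Sn : S != 0 by rewrite gt_eqF// (lt_le_trans ltr01).
case: (pselect (U y)) => Uy; last first.
  have -> : (fun n => G n y) = cst 0.
    apply/funext => n; rewrite /G patchE ifF//; apply/negbTE; rewrite notin_setE /=.
    by move=> /andP[].
  by rewrite /Ef patchE memNset//; exact: cvg_cst.
pose k := (2 * b * (enorm y + 1) + 1) / S.
pose P (t : R) := (1 + k * t) * ((1 + eta * t) * Ef y +
  b ^+ 2 * ((eta ^+ 2 * t ^+ 2 + eta * t) / 2) * Nf y) + k * t * Nf y.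
have cid : continuous (fun t : R => t) by move=> t; exact: cvg_id.
have cP : continuous P by rewrite /P; ctn.
have := comp_cvg cP; rewrite (_ : P 0 = Ef y); last by rewrite /P expr0n/=; field.
apply: cvg_trans; apply: near_eq_cvg; near=> n.
have yM : enorm y < Mn n by near: n; exact: Mlarge.
rewrite /G patchE mem_set; last by apply/andP; split => //; lra.
have hn : hh n != 0 by rewrite gt_eqF.
by rewrite /P /k /Mn /dn; field; rewrite hn Sn.
Unshelve. all: by end_near. Qed.

Let F_cvg y : F n y @[n --> \oo] --> lam * Nf y.
Proof.
have Sn : S != 0 by rewrite gt_eqF// (lt_le_trans ltr01).
case: (pselect (U y)) => Uy; last first.
  have -> : (fun n => F n y) = cst 0.
    by apply/funext => n; rewrite /F patchE /Nf patchE (memNset Uy) mulr0 if_same.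
  by rewrite /Nf patchE memNset// mulr0; exact: cvg_cst.
pose P (t : R) := lam * (1 - enorm y / S * t) * Nf y.
have cid : continuous (fun t : R => t) by move=> t; exact: cvg_id.
have cP : continuous P by rewrite /P; ctn.
have := comp_cvg cP; rewrite (_ : P 0 = lam * Nf y); last by rewrite /P mulr0 subr0 mulr1.
apply: cvg_trans; apply: near_eq_cvg; near=> n.
have yM : enorm y < Mn n by near: n; exact: Mlarge.
have yr : rn n < enorm y.
  near: n; have cr : rn n @[n --> \oo] --> R0 + (R1 - R0) * 0.
    apply: (comp_cvg (P := fun t => R0 + (R1 - R0) * t)); ctn.
  rewrite mulr0 addr0 in cr; exact: (cvgr_lt _ cr).
rewrite /F patchE mem_set; last by apply/andP; split; exact: ltW.
have hn : hh n != 0 by rewrite gt_eqF.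
by rewrite /P /Mn; field; rewrite hn Sn.
Unshelve. all: by end_near. Qed.

Let mG n : measurable_fun [set: plane] (G n).
Proof.
have me : measurable_fun [set: plane] (@enorm R) by exact: measurable_enorm.
have mV : measurable ([set y | R0 < enorm y < Mn n + 1] : set plane).
  exact: (@measurable_enorm_itv R `]R0, (Mn n + 1)[).
apply/(measurable_restrictT _ mV); apply: measurable_funTS.
have mk : measurable_fun [set: plane] (fun y => (2 * b * (enorm y + 1) + 1) / Mn n).
  apply: measurable_funM => //; apply: measurable_funD => //; apply: measurable_funM => //.
  exact: measurable_funD.
apply: measurable_funD; apply: measurable_funM => //; first exact: measurable_funD.
by apply: measurable_funD; exact: measurable_funM.
Qed.

Let mF n : measurable_fun [set: plane] (F n).
Proof.
have me : measurable_fun [set: plane] (@enorm R) by exact: measurable_enorm.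
have mA : measurable ([set y | rn n <= enorm y <= Mn n] : set plane).
  exact: (@measurable_enorm_itv R `[(rn n), (Mn n)]).
apply/(measurable_restrictT _ mA); apply: measurable_funTS.
apply: measurable_funM => //; apply: measurable_funM => //.
by apply: measurable_funB => //; apply: measurable_funM.
Qed.

Let F0 n y : 0 <= F n y.
Proof.
rewrite /F patchE; case: ifPn => // /[!inE] /andP[_ h]; rewrite !mulr_ge0// subr_ge0.
by rewrite ler_pdivrMr ?mul1r//; apply: lt_trans (rMn n); have := rRn n; have := dn0 n; have := R00; lra.
Qed.

(** Bounds the cutoff weight on |y| < M + 1: with h <= 1 one has (|y| + 1) h <= (M + 2) h <= S +
    2. *)
Let C0 : R := (2 * b * (S + 2) + 1) / S.
Let D y := (1 + C0) * (2 * Ef y + b ^+ 2 * Nf y) + C0 * Nf y.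

Let G_le n y : `|G n y| <= D y.
Proof.
have Sp : 0 < S by exact: lt_le_trans S1.
have C00 : 0 <= C0.
  rewrite /C0 divr_ge0 ?(ltW Sp)// addr_ge0// mulr_ge0//; first by rewrite mulr_ge0// ltW.
  by rewrite addr_ge0// ltW.
have N0 := Nf0 y; have E0 := Ef0 y.
have b20 := sqr_ge0 b.
rewrite /G patchE; case: ifPn => [|_]; last first.
  by rewrite normr0 /D; nng; rewrite addr_ge0.
rewrite inE => /andP[_ yM].
have hp := hh0 n; have h1 := hh1 n; have e0 := enorm_ge0 y.
set X := (2 * b * (enorm y + 1) + 1) / Mn n.
have X0 : 0 <= X.
  rewrite /X divr_ge0//; first by rewrite addr_ge0// mulr_ge0 ?addr_ge0// mulr_ge0// ltW.
  by rewrite /Mn divr_ge0// ltW.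
have XC : X <= C0.
  have eh : (enorm y + 1) * hh n <= S + 2.
    have : (enorm y + 1) * hh n <= (Mn n + 2) * hh n by apply: ler_wpM2r; [exact: ltW|lra].
    rewrite (_ : (Mn n + 2) * hh n = S + 2 * hh n); first lra.
    by rewrite /Mn; field; rewrite gt_eqF.
  rewrite (_ : X = (2 * b * ((enorm y + 1) * hh n) + hh n) / S); last first.
    by rewrite /X /Mn; field; rewrite !gt_eqF.
  rewrite /C0; apply: ler_wpM2r; first by rewrite invr_ge0 ltW.
  by apply: lerD => //; apply: ler_wpM2l => //; rewrite mulr_ge0// ltW.
have d0 := ltW (dn0 n); have d1 := dn1 n.
have Y0 : 0 <= 1 + dn n by lra.
have Z0 : 0 <= b ^+ 2 * ((dn n ^+ 2 + dn n) / 2).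
  by rewrite mulr_ge0// divr_ge0// addr_ge0// sqr_ge0.
have Z1 : b ^+ 2 * ((dn n ^+ 2 + dn n) / 2) <= b ^+ 2.
  rewrite ler_piMr//; have : dn n ^+ 2 <= 1 by rewrite expr_le1//; lra.
  lra.
have L0 : 0 <= (1 + dn n) * Ef y + b ^+ 2 * ((dn n ^+ 2 + dn n) / 2) * Nf y.
  by rewrite addr_ge0// mulr_ge0.
rewrite ger0_norm; last by apply: addr_ge0; apply: mulr_ge0 => //; rewrite addr_ge0.
apply: lerD; last exact: ler_wpM2r.
apply: ler_pM => //; [by rewrite addr_ge0|by lra|].
by apply: lerD; apply: ler_wpM2r => //; lra.
Qed.

Let iD : mu2.-integrable setT (EFin \o D).
Proof. by do !(apply: integrable_add || apply: integrable_scale). Qed.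

(** In the limit of the fixed-scale estimates, Fatou handles the mass, and domination by [D] handles
    the energy. The strict inequality R0 < R1 leaves room for the margins. *)
Lemma magnetic_lower_bound :
  lam * L2normsq U u <= L2normsq U W.1 + L2normsq U W.2.
Proof.
have LF : (\int[mu2]_y (lam * Nf y)%:E <= \int[mu2]_y (Ef y)%:E)%E.
  apply: (@le_trans _ _ (limn_einf (fun n => \int[mu2]_y (F n y)%:E))%E).
    rewrite (_ : (\int[mu2]_y (lam * Nf y)%:E = \int[mu2]_y limn_einf (fun n => (F n y)%:E))%E).
      apply: fatou => //; first by move=> n; apply/measurable_EFinP; exact: mF.
      by move=> n y _; rewrite lee_fin.
    apply: eq_integral => y _.
    have cE : (fun n => (F n y)%:E) @ \oo --> (lam * Nf y)%:E.
      by apply: cvg_EFin; [exact: nearW|exact: F_cvg].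
    by rewrite (cvg_limn_einf_sup cE).1.
  apply: (@le_trans _ _ (limn_einf (fun n => \int[mu2]_y (G n y)%:E))%E).
    apply: le_limn_einf => n.
    exact: (fixed_scale_bound (rRn n) (rR1n n) (rMn n) (dn0 n) (dn1 n)).
  have [|||||_ _ cv] := @dominated_convergence _ plane R mu2 setT measurableT
      (fun n y => (G n y)%:E) (EFin \o Ef) (EFin \o D).
  - by move=> n; apply/measurable_EFinP; exact: mG.
  - exact/measurable_EFinP.
  - apply: aeW => y _; apply: cvg_EFin; [exact: nearW|exact: G_cvg].
  - exact: iD.
  - by apply: aeW => y n _; rewrite abse_EFin lee_fin; exact: G_le.
  by rewrite (cvg_limn_einf_sup cv).1.
have [h1 h2 h3 _] := HH.
have e1 : L2normsq U u = \int[mu2]_y Nf y.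
  by rewrite /L2normsq Rintegral_mkcond.
have e2 : L2normsq U W.1 + L2normsq U W.2 = \int[mu2]_y Ef y.
  have [_ _ i2] := h2; have [_ _ i3] := h3.
  by rewrite /L2normsq -RintegralD// Rintegral_mkcond.
rewrite e1 e2 -RintegralZl// -lee_fin -!ge0_integral_Rintegral//.
exact: integrable_scale.
Qed.

End lower_bound.

(** * Measurability and integration by parts in the plane *)

Section plane_topology.
Context {R : realType}.
Local Notation mu := (@lebesgue_measure R).
Local Notation mu2 := (@lebesgue_measure R \x @lebesgue_measure R)%E.
Local Notation plane := (measurableTypeR R * measurableTypeR R)%type.

(** The product structure is generated by rectangles, so an open set is written as a countable union
    of squares with rational centres and half-sides 1 / (i + 1). *)
Lemma open_plane_measurable (A : set (R * R)) : open A -> measurable (A : set plane).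
Proof.
move=> oA; pose h (i : nat) : R := i.+1%:R^-1.
pose B i (q : rat) : set R := `](ratr q - h i), (ratr q + h i)[%classic.
pose F i q q' : set plane := if pselect (B i q `*` B i q' `<=` A) then B i q `*` B i q' else set0.
have -> : (A : set plane) = \bigcup_i \bigcup_q \bigcup_q' F i q q'.
  apply/seteqP; split => [x Ax|x]; last first.
    by move=> [i _] [q _] [q' _]; rewrite /F; case: pselect => // h1; exact: h1.
  have /nbhs_ballP[e /= e0 he] : nbhs x A by exact: open_nbhs_nbhs.
  have [i hi] : exists i, 2 * h i < e.
    have e2 : 0 < e / 2 by rewrite divr_gt0.
    have [i _ /(_ i (leqnn i)) /= hi] := near_infty_natSinv_lt (PosNum e2).
    by exists i; have : h i < e / 2 by []; lra.
  have hp : 0 < h i by rewrite invr_gt0.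
  have rat_near (s : R) : exists q : rat, `|ratr q - s| < h i.
    have [|q] := @rat_in_itvoo R (s - h i) (s + h i); first by lra.
    by rewrite in_itv/= => /andP[h1 h2]; exists q; rewrite ltr_norml; apply/andP; split; lra.
  have [q hq] := rat_near x.1; have [q' hq'] := rat_near x.2.
  exists i => //; exists q => //; exists q' => //; rewrite /F; case: pselect => [hB|[]] /=.
    move: hq hq'; rewrite !ltr_norml => /andP[h1 h2] /andP[h3 h4].
    by split; rewrite /B/= in_itv/=; apply/andP; split; lra.
  move=> y [/=]; rewrite /B/= !in_itv/= => /andP[y1 y2] /andP[y3 y4]; apply: he.
  move: hq hq'; rewrite !ltr_norml => /andP[h1 h2] /andP[h3 h4].
  by split; rewrite /ball/= ltr_norml; apply/andP; split; lra.
apply: bigcupT_measurable => i; apply: bigcupT_measurable_rat => q.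
apply: bigcupT_measurable_rat => q'; rewrite /F; case: pselect => hB; last exact: measurable0.
by apply: measurableX; exact: measurable_itv.
Qed.

Lemma closed_plane_measurable (A : set (R * R)) : closed A -> measurable (A : set plane).
Proof.
move=> cA; rewrite -(setCK A); apply: measurableC; apply: open_plane_measurable.
exact: closed_openC.
Qed.

Lemma continuous_plane_measurable (f : R * R -> R) : continuous f ->
  measurable_fun [set: plane] f.
Proof.
move=> cf; apply: (measurability _ (RGenOInfty.measurableE R)) => //.
move=> _ [_ [x ->] <-]; rewrite setTI; apply: open_plane_measurable.
by apply: open_comp; [move=> y _; exact: cf|exact: interval_open].
Qed.

Lemma is_derive_partial1 (phi : R * R -> R) (x1 x2 : R) :
  derivable phi (x1, x2) (1, 0) ->
  is_derive x1 1 (fun t => phi (t, x2)) ('D_(1, 0) phi (x1, x2)).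
Proof.
have E : (fun h : R => h^-1 *: (((fun t => phi (t, x2)) \o shift x1) (h *: 1) - phi (x1, x2))) =
  (fun h : R => h^-1 *: ((phi \o shift (x1, x2)) (h *: (1, 0)) - phi (x1, x2))).
  apply/funext => h /=; congr (_ *: (phi _ - _)).
  by rewrite [RHS]surjective_pairing/= scaler0 add0r.
by move=> d; split; rewrite /derivable /derive E.
Qed.

Lemma is_derive_partial2 (phi : R * R -> R) (x1 x2 : R) :
  derivable phi (x1, x2) (0, 1) ->
  is_derive x2 1 (fun t => phi (x1, t)) ('D_(0, 1) phi (x1, x2)).
Proof.
have E : (fun h : R => h^-1 *: (((fun t => phi (x1, t)) \o shift x2) (h *: 1) - phi (x1, x2))) =
  (fun h : R => h^-1 *: ((phi \o shift (x1, x2)) (h *: (0, 1)) - phi (x1, x2))).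
  apply/funext => h /=; congr (_ *: (phi _ - _)).
  by rewrite [RHS]surjective_pairing/= scaler0 add0r.
by move=> d; split; rewrite /derivable /derive E.
Qed.

Lemma continuous_support_integrable (k : R * R -> R) (N : R) : continuous k ->
  (forall y, (N <= `|y.1|) || (N <= `|y.2|) -> k y = 0) ->
  mu2.-integrable setT (EFin \o k).
Proof.
move=> ck k0; pose B : set (R * R) := `[- N, N]%classic `*` `[- N, N]%classic.
have cB : compact B by apply: compact_setX; exact: segment_compact.
have mk := continuous_plane_measurable ck.
have [C [_ hC]] : bounded_set (k @` B).
  by apply: compact_bounded; apply: continuous_compact => //; exact: continuous_subspaceT.
have bk : bounded_measurable (- N) N (- N) N k.
  split => //; exists (C + 1) => z Bz; apply: (hC (C + 1)); first by rewrite ltrDl.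
  by exists z.
have := integrable_patch (@measurable_rect R (- N) N (- N) N) (bdm_integrable bk).
apply: eq_integrable => // y _ /=; rewrite patchE; case: ifPn => //; rewrite notin_setE => nB.
congr EFin; apply/esym/k0/negP => /negP; rewrite negb_or -!ltNge => /andP[h1 h2].
by apply: nB; split; rewrite /= in_itv/= -ler_norml ltW.
Qed.

Lemma pairl_continuous (x2 : R) : continuous (fun t : R => (t, x2) : R * R).
Proof.
move=> t A [[B C] /= [nB nC] BC]; apply: filterS nB => s Bs /=; apply: BC.
by split => //=; exact: nbhs_singleton.
Qed.

Lemma pairr_continuous (x1 : R) : continuous (fun t : R => (x1, t) : R * R).
Proof.
move=> t A [[B C] /= [nB nC] BC]; apply: filterS nC => s Cs /=; apply: BC.
by split => //=; exact: nbhs_singleton.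
Qed.

Let line_integral (f f' : R -> R) (N : R) : 0 <= N -> continuous f' ->
  (forall t : R, is_derive t 1 f (f' t)) -> (forall t, N <= `|t| -> f t = 0 /\ f' t = 0) ->
  (\int[mu]_t (f' t)%:E = 0)%E.
Proof.
move=> N0 cf' df z.
have -> : (\int[mu]_t (f' t)%:E = \int[mu]_(t in `[(- N)%R, N]) (f' t)%:E)%E.
  rewrite [RHS]integral_mkcond; apply: eq_integral => t _; rewrite patchE.
  case: ifPn => //; rewrite notin_setE/= in_itv/= -ler_norml => /negP; rewrite -ltNge => h.
  by rewrite (z t (ltW h)).2.
have NN : - N <= N by lra.
rewrite (continuous_FTCE NN (fun x _ => df x) (fun x _ => cf' x)).
have [-> _] := z N (ler_norm _); have [|-> _] := z (- N); last by rewrite subrr.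
by rewrite normrN ler_norm.
Qed.

Lemma integral_derive1 (F F1 : R * R -> R) (N : R) : 0 <= N -> continuous F1 ->
  (forall x1 x2 : R, is_derive x1 1 (fun t => F (t, x2)) (F1 (x1, x2))) ->
  (forall y, (N <= `|y.1|) || (N <= `|y.2|) -> F y = 0 /\ F1 y = 0) ->
  \int[mu2]_y F1 y = 0.
Proof.
move=> N0 cF1 dF z.
have iF := continuous_support_integrable cF1 (fun y h => (z y h).2).
rewrite /Rintegral -(integral21_prod_meas1 iF) integral0_eq// => x2 _.
apply: (line_integral (f := fun t => F (t, x2)) (f' := fun t => F1 (t, x2)) N0) => //.
  move=> t; apply: (continuous_comp (f := fun t => (t, x2))); last exact: cF1.
  exact: pairl_continuous.
by move=> t h; apply: z; rewrite h.
Qed.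

Lemma integral_derive2 (F F1 : R * R -> R) (N : R) : 0 <= N -> continuous F1 ->
  (forall x1 x2 : R, is_derive x2 1 (fun t => F (x1, t)) (F1 (x1, x2))) ->
  (forall y, (N <= `|y.1|) || (N <= `|y.2|) -> F y = 0 /\ F1 y = 0) ->
  \int[mu2]_y F1 y = 0.
Proof.
move=> N0 cF1 dF z.
have iF := continuous_support_integrable cF1 (fun y h => (z y h).2).
rewrite /Rintegral -(integral12_prod_meas1 iF) integral0_eq// => x1 _.
apply: (line_integral (f := fun t => F (x1, t)) (f' := fun t => F1 (x1, t)) N0) => //.
  move=> t; apply: (continuous_comp (f := fun t => (x1, t))); last exact: cF1.
  exact: pairr_continuous.
by move=> t h; apply: z; rewrite h orbT.
Qed.

Section test.
Variables (U : set (R * R)) (phi : R * R -> R).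
Hypothesis tphi : test_function U phi.
Let S := closure [set x | phi x != 0].

Let SU : S `<=` U. Proof. by have [_ _ h] := tphi. Qed.

Lemma test_derivable x v : derivable phi x v.
Proof. by have [h _ _] := tphi; have [_ d] := h [::]; exact: d. Qed.

Lemma test_continuous : continuous phi.
Proof. by have [h _ _] := tphi; have [c _] := h [::]. Qed.

Lemma test_derive_continuous v : continuous ('D_v phi).
Proof. by have [h _ _] := tphi; have [c _] := h [:: v]. Qed.

Lemma test_box : exists2 N : R, 0 <= N &
  forall y, (N <= `|y.1|) || (N <= `|y.2|) -> ~ S y.
Proof.
have [_ cS _] := tphi.
have bnd (p : R * R -> R) : continuous p -> exists2 C : R, 0 <= C & forall y, S y -> `|p y| <= C.
  move=> cp; have [C [_ hC]] : bounded_set (p @` S).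
    by apply: compact_bounded; apply: continuous_compact => //; exact: continuous_subspaceT.
  exists (`|C| + 1) => [|y Sy]; first by rewrite addr_ge0.
  by apply: hC; [rewrite (le_lt_trans (ler_norm C)) ?ltrDl|exists y].
have [C1 C10 h1] := bnd fst (fun y => @cvg_fst _ _ _ _ _).
have [C2 C20 h2] := bnd snd (fun y => @cvg_snd _ _ _ _ _).
exists (C1 + C2 + 1) => [|y hy Sy]; first by rewrite !addr_ge0.
by have := h1 y Sy; have := h2 y Sy; case/orP: hy => /=; lra.
Qed.

Lemma test_near0 y : ~ S y -> \forall z \near y, ~ S z.
Proof.
move=> nS; have : open (~` S) by apply: closed_openC; exact: closed_closure.
by move=> oS; exact: (open_nbhs_nbhs (conj oS nS)).
Qed.

Lemma test_eq0 y : ~ S y -> phi y = 0.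
Proof.
by move=> nS; apply/eqP/negP => /negP h; apply: nS; exact: subset_closure.
Qed.

Lemma test_derive0 y v : ~ S y -> 'D_v phi y = 0.
Proof.
move=> nS; have n0 := test_near0 nS.
have : is_derive y v phi 0.
  apply: (@near_eq_is_derive _ _ _ (cst 0)).
  by apply: filterS n0 => z /test_eq0.
by move=> h; exact: (@derive_val _ _ _ _ _ _ _ h).
Qed.

(** h is controlled on U only; off the support the product vanishes in a neighbourhood, so it is
    continuous everywhere. *)
Lemma test_mul_continuous (h psi : R * R -> R) : continuous psi ->
  (forall y, ~ S y -> psi y = 0) -> (forall y, U y -> {for y, continuous h}) ->
  continuous (fun y => h y * psi y).
Proof.
move=> cpsi psi0 ch y; case: (pselect (S y)) => Sy.
  by apply: cvgM; [exact: ch (SU Sy)|exact: cpsi].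
have c0 : (fun _ : R * R => 0 : R) @ y --> (0 : R) by exact: cvg_cst.
rewrite /continuous_at psi0// mulr0; apply: (cvg_trans _ c0).
by apply: near_eq_cvg; apply: filterS (test_near0 Sy) => z nz; rewrite psi0// mulr0.
Qed.

Lemma test_mul_integrable (h psi : R * R -> R) : continuous psi ->
  (forall y, ~ S y -> psi y = 0) -> (forall y, U y -> {for y, continuous h}) ->
  mu2.-integrable setT (EFin \o (fun y => h y * psi y)).
Proof.
move=> cpsi psi0 ch; have [N N0 hN] := test_box.
apply: (@continuous_support_integrable _ N); first exact: test_mul_continuous.
by move=> y /hN /psi0 ->; rewrite mulr0.
Qed.

Let near_line1 (x1 x2 : R) : ~ S (x1, x2) -> \forall t \near x1, ~ S (t, x2).
Proof.
move=> nS.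
exact: (@pairl_continuous x2 x1 _ (test_near0 nS)).
Qed.

Let near_line2 (x1 x2 : R) : ~ S (x1, x2) -> \forall t \near x2, ~ S (x1, t).
Proof.
move=> nS.
exact: (@pairr_continuous x1 x2 _ (test_near0 nS)).
Qed.

Lemma test_ibp1 (h h1 : R * R -> R) : (forall y, U y -> {for y, continuous h}) ->
  (forall y, U y -> {for y, continuous h1}) ->
  (forall x1 x2 : R, U (x1, x2) -> is_derive x1 1 (fun t => h (t, x2)) (h1 (x1, x2))) ->
  \int[mu2]_y (h1 y * phi y) = - \int[mu2]_y (h y * 'D_(1, 0) phi y).
Proof.
move=> ch ch1 dh; have [N N0 hN] := test_box.
have d0 y : ~ S y -> 'D_(1, 0) phi y = 0 by exact: test_derive0.
have cD := @test_derive_continuous (1, 0); have cp := test_continuous.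
have i1 := test_mul_integrable cp test_eq0 ch1.
have i2 := test_mul_integrable cD d0 ch.
apply/eqP; rewrite -addr_eq0 -RintegralD//; apply/eqP.
apply: (@integral_derive1 (fun y => h y * phi y) _ N) => //.
- move=> y; apply: cvgD; [exact: (test_mul_continuous cp test_eq0 ch1)|].
  exact: (test_mul_continuous cD d0 ch).
- move=> x1 x2; case: (pselect (S (x1, x2))) => Sx.
    have hd : derivable phi (x1, x2) (1, 0) by exact: test_derivable.
    have hp := is_derive_partial1 hd.
    exact: (der_M (dh _ _ (SU Sx)) hp).
  rewrite test_eq0// d0// !mulr0 addr0.
  apply: (@near_eq_is_derive _ _ _ (cst 0)).
  by apply: filterS (near_line1 Sx) => t nS; rewrite test_eq0// mulr0.
by move=> y /hN nS; rewrite test_eq0// d0// !mulr0 addr0.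
Qed.

Lemma test_ibp2 (h h1 : R * R -> R) : (forall y, U y -> {for y, continuous h}) ->
  (forall y, U y -> {for y, continuous h1}) ->
  (forall x1 x2 : R, U (x1, x2) -> is_derive x2 1 (fun t => h (x1, t)) (h1 (x1, x2))) ->
  \int[mu2]_y (h1 y * phi y) = - \int[mu2]_y (h y * 'D_(0, 1) phi y).
Proof.
move=> ch ch1 dh; have [N N0 hN] := test_box.
have d0 y : ~ S y -> 'D_(0, 1) phi y = 0 by exact: test_derive0.
have cD := @test_derive_continuous (0, 1); have cp := test_continuous.
have i1 := test_mul_integrable cp test_eq0 ch1.
have i2 := test_mul_integrable cD d0 ch.
apply/eqP; rewrite -addr_eq0 -RintegralD//; apply/eqP.
apply: (@integral_derive2 (fun y => h y * phi y) _ N) => //.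
- move=> y; apply: cvgD; [exact: (test_mul_continuous cp test_eq0 ch1)|].
  exact: (test_mul_continuous cD d0 ch).
- move=> x1 x2; case: (pselect (S (x1, x2))) => Sx.
    have hd : derivable phi (x1, x2) (0, 1) by exact: test_derivable.
    have hp := is_derive_partial2 hd.
    exact: (der_M (dh _ _ (SU Sx)) hp).
  rewrite test_eq0// d0// !mulr0 addr0.
  apply: (@near_eq_is_derive _ _ _ (cst 0)).
  by apply: filterS (near_line2 Sx) => t nS; rewrite test_eq0// mulr0.
by move=> y /hN nS; rewrite test_eq0// d0// !mulr0 addr0.
Qed.

Lemma test_restrict (k : R * R -> R) : measurable (U : set plane) ->
  (forall y, ~ S y -> k y = 0) -> \int[mu2]_(y in U) k y = \int[mu2]_y k y.
Proof.
move=> mU k0; rewrite [LHS]Rintegral_mkcond; apply: eq_Rintegral => y _.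
by rewrite patchE; case: ifPn => //; rewrite notin_setE => nU; rewrite k0// => /SU.
Qed.

End test.

(** The components are - i d_e (f + i g) - b a (f + i g), split into g_e - b a f and - f_e - b a g.
    Since U is only assumed measurable, regularity is asked at the points of U, which contains the
    supports of the test functions. *)
Lemma classical_magnetic_gradient (b : R) (U : set (R * R)) (f g f1 f2 g1 g2 : R * R -> R) :
  measurable (U : set plane) ->
  (forall h, h = f \/ h = g \/ h = f1 \/ h = f2 \/ h = g1 \/ h = g2 ->
     forall y, U y -> {for y, continuous h}) ->
  (forall x1 x2 : R, U (x1, x2) -> is_derive x1 1 (fun t => f (t, x2)) (f1 (x1, x2))) ->
  (forall x1 x2 : R, U (x1, x2) -> is_derive x2 1 (fun t => f (x1, t)) (f2 (x1, x2))) ->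
  (forall x1 x2 : R, U (x1, x2) -> is_derive x1 1 (fun t => g (t, x2)) (g1 (x1, x2))) ->
  (forall x1 x2 : R, U (x1, x2) -> is_derive x2 1 (fun t => g (x1, t)) (g2 (x1, x2))) ->
  magnetic_gradient b U (fun x => Complex (f x) (g x))
    ((fun x => Complex (g1 x - b * (vpot x).1 * f x) (- f1 x - b * (vpot x).1 * g x)),
     (fun x => Complex (g2 x - b * (vpot x).2 * f x) (- f2 x - b * (vpot x).2 * g x))).
Proof.
move=> mU ch df1 df2 dg1 dg2.
have key e (a he ge : R * R -> R) phi : test_function U phi -> continuous a ->
    (forall y, U y -> {for y, continuous he}) -> (forall y, U y -> {for y, continuous ge}) ->
    (\int[mu2]_y (he y * phi y) = - (\int[mu2]_y (f y * 'D_e phi y))) ->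
    (\int[mu2]_y (ge y * phi y) = - (\int[mu2]_y (g y * 'D_e phi y))) ->
    cintegral U (fun x => Complex (ge x - b * a x * f x) (- he x - b * a x * g x) * (phi x)%:C%C) =
    cintegral U (fun x => Complex (f x) (g x) * ('i%C * ('D_e phi x)%:C%C - (b * a x * phi x)%:C%C)).
  move=> tphi ca che cge ef eg.
  have cp := test_continuous tphi; have cD := test_derive_continuous (v := e) tphi.
  have p0 y : ~ closure [set x | phi x != 0] y -> phi y = 0 by exact: test_eq0.
  have D0 y : ~ closure [set x | phi x != 0] y -> 'D_e phi y = 0 by exact: test_derive0.
  have cf y : U y -> {for y, continuous f} by apply: ch; left.
  have cg y : U y -> {for y, continuous g} by apply: ch; right; left.
  have caf y : U y -> {for y, continuous (fun y => b * a y * f y)}.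
    by move=> Uy; apply: cvgM; [apply: cvgM; [exact: cvg_cst|exact: ca]|exact: cf].
  have cag y : U y -> {for y, continuous (fun y => b * a y * g y)}.
    by move=> Uy; apply: cvgM; [apply: cvgM; [exact: cvg_cst|exact: ca]|exact: cg].
  have i1 := test_mul_integrable tphi cp p0 che.
  have i2 := test_mul_integrable tphi cp p0 cge.
  have i3 := test_mul_integrable tphi cp p0 caf.
  have i4 := test_mul_integrable tphi cp p0 cag.
  have i5 := test_mul_integrable tphi cD D0 cf.
  have i6 := test_mul_integrable tphi cD D0 cg.
  rewrite /cintegral; congr Complex.
    rewrite !(test_restrict tphi)//; last 2 first.
    - by move=> y nS /=; rewrite p0// D0//; ring.
    - by move=> y nS /=; rewrite p0//; ring.
    transitivity (\int[mu2]_y (ge y * phi y) - \int[mu2]_y (b * a y * f y * phi y)).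
      by rewrite -RintegralB//; apply: eq_Rintegral => y _ /=; ring.
    rewrite eg -opprD -RintegralD// -mulN1r -RintegralZl//; last exact: integrable_add.
    by apply: eq_Rintegral => y _ /=; ring.
  rewrite !(test_restrict tphi)//; last 2 first.
  - by move=> y nS /=; rewrite p0// D0//; ring.
  - by move=> y nS /=; rewrite p0//; ring.
  transitivity (- (\int[mu2]_y (he y * phi y)) - (\int[mu2]_y (b * a y * g y * phi y))).
    rewrite -opprD -RintegralD// -mulN1r -RintegralZl//; last exact: integrable_add.
    by apply: eq_Rintegral => y _ /=; ring.
  rewrite ef opprK -RintegralB//.
  by apply: eq_Rintegral => y _ /=; ring.
have ca1 : continuous (fun y : R * R => (vpot y).1).
  move=> y; rewrite /vpot/=; apply: cvgM; last exact: cvg_cst.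
  by apply: cvgN; exact: cvg_snd.
have ca2 : continuous (fun y : R * R => (vpot y).2).
  by move=> y; rewrite /vpot/=; apply: cvgM; [exact: cvg_fst|exact: cvg_cst].
have c1 y : U y -> {for y, continuous f1} by apply: ch; do 2 right; left.
have c2 y : U y -> {for y, continuous f2} by apply: ch; do 3 right; left.
have c3 y : U y -> {for y, continuous g1} by apply: ch; do 4 right; left.
have c4 y : U y -> {for y, continuous g2} by apply: ch; do 5 right.
have cf y : U y -> {for y, continuous f} by apply: ch; left.
have cg y : U y -> {for y, continuous g} by apply: ch; right; left.
split=> phi tphi.
  by apply: (key (1, 0) _ f1 g1) => //; apply: (test_ibp1 tphi).
by apply: (key (0, 1) _ f2 g2) => //; apply: (test_ibp2 tphi).
Qed.

End plane_topology.

(** * The trial function and its integrals *)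

Section trial.
Context {R : realType}.
Local Notation mu := (@lebesgue_measure R).
Local Notation mu2 := (@lebesgue_measure R \x @lebesgue_measure R)%E.
Local Notation plane := (measurableTypeR R * measurableTypeR R)%type.

Section profile.
Variables (b c : R).

Definition trial_m (x : R * R) : R :=
  (1 + c * (x.1 ^+ 2 + x.2 ^+ 2)^-1) * expR (- (b * (x.1 ^+ 2 + x.2 ^+ 2) * 4^-1)).
(** The derivative of [trial_m] with respect to |x|^2, so that d_j [trial_m] = 2 x_j [trial_m']. *)
Definition trial_m' (x : R * R) : R :=
  (- (c * (x.1 ^+ 2 + x.2 ^+ 2)^-1 ^+ 2) - b / 4 * (1 + c * (x.1 ^+ 2 + x.2 ^+ 2)^-1)) *
  expR (- (b * (x.1 ^+ 2 + x.2 ^+ 2) * 4^-1)).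

Definition trial_f x := x.1 * trial_m x.
Definition trial_g x := x.2 * trial_m x.
Definition trial_f1 x := trial_m x + 2 * x.1 ^+ 2 * trial_m' x.
(** Both d_2 of [trial_f] and d_1 of [trial_g], hence the absence of a [trial_g1]. *)
Definition trial_f2 x := 2 * x.1 * x.2 * trial_m' x.
Definition trial_g2 x := trial_m x + 2 * x.2 ^+ 2 * trial_m' x.

(* (z + c / conj z) exp (- b |z|^2 / 4) *)
Definition trial_u (x : R * R) : R[i] := Complex (trial_f x) (trial_g x).
Definition trial_W : (R * R -> R[i]) * (R * R -> R[i]) :=
  ((fun x => Complex (trial_f2 x - b * (vpot x).1 * trial_f x)
                     (- trial_f1 x - b * (vpot x).1 * trial_g x)),
   (fun x => Complex (trial_g2 x - b * (vpot x).2 * trial_f x)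
                     (- trial_f2 x - b * (vpot x).2 * trial_g x))).

Lemma trial_continuous x : x.1 ^+ 2 + x.2 ^+ 2 != 0 -> forall h,
  h = trial_f \/ h = trial_g \/ h = trial_f1 \/ h = trial_f2 \/ h = trial_f2 \/ h = trial_g2 ->
  {for x, continuous h}.
Proof.
move=> xn h.
have c1 : (fun y : R * R => y.1) @ x --> x.1 by exact: cvg_fst.
have c2 : (fun y : R * R => y.2) @ x --> x.2 by exact: cvg_snd.
have cc (k : R) : (fun _ : R * R => k) @ x --> k by exact: cvg_cst.
have cX (k : R * R -> R) (l : R) : k @ x --> l -> (fun y => k y ^+ 2) @ x --> l ^+ 2.
  by move=> ck; rewrite expr2; under eq_fun do rewrite expr2; exact: cvgM.
have cr : (fun y : R * R => y.1 ^+ 2 + y.2 ^+ 2) @ x --> x.1 ^+ 2 + x.2 ^+ 2.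
  by apply: cvgD; exact: cX.
have ci : (fun y : R * R => (y.1 ^+ 2 + y.2 ^+ 2)^-1) @ x --> (x.1 ^+ 2 + x.2 ^+ 2)^-1.
  exact: cvgV.
have ce : (fun y : R * R => expR (- (b * (y.1 ^+ 2 + y.2 ^+ 2) * 4^-1))) @ x -->
    expR (- (b * (x.1 ^+ 2 + x.2 ^+ 2) * 4^-1)).
  apply: (cvg_comp (fun y : R * R => - (b * (y.1 ^+ 2 + y.2 ^+ 2) * 4^-1)) expR); last exact: continuous_expR.
  by apply: cvgN; apply: cvgM => //; exact: cvgM.
have c1ci : (fun y : R * R => 1 + c * (y.1 ^+ 2 + y.2 ^+ 2)^-1) @ x --> 1 + c * (x.1 ^+ 2 + x.2 ^+ 2)^-1.
  by apply: cvgD => //; exact: cvgM.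
have cm : trial_m @ x --> trial_m x by exact: cvgM.
have cm' : trial_m' @ x --> trial_m' x.
  apply: cvgM => //; apply: cvgB; last exact: cvgM.
  by apply: cvgN; apply: cvgM => //; exact: cX.
have hf : {for x, continuous trial_f} by exact: cvgM.
have hg : {for x, continuous trial_g} by exact: cvgM.
have hf1 : {for x, continuous trial_f1}.
  by apply: cvgD => //; apply: cvgM => //; apply: cvgM => //; exact: cX.
have hf2 : {for x, continuous trial_f2}.
  by apply: cvgM => //; apply: cvgM => //; exact: cvgM.
have hg2 : {for x, continuous trial_g2}.
  by apply: cvgD => //; apply: cvgM => //; apply: cvgM => //; exact: cX.
by case=> [->//|[->//|[->//|[->//|[->//|->//]]]]].
Qed.

Let dm1 (x1 x2 : R) : x1 ^+ 2 + x2 ^+ 2 != 0 ->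
  is_derive x1 1 (fun t => trial_m (t, x2)) (2 * x1 * trial_m' (x1, x2)).
Proof.
move=> xn.
have dX := der_D (der_X 2 (der_id x1)) (der_cst (x2 ^+ 2) x1).
have dm := der_M (der_D (der_cst 1 x1) (der_M (der_cst c x1) (der_V dX xn)))
  (der_exp (der_N (der_M (der_M (der_cst b x1) dX) (der_cst 4^-1 x1)))).
apply: (@is_derive_eq _ _ _ _ _ _ _ _ dm).
by rewrite /trial_m' /=; field.
Qed.

Let dm2 (x1 x2 : R) : x1 ^+ 2 + x2 ^+ 2 != 0 ->
  is_derive x2 1 (fun t => trial_m (x1, t)) (2 * x2 * trial_m' (x1, x2)).
Proof.
move=> xn.
have dX := der_D (der_cst (x1 ^+ 2) x2) (der_X 2 (der_id x2)).
have dm := der_M (der_D (der_cst 1 x2) (der_M (der_cst c x2) (der_V dX xn)))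
  (der_exp (der_N (der_M (der_M (der_cst b x2) dX) (der_cst 4^-1 x2)))).
apply: (@is_derive_eq _ _ _ _ _ _ _ _ dm).
by rewrite /trial_m' /=; field.
Qed.

Lemma trial_gradient (U : set (R * R)) : measurable (U : set plane) ->
  (forall x, U x -> x.1 ^+ 2 + x.2 ^+ 2 != 0) -> magnetic_gradient b U trial_u trial_W.
Proof.
move=> mU U0.
apply: (@classical_magnetic_gradient R b U trial_f trial_g trial_f1 trial_f2 trial_f2 trial_g2) => //.
- by move=> h hh y /U0 yn; exact: trial_continuous.
- move=> x1 x2 /U0 /= xn.
  apply: (@is_derive_eq _ _ _ _ _ _ _ _ (der_M (der_id x1) (dm1 xn))).
  by rewrite /trial_f1 /=; ring.
- move=> x1 x2 /U0 /= xn.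
  apply: (@is_derive_eq _ _ _ _ _ _ _ _ (der_M (der_cst x1 x2) (dm2 xn))).
  by rewrite /trial_f2 /=; ring.
- move=> x1 x2 /U0 /= xn.
  apply: (@is_derive_eq _ _ _ _ _ _ _ _ (der_M (der_cst x2 x1) (dm1 xn))).
  by rewrite /trial_f2 /=; ring.
- move=> x1 x2 /U0 /= xn.
  apply: (@is_derive_eq _ _ _ _ _ _ _ _ (der_M (der_id x2) (dm2 xn))).
  by rewrite /trial_g2 /=; ring.
Qed.

Let q x := b * enorm x ^+ 2 / 2.

Let gaussE x : gauss b x = expR (- (b * (x.1 ^+ 2 + x.2 ^+ 2) * 4^-1)) ^+ 2.
Proof.
by rewrite /gauss sqr_enorm [RHS]expr2 -expRD; congr expR; field.
Qed.

Lemma trial_massE x : x.1 ^+ 2 + x.2 ^+ 2 != 0 ->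
  sqmod (trial_u x) = gauss b x * (enorm x ^+ 2 + 2 * c + c ^+ 2 / enorm x ^+ 2).
Proof.
move=> xn; rewrite gaussE sqr_enorm /sqmod /trial_u /= /trial_f /trial_g /trial_m.
by move: (expR _) => E; field.
Qed.

(** Isolating b times the mass leaves exactly what decides the quotient minus b. The polynomial in q
    will be integrated over the whole plane, and the |x|^-4 term produces I_4. *)
Lemma trial_energyE x : x.1 ^+ 2 + x.2 ^+ 2 != 0 ->
  sqmod (trial_W.1 x) + sqmod (trial_W.2 x) = b * sqmod (trial_u x) +
  gauss b x * (2 - 6 * q x + 2 * q x ^+ 2 + 2 * c ^+ 2 / enorm x ^+ 2 ^+ 2 + b ^+ 2 * c ^+ 2 / 2
    - 4 * b * c + 2 * b * c * q x - b * c ^+ 2 / enorm x ^+ 2).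
Proof.
move=> xn; rewrite trial_massE// gaussE /q sqr_enorm /sqmod /trial_W /= /trial_f1 /trial_f2 /trial_g2.
rewrite /trial_f /trial_g /trial_m /trial_m' /vpot /=.
by move: (expR _) => E; field.
Qed.

Let msq : measurable_fun [set: plane] (fun x : R * R => x.1 ^+ 2 + x.2 ^+ 2).
Proof. by apply: measurable_funD; apply: measurable_funX. Qed.
Let minv : measurable_fun [set: plane] (fun x : R * R => (x.1 ^+ 2 + x.2 ^+ 2)^-1).
Proof. exact: measurable_funV. Qed.
Let mexp : measurable_fun [set: plane] (fun x : R * R => expR (- (b * (x.1 ^+ 2 + x.2 ^+ 2) * 4^-1))).
Proof.
apply: (measurableT_comp (@measurable_expR R)); apply: measurableT_comp => //.
by apply: measurable_funM => //; exact: measurable_funM.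
Qed.
Let m1 : measurable_fun [set: plane] (fun x : R * R => 1 + c * (x.1 ^+ 2 + x.2 ^+ 2)^-1).
Proof. by apply: measurable_funD => //; exact: measurable_funM. Qed.
Let mm : measurable_fun [set: plane] trial_m.
Proof. exact: measurable_funM. Qed.
Let mm' : measurable_fun [set: plane] trial_m'.
Proof.
apply: measurable_funM => //; apply: measurable_funB; last exact: measurable_funM.
by apply: measurableT_comp => //; apply: measurable_funM => //; exact: measurable_funX.
Qed.

Let mf : measurable_fun [set: plane] trial_f.
Proof. exact: measurable_funM. Qed.
Let mg : measurable_fun [set: plane] trial_g.
Proof. exact: measurable_funM. Qed.
Let mf1 : measurable_fun [set: plane] trial_f1.
Proof.
apply: measurable_funD => //; apply: measurable_funM => //; apply: measurable_funM => //.
exact: measurable_funX.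
Qed.
Let mf2 : measurable_fun [set: plane] trial_f2.
Proof. by apply: measurable_funM => //; apply: measurable_funM => //; exact: measurable_funM. Qed.
Let mg2 : measurable_fun [set: plane] trial_g2.
Proof.
apply: measurable_funD => //; apply: measurable_funM => //; apply: measurable_funM => //.
exact: measurable_funX.
Qed.
Let mv1 : measurable_fun [set: plane] (fun z => b * (vpot z).1).
Proof.
apply: measurable_funM => //; rewrite /vpot/=; apply: measurable_funM => //.
by apply: measurableT_comp => //; exact: measurable_snd.
Qed.
Let mv2 : measurable_fun [set: plane] (fun z => b * (vpot z).2).
Proof. by apply: measurable_funM => //; rewrite /vpot/=; apply: measurable_funM. Qed.

Let mN (h : R * R -> R) : measurable_fun [set: plane] h -> measurable_fun [set: plane] (fun x => - h x).
Proof. by move=> mh; apply: measurableT_comp. Qed.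

Lemma trial_measurable w : w = trial_u \/ w = trial_W.1 \/ w = trial_W.2 ->
  measurable_fun [set: plane] (fun x => complex.Re (w x)) /\
  measurable_fun [set: plane] (fun x => complex.Im (w x)).
Proof.
have mN1 := mN mf1; have mN2 := mN mf2.
have a1 := measurable_funM mv1 mf; have a2 := measurable_funM mv1 mg.
have a3 := measurable_funM mv2 mf; have a4 := measurable_funM mv2 mg.
by case=> [->|[->|->]]; split => /=; [exact: mf|exact: mg|..];
  apply: measurable_funB.
Qed.

End profile.

Section estimates.
Variables (b c r1 r2 : R) (U : set (R * R)).
Hypotheses (b0 : 0 < b) (c0 : 0 < c) (r10 : 0 < r1) (mU : measurable (U : set plane))
  (Ur1 : forall x, U x -> r1 < enorm x) (Kr2 : forall x, ~ U x -> enorm x <= r2).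
Let K : set (R * R) := ~` U.
Let q x := b * enorm x ^+ 2 / 2.
Let G n := @gauss_moment R b n.

Let xn x : U x -> x.1 ^+ 2 + x.2 ^+ 2 != 0.
Proof.
move=> /Ur1 h; rewrite -sqr_enorm expf_neq0// gt_eqF//; exact: lt_trans h.
Qed.

Let r20 : 0 <= r2.
Proof.
have [U0|/Kr2] := pselect (U 0); last exact: le_trans (enorm_ge0 _).
have := Ur1 U0; rewrite /enorm /= expr0n/= addr0 sqrtr0 => h.
by have := lt_trans r10 h; rewrite ltxx.
Qed.

Let me : measurable_fun [set: plane] (@enorm R).
Proof. exact: measurable_enorm. Qed.

Let mG n : measurable_fun [set: plane] (G n).
Proof.
have mq : measurable_fun [set: plane] (fun z => b * enorm z ^+ 2 / 2).
  by apply: measurable_funM => //; apply: measurable_funM => //; exact: measurable_funX.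
apply: measurable_funM; first exact: measurable_funX.
apply: (measurableT_comp (@measurable_expR R)); exact: measurableT_comp.
Qed.

Let q0 x : 0 <= q x.
Proof. by rewrite /q divr_ge0// mulr_ge0 ?sqr_ge0// ltW. Qed.

Let g0 x : 0 <= gauss b x. Proof. exact: expR_ge0. Qed.

Let G0 n x : 0 <= G n x.
Proof. by rewrite /G /gauss_moment mulr_ge0// exprn_ge0//; exact: q0. Qed.

Let GE n x : G n x = q x ^+ n * gauss b x. Proof. by []. Qed.

Let iGv n v : (\int[mu2]_z (G n z)%:E = v%:E)%E ->
  mu2.-integrable setT (EFin \o G n) /\ \int[mu2]_z G n z = v.
Proof.
move=> e; split; last by rewrite /Rintegral e.
apply/integrableP; split; first exact/measurable_EFinP.
under eq_integral => z _ do rewrite /= ger0_norm//.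
by rewrite e ltry.
Qed.

Let iG0 := (iGv (gauss_integral0 b0)).1.
Let iG1 := (iGv (gauss_integral1 b0)).1.
Let iG2 := (iGv (gauss_integral2 b0)).1.
Let vG0 := (iGv (gauss_integral0 b0)).2.
Let vG1 := (iGv (gauss_integral1 b0)).2.
Let vG2 := (iGv (gauss_integral2 b0)).2.

Let RintGZ k n : mu2.-integrable setT (EFin \o G n) ->
  \int[mu2]_x (k * G n x) = k * \int[mu2]_x G n x.
Proof. by move=> i; rewrite RintegralZl. Qed.

Let Udom (h k : R * R -> R) : mu2.-integrable setT (EFin \o k) -> measurable_fun [set: plane] h ->
  (forall x, U x -> 0 <= h x) -> (forall x, U x -> h x <= k x) -> mu2.-integrable U (EFin \o h).
Proof.
move=> ik mh h0 hk.
have ikU : mu2.-integrable U (EFin \o k) by exact: (integrableS measurableT).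
apply: (le_integrable mU _ _ ikU); first by apply/measurable_EFinP; exact: measurable_funTS.
by move=> x Ux; rewrite !abse_EFin lee_fin ger0_norm ?h0// (le_trans (hk x Ux))// ler_norm.
Qed.

Let r1inv x : U x -> (enorm x ^+ 2)^-1 <= (r1 ^+ 2)^-1.
Proof.
move=> /Ur1 h; rewrite lef_pV2 ?posrE ?exprn_gt0//; last exact: lt_trans h.
by apply: lerXn2r; rewrite ?nnegrE ?(ltW r10) ?enorm_ge0// ltW.
Qed.

(** Integrable majorants on U of the mass and energy densities, written with Gaussian moments whose
    integrals are known; negative powers of |x| are bounded by powers of 1 / r1. *)
Let Dm x := 2 / b * G 1 x + (2 * c + c ^+ 2 / r1 ^+ 2) * G 0 x.
Let De x := b * Dm x + ((2 + 2 * c ^+ 2 / r1 ^+ 2 ^+ 2 + b ^+ 2 * c ^+ 2 / 2) * G 0 x +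
  (2 * b * c * G 1 x + 2 * G 2 x)).

Let iDm : mu2.-integrable setT (EFin \o Dm).
Proof. by apply: integrable_add; exact: integrable_scale. Qed.

Let iDe : mu2.-integrable setT (EFin \o De).
Proof.
apply: integrable_add; first exact: integrable_scale.
by apply: integrable_add; [|apply: integrable_add]; exact: integrable_scale.
Qed.

Let mass_le x : U x -> sqmod (trial_u b c x) <= Dm x.
Proof.
move=> Ux; rewrite trial_massE; last exact: xn.
rewrite /Dm !GE expr1 expr0 mul1r /q.
have -> : 2 / b * (b * enorm x ^+ 2 / 2 * gauss b x) = gauss b x * enorm x ^+ 2.
  by field; rewrite gt_eqF.
rewrite -addrA mulrDr lerD2l mulrC; apply: ler_wpM2r => //.
rewrite lerD2l; apply: ler_wpM2l; [exact: sqr_ge0|exact: r1inv].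
Qed.

Let energy_le x : U x -> sqmod ((trial_W b c).1 x) + sqmod ((trial_W b c).2 x) <= De x.
Proof.
move=> Ux; rewrite trial_energyE; last exact: xn.
rewrite /De; apply: lerD; first by apply: ler_wpM2l; [exact: ltW|exact: mass_le].
rewrite !GE expr1 expr0 mul1r -/(q x).
rewrite (_ : (2 + 2 * c ^+ 2 / r1 ^+ 2 ^+ 2 + b ^+ 2 * c ^+ 2 / 2) * gauss b x +
  (2 * b * c * (q x * gauss b x) + 2 * (q x ^+ 2 * gauss b x)) =
  gauss b x * (2 + 2 * c ^+ 2 / r1 ^+ 2 ^+ 2 + b ^+ 2 * c ^+ 2 / 2 + 2 * b * c * q x + 2 * q x ^+ 2)); last by ring.
apply: ler_wpM2l => //.
have h1 : c ^+ 2 / enorm x ^+ 2 ^+ 2 <= c ^+ 2 / r1 ^+ 2 ^+ 2.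
  apply: ler_wpM2l; first exact: sqr_ge0.
  rewrite -[(enorm x ^+ 2 ^+ 2)^-1]exprVn -[(r1 ^+ 2 ^+ 2)^-1]exprVn; apply: lerXn2r; rewrite ?nnegrE ?invr_ge0 ?sqr_ge0//; exact: r1inv.
have h2 : 0 <= b * c ^+ 2 / enorm x ^+ 2.
  by apply: divr_ge0; [apply: mulr_ge0; [exact: ltW|exact: sqr_ge0]|exact: sqr_ge0].
have h3 : 0 <= b * c by rewrite mulr_ge0// ltW.
have h4 := q0 x.
rewrite (_ : 2 * c ^+ 2 / enorm x ^+ 2 ^+ 2 = 2 * (c ^+ 2 / enorm x ^+ 2 ^+ 2)); last by ring.
rewrite (_ : 2 * c ^+ 2 / r1 ^+ 2 ^+ 2 = 2 * (c ^+ 2 / r1 ^+ 2 ^+ 2)); last by ring.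
lra.
Qed.

Let sq0 (z : R[i]) : 0 <= sqmod z. Proof. by rewrite addr_ge0// sqr_ge0. Qed.

Let msqmod (w : R * R -> R[i]) : w = trial_u b c \/ w = (trial_W b c).1 \/ w = (trial_W b c).2 ->
  measurable_fun [set: plane] (fun x => sqmod (w x)).
Proof.
by move=> /trial_measurable[h1 h2]; apply: measurable_funD; exact: measurable_funX.
Qed.

Lemma trial_H1A : H1A b U (trial_u b c) (trial_W b c).
Proof.
have h w : w = trial_u b c \/ w = (trial_W b c).1 \/ w = (trial_W b c).2 ->
    mu2.-integrable U (fun x => (sqmod (w x))%:E) -> L2 U w.
  by move=> hw iw; have [h1 h2] := trial_measurable hw; split => //; exact: measurable_funTS.
split.
- apply: h; first by left.
  by apply: (Udom iDm) => //; apply: msqmod; left.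
- apply: h; first by right; left.
  apply: (Udom iDe) => //; first by apply: msqmod; right; left.
  by move=> x /energy_le; apply: le_trans; rewrite lerDl.
- apply: h; first by right; right.
  apply: (Udom iDe) => //; first by apply: msqmod; right; right.
  by move=> x /energy_le; apply: le_trans; rewrite lerDr.
- by apply: trial_gradient => // x; exact: xn.
Qed.

Let iu : mu2.-integrable U (EFin \o (fun x => sqmod (trial_u b c x))).
Proof. by have [[_ _ h] _ _ _] := trial_H1A. Qed.
Let iw1 : mu2.-integrable U (EFin \o (fun x => sqmod ((trial_W b c).1 x))).
Proof. by have [_ [_ _ h] _ _] := trial_H1A. Qed.
Let iw2 : mu2.-integrable U (EFin \o (fun x => sqmod ((trial_W b c).2 x))).
Proof. by have [_ _ [_ _ h] _] := trial_H1A. Qed.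

Let Rint_setC (T : R * R -> R) : mu2.-integrable setT (EFin \o T) ->
  \int[mu2]_x T x = \int[mu2]_(x in U) T x + \int[mu2]_(x in K) T x.
Proof.
move=> iT; have mK : measurable (K : set plane) by exact: measurableC.
have e : [set: plane] = U `|` K by rewrite /K setUv.
rewrite [in LHS]e Rintegral_setU//.
- by apply: (integrableS measurableT) => //; exact: measurableU.
- by apply/disj_set2P; rewrite /K setICr.
Qed.

Lemma trial_mass_upper :
  L2normsq U (trial_u b c) <= 4 * pi / b ^+ 2 * (1 + b * ((2 * c + c ^+ 2 / r1 ^+ 2) / 2)).
Proof.
have iDmU : mu2.-integrable U (EFin \o Dm) by exact: (integrableS measurableT).
apply: (@le_trans _ _ (\int[mu2]_(x in U) Dm x)).
  by apply: le_Rintegral => // x; exact: mass_le.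
apply: (@le_trans _ _ (\int[mu2]_x Dm x)).
  rewrite (Rint_setC iDm) lerDl; apply: Rintegral_ge0 => x _.
  rewrite /Dm addr_ge0// mulr_ge0//; first by rewrite divr_ge0// ltW.
  by rewrite addr_ge0 ?divr_ge0 ?sqr_ge0// mulr_ge0// ltW.
rewrite /Dm RintegralD//; [|exact: integrable_scale|exact: integrable_scale].
rewrite (RintGZ _ iG1) (RintGZ _ iG0) vG0 vG1 le_eqVlt; apply/orP; left; apply/eqP.
by rewrite mulr2n; field; rewrite !gt_eqF.
Qed.

(** The contribution of |z|^2 alone, minus its integral over the complement of U; it serves to show
    that the mass is positive for small b. *)
Lemma trial_mass_lower : (mu2 K < +oo)%E ->
  4 * pi / b ^+ 2 - r2 ^+ 2 * fine (mu2 K) <= L2normsq U (trial_u b c).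
Proof.
move=> Kfin; have mK : measurable (K : set plane) by exact: measurableC.
have i2 : mu2.-integrable setT (EFin \o (fun x => 2 / b * G 1 x)) by exact: integrable_scale.
have e : \int[mu2]_x (2 / b * G 1 x) = 4 * pi / b ^+ 2.
  by rewrite RintegralZl// vG1 mulr2n; field; rewrite gt_eqF.
have sqE x : 2 / b * G 1 x = enorm x ^+ 2 * gauss b x.
  by rewrite GE expr1 /q; field; rewrite gt_eqF.
rewrite lerBlDr -e (Rint_setC i2); apply: lerD.
  apply: le_Rintegral => //; first exact: (integrableS measurableT).
  move=> x Ux; rewrite sqE trial_massE; last exact: xn.
  rewrite mulrC; apply: ler_wpM2l => //; rewrite -addrA lerDl addr_ge0//.
    by rewrite mulr_ge0// ltW.
  by rewrite divr_ge0// sqr_ge0.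
rewrite -Rintegral_cst//; apply: le_Rintegral => //.
- exact: (integrableS measurableT).
- by apply/integrableP; split; [apply/measurable_EFinP; exact: measurable_cst|
    under eq_integral do rewrite /=; rewrite integral_cst// lte_mul_pinfty].
move=> x Kx; rewrite sqE -[leRHS]mulr1; apply: ler_pM => //; first exact: sqr_ge0.
  by apply: lerXn2r; rewrite ?nnegrE ?enorm_ge0//; exact: Kr2.
by rewrite -expR0 ler_expR oppr_le0; exact: q0.
Qed.

Let I4 := \int[mu2]_(x in U) (enorm x ^+ 2 ^+ 2)^-1.

Let mi4 : measurable_fun [set: plane] (fun x : R * R => (enorm x ^+ 2 ^+ 2)^-1).
Proof. by apply: measurable_funV; do 2 apply: measurable_funX. Qed.

Lemma integrable_I4 : mu2.-integrable U (EFin \o (fun x => (enorm x ^+ 2 ^+ 2)^-1)).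
Proof.
have mD : measurable ([set z : R * R | r1 < enorm z] : set plane).
  rewrite (_ : [set _ | _] = [set z | enorm z \in `]r1, +oo[]).
    exact: measurable_enorm_itv.
  by apply/seteqP; split => z /=; rewrite in_itv/= andbT.
apply/integrableP; split; first by apply/measurable_EFinP; exact: measurable_funTS.
apply: (@le_lt_trans _ _ (\int[mu2]_(z in [set z | (r1 < enorm z)%R]) (enorm z ^- 4)%:E)%E).
  rewrite (_ : (\int[mu2]_(x in U) _ = \int[mu2]_(x in U) (enorm x ^- 4)%:E)%E).
    apply: ge0_subset_integral => //.
    - apply/measurable_EFinP; apply: measurable_funTS.
      by under eq_fun do rewrite (exprM _ 2 2).
    - by move=> z _; rewrite lee_fin invr_ge0 exprn_ge0// enorm_ge0.
  apply: eq_integral => z _; rewrite /= -exprM ger0_norm//.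
  by rewrite invr_ge0 exprn_ge0// enorm_ge0.
by rewrite integral_enorm_powN4// ltry.
Qed.

(** Over the whole plane the terms of order 1 / b cancel, as 2 - 6 + 4 = 0, and - 4 pi c remains.
    Removing the complement K, where the integrand is 2 - O(b), costs 2 |K|, and the |x|^-4 term
    adds 2 c^2 I_4. *)
Lemma trial_energy_upper : (mu2 K < +oo)%E ->
  L2normsq U (trial_W b c).1 + L2normsq U (trial_W b c).2 - b * L2normsq U (trial_u b c) <=
  - 4 * pi * c + 2 * c ^+ 2 * I4 - 2 * fine (mu2 K) +
  b * ((4 * r2 ^+ 2 + 4 * c) * fine (mu2 K) + pi * c ^+ 2).
Proof.
move=> Kfin; have mK : measurable (K : set plane) by exact: measurableC.
pose T x := (2 - 4 * b * c) * G 0 x + ((2 * b * c - 6) * G 1 x + 2 * G 2 x).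
have iT : mu2.-integrable setT (EFin \o T).
  by apply: integrable_add; [|apply: integrable_add]; exact: integrable_scale.
have iTU : mu2.-integrable U (EFin \o T) by exact: (integrableS measurableT).
have iTK : mu2.-integrable K (EFin \o T) by exact: (integrableS measurableT).
have vT : \int[mu2]_x T x = - 4 * pi * c.
  rewrite /T RintegralD//; [|exact: integrable_scale|by apply: integrable_add; exact: integrable_scale].
  rewrite RintegralD//; [|exact: integrable_scale|exact: integrable_scale].
  rewrite (RintGZ _ iG1) (RintGZ _ iG0) (RintGZ _ iG2).
  by rewrite vG0 vG1 vG2 !mulrS mulr0n; field; rewrite gt_eqF.
(* On K, from 1 - q <= gauss <= 1 and q <= b r2^2 / 2. *)
have TK : (2 - b * (4 * r2 ^+ 2 + 4 * c)) * fine (mu2 K) <= \int[mu2]_(x in K) T x.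
  rewrite -Rintegral_cst//; apply: le_Rintegral => //.
    apply/integrableP; split; first by apply/measurable_EFinP; exact: measurable_cst.
    by rewrite (_ : (fun _ => _) = cst (`|2 - b * (4 * r2 ^+ 2 + 4 * c)|%:E))//
      integral_cst// lte_mul_pinfty.
  move=> x Kx.
  have q2 : q x <= b * r2 ^+ 2 / 2.
    apply: ler_wpM2r => //; apply: ler_wpM2l; first exact: ltW.
    by apply: lerXn2r; rewrite ?nnegrE ?enorm_ge0//; exact: Kr2.
  have gq : 1 - q x <= gauss b x by have := expR_ge1Dx (- q x); rewrite /gauss.
  have g1 : gauss b x <= 1 by rewrite -expR0 ler_expR oppr_le0; exact: q0.
  have qx := q0 x; have gx := g0 x; have bc : 0 <= b * c by rewrite mulr_ge0// ltW.
  have p1 : gauss b x * (6 * q x + 4 * (b * c)) <= 6 * q x + 4 * (b * c).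
    have h : 0 <= 6 * q x + 4 * (b * c) by lra.
    by rewrite ler_piMl.
  have p2 : 0 <= gauss b x * (2 * q x ^+ 2 + 2 * (b * c) * q x).
    apply: mulr_ge0 => //; apply: addr_ge0; first by rewrite mulr_ge0 ?sqr_ge0.
    by apply: mulr_ge0 => //; rewrite mulr_ge0.
  rewrite /T !GE expr0 expr1 mul1r.
  rewrite (_ : (2 - 4 * b * c) * gauss b x +
    ((2 * b * c - 6) * (q x * gauss b x) + 2 * (q x ^+ 2 * gauss b x)) =
    2 * gauss b x - gauss b x * (6 * q x + 4 * (b * c)) +
    gauss b x * (2 * q x ^+ 2 + 2 * (b * c) * q x)); last by ring.
  rewrite (_ : b * (4 * r2 ^+ 2 + 4 * c) = 8 * (b * r2 ^+ 2 / 2) + 4 * (b * c)); last by field.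
  move: q2 gq p1 p2; move: (b * r2 ^+ 2 / 2) (gauss b x * _) (gauss b x * _) => t1 t2 t3.
  lra.
have i4 := integrable_I4.
have i4c : mu2.-integrable U (EFin \o (fun x => 2 * c ^+ 2 * (enorm x ^+ 2 ^+ 2)^-1)).
  by have := integrableZl mU (2 * c ^+ 2) i4; apply.
have iGc : mu2.-integrable U (EFin \o (fun x => b ^+ 2 * c ^+ 2 / 2 * G 0 x)).
  by apply: (integrableS measurableT) => //; exact: integrable_scale.
have G0U : \int[mu2]_(x in U) (b ^+ 2 * c ^+ 2 / 2 * G 0 x) <= b * (pi * c ^+ 2).
  apply: (@le_trans _ _ (\int[mu2]_x (b ^+ 2 * c ^+ 2 / 2 * G 0 x))).
    have i : mu2.-integrable setT (EFin \o (fun x => b ^+ 2 * c ^+ 2 / 2 * G 0 x)).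
      exact: integrable_scale.
    rewrite (Rint_setC i) lerDl; apply: Rintegral_ge0 => x _.
    by rewrite mulr_ge0// divr_ge0// mulr_ge0 ?sqr_ge0.
  rewrite RintegralZl// vG0 le_eqVlt; apply/orP; left; apply/eqP.
  by rewrite mulr2n; field; rewrite gt_eqF.
have ibu : mu2.-integrable U (EFin \o (fun x => b * sqmod (trial_u b c x))).
  by have := integrableZl mU b iu; apply.
have iw : mu2.-integrable U (EFin \o (fun x => sqmod ((trial_W b c).1 x) + sqmod ((trial_W b c).2 x))).
  by have := integrableD mU iw1 iw2; apply.
have i4G : mu2.-integrable U (EFin \o (fun x => 2 * c ^+ 2 * (enorm x ^+ 2 ^+ 2)^-1 +
    b ^+ 2 * c ^+ 2 / 2 * G 0 x)).
  by have := integrableD mU i4c iGc; apply.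
have iT4 : mu2.-integrable U (EFin \o (fun x => T x + (2 * c ^+ 2 * (enorm x ^+ 2 ^+ 2)^-1 +
    b ^+ 2 * c ^+ 2 / 2 * G 0 x))).
  by have := integrableD mU iTU i4G; apply.
have main : L2normsq U (trial_W b c).1 + L2normsq U (trial_W b c).2 <=
    b * L2normsq U (trial_u b c) + (\int[mu2]_(x in U) T x +
      (2 * c ^+ 2 * I4 + \int[mu2]_(x in U) (b ^+ 2 * c ^+ 2 / 2 * G 0 x))).
  have e4 : 2 * c ^+ 2 * I4 = \int[mu2]_(x in U) (2 * c ^+ 2 * (enorm x ^+ 2 ^+ 2)^-1).
    by rewrite RintegralZl.
  have eu : b * L2normsq U (trial_u b c) = \int[mu2]_(x in U) (b * sqmod (trial_u b c x)).
    by rewrite RintegralZl.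
  rewrite e4 eu /L2normsq -RintegralD// -(RintegralD mU i4c iGc).
  rewrite -(RintegralD mU iTU i4G) -(RintegralD mU ibu iT4).
  apply: le_Rintegral => //; first by have := integrableD mU ibu iT4; apply.
  move=> x Ux; rewrite trial_energyE; last exact: xn.
  rewrite lerD2l -/(q x) /T !GE expr0 expr1 !mul1r.
  have g1 : gauss b x <= 1 by rewrite -expR0 ler_expR oppr_le0; exact: q0.
  have e0 : 0 <= c ^+ 2 * (enorm x ^+ 2 ^+ 2)^-1 by rewrite mulr_ge0 ?sqr_ge0// invr_ge0 sqr_ge0.
  have e1 : 0 <= gauss b x * (b * c ^+ 2 / enorm x ^+ 2).
    apply: mulr_ge0 => //; apply: divr_ge0; last exact: sqr_ge0.
    by apply: mulr_ge0; [exact: ltW|exact: sqr_ge0].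
  have e2 : gauss b x * (c ^+ 2 * (enorm x ^+ 2 ^+ 2)^-1) <= c ^+ 2 * (enorm x ^+ 2 ^+ 2)^-1.
    by rewrite ler_piMl.
  rewrite (_ : gauss b x * _ = 2 * (gauss b x * (c ^+ 2 * (enorm x ^+ 2 ^+ 2)^-1)) -
    gauss b x * (b * c ^+ 2 / enorm x ^+ 2) + (2 * gauss b x + 2 * (q x ^+ 2 * gauss b x) -
    6 * (q x * gauss b x) + b ^+ 2 * c ^+ 2 / 2 * gauss b x - 4 * b * c * gauss b x +
    2 * b * c * (q x * gauss b x))); last by ring.
  move: e1 e2; set A1 := gauss b x * (b * c ^+ 2 / _); set A2 := gauss b x * (c ^+ 2 * _).
  rewrite (_ : 2 * c ^+ 2 * (enorm x ^+ 2 ^+ 2)^-1 = 2 * (c ^+ 2 * (enorm x ^+ 2 ^+ 2)^-1)); last by ring.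
  move: (c ^+ 2 * (enorm x ^+ 2 ^+ 2)^-1) => A3 e1 e2; rewrite -subr_ge0.
  rewrite (_ : _ - _ = 2 * (A3 - A2) + A1); last by ring.
  by rewrite addr_ge0// mulr_ge0// subr_ge0.
have TE := Rint_setC iT; rewrite vT in TE.
rewrite lerBlDl; apply: (le_trans main); rewrite lerD2l.
move: TE TK G0U; set t1 := \int[mu2]_(x in U) T x; set t2 := \int[mu2]_(x in K) T x.
set t3 := \int[mu2]_(x in U) _; rewrite mulrBl => TE TK G0U.
rewrite (_ : b * ((4 * r2 ^+ 2 + 4 * c) * fine (mu2 K) + pi * c ^+ 2) =
  b * (4 * r2 ^+ 2 + 4 * c) * fine (mu2 K) + b * (pi * c ^+ 2)); last by ring.
lra.
Qed.

End estimates.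

End trial.

(** * Star-shaped sets, disks and the bathtub principle *)

Section planar_sets.
Context {R : realType}.
Local Notation mu := (@lebesgue_measure R).
Local Notation mu2 := (@lebesgue_measure R \x @lebesgue_measure R)%E.
Local Notation plane := (measurableTypeR R * measurableTypeR R)%type.

Lemma enorm_continuous : continuous (@enorm R).
Proof.
move=> x; apply: (cvg_comp (fun x : R * R => x.1 ^+ 2 + x.2 ^+ 2) (@Num.sqrt R)); last exact: sqrt_continuous.
have cX (k : R * R -> R) (l : R) : k @ x --> l -> (fun y => k y ^+ 2) @ x --> l ^+ 2.
  by move=> ck; rewrite expr2; under eq_fun do rewrite expr2; exact: cvgM.
by apply: cvgD; apply: cX; [exact: cvg_fst|exact: cvg_snd].
Qed.

Lemma open_enorm_gt (r : R) : open [set x : R * R | r < enorm x].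
Proof.
have -> : [set x : R * R | r < enorm x] = @enorm R @^-1` `]r, +oo[.
  by apply/seteqP; split => x /=; rewrite in_itv/= andbT.
by apply: open_comp; [move=> x _; exact: enorm_continuous|exact: interval_open].
Qed.

Lemma open_enorm_lt (r : R) : open [set x : R * R | enorm x < r].
Proof.
have -> : [set x : R * R | enorm x < r] = @enorm R @^-1` `]-oo, r[.
  by apply/seteqP; split => x /=; rewrite in_itv/=.
by apply: open_comp; [move=> x _; exact: enorm_continuous|exact: interval_open].
Qed.

Lemma closed_enorm_le (r : R) : closed [set x : R * R | enorm x <= r].
Proof.
rewrite (_ : [set _ | _] = ~` [set x : R * R | r < enorm x]).
  by apply: open_closedC; exact: open_enorm_gt.
by apply/seteqP; split => x /=; [move=> h; apply/negP; rewrite -leNgt|move/negP; rewrite -leNgt].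
Qed.

Lemma enorm_eq0 (x : R * R) : enorm x = 0 -> x = 0.
Proof.
move=> h; have := sqr_enorm x; rewrite h expr0n/= => /esym/eqP.
rewrite paddr_eq0 ?sqr_ge0// !sqrf_eq0 => /andP[/eqP h1 /eqP h2].
by rewrite (surjective_pairing x) h1 h2.
Qed.

Lemma polar_form (x : R * R) : exists t, x = polar_point (enorm x) t.
Proof.
have [/enorm_eq0 ->|xn] := eqVneq (enorm x) 0.
  by exists 0; rewrite /polar_point /enorm/= expr0n/= addr0 sqrtr0 !mul0r.
have x0 : 0 < enorm x by rewrite lt_neqAle eq_sym xn enorm_ge0.
have E := sqr_enorm x.
pose s := x.1 / enorm x.
have s1 : s ^+ 2 <= 1.
  by rewrite expr_div_n ler_pdivrMr ?exprn_gt0// mul1r E lerDl sqr_ge0.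
have sI : -1 <= s <= 1 by rewrite -ler_norml -(expr_le1 (n := 2))// real_normK ?num_real.
have cs : cos (acos s) = s by rewrite acosK// in_itv.
have ss : sin (acos s) = `|x.2| / enorm x.
  rewrite sin_acos// -[RHS]ger0_norm ?divr_ge0 ?(ltW x0)// -sqrtr_sqr; congr Num.sqrt.
  rewrite !expr_div_n real_normK ?num_real// -[1](divff (_ : enorm x ^+ 2 != 0)) ?expf_neq0//.
  by rewrite -mulrBl E addrC addKr.
have c1 : enorm x * s = x.1 by rewrite /s mulrC divfK.
have c2 : enorm x * (`|x.2| / enorm x) = `|x.2| by rewrite mulrC divfK.
have [h|h] := leP 0 x.2.
  exists (acos s); rewrite /polar_point cs ss c1 c2 ger0_norm//; exact: surjective_pairing.
exists (- acos s); rewrite /polar_point cosN sinN cs ss mulrN c1 c2 ltr0_norm// opprK.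
exact: surjective_pairing.
Qed.

Lemma periodic_int (g : R -> R) (T t : R) (k : int) : periodic g T ->
  g (t + k%:~R * T) = g t.
Proof.
move=> pg; case: k => n; first by rewrite -pmulrn mulr_natl periodicn.
have := periodicn pg n.+1 (t + (Negz n)%:~R * T).
by rewrite NegzE mulrNz mulNr -pmulrn mulr_natl subrK => ->.
Qed.

(** Modulo 2 pi the difference is some d in [0, 2 pi) with cos d = 1, and cos d = 1 - 2 sin^2 (d /
    2) forces d = 0. *)
Lemma cos_sin_inj (f : R -> R) (a b : R) : periodic f (pi *+ 2) ->
  cos a = cos b -> sin a = sin b -> f a = f b.
Proof.
move=> pf ec es.
have p0 : 0 < pi :> R by exact: pi_gt0.
have p20 : 0 < (pi *+ 2 : R) by rewrite pmulrn_lgt0.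
pose k := Num.floor ((a - b) / (pi *+ 2)); pose d := a - b - k%:~R * (pi *+ 2).
have /andP[d0 d2] : 0 <= d < pi *+ 2.
  have /andP[h1 h2] := Num.Theory.floor_itv ((a - b) / (pi *+ 2)).
  rewrite -/k in h1 h2; rewrite ler_pdivlMr// in h1; rewrite ltr_pdivrMr// intrD mulrDl mul1r in h2.
  by rewrite /d; apply/andP; split; lra.
have cd : cos d = 1.
  have -> : d = (a - b) + (- k)%:~R * (pi *+ 2) by rewrite /d mulrNz mulNr.
  rewrite (periodic_int _ _ (@cosD2pi R)).
  by rewrite cosB ec es -!expr2 cos2Dsin2.
have dz : d = 0.
  apply/eqP; rewrite eq_le d0 andbT leNgt; apply/negP => dp.
  have hd : 0 < d / 2 < pi by rewrite divr_gt0//= ltr_pdivrMr// mulr_natr.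
  have := sin_gt0_pi hd => s0.
  have : cos d = 1 - 2 * sin (d / 2) ^+ 2.
    rewrite -[in LHS](_ : d / 2 + d / 2 = d); last by field.
    by rewrite cosD -!expr2; have := cos2Dsin2 (d / 2); lra.
  rewrite cd; have : 0 < sin (d / 2) ^+ 2 by rewrite exprn_gt0.
  lra.
have -> : a = b + k%:~R * (pi *+ 2) by have := dz; rewrite /d; lra.
exact: periodic_int.
Qed.

Lemma open_positive_measure (O : set (R * R)) : open O -> O !=set0 -> (0 < mu2 O)%E.
Proof.
move=> oO [x Ox]; have /nbhs_ballP[e /= e0 he] : nbhs x O by exact: open_nbhs_nbhs.
pose B : set plane := `](x.1 - e), (x.1 + e)[%classic `*` `](x.2 - e), (x.2 + e)[%classic.
have BO : B `<=` O.
  move=> y [/=]; rewrite !in_itv/= => /andP[h1 h2] /andP[h3 h4]; apply: he.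
  by split; rewrite /ball/= ltr_norml; apply/andP; split; lra.
have mB : measurable B by apply: measurableX; exact: measurable_itv.
apply: (@lt_le_trans _ _ (mu2 B)); last first.
  by apply: le_measure; rewrite ?inE//; exact: open_plane_measurable.
rewrite product_measure1E; [|exact: measurable_itv|exact: measurable_itv].
rewrite /= !lebesgue_measure_itv/= !lte_fin !ifT; [|lra|lra].
by rewrite -!EFinB -EFinM lte_fin mulr_gt0//; lra.
Qed.

Lemma Rintegral_gt0 (D O : set (R * R)) (h : R * R -> R) : measurable (D : set plane) ->
  open O -> O !=set0 -> O `<=` D -> mu2.-integrable D (EFin \o h) ->
  (forall x, D x -> 0 <= h x) -> (forall x, O x -> 0 < h x) -> 0 < \int[mu2]_(x in D) h x.
Proof.
move=> mD oO O0 OD ih h0 hp.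
rewrite lt_neqAle Rintegral_ge0// andbT; apply/negP => /eqP e.
have z : (\int[mu2]_(x in D) `|(EFin \o h) x| = 0)%E.
  rewrite -[RHS](_ : (\int[mu2]_(x in D) h x)%:E = 0%E); last by rewrite -e.
  rewrite /Rintegral fineK; last exact: (integrable_fin_num mD ih).
  by apply: eq_integral => x /[!inE] Dx; rewrite /= ger0_norm// h0.
have [N [mN N0 hN]] := (ae_eq_integral_abs mu2 mD (measurable_int mu2 ih)).1 z.
have := open_positive_measure oO O0; rewrite ltNge => /negP; apply.
rewrite -N0; apply: le_measure; rewrite ?inE//; first exact: open_plane_measurable.
move=> x Ox; apply: hN => /= /(_ (OD _ Ox)) [hx].
by have := hp x Ox; rewrite hx ltxx.
Qed.

Definition inv4 (x : R * R) : R := (enorm x ^+ 2 ^+ 2)^-1.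

Lemma moment4E (U : set (R * R)) : moment 4 U = \int[mu2]_(x in U) inv4 x.
Proof.
apply: eq_Rintegral => x _; rewrite powRN powR_mulrn ?enorm_ge0//.
by rewrite /inv4 -exprM.
Qed.

Lemma moment4_outside (r : R) : 0 < r ->
  \int[mu2]_(x in [set x | r < enorm x]) inv4 x = pi / r ^+ 2.
Proof.
move=> r0; rewrite /Rintegral -[RHS]/(fine (pi / r ^+ 2)%:E) -(integral_enorm_powN4 r0).
by congr fine; apply: eq_integral => x _; rewrite /inv4 -exprM.
Qed.

(** With D the closed disk of radius s, P = K - D and Q = D - K, equal moments mean equal integrals
    of |x|^-4 over P and Q. This function is below s^-4 on P and at least s^-4 on Q, so |P| >= |Q|;
    the open set O, of positive measure, makes the inequality strict. *)
Lemma bathtub (K : set (R * R)) (r1 s : R) : closed K -> 0 < r1 -> 0 < s ->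
  (forall x, ~ K x -> r1 < enorm x) -> (mu2 K < +oo)%E ->
  (forall x, enorm x = 0 -> K x) ->
  mu2.-integrable (~` K : set plane) (EFin \o inv4) ->
  \int[mu2]_(x in ~` K) inv4 x = pi / s ^+ 2 ->
  (exists2 O : set (R * R), open O & O !=set0 /\
     (O `<=` K `&` [set x | s < enorm x] \/ O `<=` ~` K `&` [set x | enorm x < s])) ->
  pi * s ^+ 2 < fine (mu2 K).
Proof.
move=> cK r10 s0 Kr1 Kfin K0 iK eK hO.
have mK : measurable (K : set plane) by exact: closed_plane_measurable.
pose U : set plane := ~` K; pose D : set plane := [set x | enorm x <= s].
have mU : measurable U by exact: measurableC.
have mD : measurable D by apply: closed_plane_measurable; exact: closed_enorm_le.
have mDC : measurable (~` D) by exact: measurableC.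
have DCE : ~` D = [set x | s < enorm x].
  by apply/seteqP; split => x /=; rewrite /D/=; [move/negP; rewrite -ltNge|move=> h; apply/negP; rewrite -ltNge].
have mI : measurable_fun [set: plane] inv4.
  by apply: measurable_funV; do 2 apply: measurable_funX; exact: measurable_enorm.
have i0 x : 0 <= inv4 x by rewrite invr_ge0 sqr_ge0.
have iDC : mu2.-integrable (~` D) (EFin \o inv4).
  apply/integrableP; split; first by apply/measurable_EFinP; exact: measurable_funTS.
  rewrite (_ : (\int[mu2]_(x in ~` D) _ = (pi / s ^+ 2)%:E)%E) ?ltry//.
  rewrite -(integral_enorm_powN4 s0) DCE; apply: eq_integral => x _ /=.
  by rewrite ger0_norm// /inv4 -exprM.
have eDC : \int[mu2]_(x in ~` D) inv4 x = pi / s ^+ 2 by rewrite DCE moment4_outside.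
pose P : set plane := K `&` ~` D; pose Q : set plane := U `&` D; pose T : set plane := U `&` ~` D.
have mP : measurable P by exact: measurableI.
have mQ : measurable Q by exact: measurableI.
have mT : measurable T by exact: measurableI.
have eU : U = Q `|` T by rewrite /Q /T -setIUr setUv setIT.
have eD : ~` D = P `|` T by rewrite /P /T -setIUl /U setUv setTI.
have iQ : mu2.-integrable Q (EFin \o inv4) by apply: integrableS iK => // x [].
have iT : mu2.-integrable T (EFin \o inv4) by apply: integrableS iK => // x [].
have iP : mu2.-integrable P (EFin \o inv4) by apply: integrableS iDC => // x [].
(* The common part T of the two exteriors cancels. *)
have key : \int[mu2]_(x in Q) inv4 x = \int[mu2]_(x in P) inv4 x.
  have h1 : \int[mu2]_(x in U) inv4 x = \int[mu2]_(x in Q) inv4 x + \int[mu2]_(x in T) inv4 x.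
    rewrite [in LHS]eU Rintegral_setU//; first by rewrite -eU.
    by apply/disj_set2P; apply/seteqP; split => x // -[[_ a] [_ c]].
  have h2 : \int[mu2]_(x in ~` D) inv4 x = \int[mu2]_(x in P) inv4 x + \int[mu2]_(x in T) inv4 x.
    rewrite [in LHS]eD Rintegral_setU//; first by rewrite -eD.
    by apply/disj_set2P; apply/seteqP; split => x // -[[a _] [c _]].
  by apply: (addIr (\int[mu2]_(x in T) inv4 x)); rewrite -h1 -h2 eDC.
have Dfin : mu2 D = (pi * s ^+ 2)%:E by exact: measure_disk0.
have Pfin : (mu2 P < +oo)%E.
  by apply: le_lt_trans Kfin; apply: le_measure; rewrite ?inE// => x [].
have Qfin : (mu2 Q < +oo)%E.
  apply: (@le_lt_trans _ _ (mu2 D)); last by rewrite Dfin ltry.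
  by apply: le_measure; rewrite ?inE// => x [].
pose C : set plane := K `&` D.
have mC : measurable C by exact: measurableI.
have Cfin : (mu2 C < +oo)%E.
  by apply: le_lt_trans Kfin; apply: le_measure; rewrite ?inE// => x [].
have eK2 : fine (mu2 K) = fine (mu2 C) + fine (mu2 P).
  rewrite -fineD ?ge0_fin_numE//; congr fine.
  rewrite -measureU//; first by rewrite /C /P -setIUr setUv setIT.
  by apply/seteqP; split => x // -[[_ a] [_ c]].
have eD2 : pi * s ^+ 2 = fine (mu2 C) + fine (mu2 Q).
  rewrite -[LHS]/(fine (pi * s ^+ 2)%:E) -Dfin -fineD ?ge0_fin_numE//; congr fine.
  rewrite -measureU//; first by rewrite /C /Q /U -setIUl setUv setTI.
  by apply/seteqP; split => x // -[[a _] [c _]].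
pose v := (s ^+ 2 ^+ 2)^-1.
have v0 : 0 < v by rewrite invr_gt0 !exprn_gt0.
have icst (A : set plane) : measurable A -> (mu2 A < +oo)%E -> mu2.-integrable A (EFin \o cst v).
  move=> mA fA; apply/integrableP; split; first by apply/measurable_EFinP; exact: measurable_cst.
  by rewrite (_ : (fun _ => _) = cst `|v|%:E)// integral_cst// lte_mul_pinfty.
have leQ x : D x -> 0 < enorm x -> v <= inv4 x.
  move=> Dx x0; rewrite lef_pV2 ?posrE ?exprn_gt0//.
  by do 2 (apply: lerXn2r; rewrite ?nnegrE ?sqr_ge0 ?enorm_ge0 ?(ltW s0)//).
have ltQ x : enorm x < s -> 0 < enorm x -> v < inv4 x.
  move=> Dx x0; rewrite ltf_pV2 ?posrE ?exprn_gt0//.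
  by do 2 (apply: ltrXn2r; rewrite ?nnegrE ?sqr_ge0 ?enorm_ge0 ?(ltW s0)//).
have ltP x : s < enorm x -> inv4 x < v.
  move=> Dx; have x0 := lt_trans s0 Dx; rewrite ltf_pV2 ?posrE ?exprn_gt0//.
  by do 2 (apply: ltrXn2r; rewrite ?nnegrE ?sqr_ge0 ?enorm_ge0 ?(ltW s0)//).
have Upos x : U x -> 0 < enorm x by move=> /Kr1; exact: lt_trans.
have iPd : mu2.-integrable P (EFin \o (fun x => v - inv4 x)).
  by have := integrableB mP (icst _ mP Pfin) iP; apply.
have iQd : mu2.-integrable Q (EFin \o (fun x => inv4 x - v)).
  by have := integrableB mQ iQ (icst _ mQ Qfin); apply.
have P0 x : P x -> 0 <= v - inv4 x by rewrite /P DCE => -[_ /ltP /ltW]; rewrite subr_ge0.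
have Q0 x : Q x -> 0 <= inv4 x - v by move=> [/Upos h1 h2]; rewrite subr_ge0 leQ.
have tot : \int[mu2]_(x in P) (v - inv4 x) + \int[mu2]_(x in Q) (inv4 x - v) =
    v * (fine (mu2 K) - pi * s ^+ 2).
  rewrite (RintegralB mP (icst _ mP Pfin) iP) (RintegralB mQ iQ (icst _ mQ Qfin)).
  by rewrite !Rintegral_cst// key eK2 eD2; ring.
have : 0 < v * (fine (mu2 K) - pi * s ^+ 2).
  rewrite -tot; have [V oV [Vne [VP|VQ]]] := hO.
    apply: ltr_pwDl; last exact: Rintegral_ge0.
    apply: (Rintegral_gt0 mP oV Vne) => //; first by rewrite /P DCE.
    by move=> x /VP[_ /ltP]; rewrite subr_gt0.
  apply: ltr_wpDl; first exact: Rintegral_ge0.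
  apply: (Rintegral_gt0 mQ oV Vne) => //; first by move=> x /VQ[h1 /ltW h2].
  by move=> x /VQ[/Upos h1 h2]; rewrite subr_gt0 ltQ.
by rewrite pmulr_rgt0// subr_gt0.
Qed.

Section star.
Variable rho : R -> R.
Hypotheses (rho_gt0 : forall t, 0 < rho t) (rho_cont : continuous rho)
  (rho_per : periodic rho (pi *+ 2)).
Let Omega := star_domain rho.

(** The definition allows any polar representation of a point; the radius is its norm and rho is
    periodic, so the choice of angle is immaterial. *)
Lemma star_polar (r t : R) : 0 < r -> Omega (polar_point r t) <-> r < rho t.
Proof.
move=> r0; split=> [[s [phi [s0 sr e]]]|rt]; last by exists r, t; split => //; exact: ltW.
have es : s = r.
  by rewrite -(enorm_polar phi s0) -(enorm_polar t (ltW r0)) -/(polar_point r t) e.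
move: e; rewrite /polar_point es => -[e1 e2].
have rn : r != 0 by rewrite gt_eqF.
have c1 : cos t = cos phi by exact: (mulfI rn).
have c2 : sin t = sin phi by exact: (mulfI rn).
by rewrite (cos_sin_inj rho_per c1 c2) -es.
Qed.

(* Near a point of polar angle t0 the angle is t0 + atan (v / u), where (u, v)
   are the coordinates rotated by - t0. *)
Let lu (t0 : R) (x : R * R) := x.1 * cos t0 + x.2 * sin t0.
Let lv (t0 : R) (x : R * R) := - x.1 * sin t0 + x.2 * cos t0.
Let ang (t0 : R) (x : R * R) := t0 + atan (lv t0 x / lu t0 x).

Let ang_polar t0 x : 0 < lu t0 x -> x = polar_point (enorm x) (ang t0 x).
Proof.
move=> u0; set u := lu t0 x in u0 *; set v := lv t0 x.
have cs := cos2Dsin2 t0.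
have e1 : u * cos t0 - v * sin t0 = x.1.
  rewrite /u /v /lu /lv (_ : _ - _ = x.1 * (cos t0 ^+ 2 + sin t0 ^+ 2)); last by ring.
  by rewrite cs mulr1.
have e2 : u * sin t0 + v * cos t0 = x.2.
  rewrite /u /v /lu /lv (_ : _ + _ = x.2 * (cos t0 ^+ 2 + sin t0 ^+ 2)); last by ring.
  by rewrite cs mulr1.
have eE : enorm x = u * Num.sqrt (1 + (v / u) ^+ 2).
  rewrite -[u in u * _]ger0_norm ?(ltW u0)// -sqrtr_sqr -sqrtrM ?sqr_ge0// /enorm; congr Num.sqrt.
  rewrite -e1 -e2 (_ : (u * cos t0 - v * sin t0) ^+ 2 + _ = (u ^+ 2 + v ^+ 2) * (cos t0 ^+ 2 + sin t0 ^+ 2)); last by ring.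
  by rewrite cs; field; rewrite gt_eqF.
have sq0 : 0 < Num.sqrt (1 + (v / u) ^+ 2) by rewrite sqrtr_gt0 ltr_pwDl// sqr_ge0.
set al := atan (v / u).
have ca : enorm x * cos al = u by rewrite /al cos_atan eE -mulrA divff ?mulr1// gt_eqF.
have can0 : cos al != 0 by rewrite /al cos_atan invr_eq0 gt_eqF.
have sa : enorm x * sin al = v.
  have : tan al = v / u by rewrite /al atanK.
  rewrite /tan => h; have -> : sin al = v / u * cos al by rewrite -h divfK.
  by rewrite mulrCA ca divfK// gt_eqF.
rewrite /polar_point /ang -/u -/v -/al cosD sinD !mulrDr mulrN.
rewrite (surjective_pairing x) -[in LHS]e1 -[in LHS]e2 /=; congr pair.
  by rewrite -[in LHS]ca -[in LHS]sa -surjective_pairing; ring.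
by rewrite -[in LHS]ca -[in LHS]sa -surjective_pairing; ring.
Qed.

Let lu_cont t0 : continuous (lu t0).
Proof.
by move=> x; apply: cvgD; apply: cvgM; [exact: cvg_fst|exact: cvg_cst|exact: cvg_snd|exact: cvg_cst].
Qed.
Let lv_cont t0 : continuous (lv t0).
Proof.
move=> x; apply: cvgD; apply: cvgM;
  [by apply: cvgN; exact: cvg_fst|exact: cvg_cst|exact: cvg_snd|exact: cvg_cst].
Qed.

(** The tolerance |r0 - rho t0| preserves the sign of |x| - rho (angle of x) near the point. The
    added indicator keeps the tolerance positive when r0 = rho t0. *)
Let near_polar r0 t0 : 0 < r0 -> \forall x \near polar_point r0 t0, 0 < lu t0 x /\
  `|(enorm x - rho (ang t0 x)) - (r0 - rho t0)| < `|r0 - rho t0| + (r0 == rho t0)%:R.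
Proof.
move=> r00; set x0 := polar_point r0 t0.
have u0 : lu t0 x0 = r0.
  rewrite /lu /x0 /polar_point/= (_ : _ + _ = r0 * (cos t0 ^+ 2 + sin t0 ^+ 2)); last by ring.
  by rewrite cos2Dsin2 mulr1.
have v0 : lv t0 x0 = 0 by rewrite /lv /x0 /polar_point/=; ring.
have ca : ang t0 @ x0 --> t0.
  rewrite -[X in _ --> X]addr0; apply: cvgD; first exact: cvg_cst.
  rewrite -[X in _ --> X](@atan0 R).
  apply: (cvg_comp (fun x => lv t0 x / lu t0 x) (@atan R)); last exact: continuous_atan.
  rewrite -(mul0r r0^-1) -{1}v0 -u0; apply: cvgM; first exact: lv_cont.
  by apply: cvgV; [rewrite u0 gt_eqF|exact: lu_cont].
have cD : (fun x => enorm x - rho (ang t0 x)) @ x0 --> r0 - rho t0.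
  apply: cvgB; last first.
    apply: (cvg_comp (ang t0) rho ca); exact: rho_cont.
  by rewrite -[X in _ --> X](enorm_polar t0 (ltW r00)); exact: enorm_continuous.
have e0 : 0 < `|r0 - rho t0| + (r0 == rho t0)%:R.
  have [->|h] := eqVneq r0 (rho t0); first by rewrite subrr normr0 add0r.
  by rewrite addr0 normr_gt0 subr_eq0.
have h : lu t0 @ x0 --> r0 by rewrite -u0; exact: lu_cont.
have hu : \forall x \near x0, 0 < lu t0 x by exact: (cvgr_gt _ h).
have /cvgrPdist_lt/(_ _ e0) hD := cD.
by apply: filterS2 hu hD => x h1 h2; split => //; rewrite distrC.
Qed.

Lemma star_interior r t : 0 < r -> r < rho t -> nbhs (polar_point r t) Omega.
Proof.
move=> r0 rt; apply: filterS (near_polar t r0) => x [u0].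
rewrite lt_eqF// addr0 ltr_norml => /andP[h1 h2].
have e := ang_polar u0; rewrite e; apply/star_polar.
  have := enorm_ge0 x; rewrite le_eqVlt => /predU1P[z|//].
  by move: u0; rewrite e -z /lu /polar_point/= !mul0r addr0 ltxx.
by move: h1 h2; rewrite (ltr0_norm (_ : r - rho t < 0)) ?subr_lt0//; lra.
Qed.

(** Stated with a neighbourhood, so that such points also avoid the closure of the domain. *)
Lemma star_exterior r t : rho t < r -> nbhs (polar_point r t) (~` Omega).
Proof.
move=> rt; have r0 : 0 < r by exact: lt_trans rt.
apply: filterS (near_polar t r0) => x [u0].
rewrite gt_eqF// addr0 ltr_norml => /andP[h1 h2].
have e := ang_polar u0; rewrite e /setC /=.
have x0 : 0 < enorm x.
  have := enorm_ge0 x; rewrite le_eqVlt => /predU1P[z|//].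
  by move: u0; rewrite e -z /lu /polar_point/= !mul0r addr0 ltxx.
move=> /(star_polar _ x0).
by move: h1 h2; rewrite (gtr0_norm (_ : 0 < r - rho t)) ?subr_gt0//; lra.
Qed.

Lemma rho_bounds : exists m M : R, [/\ 0 < m, m <= M & forall t, m <= rho t <= M].
Proof.
have p20 : 0 < (pi *+ 2 : R) by rewrite pmulrn_lgt0// pi_gt0.
have cw : {within `[0, pi *+ 2], continuous rho} by exact: continuous_subspaceT.
have [a _ ha] := EVT_min (ltW p20) cw; have [c _ hc] := EVT_max (ltW p20) cw.
have red t : exists2 s, s \in `[0, pi *+ 2] & rho s = rho t.
  pose k := Num.floor (t / (pi *+ 2)); exists (t - k%:~R * (pi *+ 2)).
    have /andP[h1 h2] := Num.Theory.floor_itv (t / (pi *+ 2)).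
    rewrite -/k in h1 h2; rewrite ler_pdivlMr// in h1; rewrite ltr_pdivrMr// intrD mulrDl mul1r in h2.
    by rewrite in_itv/=; apply/andP; split; lra.
  by rewrite -mulNr -mulrNz periodic_int.
exists (rho a), (rho c); split => //.
  by have [s sI <-] := red a; exact: hc.
by move=> t; have [s sI <-] := red t; rewrite ha// hc.
Qed.

Lemma star_open : open Omega.
Proof.
rewrite openE => x [r [t [r0 rt ->]]]; rewrite /interior.
move: r0; rewrite le_eqVlt => /predU1P[<-|r0]; last exact: star_interior.
have [m [M [m0 _ hm]]] := rho_bounds.
have : nbhs (0 * cos t, 0 * sin t) [set x : R * R | enorm x < m].
  apply: open_nbhs_nbhs; split; first exact: open_enorm_lt.
  by rewrite /= (enorm_polar t (lexx 0)).
apply: filterS => y /= ym; have [phi e] := polar_form y.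
exists (enorm y), phi; split; [exact: enorm_ge0| |exact: e].
by apply: lt_le_trans ym _; have /andP[] := hm phi.
Qed.

Lemma star_disk m x : (forall t, m <= rho t) -> enorm x < m -> Omega x.
Proof.
move=> hm xm; have [phi e] := polar_form x.
exists (enorm x), phi; split; [exact: enorm_ge0| |exact: e].
exact: lt_le_trans xm (hm phi).
Qed.

Lemma star_closure M x : (forall t, rho t <= M) -> closure Omega x -> enorm x <= M.
Proof.
move=> hM; move: x; rewrite -/([set x | enorm x <= M]).
have cl := @closed_enorm_le M.
move=> x cx; suff : closure [set x : R * R | enorm x <= M] x by rewrite -(closure_id _).1.
apply: closureS cx => y [r [t [r0 rt ->]]] /=; rewrite enorm_polar//.
exact: ltW (lt_le_trans rt (hM t)).
Qed.

End star.

Lemma closure_disk (r : R) : 0 < r -> closure (disk 0 r) = [set x : R * R | enorm x <= r].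
Proof.
move=> r0; have dE (x : R * R) : disk 0 r x = (enorm x < r) by rewrite /disk/= subr0.
apply/seteqP; split => x.
  move=> cx; suff : closure [set x : R * R | enorm x <= r] x.
    by rewrite -(closure_id _).1//; exact: closed_enorm_le.
  by apply: closureS cx => y; rewrite dE => /ltW.
move=> /= xr B Bx.
have c : (fun t : R => (t * x.1, t * x.2)) @ (1 : R) --> x.
  move=> A nA.
  have nA' : nbhs ((fun t : R => (t * x.1, t * x.2)) 1) A.
    by rewrite /= !mul1r -surjective_pairing.
  have [[B1 B2] /= [n1 n2] sub] := nA'.
  have c1 : (fun t : R => t * x.1) @ (1 : R) --> 1 * x.1 by apply: cvgM; [exact: cvg_id|exact: cvg_cst].
  have c2 : (fun t : R => t * x.2) @ (1 : R) --> 1 * x.2 by apply: cvgM; [exact: cvg_id|exact: cvg_cst].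
  have h1 : \forall t \near (1 : R), B1 (t * x.1) by exact: (c1 _ n1).
  have h2 : \forall t \near (1 : R), B2 (t * x.2) by exact: (c2 _ n2).
  have h : \forall t \near (1 : R), A (t * x.1, t * x.2).
    by apply: filterS2 h1 h2 => t a1 a2; apply: sub.
  exact: h.
have /nbhs_ballP[e /= e0 he] : nbhs (1 : R) [set t | B (t * x.1, t * x.2)] by exact: c.
(* A boundary point is approached from inside the disk along its own ray, by the factor 1 - d. *)
pose d := Num.min (e / 2) (1 / 2).
have d0 : 0 < d by rewrite lt_min !divr_gt0.
have de : d < e by rewrite /d gt_min; apply/orP; left; lra.
have d1 : d <= 1 / 2 by rewrite /d ge_min lexx orbT.
exists ((1 - d) * x.1, (1 - d) * x.2); split; last first.
  by apply: he; rewrite /ball/= opprB addrC subrK ger0_norm// ltW.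
rewrite dE; have -> : enorm ((1 - d) * x.1, (1 - d) * x.2) = (1 - d) * enorm x.
  have d2 : 0 <= 1 - d by lra.
  rewrite /enorm /= (_ : ((1 - d) * x.1) ^+ 2 + _ = (1 - d) ^+ 2 * (x.1 ^+ 2 + x.2 ^+ 2)); last by ring.
  by rewrite sqrtrM ?sqr_ge0// sqrtr_sqr ger0_norm.
have := enorm_ge0 x; rewrite le_eqVlt => /predU1P[<-|x0]; first by rewrite mulr0.
by apply: lt_le_trans xr; rewrite gtr_pMl//; lra.
Qed.

Lemma ext_disk (r : R) : 0 < r -> ext (disk 0 r) = [set x : R * R | r < enorm x].
Proof.
move=> r0; rewrite /ext closure_disk//.
by apply/seteqP; split => x /=; [move/negP; rewrite -ltNge|move=> h; apply/negP; rewrite -ltNge].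
Qed.

End planar_sets.

(** * Bounds on the lowest eigenvalue *)

Section eigenvalue_bounds.
Context {R : realType}.
Local Notation mu2 := (@lebesgue_measure R \x @lebesgue_measure R)%E.
Local Notation plane := (measurableTypeR R * measurableTypeR R)%type.

Let admissible (b : R) (U : set (R * R)) := [set q : R | exists u W,
  [/\ H1A b U u W, L2normsq U u != 0 &
    q = (L2normsq U W.1 + L2normsq U W.2) / L2normsq U u]].

Let L2normsq_ge0 (U : set (R * R)) (u : R * R -> R[i]) : 0 <= L2normsq U u.
Proof. by apply: Rintegral_ge0 => x _; rewrite addr_ge0// sqr_ge0. Qed.

(** The quotient is at most b - (S0 - b C1) / N, where N is the mass of the trial function, at most
    (4 pi / b^2) (1 + b CA); S0 / (4 pi) is the coefficient of b^2. Nonemptiness of the set of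
    quotients is recorded because lower bounds on its infimum rely on it. *)
Lemma lambda1_upper (U : set (R * R)) (r1 r2 : R) : 0 < r1 -> measurable (U : set plane) ->
  (forall x, U x -> r1 < enorm x) -> (forall x, ~ U x -> enorm x <= r2) ->
  (mu2 (~` U) < +oo)%E -> 0 < \int[mu2]_(x in U) inv4 x ->
  exists C b1 : R, [/\ 0 <= C, 0 < b1 & forall b, 0 < b < b1 ->
    admissible b U !=set0 /\
    lambda1 b U <= b - (fine (mu2 (~` U)) / (2 * pi) + pi / (2 * \int[mu2]_(x in U) inv4 x)) * b ^+ 2
      + C * b ^+ 3].
Proof.
move=> r10 mU Ur1 Kr2 Kfin; set J := \int[mu2]_(x in U) inv4 x => J0.
set kap := fine (mu2 (~` U)).
have k0 : 0 <= kap by rewrite fine_ge0.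
have p0 : 0 < pi :> R by exact: pi_gt0.
have p2 : 2 <= pi :> R by exact: pi_ge2.
pose c := pi / J; have c0 : 0 < c by rewrite divr_gt0.
pose S0 := 2 * kap + 2 * pi ^+ 2 / J.
have S00 : 0 < S0 by rewrite ltr_wpDl ?mulr_ge0// divr_gt0// mulr_gt0// exprn_gt0.
pose C1 := (4 * r2 ^+ 2 + 4 * c) * kap + pi * c ^+ 2.
have C10 : 0 <= C1.
  apply: addr_ge0; apply: mulr_ge0 => //; [|exact: ltW|exact: sqr_ge0].
  by apply: addr_ge0; apply: mulr_ge0 => //; [exact: sqr_ge0|exact: ltW].
pose CA := (2 * c + c ^+ 2 / r1 ^+ 2) / 2.
have CA0 : 0 <= CA.
  apply: divr_ge0 => //; apply: addr_ge0; first by rewrite mulr_ge0// ltW.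
  by rewrite divr_ge0// sqr_ge0.
pose X2 := r2 ^+ 2 * kap; have X20 : 0 <= X2 by rewrite mulr_ge0// sqr_ge0.
(* The second bound on b keeps S0 - b C1 nonnegative; together with b < 1, the third makes the mass
   positive. *)
exists ((C1 + S0 * CA) / (4 * pi)), (Num.min 1 (Num.min (S0 / (C1 + 1)) (X2 + 1)^-1)).
split.
- apply: divr_ge0; last by rewrite mulr_ge0// ltW.
  by apply: addr_ge0 => //; apply: mulr_ge0 => //; exact: ltW.
- rewrite !lt_min ltr01/=; apply/andP.
  by split; [rewrite divr_gt0// ltr_wpDl|rewrite invr_gt0 ltr_wpDl].
move=> b /andP[b0]; rewrite !lt_min => /and3P[b1 bS bX].
have C1p : 0 < C1 + 1 by rewrite ltr_wpDl.
have X2p : 0 < X2 + 1 by rewrite ltr_wpDl.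
rewrite (ltr_pdivlMr _ _ C1p) in bS; rewrite -[_^-1]mul1r (ltr_pdivlMr _ _ X2p) in bX.
have H := trial_H1A b0 c0 r10 mU Ur1.
have up := trial_mass_upper b0 c0 r10 mU Ur1.
have low := trial_mass_lower b0 c0 r10 mU Ur1 Kr2 Kfin.
have en := trial_energy_upper b0 c0 r10 mU Ur1 Kr2 Kfin.
set N := L2normsq U (trial_u b c) in up low en.
set D := L2normsq U (trial_W b c).1 + L2normsq U (trial_W b c).2 in en.
rewrite -/kap -/J -/C1 in en; rewrite -/CA in up; rewrite -/kap -/X2 in low.
have N0 : 0 < N.
  apply: lt_le_trans low; rewrite subr_gt0 ltr_pdivlMr ?exprn_gt0//.
  have : b * X2 < 1 by have := b0; lra.
  have : b * (b * X2) <= 1 * (b * X2) by apply: ler_wpM2r; [rewrite mulr_ge0// ltW|exact: ltW].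
  rewrite expr2 (_ : X2 * (b * b) = b * (b * X2)); last by ring.
  lra.
have DX : D <= b * N - (S0 - b * C1).
  have : - 4 * pi * c + 2 * c ^+ 2 * J = - (2 * pi ^+ 2 / J).
    by rewrite /c; field; rewrite gt_eqF.
  by move: en; rewrite /S0; lra.
have X0 : 0 <= S0 - b * C1.
  rewrite subr_ge0; apply: ltW; apply: le_lt_trans bS.
  by apply: ler_wpM2l; [exact: ltW|rewrite lerDl].
split; first by exists (D / N), (trial_u b c), (trial_W b c); split => //; rewrite gt_eqF.
apply: (@le_trans _ _ (D / N)).
  apply: ge_inf.
    exists 0 => _ [u [W [_ _ ->]]]; apply: divr_ge0 => //; exact: addr_ge0.
  by exists (trial_u b c), (trial_W b c); split => //; rewrite gt_eqF.
have bCA : 0 <= b * CA by rewrite mulr_ge0// ltW.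
have step1 : D / N <= b - (S0 - b * C1) / N.
  rewrite ler_pdivrMr// mulrBl divfK ?gt_eqF//.
have Nm0 : 0 < 4 * pi / b ^+ 2 * (1 + b * CA).
  by rewrite mulr_gt0 ?divr_gt0 ?mulr_gt0 ?exprn_gt0// ltr_pwDl.
have step2 : (S0 - b * C1) / (4 * pi / b ^+ 2 * (1 + b * CA)) <= (S0 - b * C1) / N.
  by apply: ler_wpM2l => //; rewrite lef_pV2.
(* This is 1 - y <= 1 / (1 + y). *)
have step3 : (S0 - b * C1) * (b ^+ 2 / (4 * pi) * (1 - b * CA)) <=
    (S0 - b * C1) / (4 * pi / b ^+ 2 * (1 + b * CA)).
  apply: ler_wpM2l => //.
  rewrite -[leRHS]mul1r ler_pdivlMr//.
  rewrite (_ : b ^+ 2 / (4 * pi) * (1 - b * CA) * (4 * pi / b ^+ 2 * (1 + b * CA)) = 1 - (b * CA) ^+ 2).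
    by rewrite gerBl sqr_ge0.
  have e (P y : R) : P != 0 ->
      b ^+ 2 / (4 * P) * (1 - y) * (4 * P / b ^+ 2 * (1 + y)) = 1 - y ^+ 2.
    by move=> Pn; field; rewrite (gt_eqF b0) Pn.
  by apply: e; rewrite gt_eqF.
apply: (le_trans step1).
have step4 : (S0 - b * (C1 + S0 * CA)) * (b ^+ 2 / (4 * pi)) <=
    (S0 - b * C1) * (b ^+ 2 / (4 * pi) * (1 - b * CA)).
  rewrite (_ : (S0 - b * C1) * _ = (S0 - b * (C1 + S0 * CA)) * (b ^+ 2 / (4 * pi)) +
    b * C1 * (b * CA) * (b ^+ 2 / (4 * pi))); last by ring.
  rewrite lerDl mulr_ge0//; first by rewrite mulr_ge0// mulr_ge0// ltW.
  by rewrite divr_ge0 ?sqr_ge0// mulr_ge0// ltW.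
rewrite (_ : b - (kap / (2 * pi) + pi / (2 * J)) * b ^+ 2 + (C1 + S0 * CA) / (4 * pi) * b ^+ 3 =
  b - (S0 - b * (C1 + S0 * CA)) * (b ^+ 2 / (4 * pi))).
  by rewrite lerD2l lerN2 (le_trans step4)// (le_trans step3).
have e (P y : R) : P != 0 -> b - (kap / (2 * P) + P / (2 * J)) * b ^+ 2 + y / (4 * P) * b ^+ 3 =
    b - (2 * kap + 2 * P ^+ 2 / J - b * y) * (b ^+ 2 / (4 * P)).
  by move=> Pn; field; rewrite (gt_eqF J0) Pn.
by apply: e; rewrite gt_eqF.
Qed.

(** The allowance tau is spent in two halves: r1^2 = r^2 + tau / 2 enlarges the radius, and r1^2 eps
    = tau / 2 covers the error of the weights, which is of order sqrt b. *)
Lemma lambda1_disk_lower (r tau : R) : 0 < r -> 0 < tau ->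
  exists2 b0 : R, 0 < b0 & forall b, 0 < b < b0 ->
    b - b ^+ 2 * (r ^+ 2 + tau) <= lambda1 b (ext (disk 0 r)).
Proof.
move=> r0 t0; pose U : set (R * R) := [set x | r < enorm x].
have mU : measurable (U : set plane) by apply: open_plane_measurable; exact: open_enorm_gt.
have KE : ~` U = [set x : R * R | enorm x <= r].
  by apply/seteqP; split => x /=; [move/negP; rewrite -leNgt|move=> h; apply/negP; rewrite -leNgt].
have Kr2 x : ~ U x -> enorm x <= r by move/negP; rewrite -leNgt.
have Kfin : (mu2 (~` U) < +oo)%E by rewrite KE measure_disk0// ltry.
have J0 : 0 < \int[mu2]_(x in U) inv4 x.
  by rewrite moment4_outside// divr_gt0 ?pi_gt0// exprn_gt0.
have [C [b1 [_ b10 ne]]] := lambda1_upper r0 mU (fun x h => h) Kr2 Kfin J0.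
pose r1 := Num.sqrt (r ^+ 2 + tau / 2).
have s0 : 0 < r ^+ 2 + tau / 2 by rewrite addr_gt0 ?exprn_gt0// divr_gt0.
have r1E : r1 ^+ 2 = r ^+ 2 + tau / 2 by rewrite sqr_sqrtr// ltW.
have r10 : 0 < r1 by rewrite sqrtr_gt0.
have rr1 : r < r1.
  by rewrite -(ltr_pXn2r (n := 2)) ?nnegrE ?(ltW r0) ?(ltW r10)// r1E ltrDl divr_gt0.
pose eps := tau / 2 / r1 ^+ 2.
have e0 : 0 < eps by rewrite !divr_gt0// exprn_gt0.
have lamE b : b - b ^+ 2 * r1 ^+ 2 * (1 + eps) = b - b ^+ 2 * (r ^+ 2 + tau).
  have : r1 ^+ 2 * (1 + eps) = r ^+ 2 + tau.
    by rewrite mulrDr mulr1 /eps mulrC divfK ?gt_eqF ?exprn_gt0// r1E; field.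
  by rewrite -mulrA => ->.
(* The bounds on sqrt b that give both smallness hypotheses of [magnetic_lower_bound]. *)
pose t := Num.min (1 / 20 / r1) (eps / (100 * 110) / r1).
have tp : 0 < t.
  by rewrite lt_min; apply/andP; split; rewrite divr_gt0// divr_gt0// mulr_gt0.
exists (Num.min b1 (Num.min (t ^+ 2) (r ^+ 2 + tau)^-1)).
  by rewrite !lt_min b10 exprn_gt0//= invr_gt0 addr_gt0// exprn_gt0.
move=> b /andP[b0]; rewrite !lt_min => /and3P[bb1 bt bl].
have st : Num.sqrt b <= t.
  by rewrite -[leRHS]ger0_norm ?(ltW tp)// -sqrtr_sqr ler_wsqrtr// ltW.
have [t1 t2] : t <= 1 / 20 / r1 /\ t <= eps / (100 * 110) / r1 by rewrite !ge_min !lexx orbT.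
have h1 : Num.sqrt b * r1 <= 1 / 20 by rewrite -ler_pdivlMr// (le_trans st).
have h2 : Num.sqrt b * r1 * 100 * 110 <= eps.
  by rewrite -mulrA -ler_pdivlMr// -ler_pdivlMr// (le_trans st).
have h3 : 0 <= b - b ^+ 2 * r1 ^+ 2 * (1 + eps).
  rewrite lamE subr_ge0 expr2 -mulrA ler_piMr ?(ltW b0)//.
  have rt : 0 < r ^+ 2 + tau by rewrite addr_gt0// exprn_gt0.
  by rewrite -ler_pdivlMr// mul1r ltW.
rewrite ext_disk// -lamE; apply: lb_le_inf.
  by have [|h _] := ne b; first by rewrite b0.
move=> _ [u [W [HH N0 ->]]].
have Np : 0 < L2normsq U u by rewrite lt_neqAle eq_sym N0 L2normsq_ge0.
rewrite ler_pdivlMr//; exact: (magnetic_lower_bound b0 r0 rr1 HH h1 h2 h3).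
Qed.

End eigenvalue_bounds.

(** * Application to a star-shaped domain *)

Theorem theorem1p3 (R : realType) (rho : R -> R)
    (rho_gt0 : forall theta, 0 < rho theta)
    (rho_smooth : smooth rho)
    (rho_periodic : periodic rho (pi *+ 2)) :
  let Omega := star_domain rho in
  (exists2 E : R -> R,
     E =O_ (0^'+) (fun b => b `^ (5 / 2)) &
     \forall b \near 0^'+,
       lambda1 b (ext Omega) <=
         b - (area Omega / (2 * pi) + pi / (2 * moment 4 (ext Omega))) * b ^+ 2
         + E b) /\
  ((~ exists c r, Omega = disk c r) ->
   exists Rstar : R,
     unique (fun r => 0 < r /\
       moment 4 (ext (disk 0 r)) = moment 4 (ext Omega)) Rstar /\
     exists2 b0 : R, 0 < b0 &
       forall b, 0 < b < b0 ->
         lambda1 b (ext Omega) < lambda1 b (ext (disk 0 Rstar))).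
Proof.
move=> Omega; set mu2 := (@lebesgue_measure R \x @lebesgue_measure R)%E.
have p0 : 0 < pi :> R by exact: pi_gt0.
have rho_cont : continuous rho.
  by move=> t; have := rho_smooth 0%N t => /derivableP; exact: der_continuous.
have [m [M [m0 mM bnd]]] := rho_bounds rho_gt0 rho_cont rho_periodic.
have bm t : m <= rho t by have /andP[] := bnd t.
have bM t : rho t <= M by have /andP[] := bnd t.
pose K := closure Omega; pose U := ext Omega.
have cK : closed K by exact: closed_closure.
have mK : measurable (K : set (measurableTypeR R * measurableTypeR R)) by exact: closed_plane_measurable.
have mU : measurable (U : set (measurableTypeR R * measurableTypeR R)) by exact: measurableC.
have CU : ~` U = K by rewrite /U /ext setCK.
have oO : open Omega by exact: star_open.
have OK : Omega `<=` K by exact: subset_closure.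
(* Half the minimum of rho, so that the norm is strictly larger on the exterior. *)
have m2 : 0 < m / 2 by rewrite divr_gt0.
have Ur1 x : U x -> m / 2 < enorm x.
  move=> Ux; rewrite ltNge; apply/negP => h; apply: Ux; apply: OK.
  by apply: (star_disk (m := m)) => //; apply: le_lt_trans h _; lra.
have Kr2 x : ~ U x -> enorm x <= M.
  by move=> nU; apply: (star_closure bM); rewrite -[closure _]/K -CU.
have M0 : 0 < M by exact: lt_le_trans mM.
have Kfin : (mu2 K < +oo)%E.
  apply: (@le_lt_trans _ _ (mu2 [set x | enorm x <= M])); last by rewrite /mu2 measure_disk0// ltry.
  apply: le_measure; rewrite ?inE//; first by apply: closed_plane_measurable; exact: closed_enorm_le.
  by move=> x Kx; apply: Kr2; rewrite /U /ext => h; exact: h.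
have iJ : mu2.-integrable U (EFin \o inv4) by exact: (integrable_I4 m2 mU Ur1).
have i4 x : 0 <= @inv4 R x by rewrite invr_ge0 sqr_ge0.
have J0 : 0 < \int[mu2]_(x in U) inv4 x.
  apply: (@Rintegral_gt0 _ _ [set x : R * R | M < enorm x]) => //.
  - exact: open_enorm_gt.
  - exists (polar_point (M + 1) 0); rewrite /= enorm_polar; last by lra.
    by rewrite ltrDl.
  - move=> x /= h; apply: contrapT => /Kr2; rewrite leNgt h; by [].
  - by move=> x /= h; rewrite invr_gt0 !exprn_gt0// (lt_trans M0).
have J4 : moment 4 U = \int[mu2]_(x in U) inv4 x by rewrite moment4E.
have CUfin : (mu2 (~` U) < +oo)%E by rewrite CU.
have [C [b1 [C0 b10 up]]] := lambda1_upper m2 mU Ur1 Kr2 CUfin J0.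
rewrite CU in up; set kap := fine (mu2 K) in up; set J := \int[mu2]_(x in U) inv4 x in J0 J4 up.
(* The trial bound carries the area of the closure; the smaller area of Omega weakens it, so no
   statement about the boundary measure is needed. *)
have aK : area Omega <= kap.
  rewrite /area /kap; apply: fine_le.
  - rewrite ge0_fin_numE//; apply: le_lt_trans Kfin; apply: le_measure; rewrite ?inE//.
    exact: open_plane_measurable.
  - by rewrite ge0_fin_numE.
  - by apply: le_measure; rewrite ?inE//; exact: open_plane_measurable.
split.
  (* For b <= 1 one has b^3 <= b^(5/2). *)
  exists (fun b => C * b ^+ 3).
    apply/eqO_exP; exists (C + 1); first by rewrite ltr_wpDl.
    near=> b.
    have b0 : 0 < b by near: b; exact: nbhs_right_gt.
    have bl : b <= 1 by near: b; apply: nbhs_right_le; exact: ltr01.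
    rewrite normrM (ger0_norm C0) ger0_norm ?exprn_ge0 ?(ltW b0)// ger0_norm ?powR_ge0//.
    apply: ler_pM => //; [by rewrite exprn_ge0// ltW|by rewrite lerDl|].
    by rewrite -powR_mulrn ?(ltW b0)//; apply: ger_powR; [rewrite b0|lra].
  near=> b.
  have b0 : 0 < b by near: b; exact: nbhs_right_gt.
  have bl : b < b1 by near: b; exact: nbhs_right_lt.
  have [|_ h] := up b; first by rewrite b0.
  apply: (le_trans h); rewrite J4 lerD2r lerD2l lerN2; apply: ler_wpM2r; first exact: sqr_ge0.
  by rewrite lerD2r; apply: ler_wpM2r => //; rewrite invr_ge0 mulr_ge0// ltW.
move=> ndisk; pose s := Num.sqrt (pi / J).
have piJ : 0 < pi / J by rewrite divr_gt0.
have s0 : 0 < s by rewrite sqrtr_gt0.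
have sE : s ^+ 2 = pi / J by rewrite sqr_sqrtr// ltW.
have Js : J = pi / s ^+ 2 by rewrite sE invf_div mulrC divfK// gt_eqF.
exists s; split.
  have md r : 0 < r -> moment 4 (ext (disk 0 r)) = pi / r ^+ 2.
    by move=> r0; rewrite moment4E ext_disk// moment4_outside.
  split; first by split => //; rewrite md// J4.
  move=> r [r0]; rewrite md// J4 Js => h.
  have h2 : s ^+ 2 = r ^+ 2.
    by apply: invr_inj; apply: (mulfI (x := pi)); [rewrite gt_eqF|exact: esym].
  by apply/eqP; rewrite -(eqrXn2 (n := 2)) ?(ltW s0) ?(ltW r0)//; apply/eqP.
(* If rho exceeds s somewhere, part of Omega lies outside the disk; if it falls below s, an open
   part of the exterior lies inside. Otherwise rho is constantly s and Omega is a disk. *)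
have kaps : pi * s ^+ 2 < kap.
  apply: (bathtub (r1 := m / 2)) => //.
  - by move=> x x0; apply: OK; apply: (star_disk (m := m)) => //; rewrite x0.
  - have [[t st]|h] := pselect (exists t, s < rho t).
      exists (Omega `&` [set x | s < enorm x]).
        by apply: openI => //; exact: open_enorm_gt.
      split; last by left => x [h1 h2]; split => //; exact: OK.
      have r0 : 0 < (s + rho t) / 2 by have := rho_gt0 t; lra.
      exists (polar_point ((s + rho t) / 2) t); split; last by rewrite /= enorm_polar ?(ltW r0)//; lra.
      by apply/(star_polar rho_periodic) => //; lra.
    have [[t st]|h'] := pselect (exists t, rho t < s).
      exists (~` K `&` [set x | enorm x < s]).
        by apply: openI; [exact: closed_openC|exact: open_enorm_lt].
      split; last by right.
      have r0 : 0 < (s + rho t) / 2 by have := rho_gt0 t; lra.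
      exists (polar_point ((s + rho t) / 2) t); split; last by rewrite /= enorm_polar ?(ltW r0)//; lra.
      have rt : rho t < (s + rho t) / 2 by lra.
      by move=> cl; have [y [Oy nOy]] := cl _ (star_exterior rho_gt0 rho_cont rho_periodic rt).
    case: ndisk; exists 0, s; apply/seteqP.
    have rE t : rho t = s.
      apply/eqP; rewrite eq_le !leNgt; apply/andP; split; apply/negP => a.
        by apply: h; exists t.
      by apply: h'; exists t.
    split => x; rewrite /disk/= subr0.
      by move=> [r [t [r0 rs ->]]]; rewrite enorm_polar// -(rE t).
    move=> xs; have [t e] := polar_form x.
    by exists (enorm x), t; split; [exact: enorm_ge0|rewrite rE|exact: e].
(* As pi / (2 J) = s^2 / 2 and kap / (2 pi) > s^2 / 2, the coefficient [sig] exceeds s^2. Half the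
   gap is granted to the lower bound for the disk; the other half absorbs C b^3. *)
pose sig := kap / (2 * pi) + pi / (2 * J).
pose tau := (sig - s ^+ 2) / 2.
have t0 : 0 < tau.
  rewrite divr_gt0// subr_gt0 /sig (_ : pi / (2 * J) = s ^+ 2 / 2); last first.
    by rewrite sE; field; rewrite gt_eqF.
  have : s ^+ 2 / 2 < kap / (2 * pi).
    rewrite ltr_pdivlMr ?mulr_gt0// (_ : s ^+ 2 / 2 * (2 * pi) = pi * s ^+ 2)//; by field.
  lra.
have [b2 b20 low] := lambda1_disk_lower s0 t0.
exists (Num.min b1 (Num.min b2 (tau / (C + 1)))).
  by rewrite !lt_min b10 b20 divr_gt0// ltr_wpDl.
move=> b /andP[b0]; rewrite !lt_min => /and3P[bb1 bb2 bt].
have [|_ h1] := up b; first by rewrite b0.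
have h2 : b - b ^+ 2 * (s ^+ 2 + tau) <= lambda1 b (ext (disk 0 s)) by apply: low; rewrite b0.
apply: (le_lt_trans h1); apply: lt_le_trans h2.
rewrite ltr_pdivlMr ?ltr_wpDl// in bt.
have Cb : C * b < tau by have := b0; lra.
rewrite -/sig -subr_gt0 (_ : _ - _ = b ^+ 2 * (tau - C * b)); last by rewrite /tau; field.
by rewrite mulr_gt0 ?exprn_gt0// subr_gt0.
Unshelve. all: by end_near. Qed.
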